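(* Let $\mathcal D=\frac1{2\pi i}\frac{d}{d\tau}$, let $p\ge5$ be a prime, $\ell_p=(p-1)/2$, and $x_j=6j-p$ for $1\le j\le\ell_p$. Define $H^{(p)}_j(Q)$, $1\le j\le \ell_p$, as follows. (1) If $p\equiv1\pmod{12}$, let $s\ge1$ be an integer with $(s,6p)=1$ and $s^2\equiv-1\pmod p$, and set $$H_j^{(p)}(Q)=(-1)^jQ^{\Delta_{(p,j)}}\frac{\Theta_{p,sx_j}(\tau)}{\eta(\tau)^2}=\frac{(-1)^j}{(Q;Q)_\infty^2}\sum_{\substack{n\in\mathbb Z\\ n\equiv sx_j\ (\mathrm{mod}\ p)}}n\left(\frac{12}{n}\right)Q^{\frac{x_j^2+n^2-2p}{24p}} .$$ (2) If $p\equiv5\pmod{12}$, let $s\ge1$ be an integer with $(s,6p)=1$ and $s^2\equiv-1\pmod p$, and set $$H_j^{(p)}(Q)=(-1)^jQ^{\Delta_{(p,j)}}E_4(\tau)\frac{\Theta_{p,sx_j}(\tau)}{\eta(\tau)^{10}}=\frac{(-1)^jE_4(\tau)}{(Q;Q)_\infty^{10}}\sum_{\substack{n\in\mathbb Z\\ n\equiv sx_j\ (\mathrm{mod}\ p)}}n\left(\frac{12}{n}\right)Q^{\frac{x_j^2+n^2-10p}{24p}} .$$ (3) If $p\equiv7\pmod{12}$, let $s\ge1$ be an integer with $(s,2p)=1$ and $3s^2\equiv-1\pmod p$, and set $$H_j^{(p)}(Q)=(-1)^{j+1}Q^{\Delta_{(p,j)}}\frac1{\eta(\tau)^3}\,\mathcal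 D\!\left(\frac{\theta_{p,sx_j}(\tau)}{\eta(\tau)}\right).$$ (4) If $p=11$, set $$H_j^{(11)}(Q)=(-1)^{j+1}\left(\frac{x_j}{11}\right)Q^{\Delta_{(11,j)}}\frac1{\eta(\tau)^3}\,\mathcal D\!\left(\frac{\Xi_{11,j}(\tau)}{\eta(\tau)^4}\right).$$ Then in each of these cases, for every $C\in\mathbb C$, the vector $\bigl(C\,H_j^{(p)}(Q)\bigr)_{1\le j\le\ell_p}$ consists of holomorphic $Q$-series for $|Q|<1$ and satisfies the homogeneous system $$Q^{-\Delta_{(p,j)}}H_j(Q)+\sqrt{\frac{\pi}{t}}\sum_{k=1}^{\ell_p}M^{(p)}_{jk}\,Q_1^{-\Delta_{(p,k)}}H_k(Q_1)=0,\qquad 1\le j\le\ell_p,\ \Re t>0 .$$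
   Context: For $\tau$ in the upper half-plane, $t=-\pi i\tau$, $Q=e^{2\pi i\tau}=e^{-2t}$, $Q_1=e^{-2\pi i/\tau}=e^{-2\pi^2/t}$, $Q^r=e^{2\pi ir\tau}$, $Q_1^r=e^{-2\pi ir/\tau}$ for rational $r$; principal square root. $\left(\frac{\cdot}{\cdot}\right)$ is the Kronecker symbol, $(Q;Q)_\infty=\prod_{n\ge1}(1-Q^n)$, $\eta(\tau)=Q^{1/24}(Q;Q)_\infty$, $E_4$ is the normalized weight-4 Eisenstein series for $SL(2,\mathbb Z)$. $$\Delta_{(p,j)}=\frac{(6j-p)^2}{24p},\qquad M^{(p)}_{jk}=\frac{2}{\sqrt p}(-1)^{j+k+\lfloor (p+3)/6\rfloor}\sin\Bigl(\frac{6\pi jk}{p}\Bigr).$$ For $x\in\mathbb Z/p\mathbb Z$, $$\Theta_{p,x}(\tau)=\sum_{\substack{n\in\mathbb Z\\ n\equiv x\ (\mathrm{mod}\ p)}}n\left(\frac{12}{n}\right)Q^{\frac{n^2}{24p}},\qquad \theta_{p,x}(\tau)=\sum_{\substack{n\in\mathbb Z\\ n\equiv x\ (\mathrm{mod}\ p)}}\left(\frac{-4}{n}\right)Q^{\frac{n^2}{8p}},$$ and $$\Xi_{11,j}(\tau)=\Theta_{11,x_j}(\tau)\theta_{11,5x_j}(\tau)-\Theta_{11,3x_j}(\tau)\theta_{11,2x_j}(\tau)+\Theta_{11,4x_j}(\tau)\theta_{11,3x_j}(\tau).$$ *)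

(* Defs.v *)
(* Stdlib reals and integers, complex analysis from Coquelicot. *)
From Stdlib Require Import Reals ZArith Znumtheory List Arith.
From Coquelicot Require Import Coquelicot.

Open Scope C_scope.

(** * Elementary complex functions *)

Definition Cexp (z : C) : C :=
  RtoC (exp (Re z)) * (cos (Im z), sin (Im z)).

(* Principal branch, argument in (-PI, PI] before halving. *)
Definition Csqrt (z : C) : C :=
  (sqrt ((Cmod z + Re z) / 2),
   ((if Rlt_dec (Im z) 0 then -1 else 1) * sqrt ((Cmod z - Re z) / 2))%R).

Definition CLim_seq (u : nat -> C) : C :=
  (real (Lim_seq (fun n => Re (u n))), real (Lim_seq (fun n => Im (u n)))).

Definition CSeries (a : nat -> C) : C := CLim_seq (sum_n a).

Definition CSeriesZ (f : Z -> C) : C :=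
  CSeries (fun n => f (Z.of_nat n)) + CSeries (fun n => f (- Z.of_nat (S n))%Z).

(* Sum over the integers congruent to [x] modulo [p]. *)
Definition CSeries_mod (p : nat) (x : Z) (f : Z -> C) : C :=
  CSeriesZ (fun n => if ((n - x) mod Z.of_nat p =? 0)%Z then f n else RtoC 0).

(** * Kronecker symbol *)

Definition legendre (a q : Z) : Z :=
  if (a mod q =? 0)%Z then 0%Z
  else if existsb (fun x => ((Z.of_nat x * Z.of_nat x - a) mod q =? 0)%Z)
                  (seq 0 (Z.to_nat q))
  then 1%Z else (-1)%Z.

Definition kronecker_prime (a q : Z) : Z :=
  if (q =? 2)%Z then
    if Z.even a then 0%Z
    else if ((a mod 8 =? 1)%Z || (a mod 8 =? 7)%Z)%bool then 1%Z else (-1)%Z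
  else legendre a q.

(* For [2 <= q] and [0 < n]: the exponents [k >= 1] with [q ^ k] dividing [n]
   all lie in [1 .. n]. *)
Definition valuation (q n : Z) : nat :=
  length (filter (fun k => (n mod (q ^ Z.of_nat k) =? 0)%Z) (seq 1 (Z.to_nat n))).

(* With [n = u * prod_q q ^ v_q(n)] and [u = 1] or [-1], the symbol is
   [(a/u) * prod_q (a/q) ^ v_q(n)], where [(a/-1)] is the sign of [a]
   (taken to be [1] at [0]); [(a/0)] is [1] if [a] is a unit and [0] otherwise. *)
Definition kronecker (a n : Z) : Z :=
  if (n =? 0)%Z then if (Z.abs a =? 1)%Z then 1%Z else 0%Z
  else
    ((if ((n <? 0)%Z && (a <? 0)%Z)%bool then -1 else 1) *
     fold_right Z.mul 1
       (map (fun q =>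
               if prime_dec (Z.of_nat q)
               then kronecker_prime a (Z.of_nat q)
                      ^ Z.of_nat (valuation (Z.of_nat q) (Z.abs n))
               else 1)
            (seq 2 (Z.abs_nat n))))%Z.

(** * The variables [Q] and [Q_1] *)

(* [Q ^ r = e ^ (2 pi i r tau)] and [Q_1 ^ r = e ^ (- 2 pi i r / tau)]. *)
Definition Qpow (tau : C) (r : R) : C := Cexp (RtoC (2 * PI * r) * Ci * tau).
Definition Q1pow (tau : C) (r : R) : C := Cexp (- (RtoC (2 * PI * r) * Ci / tau)).

Definition Qof (tau : C) : C := Qpow tau 1.
Definition Q1of (tau : C) : C := Q1pow tau 1.

(** * Modular forms *)

Fixpoint Qpoch_partial (q : C) (N : nat) : C :=
  match N with
  | O => RtoC 1
  | S N' => Qpoch_partial q N' * (RtoC 1 - q ^ N)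
  end.

Definition Qpoch (q : C) : C := CLim_seq (Qpoch_partial q).

Definition eta (tau : C) : C := Qpow tau (1 / 24) * Qpoch (Qof tau).

Definition sigma3 (n : nat) : nat :=
  list_sum (map (fun d => d ^ 3)%nat
                (filter (fun d => n mod d =? 0)%nat (seq 1 n))).

(* [1 + 240 * sum_(n >= 1) sigma_3(n) Q ^ n] *)
Definition E4 (tau : C) : C :=
  RtoC 1 + RtoC 240 * CSeries (fun n => RtoC (INR (sigma3 (S n))) * Qof tau ^ S n).

Definition Theta (p : nat) (x : Z) (tau : C) : C :=
  CSeries_mod p x (fun n =>
    RtoC (IZR (n * kronecker 12 n)) * Qpow tau (IZR (n ^ 2) / (24 * INR p))).

Definition theta (p : nat) (x : Z) (tau : C) : C :=
  CSeries_mod p x (fun n =>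
    RtoC (IZR (kronecker (-4) n)) * Qpow tau (IZR (n ^ 2) / (8 * INR p))).

(* [C_derive] is a total operator; it is the complex derivative wherever the
   function is complex differentiable ([is_C_derive_unique]). *)
Definition Dtau (f : C -> C) (tau : C) : C :=
  / (RtoC (2 * PI) * Ci) * C_derive f tau.

(** * The data attached to [p] *)

Definition ell (p : nat) : nat := ((p - 1) / 2)%nat.

Definition xj (p j : nat) : Z := (6 * Z.of_nat j - Z.of_nat p)%Z.

Definition Delta_pj (p j : nat) : R := (IZR (xj p j ^ 2) / (24 * INR p))%R.

Definition Mcoef (p j k : nat) : R :=
  (2 / sqrt (INR p) * (-1) ^ (j + k + (p + 3) / 6)
   * sin (6 * PI * INR j * INR k / INR p))%R.

Definition Xi11 (j : nat) (tau : C) : C :=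
  let x := xj 11 j in
  Theta 11 x tau * theta 11 (5 * x) tau
  - Theta 11 (3 * x) tau * theta 11 (2 * x) tau
  + Theta 11 (4 * x) tau * theta 11 (3 * x) tau.

(** * The vectors [H], as functions of [tau] *)

Definition H_mod1 (p : nat) (s : Z) (j : nat) (tau : C) : C :=
  RtoC ((-1) ^ j) * Qpow tau (Delta_pj p j) * (Theta p (s * xj p j) tau / eta tau ^ 2).

Definition H_mod1_series (p : nat) (s : Z) (j : nat) (tau : C) : C :=
  RtoC ((-1) ^ j) / Qpoch (Qof tau) ^ 2
  * CSeries_mod p (s * xj p j) (fun n =>
      RtoC (IZR (n * kronecker 12 n))
      * Qpow tau (IZR (xj p j ^ 2 + n ^ 2 - 2 * Z.of_nat p) / (24 * INR p))).

Definition H_mod5 (p : nat) (s : Z) (j : nat) (tau : C) : C :=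
  RtoC ((-1) ^ j) * Qpow tau (Delta_pj p j) * E4 tau
  * (Theta p (s * xj p j) tau / eta tau ^ 10).

Definition H_mod5_series (p : nat) (s : Z) (j : nat) (tau : C) : C :=
  RtoC ((-1) ^ j) * E4 tau / Qpoch (Qof tau) ^ 10
  * CSeries_mod p (s * xj p j) (fun n =>
      RtoC (IZR (n * kronecker 12 n))
      * Qpow tau (IZR (xj p j ^ 2 + n ^ 2 - 10 * Z.of_nat p) / (24 * INR p))).

Definition H_mod7 (p : nat) (s : Z) (j : nat) (tau : C) : C :=
  RtoC ((-1) ^ (j + 1)) * Qpow tau (Delta_pj p j) * (RtoC 1 / eta tau ^ 3)
  * Dtau (fun u => theta p (s * xj p j) u / eta u) tau.

Definition H_11 (j : nat) (tau : C) : C :=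
  RtoC ((-1) ^ (j + 1)) * RtoC (IZR (kronecker (xj 11 j) 11))
  * Qpow tau (Delta_pj 11 j) * (RtoC 1 / eta tau ^ 3)
  * Dtau (fun u => Xi11 j u / eta u ^ 4) tau.

(** * The conclusion *)

(* Complex differentiable on the open unit disc and equal there to the sum of
   a power series. *)
Definition holomorphic_Qseries (h : C -> C) : Prop :=
  (forall q : C, Cmod q < 1 -> ex_derive (K := C_AbsRing) (V := C_NormedModule) h q) /\
  exists a : nat -> C, forall q : C, Cmod q < 1 ->
    is_series (K := C_AbsRing) (V := C_NormedModule) (fun n => a n * q ^ n) (h q).

(* [tau = i t / PI] inverts [t = - PI i tau]. *)
Definition homogeneous_system (p : nat) (h : nat -> C -> C) : Prop :=
  forall (j : nat) (t : C), (1 <= j <= ell p)%nat -> 0 < Re t ->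
    let tau := Ci * t / RtoC PI in
    Qpow tau (- Delta_pj p j) * h j (Qof tau)
    + Csqrt (RtoC PI / t)
      * sum_n_m (fun k =>
          RtoC (Mcoef p j k) * Q1pow tau (- Delta_pj p k) * h k (Q1of tau)) 1 (ell p)
    = RtoC 0.

(* [H j tau] only depends on [Q = e ^ (2 pi i tau)]: it is [h j Q] for a function
   [h j] on the unit disc (unique, as holomorphic functions are determined by
   their values on the punctured disc), and every multiple of [h] consists of
   holomorphic [Q]-series and solves the system. *)
Definition multiples_solve_system (p : nat) (H : nat -> C -> C) : Prop :=
  exists h : nat -> C -> C,
    (forall (j : nat) (tau : C), (1 <= j <= ell p)%nat -> 0 < Im tau ->
       h j (Qof tau) = H j tau) /\
    (forall c : C,
       (forall j : nat, (1 <= j <= ell p)%nat ->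
          holomorphic_Qseries (fun q => c * h j q)) /\
       homogeneous_system p (fun j q => c * h j q)).

(* Main.v *)
(** Under [tau -> -1/tau] the weight 3/2 series [Theta_{p,x}] and the weight 1/2 series [theta_{p,x}]
    are carried to finite Fourier transforms of themselves over [x mod p]: this is Poisson summation,
    with the Gauss sums of the characters [(12/.)] and [(-4/.)]. Both series are odd in [x], so the
    transforms are sine transforms over [1 <= k <= (p-1)/2]. As [12 a = 1] and [s^2 = -1] (or
    [4 a = 1] and [3 s^2 = -1]) modulo [p], the kernel between the classes [s x_j] and [s x_k] is
    [- sin (6 pi j k / p)], which is the matrix [M] up to signs. The factors [eta], [E4] bring the
    weight to 1/2. When the numerator has weight 0 the inversion matrix is constant, so it passes to
    [D], which raises the weight to 2, and [1/eta^3] lowers it to 1/2. For [p = 11] the same holds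
    for the quadratic form [Xi] in the theta series by a bilinear identity between the numbers
    [2 sin (2 pi m / 11)], with [sqrt 11] written as a Gauss sum.

    The exponents of [Q] in [Theta_{p, s x_j}] lie in a single class modulo 1, which [x_j] and [s]
    make complementary to [Delta_{(p,j)}]; hence [H_j] is a power series in [Q].

    Poisson summation is obtained without integrals: finite Fourier inversion on [Z/LZ] applied to
    samples of a Gaussian, whose Riemann sums tend to the Fourier coefficients as [L] grows.
    The inversion of [eta] follows from Euler's pentagonal number theorem, which makes [eta] a theta
    series, and that of [E4] from Ramanujan's identity [E4 = P^2 - 12 q P'], where [P = 24 q eta'/eta]
    is the logarithmic derivative. *)

Require Import Defs.
From mathcomp Require all_boot all_order all_algebra cyclic finfield ring.
From Stdlib Require Import Reals ZArith Znumtheory Arith Lia Lra List Permutation Bool Zwf.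
From Stdlib Require Import Classical ClassicalEpsilon FunctionalExtensionality.
From Coquelicot Require Import Coquelicot.

Local Open Scope C_scope.

(** * Unconditional sums *)

(** Integrality of the exponents dictates the factors. Over [eta ^ n], the exponents of [Theta]
    match [- Delta_pj] modulo 1 as soon as [n p] is 2 modulo 24 ([n] being even): [n = 2] for [p] =
    1 and [n = 10] for [p] = 5 modulo 12. The weight 3/2 - 5 is then brought back to 1/2 by [E4].
    Half-integral weights need no choice of branch: every formula is stated for a number [w] with
    [w ^ 2 = - Ci * tau] and positive real part, and weight k/2 means a factor [w ^ k]. The series
    of the statement are limits of partial sums, while the proof keeps reindexing, splitting into
    classes and exchanging sums; hence a theory of absolutely summable families over arbitrary index
    types. The Kronecker symbols are defined through factorization, so their periodicity modulo 12
    and 4 has to be proved: multiplicativity reduces it to primes, where it is the quadratic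
    character of -1 and -3, read off a primitive root. The Gaussian integral is never computed: its
    value 1 is forced by the self-duality of the theta sum. *)

Definition classic_eq_dec {I : Type} (x y : I) : {x = y} + {x <> y} :=
  excluded_middle_informative (x = y).

Definition lsum {I : Type} (f : I -> C) (l : list I) : C :=
  fold_right (fun i s => f i + s) (RtoC 0) l.

Definition rsum {I : Type} (g : I -> R) (l : list I) : R :=
  fold_right (fun i s => g i + s)%R 0%R l.

Definition summableR {I : Type} (g : I -> R) : Prop :=
  exists M : R, forall l, NoDup l -> (rsum g l <= M)%R.

Definition summable {I : Type} (f : I -> C) : Prop := summableR (fun i => Cmod (f i)).

(** Convergence along the net of finite lists without repetition, ordered by inclusion. No
    enumeration of [I] enters, so the notion is invariant under reindexing. *)
Definition is_usum {I : Type} (f : I -> C) (s : C) : Prop :=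
  forall eps : R, (0 < eps)%R -> exists l0, NoDup l0 /\
    forall l, NoDup l -> incl l0 l -> (Cmod (lsum f l - s) < eps)%R.

(** An arbitrary number when no sum exists; [usum_eq] and [summable_is_usum] give it its meaning. *)
Definition usum {I : Type} (f : I -> C) : C := epsilon (inhabits (RtoC 0)) (is_usum f).

Definition notin {I : Type} (l0 : list I) (i : I) : bool :=
  if in_dec classic_eq_dec i l0 then false else true.

Lemma notin_true {I : Type} (l0 : list I) i : notin l0 i = true <-> ~ In i l0.
Proof. unfold notin. destruct (in_dec classic_eq_dec i l0); split; intros; easy || tauto. Qed.

Lemma permutation_incl {I : Type} (l0 l : list I) : NoDup l0 -> NoDup l -> incl l0 l ->
  Permutation l (l0 ++ filter (notin l0) l).
Proof.
  intros H0 H Hi. apply NoDup_Permutation; auto.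
  - apply NoDup_app; auto.
    + now apply NoDup_filter.
    + intros a Ha Hb. apply filter_In in Hb. rewrite notin_true in Hb. tauto.
  - intros x. rewrite in_app_iff, filter_In, notin_true. split.
    + intros Hx. destruct (classic (In x l0)); tauto.
    + intros [Hx|Hx]; [now apply Hi | tauto].
Qed.

Lemma common_nodup {I : Type} (l1 l2 : list I) :
  exists l, NoDup l /\ incl l1 l /\ incl l2 l.
Proof.
  exists (nodup classic_eq_dec (l1 ++ l2)). split; [apply NoDup_nodup|].
  split; intros x Hx; apply nodup_In, in_or_app; auto.
Qed.

Lemma lsum_app {I : Type} (f : I -> C) l1 l2 : lsum f (l1 ++ l2) = lsum f l1 + lsum f l2.
Proof.
  induction l1 as [|a l1 IH]; simpl; [ring|].
  change (f a + lsum f (l1 ++ l2) = f a + lsum f l1 + lsum f l2). rewrite IH. ring.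
Qed.

Lemma lsum_cons {I : Type} (f : I -> C) a l : lsum f (a :: l) = f a + lsum f l.
Proof. reflexivity. Qed.

Lemma rsum_cons {I : Type} (f : I -> R) a l : rsum f (a :: l) = (f a + rsum f l)%R.
Proof. reflexivity. Qed.

Lemma rsum_app {I : Type} (f : I -> R) l1 l2 : rsum f (l1 ++ l2) = (rsum f l1 + rsum f l2)%R.
Proof.
  induction l1 as [|a l1 IH]; [simpl; ring|].
  simpl app. rewrite !rsum_cons, IH. ring.
Qed.

Lemma lsum_perm {I : Type} (f : I -> C) l1 l2 : Permutation l1 l2 -> lsum f l1 = lsum f l2.
Proof.
  induction 1; rewrite ?lsum_cons; try congruence; ring.
Qed.

Lemma rsum_perm {I : Type} (f : I -> R) l1 l2 : Permutation l1 l2 -> rsum f l1 = rsum f l2.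
Proof.
  induction 1; rewrite ?rsum_cons; try congruence; ring.
Qed.

Lemma lsum_ext_in {I : Type} (f g : I -> C) l :
  (forall i, In i l -> f i = g i) -> lsum f l = lsum g l.
Proof.
  induction l as [|a l IH]; intros H; [reflexivity|].
  rewrite !lsum_cons, IH, H; auto; [now left | intros; apply H; now right].
Qed.

Lemma rsum_le {I : Type} (f g : I -> R) l :
  (forall i, In i l -> f i <= g i)%R -> (rsum f l <= rsum g l)%R.
Proof.
  induction l as [|a l IH]; intros H; [apply Rle_refl|].
  rewrite !rsum_cons. apply Rplus_le_compat; [apply H; now left|].
  apply IH. intros; apply H; now right.
Qed.

Lemma rsum_ge0 {I : Type} (f : I -> R) l : (forall i, 0 <= f i)%R -> (0 <= rsum f l)%R.
Proof.
  intros H; induction l as [|a l IH]; [apply Rle_refl|].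
  rewrite rsum_cons. specialize (H a). lra.
Qed.

Lemma lsum_plus {I : Type} (f g : I -> C) l :
  lsum (fun i => f i + g i) l = lsum f l + lsum g l.
Proof. induction l as [|a l IH]; [simpl; ring|]. rewrite !lsum_cons, IH. ring. Qed.

Lemma lsum_scal {I : Type} (c : C) (f : I -> C) l : lsum (fun i => c * f i) l = c * lsum f l.
Proof. induction l as [|a l IH]; [simpl; ring|]. rewrite !lsum_cons, IH. ring. Qed.

Lemma rsum_plus {I : Type} (f g : I -> R) l :
  rsum (fun i => f i + g i)%R l = (rsum f l + rsum g l)%R.
Proof. induction l as [|a l IH]; [simpl; ring|]. rewrite !rsum_cons, IH. ring. Qed.

Lemma rsum_scal {I : Type} (c : R) (f : I -> R) l :
  rsum (fun i => c * f i)%R l = (c * rsum f l)%R.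
Proof. induction l as [|a l IH]; [simpl; ring|]. rewrite !rsum_cons, IH. ring. Qed.

Lemma lsum_RtoC {I : Type} (f : I -> R) l : lsum (fun i => RtoC (f i)) l = RtoC (rsum f l).
Proof.
  induction l as [|a l IH]; [reflexivity|].
  rewrite lsum_cons, rsum_cons, IH, RtoC_plus. reflexivity.
Qed.

Lemma Cmod_lsum {I : Type} (f : I -> C) l : (Cmod (lsum f l) <= rsum (fun i => Cmod (f i)) l)%R.
Proof.
  induction l as [|a l IH]; [simpl; rewrite Cmod_0; lra|].
  rewrite lsum_cons, rsum_cons. eapply Rle_trans; [apply Cmod_triangle|]. lra.
Qed.

Lemma rsum_incl {I : Type} (g : I -> R) l0 l : (forall i, 0 <= g i)%R ->
  NoDup l0 -> NoDup l -> incl l0 l -> (rsum g l0 <= rsum g l)%R.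
Proof.
  intros Hg H0 H Hi. rewrite (rsum_perm _ _ _ (permutation_incl l0 l H0 H Hi)), rsum_app.
  pose proof (rsum_ge0 g (filter (notin l0) l) Hg). lra.
Qed.

Lemma lsum_map {I J : Type} (f : J -> C) (h : I -> J) l : lsum f (map h l) = lsum (fun i => f (h i)) l.
Proof. induction l as [|a l IH]; [reflexivity|]. simpl map. now rewrite !lsum_cons, IH. Qed.

Lemma rsum_map {I J : Type} (f : J -> R) (h : I -> J) l : rsum f (map h l) = rsum (fun i => f (h i)) l.
Proof. induction l as [|a l IH]; [reflexivity|]. simpl map. now rewrite !rsum_cons, IH. Qed.

Lemma rsum_filter_nonzero {I : Type} (g : I -> R) (b : I -> bool) l :
  (forall i, b i = false -> g i = 0%R) -> rsum g (filter b l) = rsum g l.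
Proof.
  intros H; induction l as [|a l IH]; [reflexivity|]. simpl.
  destruct (b a) eqn:E; rewrite ?rsum_cons, IH; [reflexivity|]. rewrite (H _ E). ring_simplify. reflexivity.
Qed.

Lemma lsum_filter_nonzero {I : Type} (g : I -> C) (b : I -> bool) l :
  (forall i, b i = false -> g i = RtoC 0) -> lsum g (filter b l) = lsum g l.
Proof.
  intros H; induction l as [|a l IH]; [reflexivity|]. simpl.
  destruct (b a) eqn:E; rewrite ?lsum_cons, IH; [reflexivity|].
  fold (lsum g l). rewrite (H _ E). ring.
Qed.

Lemma is_usum_unique {I : Type} (f : I -> C) s1 s2 : is_usum f s1 -> is_usum f s2 -> s1 = s2.
Proof.
  intros H1 H2. apply Ceq_minus. apply Cmod_eq_0.
  apply Rle_antisym; [|apply Cmod_ge_0]. apply le_epsilon. intros eps He.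
  destruct (H1 (eps / 2)%R) as (l1 & N1 & L1); [lra|].
  destruct (H2 (eps / 2)%R) as (l2 & N2 & L2); [lra|].
  destruct (common_nodup l1 l2) as (l & N & I1 & I2).
  specialize (L1 l N I1). specialize (L2 l N I2).
  replace (s1 - s2) with ((lsum f l - s2) + - (lsum f l - s1)) by ring.
  eapply Rle_trans; [apply Cmod_triangle|]. rewrite Cmod_opp. lra.
Qed.

Lemma usum_eq {I : Type} (f : I -> C) s : is_usum f s -> usum f = s.
Proof.
  intros H. apply (is_usum_unique f); [|exact H].
  unfold usum. apply epsilon_spec. now exists s.
Qed.

Lemma summableR_sup {I : Type} (g : I -> R) : (forall i, 0 <= g i)%R -> summableR g ->
  exists s : R, (forall l, NoDup l -> rsum g l <= s)%R /\
    forall eps, (0 < eps)%R -> exists l0, NoDup l0 /\ (s - eps < rsum g l0)%R.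
Proof.
  intros Hg [M HM].
  destruct (completeness (fun x => exists l, NoDup l /\ x = rsum g l)) as [s [Hs1 Hs2]].
  - exists M. intros x (l & Hl & ->). auto.
  - exists 0%R, nil. split; [constructor|reflexivity].
  - exists s. split; [intros l Hl; apply Hs1; eauto|].
    intros eps He. apply NNPP. intros Hn.
    assert (s <= s - eps)%R; [|lra].
    apply Hs2. intros x (l & Hl & ->). apply Rnot_lt_le. intros Hlt.
    apply Hn. exists l; auto.
Qed.

Lemma summableR_le {I : Type} (g h : I -> R) :
  (forall i, g i <= h i)%R -> summableR h -> summableR g.
Proof.
  intros H [M HM]. exists M. intros l Hl. eapply Rle_trans; [|apply HM, Hl].
  apply rsum_le; auto.
Qed.

Lemma is_usum_RtoC {I : Type} (g : I -> R) : (forall i, 0 <= g i)%R -> summableR g ->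
  exists s, is_usum (fun i => RtoC (g i)) s.
Proof.
  intros Hg Hs. destruct (summableR_sup g Hg Hs) as (s & H1 & H2).
  exists (RtoC s). intros eps He. destruct (H2 eps He) as (l0 & N0 & L0).
  exists l0. split; auto. intros l N Hi. rewrite lsum_RtoC, <- RtoC_minus, Cmod_R.
  pose proof (rsum_incl g l0 l Hg N0 N Hi). specialize (H1 l N).
  apply Rabs_def1; lra.
Qed.

Lemma is_usum_plus {I : Type} (f g : I -> C) s t :
  is_usum f s -> is_usum g t -> is_usum (fun i => f i + g i) (s + t).
Proof.
  intros Hf Hg eps He.
  destruct (Hf (eps / 2)%R) as (l1 & N1 & L1); [lra|].
  destruct (Hg (eps / 2)%R) as (l2 & N2 & L2); [lra|].
  destruct (common_nodup l1 l2) as (l & N & I1 & I2).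
  exists l. split; auto. intros l' N' I'. rewrite lsum_plus.
  specialize (L1 l' N' (incl_tran I1 I')). specialize (L2 l' N' (incl_tran I2 I')).
  replace (lsum f l' + lsum g l' - (s + t)) with ((lsum f l' - s) + (lsum g l' - t)) by ring.
  eapply Rle_lt_trans; [apply Cmod_triangle|]. lra.
Qed.

Lemma is_usum_scal {I : Type} (c : C) (f : I -> C) s :
  is_usum f s -> is_usum (fun i => c * f i) (c * s).
Proof.
  intros Hf eps He.
  assert (Hc : (0 < Cmod c + 1)%R) by (pose proof (Cmod_ge_0 c); lra).
  destruct (Hf (eps / (Cmod c + 1))%R) as (l1 & N1 & L1); [now apply Rdiv_lt_0_compat|].
  exists l1. split; auto. intros l N Hi. rewrite lsum_scal.
  replace (c * lsum f l - c * s) with (c * (lsum f l - s)) by ring. rewrite Cmod_mult.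
  specialize (L1 l N Hi).
  assert ((Cmod c + 1) * Cmod (lsum f l - s) < eps)%R.
  { apply (Rmult_lt_compat_l (Cmod c + 1)) in L1; auto. field_simplify in L1; lra. }
  pose proof (Cmod_ge_0 (lsum f l - s)). lra.
Qed.

Lemma im_le_Cmod (c : C) : (Rabs (Im c) <= Cmod c)%R.
Proof. eapply Rle_trans; [apply Rmax_r|]. apply Rmax_Cmod. Qed.

(** Real and imaginary parts [u] are each the difference of (|u| + u)/2 and (|u| - u)/2, nonnegative
    families dominated by the moduli, and a bounded nonnegative family sums to its supremum. *)
Lemma summable_is_usum {I : Type} (f : I -> C) : summable f -> is_usum f (usum f).
Proof.
  intros Hf. unfold usum. apply epsilon_spec.
  assert (K : forall u : I -> R, (forall i, Rabs (u i) <= Cmod (f i))%R ->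
    exists s, is_usum (fun i => RtoC (u i)) s).
  { intros u Hu.
    destruct (is_usum_RtoC (fun i => (Rabs (u i) + u i) / 2)%R) as [s1 H1].
    - intros i. pose proof (Rle_abs (- u i)). rewrite Rabs_Ropp in H. lra.
    - apply summableR_le with (2 := Hf). intros i. specialize (Hu i).
      pose proof (Rle_abs (u i)). lra.
    - destruct (is_usum_RtoC (fun i => (Rabs (u i) - u i) / 2)%R) as [s2 H2].
      + intros i. pose proof (Rle_abs (u i)). lra.
      + apply summableR_le with (2 := Hf). intros i. specialize (Hu i).
        pose proof (Rle_abs (- u i)). rewrite Rabs_Ropp in H. lra.
      + exists (s1 + RtoC (-1) * s2).
        pose proof (is_usum_plus _ _ _ _ H1 (is_usum_scal (RtoC (-1)) _ _ H2)) as H3.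
        match type of H3 with is_usum ?g _ =>
          replace (fun i => RtoC (u i)) with g; [exact H3|] end.
        apply functional_extensionality. intros i.
        rewrite <- RtoC_mult, <- RtoC_plus. f_equal. field. }
  destruct (K (fun i => Re (f i))) as [s1 H1]; [intros; apply re_le_Cmod|].
  destruct (K (fun i => Im (f i))) as [s2 H2]; [intros; apply im_le_Cmod|].
  exists (s1 + Ci * s2).
  pose proof (is_usum_plus _ _ _ _ H1 (is_usum_scal Ci _ _ H2)) as H3.
  match type of H3 with is_usum ?g _ => replace f with g at 1; [exact H3|] end.
  apply functional_extensionality. intros i. destruct (f i) as [a b].
  unfold Ci, RtoC, Cmult, Cplus; simpl. f_equal; ring.
Qed.

Lemma summable_plus {I : Type} (f g : I -> C) :
  summable f -> summable g -> summable (fun i => f i + g i).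
Proof.
  intros [M HM] [N HN]. exists (M + N)%R. intros l Hl.
  eapply Rle_trans; [apply rsum_le; intros; apply Cmod_triangle|].
  rewrite rsum_plus. apply Rplus_le_compat; auto.
Qed.

Lemma summableR_scal {I : Type} (c : R) (g : I -> R) : (0 <= c)%R ->
  summableR g -> summableR (fun i => c * g i)%R.
Proof.
  intros Hc [M HM]. exists (c * M)%R. intros l Hl. rewrite rsum_scal.
  apply Rmult_le_compat_l; auto.
Qed.

Lemma summableR_plus {I : Type} (f g : I -> R) :
  summableR f -> summableR g -> summableR (fun i => f i + g i)%R.
Proof.
  intros [M HM] [N HN]. exists (M + N)%R. intros l Hl.
  rewrite rsum_plus. apply Rplus_le_compat; auto.
Qed.

Lemma summable_scal {I : Type} (c : C) (f : I -> C) :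
  summable f -> summable (fun i => c * f i).
Proof.
  intros H. apply (summableR_scal (Cmod c)) in H; [|apply Cmod_ge_0].
  apply summableR_le with (2 := H). intros i. rewrite Cmod_mult. apply Rle_refl.
Qed.

Lemma summable_opp {I : Type} (f : I -> C) : summable f -> summable (fun i => - f i).
Proof.
  intros H. apply summableR_le with (2 := H). intros i. rewrite Cmod_opp. apply Rle_refl.
Qed.

Lemma summable_le {I : Type} (f : I -> C) (g : I -> R) :
  (forall i, Cmod (f i) <= g i)%R -> summableR g -> summable f.
Proof. intros H Hg. now apply summableR_le with (2 := Hg). Qed.

Lemma usum_plus {I : Type} (f g : I -> C) : summable f -> summable g ->
  usum (fun i => f i + g i) = usum f + usum g.
Proof. intros. apply usum_eq, is_usum_plus; now apply summable_is_usum. Qed.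

Lemma usum_scal {I : Type} (c : C) (f : I -> C) : summable f ->
  usum (fun i => c * f i) = c * usum f.
Proof. intros. apply usum_eq, is_usum_scal; now apply summable_is_usum. Qed.

Lemma usum_ext {I : Type} (f g : I -> C) : (forall i, f i = g i) -> usum f = usum g.
Proof. intros H. f_equal. now apply functional_extensionality. Qed.

Lemma summable_ext {I : Type} (f g : I -> C) : (forall i, f i = g i) -> summable f -> summable g.
Proof. intros H. now replace g with f by now apply functional_extensionality. Qed.

Lemma usum_opp {I : Type} (f : I -> C) : summable f -> usum (fun i => - f i) = - usum f.
Proof.
  intros H. rewrite (usum_ext _ (fun i => (- RtoC 1) * f i)) by (intros; ring).
  rewrite usum_scal by auto. ring.
Qed.

Lemma summable_minus {I : Type} (f g : I -> C) :
  summable f -> summable g -> summable (fun i => f i - g i).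
Proof. intros Hf Hg. apply summable_plus; [exact Hf|now apply summable_opp]. Qed.

Lemma usum_minus {I : Type} (f g : I -> C) : summable f -> summable g ->
  usum (fun i => f i - g i) = usum f - usum g.
Proof.
  intros Hf Hg. unfold Cminus. rewrite usum_plus, usum_opp; auto. now apply summable_opp.
Qed.

Lemma usum_bound {I : Type} (f : I -> C) M :
  (forall l, NoDup l -> rsum (fun i => Cmod (f i)) l <= M)%R -> (Cmod (usum f) <= M)%R.
Proof.
  intros H. apply le_epsilon. intros eps He.
  destruct (summable_is_usum f (ex_intro _ M H) eps He) as (l & N & L).
  specialize (L l N (incl_refl l)).
  replace (usum f) with (lsum f l + - (lsum f l - usum f)) by ring.
  eapply Rle_trans; [apply Cmod_triangle|]. rewrite Cmod_opp.
  apply Rplus_le_compat; [|lra].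
  eapply Rle_trans; [apply Cmod_lsum|]. auto.
Qed.

Lemma summable_tail {I : Type} (g : I -> R) : (forall i, 0 <= g i)%R -> summableR g ->
  forall eps, (0 < eps)%R -> exists l0, NoDup l0 /\
    forall l, NoDup l -> (forall i, In i l -> ~ In i l0) -> (rsum g l < eps)%R.
Proof.
  intros Hg Hs eps He. destruct (summableR_sup g Hg Hs) as (s & H1 & H2).
  destruct (H2 eps He) as (l0 & N0 & L0). exists l0. split; auto.
  intros l N D. assert (NoDup (l0 ++ l)).
  { apply NoDup_app; auto. intros a Ha Hb. now apply (D a). }
  specialize (H1 _ H). rewrite rsum_app in H1. lra.
Qed.

Lemma usum_finite {I : Type} (f : I -> C) l : NoDup l ->
  (forall i, ~ In i l -> f i = RtoC 0) -> summable f /\ usum f = lsum f l.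
Proof.
  intros N H.
  assert (Z : forall l', NoDup l' -> incl l l' -> lsum f l' = lsum f l).
  { intros l' N' Hi. rewrite (lsum_perm _ _ _ (permutation_incl l l' N N' Hi)), lsum_app.
    rewrite (lsum_ext_in f (fun _ => RtoC 0 * RtoC 0) (filter _ _)).
    - rewrite lsum_scal. ring.
    - intros i Hin. apply filter_In in Hin. rewrite notin_true in Hin. rewrite H by tauto. ring. }
  split.
  - exists (rsum (fun i => Cmod (f i)) l). intros l' N'.
    rewrite <- (rsum_filter_nonzero _ (fun i => negb (notin l i)) l').
    + apply rsum_incl; auto.
      * intros; apply Cmod_ge_0.
      * now apply NoDup_filter.
      * intros i Hin. apply filter_In in Hin. destruct Hin as [_ Hin].
        apply NNPP. rewrite <- notin_true. intros E. rewrite E in Hin. easy.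
    + intros i Hi. rewrite H, Cmod_0; auto. apply notin_true. now destruct (notin l i).
  - apply usum_eq. intros eps He. exists l. split; auto. intros l' N' Hi.
    rewrite Z by auto. replace (lsum f l - lsum f l) with (RtoC 0) by ring. now rewrite Cmod_0.
Qed.

(** * Reindexing and Fubini *)

Lemma summable_inj {A I : Type} (f : I -> C) (psi : A -> I) :
  (forall a b, psi a = psi b -> a = b) -> summable f -> summable (fun a => f (psi a)).
Proof.
  intros Hinj [M HM]. exists M. intros l N.
  rewrite <- (rsum_map (fun i => Cmod (f i)) psi). apply HM.
  now apply FinFun.Injective_map_NoDup.
Qed.

Lemma preimage_list {A I : Type} (psi : A -> I) (l : list I) : NoDup l ->
  (forall i, In i l -> exists a, psi a = i) -> exists l', NoDup l' /\ map psi l' = l.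
Proof.
  induction l as [|i l IH]; intros N H.
  - exists nil. split; [constructor|reflexivity].
  - inversion_clear N. destruct IH as (l' & N' & E); auto; [intros; apply H; now right|].
    destruct (H i) as [a Ha]; [now left|]. exists (a :: l'). split.
    + constructor; auto. intros Hin. apply H0. rewrite <- E, <- Ha. now apply in_map.
    + simpl. congruence.
Qed.

(** Discarding the indices outside the image changes no finite sum, and what is left of a list pulls
    back along [psi]. Typical use: a sum over one residue class becomes a sum over all integers. *)
Lemma summable_usum_inj {A I : Type} (f : I -> C) (psi : A -> I) :
  (forall a b, psi a = psi b -> a = b) ->
  (forall i, (forall a, psi a <> i) -> f i = RtoC 0) ->
  summable (fun a => f (psi a)) -> summable f /\ usum f = usum (fun a => f (psi a)).
Proof.
  intros Hinj H0 Hs.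
  assert (K : forall l, NoDup l -> exists l', NoDup l' /\
    map psi l' = filter (fun i => if excluded_middle_informative (exists a, psi a = i)
       then true else false) l).
  { intros l N. apply preimage_list; [now apply NoDup_filter|].
    intros i Hi. apply filter_In in Hi. destruct Hi as [_ Hi].
    now destruct (excluded_middle_informative (exists a, psi a = i)). }
  assert (Z : forall i, (if excluded_middle_informative (exists a, psi a = i)
       then true else false) = false -> f i = RtoC 0).
  { intros i Hi. destruct (excluded_middle_informative (exists a, psi a = i)) as [|n]; [easy|].
    apply H0. intros a Ha. apply n. now exists a. }
  split.
  - destruct Hs as [M HM]. exists M. intros l N. destruct (K l N) as (l' & N' & E).
    rewrite <- (rsum_filter_nonzero _ (fun i => if excluded_middle_informative (exists a, psi a = i)
       then true else false)).
    + rewrite <- E, rsum_map. auto.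
    + intros i Hi. rewrite Z, Cmod_0; auto.
  - apply usum_eq. intros eps He.
    destruct (summable_is_usum _ Hs eps He) as (l0 & N0 & L0).
    exists (map psi l0). split; [now apply FinFun.Injective_map_NoDup|].
    intros l N Hi. destruct (K l N) as (l' & N' & E).
    rewrite <- (lsum_filter_nonzero _ _ l Z), <- E, lsum_map. apply L0; auto.
    intros a Ha. assert (In (psi a) (map psi l')).
    { rewrite E, filter_In. split; [now apply Hi, in_map|].
      destruct (excluded_middle_informative (exists a0, psi a0 = psi a)); auto.
      exfalso. eauto. }
    apply in_map_iff in H. destruct H as (b & Hb & Hin). apply Hinj in Hb. congruence.
Qed.

Lemma usum_bij {A I : Type} (f : I -> C) (psi : A -> I) (phi : I -> A) :
  (forall a, phi (psi a) = a) -> (forall i, psi (phi i) = i) -> summable f ->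
  usum f = usum (fun a => f (psi a)).
Proof.
  intros H1 H2 Hs.
  assert (Hi : forall a b, psi a = psi b -> a = b).
  { intros a b E. rewrite <- (H1 a), <- (H1 b). congruence. }
  apply summable_usum_inj; auto.
  - intros i Hn. exfalso. apply (Hn (phi i)); auto.
  - now apply summable_inj.
Qed.

(** Extension by zero instead of a subtype, so that all fibres are families over the same index
    type. *)
Definition fibre {I J : Type} (phi : I -> J) (f : I -> C) (j : J) : I -> C :=
  fun i => if classic_eq_dec (phi i) j then f i else RtoC 0.

Lemma summable_restrict {I : Type} (P : I -> bool) (f : I -> C) :
  summable f -> summable (fun i => if P i then f i else RtoC 0).
Proof.
  intros H. apply summableR_le with (2 := H). intros i. destruct (P i).
  - apply Rle_refl.
  - rewrite Cmod_0. apply Cmod_ge_0.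
Qed.

Lemma summable_fibre {I J : Type} (phi : I -> J) (f : I -> C) j :
  summable f -> summable (fibre phi f j).
Proof.
  intros H. unfold fibre.
  apply summable_ext with (f := fun i => if (if classic_eq_dec (phi i) j then true else false) then f i else RtoC 0).
  - intros i. now destruct (classic_eq_dec (phi i) j).
  - now apply summable_restrict.
Qed.

(** A finite sum of fibre sums is the sum of [f] over the indices lying above the list, so the error
    is a tail of [f]. Fubini, Cauchy products and the collection of equal powers are the cases of a
    projection, of the sum of two exponents, and of an exponent. *)
Lemma usum_fibre {I J : Type} (phi : I -> J) (f : I -> C) : summable f ->
  summable (fun j => usum (fibre phi f j)) /\
  usum f = usum (fun j => usum (fibre phi f j)).
Proof.
  intros Hs.
  assert (A : forall l, NoDup l -> lsum (fun j => usum (fibre phi f j)) l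
     = usum (fun i => if notin l (phi i) then RtoC 0 else f i)).
  { induction l as [|j l IH]; intros N.
    - simpl. symmetry. apply usum_eq. intros eps He. exists nil. split; [constructor|].
      intros l _ _. rewrite (lsum_ext_in _ (fun _ => RtoC 0 * RtoC 0)).
      + rewrite lsum_scal. replace (_ - _) with (RtoC 0) by ring. now rewrite Cmod_0.
      + intros i _. unfold notin. simpl. ring.
    - inversion_clear N. rewrite lsum_cons, IH by auto. rewrite <- usum_plus.
      + apply usum_ext. intros i. unfold fibre, notin.
        destruct (classic_eq_dec (phi i) j) as [e|n].
        * rewrite e. destruct (in_dec classic_eq_dec j l); [contradiction|].
          destruct (in_dec classic_eq_dec j (j :: l)) as [|n']; [ring|]. exfalso; apply n'; now left.
        * destruct (in_dec classic_eq_dec (phi i) l) as [i0|n0];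
          destruct (in_dec classic_eq_dec (phi i) (j :: l)) as [i1|n1]; try ring.
          -- exfalso; apply n1; now right.
          -- exfalso. destruct i1; [congruence|contradiction].
      + now apply summable_fibre.
      + apply summable_ext with (f := fun i => if negb (notin l (phi i)) then f i else RtoC 0).
        * intros i; now destruct (notin l (phi i)).
        * now apply (summable_restrict (fun i => negb (notin l (phi i)))). }
  (* Finitely many fibre sums are approximated by finite sums within their own fibres. The fibres
     being disjoint, these lists concatenate to one list without repetition, to which the bound for
     [f] applies. *)
  assert (B : forall l, NoDup l -> forall eps, (0 < eps)%R -> exists L, NoDup L /\
     (forall i, In i L -> In (phi i) l) /\
     (rsum (fun j => Cmod (usum (fibre phi f j))) l <= rsum (fun i => Cmod (f i)) L + eps)%R).
  { induction l as [|j l IH]; intros N eps He.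
    - exists nil. split; [constructor|]. split; [easy|]. simpl. lra.
    - inversion_clear N. destruct (IH H0 (eps / 2)%R) as (L & NL & IL & BL); [lra|].
      destruct (summable_is_usum _ (summable_fibre phi f j Hs) (eps / 2)%R) as (l0 & N0 & L0); [lra|].
      specialize (L0 l0 N0 (incl_refl _)).
      set (b := fun i => if classic_eq_dec (phi i) j then true else false).
      exists (filter b l0 ++ L). split; [|split].
      + apply NoDup_app; auto; [now apply NoDup_filter|].
        intros a Ha Hb. apply filter_In in Ha. destruct Ha as [_ Ha]. unfold b in Ha.
        destruct (classic_eq_dec (phi a) j) as [e|]; [|easy]. apply H. rewrite <- e. auto.
      + intros i Hi. apply in_app_or in Hi. destruct Hi as [Hi|Hi]; [|right; auto].
        apply filter_In in Hi. destruct Hi as [_ Hi]. unfold b in Hi.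
        destruct (classic_eq_dec (phi i) j) as [e|]; [|easy]. now left.
      + rewrite rsum_cons, rsum_app.
        assert (Cmod (usum (fibre phi f j)) <= rsum (fun i => Cmod (f i)) (filter b l0) + eps / 2)%R; [|lra].
        replace (usum (fibre phi f j)) with (lsum (fibre phi f j) l0
          + - (lsum (fibre phi f j) l0 - usum (fibre phi f j))) by ring.
        eapply Rle_trans; [apply Cmod_triangle|]. rewrite Cmod_opp.
        apply Rplus_le_compat; [|lra].
        rewrite <- (lsum_filter_nonzero _ b l0).
        * eapply Rle_trans; [apply Cmod_lsum|]. apply rsum_le. intros i _. unfold fibre.
          destruct (classic_eq_dec (phi i) j); [apply Rle_refl|]. rewrite Cmod_0. apply Cmod_ge_0.
        * intros i Hi. unfold b in Hi. unfold fibre. now destruct (classic_eq_dec (phi i) j). }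
  split.
  - destruct Hs as [M HM]. exists M. intros l N. apply le_epsilon. intros eps He.
    destruct (B l N eps He) as (L & NL & _ & BL). specialize (HM L NL). lra.
  - symmetry. apply usum_eq. intros eps He.
    destruct (summable_tail _ (fun i => Cmod_ge_0 (f i)) Hs (eps / 2)%R) as (l0 & N0 & L0); [lra|].
    exists (nodup classic_eq_dec (map phi l0)). split; [apply NoDup_nodup|].
    intros l N Hi. rewrite A by auto.
    assert (S1 : summable (fun i => if notin l (phi i) then RtoC 0 else f i)).
    { apply summable_ext with (f := fun i => if negb (notin l (phi i)) then f i else RtoC 0).
      - intros i; now destruct (notin l (phi i)).
      - now apply (summable_restrict (fun i => negb (notin l (phi i)))). }
    rewrite <- usum_minus by auto.
    apply Rle_lt_trans with (eps / 2)%R; [|lra]. apply usum_bound.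
    intros L NL. rewrite <- (rsum_filter_nonzero _ (fun i => notin l (phi i))).
    + eapply Rle_trans; [|left; apply (L0 (filter (fun i => notin l (phi i)) L))].
      * apply rsum_le. intros i Hin. apply filter_In in Hin. rewrite (proj2 Hin).
        replace (0 - f i) with (- f i) by ring. rewrite Cmod_opp. apply Rle_refl.
      * now apply NoDup_filter.
      * intros i Hin Hin0. apply filter_In in Hin. destruct Hin as [_ Hin].
        rewrite notin_true in Hin. apply Hin, Hi, nodup_In, in_map, Hin0.
    + intros i E. rewrite E. replace (f i - f i) with (RtoC 0) by ring. apply Cmod_0.
Qed.

Lemma rsum_list_prod {A B : Type} (g : A * B -> R) la lb :
  rsum g (list_prod la lb) = rsum (fun a => rsum (fun b => g (a, b)) lb) la.
Proof.
  induction la as [|a la IH]; [reflexivity|]. simpl list_prod.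
  rewrite rsum_app, rsum_map, rsum_cons, IH. reflexivity.
Qed.

Lemma NoDup_list_prod {A B : Type} (la : list A) (lb : list B) :
  NoDup la -> NoDup lb -> NoDup (list_prod la lb).
Proof.
  intros Ha Hb. induction Ha as [|a la Hn Ha IH]; simpl; [constructor|].
  apply NoDup_app; auto.
  - apply FinFun.Injective_map_NoDup; auto. intros b b' E. congruence.
  - intros [x y] Hin Hin'. apply in_map_iff in Hin. destruct Hin as (b & E & _).
    apply in_prod_iff in Hin'. injection E as -> ->. tauto.
Qed.

Lemma summableR_prod {A B : Type} (g : A * B -> R) (M : A -> R) :
  (forall i, 0 <= g i)%R ->
  (forall a l, NoDup l -> rsum (fun b => g (a, b)) l <= M a)%R ->
  summableR M -> summableR g.
Proof.
  intros Hg HM [K HK]. exists K. intros l N.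
  set (la := nodup classic_eq_dec (map fst l)). set (lb := nodup classic_eq_dec (map snd l)).
  eapply Rle_trans; [apply (rsum_incl g l (list_prod la lb)); auto|].
  - apply NoDup_list_prod; apply NoDup_nodup.
  - intros [a b] Hin. apply in_prod_iff. split; apply nodup_In;
      apply in_map_iff; exists (a, b); auto.
  - rewrite rsum_list_prod. eapply Rle_trans; [|apply (HK la); apply NoDup_nodup].
    apply rsum_le. intros a _. apply HM, NoDup_nodup.
Qed.

Lemma usum_prod {A B : Type} (f : A * B -> C) : summable f ->
  (forall a, summable (fun b => f (a, b))) /\
  summable (fun a => usum (fun b => f (a, b))) /\
  usum f = usum (fun a => usum (fun b => f (a, b))).
Proof.
  intros Hs.
  assert (S1 : forall a, summable (fun b => f (a, b))).
  { intros a. apply (summable_inj f (fun b => (a, b))); auto. intros b b' E. congruence. }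
  assert (E : forall a, usum (fibre fst f a) = usum (fun b => f (a, b))).
  { intros a. destruct (summable_usum_inj (fibre fst f a) (fun b => (a, b))) as [_ H].
    - intros b b' E. congruence.
    - intros [a' b] H. unfold fibre. destruct (classic_eq_dec (fst (a', b)) a) as [e|]; auto.
      simpl in e. subst. now destruct (H b).
    - apply summable_ext with (2 := S1 a). intros b. unfold fibre. simpl.
      now destruct (classic_eq_dec a a).
    - rewrite H. apply usum_ext. intros b. unfold fibre. simpl. now destruct (classic_eq_dec a a). }
  destruct (usum_fibre fst f Hs) as [H1 H2].
  split; [exact S1|]. split.
  - apply summable_ext with (2 := H1). exact E.
  - rewrite H2. now apply usum_ext.
Qed.

Lemma summable_mult {A B : Type} (f : A -> C) (g : B -> C) : summable f -> summable g ->
  summable (fun p : A * B => f (fst p) * g (snd p)).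
Proof.
  intros Hf [M HM]. apply summableR_prod with (M := fun a => (M * Cmod (f a))%R).
  - intros; apply Cmod_ge_0.
  - intros a l N. simpl.
    eapply Rle_trans; [apply rsum_le; intros b _; rewrite Cmod_mult; apply Rle_refl|].
    rewrite rsum_scal, Rmult_comm. apply Rmult_le_compat_r; [apply Cmod_ge_0|auto].
  - apply summableR_scal; auto. apply (HM nil). constructor.
Qed.

Lemma usum_mult {A B : Type} (f : A -> C) (g : B -> C) : summable f -> summable g ->
  usum (fun p : A * B => f (fst p) * g (snd p)) = usum f * usum g.
Proof.
  intros Hf Hg. destruct (usum_prod _ (summable_mult f g Hf Hg)) as (_ & _ & ->). simpl.
  rewrite (usum_ext _ (fun a => usum g * f a)).
  - rewrite usum_scal by auto. ring.
  - intros a. rewrite usum_scal by auto. ring.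
Qed.

(** * Dominated convergence and ordinary series *)

Definition Climseq (u : nat -> C) (l : C) : Prop :=
  forall eps : R, (0 < eps)%R -> exists N, forall n, (N <= n)%nat -> (Cmod (u n - l) < eps)%R.

Lemma Climseq_lsum {I : Type} (f : nat -> I -> C) (g : I -> C) l :
  (forall i, Climseq (fun n => f n i) (g i)) -> Climseq (fun n => lsum (f n) l) (lsum g l).
Proof.
  intros H. induction l as [|a l IH].
  - intros eps He. exists 0%nat. intros n _. simpl. replace (0 - 0) with (RtoC 0) by ring.
    now rewrite Cmod_0.
  - intros eps He. destruct (H a (eps / 2)%R) as [N1 H1]; [lra|].
    destruct (IH (eps / 2)%R) as [N2 H2]; [lra|].
    exists (max N1 N2). intros n Hn. rewrite !lsum_cons.
    replace (f n a + lsum (f n) l - (g a + lsum g l))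
      with ((f n a - g a) + (lsum (f n) l - lsum g l)) by ring.
    eapply Rle_lt_trans; [apply Cmod_triangle|].
    specialize (H1 n ltac:(lia)). specialize (H2 n ltac:(lia)). lra.
Qed.

Lemma usum_split {I : Type} (f : I -> C) l : NoDup l -> summable f ->
  usum f = lsum f l + usum (fun i => if notin l i then f i else RtoC 0).
Proof.
  intros N Hs. set (f1 := fun i => if negb (notin l i) then f i else RtoC 0).
  destruct (usum_finite f1 l N) as [S1 E1].
  { intros i Hi. unfold f1. now rewrite (proj2 (notin_true l i) Hi). }
  replace (lsum f l) with (lsum f1 l).
  - rewrite <- E1, <- usum_plus; auto; [|now apply summable_restrict].
    apply usum_ext. intros i. unfold f1. destruct (notin l i); simpl; ring.
  - apply lsum_ext_in. intros i Hi. unfold f1. destruct (notin l i) eqn:E; auto.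
    apply notin_true in E. contradiction.
Qed.

(** Tannery's theorem: outside a finite list the majorant [M] controls [f n] and the limit alike,
    and on the list convergence is termwise. *)
Lemma Climseq_usum {I : Type} (f : nat -> I -> C) (g : I -> C) (M : I -> R) :
  (forall n i, Cmod (f n i) <= M i)%R -> summableR M ->
  (forall i, Climseq (fun n => f n i) (g i)) ->
  summable g /\ Climseq (fun n => usum (f n)) (usum g).
Proof.
  intros HM Hs Hl.
  assert (M0 : forall i, (0 <= M i)%R).
  { intros i. eapply Rle_trans; [apply Cmod_ge_0|apply (HM 0%nat)]. }
  assert (HgM : forall i, (Cmod (g i) <= M i)%R).
  { intros i. apply le_epsilon. intros eps He. destruct (Hl i eps He) as [N HN].
    specialize (HN N (le_n N)). replace (g i) with (f N i + - (f N i - g i)) by ring.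
    eapply Rle_trans; [apply Cmod_triangle|]. rewrite Cmod_opp. specialize (HM N i). lra. }
  assert (Sg : summable g) by now apply summable_le with (1 := HgM).
  split; auto. intros eps He.
  destruct (summable_tail M M0 Hs (eps / 4)%R) as (l0 & N0 & L0); [lra|].
  destruct (Climseq_lsum f g l0 Hl (eps / 4)%R) as [N HN]; [lra|].
  exists N. intros n Hn.
  assert (Sf : summable (f n)) by now apply summable_le with (1 := HM n).
  rewrite (usum_split (f n) l0), (usum_split g l0) by auto.
  assert (T : forall h : I -> C, (forall i, Cmod (h i) <= M i)%R ->
     (Cmod (usum (fun i => if notin l0 i then h i else RtoC 0)) <= eps / 4)%R).
  { intros h Hh. apply usum_bound. intros l Nl.
    rewrite <- (rsum_filter_nonzero _ (notin l0)).
    - left. eapply Rle_lt_trans; [|apply (L0 (filter (notin l0) l))].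
      + apply rsum_le. intros i _. destruct (notin l0 i); auto. now rewrite Cmod_0.
      + now apply NoDup_filter.
      + intros i Hi. apply filter_In in Hi. now apply notin_true.
    - intros i E. rewrite E. apply Cmod_0. }
  pose proof (T (f n) (HM n)). pose proof (T g HgM). specialize (HN n Hn).
  match goal with |- (Cmod (?a + ?b - (?c + ?d)) < _)%R =>
    replace (a + b - (c + d)) with ((a - c) + b + - d) by ring end.
  eapply Rle_lt_trans; [apply Cmod_triangle|]. rewrite Cmod_opp.
  eapply Rle_lt_trans; [apply Rplus_le_compat_r, Cmod_triangle|]. lra.
Qed.

Lemma Climseq_unique u l1 l2 : Climseq u l1 -> Climseq u l2 -> l1 = l2.
Proof.
  intros H1 H2. apply Ceq_minus, Cmod_eq_0.
  apply Rle_antisym; [|apply Cmod_ge_0]. apply le_epsilon. intros eps He.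
  destruct (H1 (eps / 2)%R) as [N1 L1]; [lra|]. destruct (H2 (eps / 2)%R) as [N2 L2]; [lra|].
  specialize (L1 (max N1 N2) ltac:(lia)). specialize (L2 (max N1 N2) ltac:(lia)).
  replace (l1 - l2) with ((u (max N1 N2) - l2) + - (u (max N1 N2) - l1)) by ring.
  eapply Rle_trans; [apply Cmod_triangle|]. rewrite Cmod_opp. lra.
Qed.

Lemma Climseq_ext_ev u v l : (exists N, forall n, (N <= n)%nat -> u n = v n) ->
  Climseq u l -> Climseq v l.
Proof.
  intros [N0 E] H eps He. destruct (H eps He) as [N HN]. exists (max N0 N).
  intros n Hn. rewrite <- E by lia. apply HN. lia.
Qed.

Lemma Climseq_const c : Climseq (fun _ => c) c.
Proof.
  intros eps He. exists 0%nat. intros n _. replace (c - c) with (RtoC 0) by ring. now rewrite Cmod_0.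
Qed.

Lemma Climseq_plus u v a b : Climseq u a -> Climseq v b -> Climseq (fun n => u n + v n) (a + b).
Proof.
  intros H1 H2 eps He.
  destruct (H1 (eps / 2)%R) as [N1 L1]; [lra|]. destruct (H2 (eps / 2)%R) as [N2 L2]; [lra|].
  exists (max N1 N2). intros n Hn. specialize (L1 n ltac:(lia)). specialize (L2 n ltac:(lia)).
  replace (u n + v n - (a + b)) with ((u n - a) + (v n - b)) by ring.
  eapply Rle_lt_trans; [apply Cmod_triangle|]. lra.
Qed.

Lemma Climseq_scal c u a : Climseq u a -> Climseq (fun n => c * u n) (c * a).
Proof.
  intros H eps He. assert (Hc : (0 < Cmod c + 1)%R) by (pose proof (Cmod_ge_0 c); lra).
  destruct (H (eps / (Cmod c + 1))%R) as [N L]; [now apply Rdiv_lt_0_compat|].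
  exists N. intros n Hn. specialize (L n Hn).
  replace (c * u n - c * a) with (c * (u n - a)) by ring. rewrite Cmod_mult.
  assert ((Cmod c + 1) * Cmod (u n - a) < eps)%R.
  { apply (Rmult_lt_compat_l (Cmod c + 1)) in L; auto. field_simplify in L; lra. }
  pose proof (Cmod_ge_0 (u n - a)). lra.
Qed.

Lemma Climseq_mult u v a b : Climseq u a -> Climseq v b -> Climseq (fun n => u n * v n) (a * b).
Proof.
  intros H1 H2.
  assert (H3 : Climseq (fun n => (u n - a) * (v n - b)) (RtoC 0)).
  { intros eps He. destruct (H1 eps He) as [N1 L1]. destruct (H2 1%R) as [N2 L2]; [lra|].
    exists (max N1 N2). intros n Hn. specialize (L1 n ltac:(lia)). specialize (L2 n ltac:(lia)).
    replace ((u n - a) * (v n - b) - 0) with ((u n - a) * (v n - b)) by ring.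
    rewrite Cmod_mult. pose proof (Cmod_ge_0 (u n - a)). pose proof (Cmod_ge_0 (v n - b)). nra. }
  pose proof (Climseq_plus _ _ _ _ H3 (Climseq_plus _ _ _ _ (Climseq_scal a v b H2)
    (Climseq_plus _ _ _ _ (Climseq_scal b u a H1) (Climseq_const (- (a * b)))))) as H.
  replace (a * b) with (RtoC 0 + (a * b + (b * a + - (a * b)))) by ring.
  apply Climseq_ext_ev with (2 := H). exists 0%nat. intros n _. ring.
Qed.

Lemma Climseq_CLim_seq u l : Climseq u l -> CLim_seq u = l.
Proof.
  intros H. unfold CLim_seq. destruct l as [a b]. f_equal.
  - rewrite (is_lim_seq_unique _ (Finite a)); [reflexivity|].
    apply is_lim_seq_spec. intros eps. destruct (H eps (cond_pos eps)) as [N HN].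
    exists N. intros n Hn. specialize (HN n Hn).
    eapply Rle_lt_trans; [|exact HN].
    replace (Re (u n) - a)%R with (Re (u n - (a, b))) by reflexivity. apply re_le_Cmod.
  - rewrite (is_lim_seq_unique _ (Finite b)); [reflexivity|].
    apply is_lim_seq_spec. intros eps. destruct (H eps (cond_pos eps)) as [N HN].
    exists N. intros n Hn. specialize (HN n Hn).
    eapply Rle_lt_trans; [|exact HN].
    replace (Im (u n) - b)%R with (Im (u n - (a, b))) by reflexivity. apply im_le_Cmod.
Qed.

Lemma sum_n_lsum (a : nat -> C) n : sum_n a n = lsum a (seq 0 (S n)).
Proof.
  induction n as [|n IH].
  - rewrite sum_O. simpl. ring.
  - rewrite sum_Sn, IH. rewrite (seq_S (S n)), lsum_app. simpl. unfold plus; simpl. ring.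
Qed.

Lemma Climseq_partial (a : nat -> C) : summable a -> Climseq (fun n => lsum a (seq 0 n)) (usum a).
Proof.
  intros H eps He. destruct (summable_is_usum a H eps He) as (l0 & N0 & L0).
  exists (S (list_max l0)). intros n Hn. apply L0; [apply seq_NoDup|].
  intros i Hi. apply in_seq. pose proof (proj1 (list_max_le l0 (list_max l0)) (le_n _)) as Hm.
  rewrite Forall_forall in Hm. specialize (Hm i Hi). lia.
Qed.

Lemma Climseq_sum_n (a : nat -> C) : summable a -> Climseq (sum_n a) (usum a).
Proof.
  intros H eps He. destruct (Climseq_partial a H eps He) as [N HN]. exists N.
  intros n Hn. rewrite sum_n_lsum. apply HN. lia.
Qed.

Lemma CSeries_usum (a : nat -> C) : summable a -> CSeries a = usum a.
Proof. intros H. now apply Climseq_CLim_seq, Climseq_sum_n. Qed.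

Lemma summable_is_series (a : nat -> C) : summable a ->
  is_series (K := C_AbsRing) (V := C_NormedModule) a (usum a).
Proof.
  intros H. unfold is_series. apply filterlim_locally. intros eps.
  destruct (Climseq_sum_n a H eps (cond_pos eps)) as [N HN]. exists N. intros n Hn.
  apply C_NormedModule_mixin_compat1. apply HN. lia.
Qed.

Lemma summableR_nat (g : nat -> R) M : (forall n, 0 <= g n)%R ->
  (forall n, rsum g (seq 0 n) <= M)%R -> summableR g.
Proof.
  intros Hg H. exists M. intros l N. eapply Rle_trans; [|apply (H (S (list_max l)))].
  apply rsum_incl; auto; [apply seq_NoDup|].
  intros i Hi. apply in_seq. pose proof (proj1 (list_max_le l (list_max l)) (le_n _)) as Hm.
  rewrite Forall_forall in Hm. specialize (Hm i Hi). lia.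
Qed.

Lemma usum_Z (f : Z -> C) :
  summable (fun n => f (Z.of_nat n)) -> summable (fun n => f (- Z.of_nat (S n))%Z) ->
  summable f /\ usum f = usum (fun n => f (Z.of_nat n)) + usum (fun n => f (- Z.of_nat (S n))%Z).
Proof.
  intros H1 H2.
  set (f1 := fun z => if (0 <=? z)%Z then f z else RtoC 0).
  set (f2 := fun z => if (0 <=? z)%Z then RtoC 0 else f z).
  destruct (summable_usum_inj f1 Z.of_nat) as [S1 E1].
  - intros; lia.
  - intros i Hi. unfold f1. destruct (0 <=? i)%Z eqn:E; auto. exfalso. apply (Hi (Z.to_nat i)). lia.
  - apply summable_ext with (2 := H1). intros n. unfold f1. now rewrite (proj2 (Z.leb_le _ _)) by lia.
  - destruct (summable_usum_inj f2 (fun n => (- Z.of_nat (S n))%Z)) as [S2 E2].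
    + intros; lia.
    + intros i Hi. unfold f2. destruct (0 <=? i)%Z eqn:E; auto. exfalso. apply (Hi (Z.to_nat (- i - 1))). lia.
    + apply summable_ext with (2 := H2). intros n. unfold f2.
      now rewrite (proj2 (Z.leb_gt _ _)) by lia.
    + assert (E : forall z, f1 z + f2 z = f z).
      { intros z. unfold f1, f2. destruct (0 <=? z)%Z; ring. }
      split.
      * apply summable_ext with (1 := E). now apply summable_plus.
      * rewrite <- (usum_ext _ _ E), usum_plus, E1, E2 by auto. f_equal; apply usum_ext; intros n.
        unfold f1. now rewrite (proj2 (Z.leb_le _ _)) by lia.
Qed.

(** Gateway from the total limit operators of the statement to unconditional sums: each of the two
    one-sided series converges absolutely, so its partial sums tend to the unconditional sum. *)
Lemma CSeriesZ_usum (f : Z -> C) : summable f -> CSeriesZ f = usum f.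
Proof.
  intros H.
  assert (H1 : summable (fun n => f (Z.of_nat n))) by (apply summable_inj; auto; intros; lia).
  assert (H2 : summable (fun n => f (- Z.of_nat (S n))%Z))
    by (apply (summable_inj f (fun n => (- Z.of_nat (S n))%Z)); auto; intros; lia).
  unfold CSeriesZ. rewrite !CSeries_usum by auto. symmetry. now apply usum_Z.
Qed.

(** * Complex derivatives *)

(** Differentiability in terms of moduli alone; [Cder_is_derive] and [Cder_C_derive] carry it to the
    operators of the statement. *)
Definition Cder (f : C -> C) (z d : C) : Prop :=
  forall eps : R, (0 < eps)%R -> exists delta : R, (0 < delta)%R /\
    forall w, (Cmod (w - z) < delta)%R ->
      (Cmod (f w - f z - (w - z) * d) <= eps * Cmod (w - z))%R.

Lemma Cder_quad f z d delta M : (0 < delta)%R ->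
  (forall w, Cmod (w - z) < delta -> Cmod (f w - f z - (w - z) * d) <= M * Cmod (w - z) ^ 2)%R ->
  Cder f z d.
Proof.
  intros Hd H eps He. pose proof (Rabs_pos M).
  assert (0 < eps / (Rabs M + 1))%R by (apply Rdiv_lt_0_compat; lra).
  exists (Rmin delta (eps / (Rabs M + 1))). split; [now apply Rmin_glb_lt|].
  intros w Hw. eapply Rle_trans; [apply H|].
  - eapply Rlt_le_trans; [exact Hw|apply Rmin_l].
  - assert (W : (Cmod (w - z) < eps / (Rabs M + 1))%R) by (eapply Rlt_le_trans; [exact Hw|apply Rmin_r]).
    pose proof (Cmod_ge_0 (w - z)). replace (M * Cmod (w - z) ^ 2)%R with (M * Cmod (w - z) * Cmod (w - z))%R by ring.
    apply Rmult_le_compat_r; auto.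
    apply (Rmult_lt_compat_l (Rabs M + 1)) in W; [|lra]. field_simplify in W; [|lra].
    pose proof (Rle_abs M). nra.
Qed.

Lemma Cder_cont f z d : Cder f z d -> forall eps : R, (0 < eps)%R -> exists delta : R, (0 < delta)%R /\
  forall w, (Cmod (w - z) < delta)%R ->
   (Cmod (f w - f z) < eps)%R /\ (Cmod (f w - f z) <= (Cmod d + 1) * Cmod (w - z))%R.
Proof.
  intros H eps He. destruct (H 1%R) as (delta & Hd & Hw); [lra|].
  pose proof (Cmod_ge_0 d).
  assert (0 < eps / (Cmod d + 1))%R by (apply Rdiv_lt_0_compat; lra).
  exists (Rmin delta (eps / (Cmod d + 1))). split; [now apply Rmin_glb_lt|].
  intros w Hm.
  assert (B : (Cmod (f w - f z) <= (Cmod d + 1) * Cmod (w - z))%R).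
  { replace (f w - f z) with ((f w - f z - (w - z) * d) + (w - z) * d) by ring.
    eapply Rle_trans; [apply Cmod_triangle|]. rewrite Cmod_mult.
    assert (Cmod (f w - f z - (w - z) * d) <= 1 * Cmod (w - z))%R; [|lra].
    apply Hw. eapply Rlt_le_trans; [exact Hm|apply Rmin_l]. }
  split; auto. eapply Rle_lt_trans; [exact B|].
  assert (W : (Cmod (w - z) < eps / (Cmod d + 1))%R) by (eapply Rlt_le_trans; [exact Hm|apply Rmin_r]).
  apply (Rmult_lt_compat_l (Cmod d + 1)) in W; [|lra]. field_simplify in W; lra.
Qed.

Lemma Cder_eq f z d d' : d = d' -> Cder f z d -> Cder f z d'.
Proof. now intros ->. Qed.

Lemma Cder_ext_loc f g z d delta : (0 < delta)%R ->
  (forall w, Cmod (w - z) < delta -> f w = g w)%R -> Cder f z d -> Cder g z d.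
Proof.
  intros Hd E H eps He. destruct (H eps He) as (d1 & H1 & L1).
  exists (Rmin delta d1). split; [now apply Rmin_glb_lt|]. intros w Hw.
  rewrite <- !E.
  - apply L1. eapply Rlt_le_trans; [exact Hw|apply Rmin_r].
  - replace (z - z) with (RtoC 0) by ring. now rewrite Cmod_0.
  - eapply Rlt_le_trans; [exact Hw|apply Rmin_l].
Qed.

Lemma Cder_ext f g z d : (forall w, f w = g w) -> Cder f z d -> Cder g z d.
Proof. intros E. apply Cder_ext_loc with 1%R; auto. lra. Qed.

Lemma Cder_const c z : Cder (fun _ => c) z (RtoC 0).
Proof.
  apply Cder_quad with 1%R 0%R; [lra|]. intros w _.
  replace (c - c - (w - z) * 0) with (RtoC 0) by ring. rewrite Cmod_0. lra.
Qed.

Lemma Cder_id z : Cder (fun w => w) z (RtoC 1).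
Proof.
  apply Cder_quad with 1%R 0%R; [lra|]. intros w _.
  replace (w - z - (w - z) * 1) with (RtoC 0) by ring. rewrite Cmod_0. lra.
Qed.

Lemma Cder_plus f g z d e : Cder f z d -> Cder g z e -> Cder (fun w => f w + g w) z (d + e).
Proof.
  intros Hf Hg eps He. destruct (Hf (eps / 2)%R) as (d1 & H1 & L1); [lra|].
  destruct (Hg (eps / 2)%R) as (d2 & H2 & L2); [lra|].
  exists (Rmin d1 d2). split; [now apply Rmin_glb_lt|]. intros w Hw.
  specialize (L1 w (Rlt_le_trans _ _ _ Hw (Rmin_l _ _))).
  specialize (L2 w (Rlt_le_trans _ _ _ Hw (Rmin_r _ _))).
  replace (f w + g w - (f z + g z) - (w - z) * (d + e))
    with ((f w - f z - (w - z) * d) + (g w - g z - (w - z) * e)) by ring.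
  eapply Rle_trans; [apply Cmod_triangle|]. lra.
Qed.

Lemma Cder_mult f g z d e : Cder f z d -> Cder g z e ->
  Cder (fun w => f w * g w) z (d * g z + f z * e).
Proof.
  intros Hf Hg eps He.
  set (A := (Cmod (g z) + Cmod (f z) + Cmod d + 2)%R).
  pose proof (Cmod_ge_0 (g z)) as P1. pose proof (Cmod_ge_0 (f z)) as P2. pose proof (Cmod_ge_0 d) as P3.
  assert (HA : (0 < A)%R) by (unfold A; lra).
  assert (He' : (0 < eps / A)%R) by now apply Rdiv_lt_0_compat.
  destruct (Hf (eps / A)%R) as (d1 & H1 & L1); auto.
  destruct (Hg (eps / A)%R) as (d2 & H2 & L2); auto.
  destruct (Cder_cont g z e Hg (eps / A)%R) as (d3 & H3 & L3); auto.
  destruct (Cder_cont f z d Hf 1%R) as (d4 & H4 & L4); [lra|].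
  exists (Rmin (Rmin d1 d2) (Rmin d3 d4)). split; [now repeat apply Rmin_glb_lt|].
  intros w Hw.
  specialize (L1 w (Rlt_le_trans _ _ _ Hw (Rle_trans _ _ _ (Rmin_l _ _) (Rmin_l _ _)))).
  specialize (L2 w (Rlt_le_trans _ _ _ Hw (Rle_trans _ _ _ (Rmin_l _ _) (Rmin_r _ _)))).
  specialize (L3 w (Rlt_le_trans _ _ _ Hw (Rle_trans _ _ _ (Rmin_r _ _) (Rmin_l _ _)))).
  specialize (L4 w (Rlt_le_trans _ _ _ Hw (Rle_trans _ _ _ (Rmin_r _ _) (Rmin_r _ _)))).
  destruct L3 as [L3 _]. destruct L4 as [_ L4].
  replace (f w * g w - f z * g z - (w - z) * (d * g z + f z * e))
    with ((f w - f z - (w - z) * d) * g z + f z * (g w - g z - (w - z) * e)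
       + (f w - f z) * (g w - g z)) by ring.
  eapply Rle_trans; [apply Cmod_triangle|].
  eapply Rle_trans; [apply Rplus_le_compat_r, Cmod_triangle|]. rewrite !Cmod_mult.
  pose proof (Cmod_ge_0 (w - z)).
  set (x := Cmod (w - z)) in *. set (q := (eps / A)%R) in *.
  assert (E : eps = (q * A)%R) by (unfold q; field; lra). rewrite E.
  apply (Rmult_le_compat_r (Cmod (g z))) in L1; auto.
  apply (Rmult_le_compat_l (Cmod (f z))) in L2; auto.
  assert (T : (Cmod (f w - f z) * Cmod (g w - g z) <= ((Cmod d + 1) * x) * q)%R).
  { apply Rmult_le_compat; auto using Cmod_ge_0. lra. }
  unfold A. assert (0 <= q * x)%R by (apply Rmult_le_pos; lra). nra.
Qed.

Lemma Cder_comp f g z d e : Cder f (g z) d -> Cder g z e -> Cder (fun w => f (g w)) z (e * d).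
Proof.
  intros Hf Hg eps He.
  set (A := (Cmod d + Cmod e + 1)%R).
  pose proof (Cmod_ge_0 e) as P1. pose proof (Cmod_ge_0 d) as P2.
  assert (HA : (0 < A)%R) by (unfold A; lra).
  assert (He' : (0 < eps / A)%R) by now apply Rdiv_lt_0_compat.
  destruct (Hf (eps / A)%R) as (d1 & H1 & L1); auto.
  destruct (Hg (eps / A)%R) as (d2 & H2 & L2); auto.
  destruct (Cder_cont g z e Hg d1 H1) as (d3 & H3 & L3).
  exists (Rmin d2 d3). split; [now apply Rmin_glb_lt|]. intros w Hw.
  specialize (L2 w (Rlt_le_trans _ _ _ Hw (Rmin_l _ _))).
  destruct (L3 w (Rlt_le_trans _ _ _ Hw (Rmin_r _ _))) as [L4 L5].
  specialize (L1 _ L4).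
  replace (f (g w) - f (g z) - (w - z) * (e * d))
    with ((f (g w) - f (g z) - (g w - g z) * d) + d * (g w - g z - (w - z) * e)) by ring.
  eapply Rle_trans; [apply Cmod_triangle|]. rewrite Cmod_mult.
  pose proof (Cmod_ge_0 (w - z)).
  set (x := Cmod (w - z)) in *. set (q := (eps / A)%R) in *.
  assert (E : eps = (q * A)%R) by (unfold q; field; lra). rewrite E.
  apply (Rmult_le_compat_l (Cmod d)) in L2; auto.
  assert (T : (q * Cmod (g w - g z) <= q * ((Cmod e + 1) * x))%R) by (apply Rmult_le_compat_l; lra).
  unfold A. nra.
Qed.

Lemma Cder_scal c f z d : Cder f z d -> Cder (fun w => c * f w) z (c * d).
Proof.
  intros H. eapply Cder_eq; [|exact (Cder_mult _ _ _ _ _ (Cder_const c z) H)]. cbv beta; ring.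
Qed.

Lemma Cder_opp f z d : Cder f z d -> Cder (fun w => - f w) z (- d).
Proof.
  intros H. apply Cder_ext with (fun w => (- RtoC 1) * f w); [intros; ring|].
  eapply Cder_eq; [|exact (Cder_scal _ _ _ _ H)]. cbv beta; ring.
Qed.

Lemma Cder_minus f g z d e : Cder f z d -> Cder g z e -> Cder (fun w => f w - g w) z (d - e).
Proof. intros Hf Hg. apply Cder_plus; auto. now apply Cder_opp. Qed.

Lemma Cder_inv (z : C) : z <> 0 -> Cder (fun w => / w) z (- / (z * z)).
Proof.
  intros Hz. assert (P : (0 < Cmod z)%R) by now apply Cmod_gt_0.
  apply Cder_quad with (Cmod z / 2)%R (2 / Cmod z ^ 3)%R; [lra|]. intros w Hw.
  assert (Q : (Cmod z / 2 <= Cmod w)%R).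
  { pose proof (Cmod_triangle w (- (w - z))) as T. rewrite Cmod_opp in T.
    replace (w + - (w - z)) with z in T by ring. lra. }
  assert (w <> RtoC 0) by (apply Cmod_gt_0; lra).
  replace (/ w - / z - (w - z) * - / (z * z)) with ((w - z) ^ 2 / (w * z ^ 2)) by (field; auto).
  rewrite Cmod_div, Cmod_mult, !Cmod_pow; [|apply Cmult_neq_0; auto; now apply Cpow_nz].
  rewrite (Rmult_comm (2 / _)). unfold Rdiv. apply Rmult_le_compat_l; [apply pow2_ge_0|].
  rewrite <- (Rinv_involutive 2) by lra. rewrite <- Rinv_mult. apply Rinv_le_contravar.
  - apply Rmult_lt_0_compat; [lra|]. now apply pow_lt.
  - replace (Cmod z ^ 3)%R with (Cmod z * Cmod z ^ 2)%R by ring.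
    rewrite <- Rmult_assoc. apply Rmult_le_compat_r; [apply pow2_ge_0|]. lra.
Qed.

Lemma Cder_pow n z : Cder (fun w => w ^ n) z (RtoC (INR n) * z ^ (n - 1)).
Proof.
  induction n as [|n IH].
  - simpl. eapply Cder_eq; [|apply Cder_const]. cbv beta; ring.
  - apply Cder_ext with (fun w => w * w ^ n); [reflexivity|].
    eapply Cder_eq; [|exact (Cder_mult _ _ _ _ _ (Cder_id z) IH)].
    rewrite S_INR, RtoC_plus. replace (S n - 1)%nat with n by lia.
    destruct n as [|n]; [simpl; ring|].
    replace (S n - 1)%nat with n by lia. rewrite !Cpow_S. ring.
Qed.

Lemma Cder_is_derive f z d : Cder f z d ->
  is_derive (K := C_AbsRing) (V := C_NormedModule) f z d.
Proof.
  intros H. split.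
  - apply (is_linear_scal_l (K := C_AbsRing) (V := C_NormedModule)).
  - intros x Hx. apply (is_filter_lim_locally_unique (K := C_AbsRing) (V := AbsRing_NormedModule C_AbsRing)) in Hx.
    subst x. intros eps. destruct (H eps (cond_pos eps)) as (delta & Hd & L).
    exists (mkposreal delta Hd). intros w Hw.
    specialize (L w Hw). exact L.
Qed.

Lemma Cder_C_derive f z d : Cder f z d -> C_derive f z = d.
Proof. intros H. apply is_C_derive_unique. now apply Cder_is_derive. Qed.

(** * The mean value inequality *)

Lemma Cmod_sqr_conj (z : C) : Re (Cconj z * z) = (Cmod z ^ 2)%R.
Proof. rewrite Cmod2_alt. destruct z; simpl. ring. Qed.

Lemma Cder_real_line (F : C -> C) (a v c d : C) (s : R) :
  Cder F (a + RtoC s * v) d ->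
  derivable_pt_lim (fun x => Re (c * F (a + RtoC x * v))) s (Re (c * (v * d))).
Proof.
  intros H.
  assert (Hl : Cder (fun w => a + w * v) (RtoC s) v).
  { eapply Cder_eq; [|exact (Cder_plus _ _ _ _ _ (Cder_const a _)
       (Cder_mult _ _ _ _ _ (Cder_id _) (Cder_const v _)))]. cbv beta; ring. }
  pose proof (Cder_scal c _ _ _ (Cder_comp F (fun w => a + w * v) (RtoC s) _ _ H Hl)) as D.
  intros eps He. destruct (D (eps / 2)%R) as (delta & Hd & L); [lra|].
  exists (mkposreal delta Hd). intros h Hh Hlt. simpl in Hlt.
  specialize (L (RtoC (s + h))).
  replace (RtoC (s + h) - RtoC s) with (RtoC h) in L by (rewrite <- RtoC_minus; f_equal; ring).
  rewrite Cmod_R in L. specialize (L Hlt).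
  assert (P : (0 < Rabs h)%R) by now apply Rabs_pos_lt.
  set (A := c * F (a + RtoC (s + h) * v)) in *. set (B := c * F (a + RtoC s * v)) in *.
  set (D' := c * (v * d)) in *.
  pose proof (re_le_Cmod (A - B - RtoC h * D')) as T.
  replace (Re (A - B - RtoC h * D')) with (Re A - Re B - h * Re D')%R in T by (simpl; ring).
  replace ((Re A - Re B) / h - Re D')%R with ((Re A - Re B - h * Re D') / h)%R by (field; auto).
  unfold Rdiv at 1. rewrite Rabs_mult, Rabs_inv.
  apply (Rmult_lt_reg_r (Rabs h)); auto. rewrite Rmult_assoc, Rinv_l by lra. nra.
Qed.

(** With [D = F b - F a], the real mean value theorem for Re (conj D F) along the segment gives
    |D|^2 <= |D| M |b - a|. *)
Lemma mean_value_ineq (F F' : C -> C) (a b : C) M :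
  (forall s : R, (0 <= s <= 1)%R -> Cder F (a + RtoC s * (b - a)) (F' (a + RtoC s * (b - a)))) ->
  (forall s : R, (0 <= s <= 1)%R -> (Cmod (F' (a + RtoC s * (b - a))%C) <= M)%R) ->
  (Cmod (F b - F a) <= M * Cmod (b - a))%R.
Proof.
  intros HD HM. set (D := F b - F a).
  destruct (MVT_cor2 (fun x => Re (Cconj D * F (a + RtoC x * (b - a))))
     (fun x => Re (Cconj D * ((b - a) * F' (a + RtoC x * (b - a))))) 0 1) as (s & E & Hs); [lra| |].
  - intros s Hs. apply Cder_real_line. auto.
  - replace (a + RtoC 1 * (b - a)) with b in E by ring.
    replace (a + RtoC 0 * (b - a)) with a in E by ring.
    assert (E1 : (Re (Cconj D * F b)%C - Re (Cconj D * F a)%C = Cmod D ^ 2)%R).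
    { rewrite <- Cmod_sqr_conj. unfold D. simpl. ring. }
    rewrite E1 in E.
    assert (B : (Cmod D ^ 2 <= Cmod D * (Cmod (b - a) * M))%R).
    { rewrite E. rewrite Rminus_0_r, Rmult_1_r. eapply Rle_trans; [apply Rle_abs|].
      eapply Rle_trans; [apply re_le_Cmod|]. rewrite !Cmod_mult, Cmod_conj.
      apply Rmult_le_compat_l; [apply Cmod_ge_0|].
      apply Rmult_le_compat_l; [apply Cmod_ge_0|]. apply HM. lra. }
    pose proof (Cmod_ge_0 D) as P. destruct P as [P|P].
    + apply (Rmult_le_reg_l (Cmod D)); auto. simpl in B. lra.
    + fold D. rewrite <- P. apply Rmult_le_pos; [|apply Cmod_ge_0].
      eapply Rle_trans; [apply Cmod_ge_0|apply (HM 0%R); lra].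
Qed.

(** The mean value inequality twice: for [F w - w * F' a], whose derivative [F' w - F' a] is bounded
    by the same inequality for [F']. The loss of the factor 1/2 is harmless. *)
Lemma taylor_ineq (F F' F'' : C -> C) (a b : C) M :
  (forall s : R, (0 <= s <= 1)%R -> Cder F (a + RtoC s * (b - a)) (F' (a + RtoC s * (b - a)))) ->
  (forall s : R, (0 <= s <= 1)%R -> Cder F' (a + RtoC s * (b - a)) (F'' (a + RtoC s * (b - a)))) ->
  (forall s : R, (0 <= s <= 1)%R -> (Cmod (F'' (a + RtoC s * (b - a))%C) <= M)%R) ->
  (Cmod (F b - F a - (b - a) * F' a) <= M * Cmod (b - a) ^ 2)%R.
Proof.
  intros H1 H2 HM.
  assert (M0 : (0 <= M)%R) by (eapply Rle_trans; [apply Cmod_ge_0|apply (HM 0%R); lra]).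
  pose proof (mean_value_ineq (fun w => F w - w * F' a) (fun w => F' w - F' a) a b
    (M * Cmod (b - a))) as K.
  replace (F b - F a - (b - a) * F' a) with (F b - b * F' a - (F a - a * F' a)) by ring.
  replace (M * Cmod (b - a) ^ 2)%R with (M * Cmod (b - a) * Cmod (b - a))%R by ring.
  apply K.
  - intros s Hs. apply Cder_minus; auto.
    eapply Cder_eq; [|exact (Cder_mult _ _ _ _ _ (Cder_id _) (Cder_const (F' a) _))]. cbv beta; ring.
  - intros s Hs. pose proof (mean_value_ineq F' F'' a (a + RtoC s * (b - a)) M) as K'.
    eapply Rle_trans; [apply K'|].
    + intros x Hx. replace (a + RtoC x * (a + RtoC s * (b - a) - a)) with (a + RtoC (x * s) * (b - a))
        by (rewrite RtoC_mult; ring). apply H2. nra.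
    + intros x Hx. replace (a + RtoC x * (a + RtoC s * (b - a) - a)) with (a + RtoC (x * s) * (b - a))
        by (rewrite RtoC_mult; ring). apply HM. nra.
    + replace (a + RtoC s * (b - a) - a) with (RtoC s * (b - a)) by ring.
      rewrite Cmod_mult, Cmod_R, Rabs_pos_eq by lra.
      apply Rmult_le_compat_l; auto. pose proof (Cmod_ge_0 (b - a)). nra.
Qed.

(** Quadratic remainders with summable constants add up to a quadratic remainder, so no uniform
    convergence is needed. *)
Lemma Cder_usum {I : Type} (f : I -> C -> C) (g : I -> C) (M : I -> R) z delta : (0 < delta)%R ->
  (forall w, (Cmod (w - z) < delta)%R -> summable (fun i => f i w)) -> summable g ->
  summableR M ->
  (forall i w, (Cmod (w - z) < delta)%R ->
     (Cmod (f i w - f i z - (w - z) * g i) <= M i * Cmod (w - z) ^ 2)%R) ->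
  Cder (fun w => usum (fun i => f i w)) z (usum g).
Proof.
  intros Hd Sf Sg [K HK] B.
  assert (Hz : (Cmod (z - z) < delta)%R).
  { replace (z - z) with (RtoC 0) by ring. now rewrite Cmod_0. }
  apply Cder_quad with delta K; auto. intros w Hw.
  rewrite <- usum_scal, <- usum_minus, <- usum_minus; auto using summable_minus, summable_scal.
  apply usum_bound. intros l N.
  eapply Rle_trans; [apply rsum_le; intros i _; apply (B i w Hw)|].
  replace (rsum (fun i => M i * Cmod (w - z) ^ 2)%R l) with (Cmod (w - z) ^ 2 * rsum M l)%R.
  - rewrite Rmult_comm. apply Rmult_le_compat_r; [apply pow2_ge_0|]. auto.
  - rewrite <- rsum_scal. f_equal. apply functional_extensionality. intros; ring.
Qed.

(** * The exponential *)

Lemma Cexp_plus a b : Cexp (a + b) = Cexp a * Cexp b.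
Proof.
  unfold Cexp. destruct a as [a1 a2], b as [b1 b2]. simpl.
  rewrite exp_plus, cos_plus, sin_plus. unfold RtoC, Cmult; simpl. f_equal; ring.
Qed.

Lemma Cexp_0 : Cexp 0 = 1.
Proof. unfold Cexp. simpl. rewrite exp_0, cos_0, sin_0. unfold RtoC, Cmult; simpl. f_equal; ring. Qed.

Lemma Cmod_Cexp z : Cmod (Cexp z) = exp (Re z).
Proof.
  unfold Cexp. rewrite Cmod_mult, Cmod_R, Rabs_pos_eq by (left; apply exp_pos).
  unfold Cmod. simpl. rewrite !Rmult_1_r.
  replace (cos (Im z) * cos (Im z) + sin (Im z) * sin (Im z))%R with 1%R.
  - rewrite sqrt_1. ring.
  - pose proof (sin2_cos2 (Im z)) as H. unfold Rsqr in H. lra.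
Qed.

Lemma Cexp_nz z : Cexp z <> 0.
Proof. apply Cmod_gt_0. rewrite Cmod_Cexp. apply exp_pos. Qed.

Lemma Cexp_opp z : Cexp (- z) = / Cexp z.
Proof.
  assert (H : Cexp (- z) * Cexp z = 1) by (rewrite <- Cexp_plus, <- Cexp_0; f_equal; ring).
  replace (Cexp (- z)) with (Cexp (- z) * Cexp z * / Cexp z) by (field; apply Cexp_nz).
  rewrite H. ring.
Qed.

Lemma Cexp_pow z n : Cexp z ^ n = Cexp (RtoC (INR n) * z).
Proof.
  induction n as [|n IH].
  - simpl. rewrite Cmult_0_l, Cexp_0. reflexivity.
  - rewrite Cpow_S, IH, <- Cexp_plus, S_INR, RtoC_plus. f_equal. ring.
Qed.

Lemma exp_quad x : (Rabs x <= 1 / 2)%R -> (0 <= exp x - 1 - x <= 2 * x ^ 2)%R.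
Proof.
  intros H. apply Rabs_le_between in H. split; [pose proof (exp_ineq1_le x); lra|].
  assert (E : (exp x * exp (- x) = 1)%R) by (rewrite <- exp_plus, <- exp_0; f_equal; ring).
  pose proof (exp_ineq1_le (- x)). pose proof (exp_pos x).
  assert (exp x * (1 - x) <= 1)%R by nra.
  (* The product is 1 + x^2 (1 - 2 x). Together with exp x (1 - x) <= 1 it yields exp x <= 1 + x + 2
     x^2. *)
  assert (1 <= (1 + x + 2 * x ^ 2) * (1 - x))%R by nra.
  nra.
Qed.

Lemma sin_cos_quad y : (Rabs y <= 1)%R ->
  (Rabs (sin y - y) <= y ^ 2)%R /\ (Rabs (cos y - 1) <= y ^ 2)%R.
Proof.
  intros Hy.
  assert (S : forall x, (Rabs (sin x) <= Rabs x)%R).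
  { intros x. destruct (MVT_gen sin 0 x cos) as (c & _ & E).
    - intros t _. apply is_derive_sin.
    - intros t _. apply continuity_sin.
    - rewrite sin_0, !Rminus_0_r in E. rewrite E, Rabs_mult.
      assert (Rabs (cos c) <= 1)%R by (apply Rabs_le; apply COS_bound).
      pose proof (Rabs_pos x). nra. }
  assert (K : forall x, (Rabs (cos x - 1) <= x ^ 2)%R).
  { intros x. replace x with (2 * (x / 2))%R at 1 by field. rewrite cos_2a_sin.
    replace (1 - 2 * sin (x / 2) * sin (x / 2) - 1)%R with (- (2 * (sin (x / 2)) ^ 2))%R by ring.
    rewrite Rabs_Ropp, Rabs_pos_eq by (pose proof (pow2_ge_0 (sin (x / 2))); lra).
    specialize (S (x / 2)%R). pose proof (conj (Rabs_pos (sin (x / 2))) S) as S'.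
    apply (pow_incr _ _ 2) in S'. clear S; rename S' into S.
    rewrite !pow2_abs in S. pose proof (pow2_ge_0 x). lra. }
  split; auto.
  destruct (MVT_gen (fun x => sin x - x)%R 0 y (fun x => cos x - 1)%R) as (c & Hc & E).
  - intros t _. auto_derive; auto. ring.
  - intros t _. apply continuity_pt_minus; [apply continuity_sin|apply continuity_pt_id].
  - rewrite sin_0, !Rminus_0_r in E. rewrite E, Rabs_mult.
    assert (C1 : (Rabs c <= Rabs y)%R).
    { unfold Rmin, Rmax in Hc. destruct (Rle_dec 0 y).
      - rewrite !Rabs_pos_eq by lra. lra.
      - rewrite !Rabs_left1 by lra. lra. }
    specialize (K c). rewrite <- pow2_abs in K. rewrite <- (pow2_abs y).
    pose proof (Rabs_pos y). pose proof (Rabs_pos c).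
    assert (Rabs c ^ 2 <= Rabs y)%R by nra. nra.
Qed.

Lemma Cexp_quad w : (Cmod w < 1 / 2)%R -> (Cmod (Cexp w - 1 - w) <= 20 * Cmod w ^ 2)%R.
Proof.
  intros Hw. pose proof (re_le_Cmod w) as R1. pose proof (im_le_Cmod w) as R2.
  pose proof (Cmod2_alt w) as N. set (m := Cmod w) in *.
  destruct w as [x y]. simpl Re in *. simpl Im in *.
  destruct (exp_quad x) as [E1 E2]; [lra|]. destruct (sin_cos_quad y) as [S1 S2]; [lra|].
  apply Rabs_le_between in S1, S2.
  assert (Hx : (-1/2 < x < 1/2)%R) by (apply Rabs_le_between in R1; lra).
  assert (Hy : (-1/2 < y < 1/2)%R) by (apply Rabs_le_between in R2; lra).
  assert (Ex : (0 < exp x <= 3)%R) by (split; [apply exp_pos|nra]).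
  eapply Rle_trans; [apply Cmod_2Rmax|].
  assert (Q2 : (sqrt 2 <= 2)%R).
  { rewrite <- (sqrt_square 2) at 2 by lra. apply sqrt_le_1_alt. lra. }
  assert (A1 : (Rabs (fst (Cexp (x, y) - 1 - (x, y))%C) <= 10 * m ^ 2)%R).
  { rewrite N. simpl. apply Rabs_le.
    assert (0 <= exp x * (1 - cos y) <= 3 * y ^ 2)%R.
    { pose proof (COS_bound y). split; nra. }
    pose proof (pow2_ge_0 x). pose proof (pow2_ge_0 y). split; nra. }
  assert (A2 : (Rabs (snd (Cexp (x, y) - 1 - (x, y))%C) <= 10 * m ^ 2)%R).
  { rewrite N. simpl. apply Rabs_le.
    assert (B1 : (- (3 * y ^ 2) <= exp x * (sin y - y) <= 3 * y ^ 2)%R).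
    { pose proof (pow2_ge_0 y). split; nra. }
    assert (B2 : (- (2 * x ^ 2 + 2 * y ^ 2) <= (exp x - 1) * y <= 2 * x ^ 2 + 2 * y ^ 2)%R).
    { assert (Rabs (exp x - 1) <= 2 * Rabs x)%R.
      { apply Rabs_le. unfold Rabs. destruct (Rcase_abs x); split; nra. }
      assert (Rabs ((exp x - 1) * y) <= 2 * (Rabs x * Rabs y))%R.
      { rewrite Rabs_mult. pose proof (Rabs_pos y). nra. }
      rewrite <- (pow2_abs x), <- (pow2_abs y).
      assert (2 * (Rabs x * Rabs y) <= 2 * Rabs x ^ 2 + 2 * Rabs y ^ 2)%R.
      { pose proof (pow2_ge_0 (Rabs x - Rabs y)). pose proof (pow2_ge_0 (Rabs x)).
        pose proof (pow2_ge_0 (Rabs y)). nra. }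
      apply Rabs_le_between. lra. }
    pose proof (pow2_ge_0 x). pose proof (pow2_ge_0 y). split; nra. }
  pose proof (Rmax_lub _ _ _ A1 A2) as A3.
  assert (0 <= Rmax (Rabs (fst (Cexp (x, y) - 1 - (x, y))%C)) (Rabs (snd (Cexp (x, y) - 1 - (x, y))%C)))%R.
  { eapply Rle_trans; [apply Rabs_pos|apply Rmax_l]. }
  pose proof (sqrt_pos 2). nra.
Qed.

Lemma Cder_Cexp z : Cder Cexp z (Cexp z).
Proof.
  apply Cder_quad with (1 / 2)%R (Cmod (Cexp z) * 20)%R; [lra|]. intros w Hw.
  replace (Cexp w - Cexp z - (w - z) * Cexp z) with (Cexp z * (Cexp (w - z) - 1 - (w - z))).
  - rewrite Cmod_mult, Rmult_assoc. apply Rmult_le_compat_l; [apply Cmod_ge_0|]. now apply Cexp_quad.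
  - replace w with (z + (w - z)) at 3 by ring. rewrite Cexp_plus. ring.
Qed.

Lemma Cder_exp f z d : Cder f z d -> Cder (fun w => Cexp (f w)) z (d * Cexp (f z)).
Proof. intros H. exact (Cder_comp Cexp f z _ _ (Cder_Cexp _) H). Qed.

Lemma Cexp_2PI_Z (k : Z) : Cexp (RtoC (2 * PI * IZR k) * Ci) = 1.
Proof.
  assert (P : forall n, Cexp (RtoC (2 * PI * INR n) * Ci) = 1).
  { intros n. replace (RtoC (2 * PI * INR n) * Ci) with (RtoC (INR n) * (RtoC (2 * PI) * Ci))
      by (rewrite !RtoC_mult; ring).
    rewrite <- Cexp_pow. unfold Cexp at 1. simpl.
    replace (2 * PI * 0 - 0 * 1)%R with 0%R by ring. replace (2 * PI * 1 + 0 * 0)%R with (2 * PI)%R by ring.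
    rewrite exp_0, cos_2PI, sin_2PI. change ((1, 0)%R) with (RtoC 1). rewrite Cmult_1_l. apply Cpow_1_l. }
  destruct (Z_le_dec 0 k) as [H|H].
  - rewrite <- (Z2Nat.id k) by auto. rewrite <- INR_IZR_INZ. apply P.
  - replace (RtoC (2 * PI * IZR k) * Ci) with (- (RtoC (2 * PI * INR (Z.to_nat (- k))) * Ci)).
    + rewrite Cexp_opp, P. field.
    + rewrite INR_IZR_INZ, Z2Nat.id by lia. rewrite opp_IZR, !RtoC_mult, RtoC_opp. ring.
Qed.

(** * Riemann sums on the real line *)

Lemma rsum_Z_bound (g : Z -> R) M1 M2 : (forall z, 0 <= g z)%R ->
  (forall n, rsum (fun k => g (Z.of_nat k)) (seq 0 n) <= M1)%R ->
  (forall n, rsum (fun k => g (- Z.of_nat (S k))%Z) (seq 0 n) <= M2)%R ->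
  forall l, NoDup l -> (rsum g l <= M1 + M2)%R.
Proof.
  intros Hg H1 H2 l N. set (n := S (list_max (map Z.abs_nat l))).
  apply Rle_trans with (rsum g (map Z.of_nat (seq 0 n) ++ map (fun k => (- Z.of_nat (S k))%Z) (seq 0 n))).
  - apply rsum_incl; auto.
    + apply NoDup_app.
      * apply FinFun.Injective_map_NoDup; [intros a b; lia|apply seq_NoDup].
      * apply FinFun.Injective_map_NoDup; [intros a b; lia|apply seq_NoDup].
      * intros a Ha Hb. apply in_map_iff in Ha, Hb.
        destruct Ha as (x & Ea & _), Hb as (y & Eb & _). lia.
    + intros z Hz.
      assert (Hm : (Z.abs_nat z <= list_max (map Z.abs_nat l))%nat).
      { pose proof (proj1 (list_max_le (map Z.abs_nat l) _) (le_n _)) as Hm.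
        rewrite Forall_forall in Hm. now apply Hm, in_map. }
      apply in_or_app. destruct (Z_le_dec 0 z).
      * left. apply in_map_iff. exists (Z.to_nat z). split; [lia|]. apply in_seq. unfold n. lia.
      * right. apply in_map_iff. exists (Z.to_nat (- z - 1)). split; [lia|]. apply in_seq. unfold n. lia.
  - rewrite rsum_app, !rsum_map. apply Rplus_le_compat; auto.
Qed.

Lemma rsum_seq_S (g : nat -> R) n : rsum g (seq 0 (S n)) = (rsum g (seq 0 n) + g n)%R.
Proof. rewrite seq_S, rsum_app. simpl. ring. Qed.

Lemma riemann_inv_quad (h : R) : (0 < h <= 1)%R -> forall l, NoDup l ->
  (rsum (fun k => h / (1 + (IZR k * h) ^ 2))%R l <= 6)%R.
Proof.
  intros Hh. replace 6%R with (3 + 3)%R by ring.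
  assert (P : forall x, (0 < 1 + x ^ 2)%R) by (intros x; pose proof (pow2_ge_0 x); lra).
  assert (A : forall n, (rsum (fun k => h / (1 + (INR k * h) ^ 2)) (seq 0 (S n)) <= h + 2 * (1 - 1 / (1 + INR n * h)))%R).
  { induction n as [|n IH].
    - simpl. field_simplify; lra.
    - rewrite rsum_seq_S.
      assert (0 <= INR n * h)%R by (apply Rmult_le_pos; [apply pos_INR|lra]).
      assert (h / (1 + (INR (S n) * h) ^ 2) <= 2 * (1 / (1 + INR n * h) - 1 / (1 + INR (S n) * h)))%R; [|lra].
      rewrite S_INR. set (y := (INR n * h)%R) in *. replace ((INR n + 1) * h)%R with (y + h)%R by (unfold y; ring).
      replace (2 * (1 / (1 + y) - 1 / (1 + (y + h))))%R with (h * (2 / ((1 + y) * (1 + (y + h)))))%R by (field; lra).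
      unfold Rdiv at 1. apply Rmult_le_compat_l; [lra|].
      rewrite <- (Rinv_involutive 2) at 1 by lra. unfold Rdiv. rewrite <- Rinv_mult. apply Rinv_le_contravar.
      + apply Rmult_lt_0_compat; [lra|]. apply Rmult_lt_0_compat; lra.
      + assert ((1 + y) * (1 + (y + h)) <= 2 * (1 + (y + h) ^ 2))%R; [|lra].
        pose proof (pow2_ge_0 (y + h - 1)). nra. }
  assert (B : forall n, (rsum (fun k => h / (1 + (INR k * h) ^ 2)) (seq 0 n) <= 3)%R).
  { intros n. destruct n as [|n]; [simpl; lra|]. eapply Rle_trans; [apply A|].
    assert (0 < 1 / (1 + INR n * h))%R; [|lra].
    apply Rdiv_lt_0_compat; [lra|]. assert (0 <= INR n * h)%R by (apply Rmult_le_pos; [apply pos_INR|lra]). lra. }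
  apply rsum_Z_bound.
  - intros z. apply Rlt_le, Rdiv_lt_0_compat; [lra|auto].
  - intros n. eapply Rle_trans; [|apply (B n)]. apply rsum_le. intros k _. rewrite INR_IZR_INZ. apply Rle_refl.
  - intros n. eapply Rle_trans; [|apply (B (S n))].
    simpl seq. rewrite rsum_cons, <- seq_shift, rsum_map.
    eapply Rle_trans; [apply rsum_le with (g := fun k => (h / (1 + (INR (S k) * h) ^ 2))%R)|].
    + intros k _. rewrite opp_IZR, <- INR_IZR_INZ. right. f_equal. ring.
    + simpl INR at 2. assert (0 < h / (1 + (0 * h) ^ 2))%R by (apply Rdiv_lt_0_compat; [lra|auto]). lra.
Qed.

(** Only real arguments are constrained: the functions are differentiated on the complex plane but
    sampled on the real line. Quadratic decay is what keeps Riemann sums bounded uniformly in the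
    mesh. *)
Definition decay (F : C -> C) (K : R) : Prop :=
  forall x : R, (Cmod (F (RtoC x)) <= K / (1 + x ^ 2))%R.

Lemma inv_quad_near x y : (Rabs (y - x) <= 1)%R -> (/ (1 + y ^ 2) <= 3 / (1 + x ^ 2))%R.
Proof.
  intros H. pose proof (pow2_ge_0 x). pose proof (pow2_ge_0 y).
  apply Rabs_le_between in H.
  rewrite <- (Rinv_involutive 3) by lra. unfold Rdiv. rewrite <- Rinv_mult.
  apply Rinv_le_contravar; [lra|]. assert (x ^ 2 <= 2 * y ^ 2 + 2)%R; [|lra].
  assert (- 1 <= (y - x) <= 1)%R by lra.
  assert ((y - x) ^ 2 <= 1)%R by nra. pose proof (pow2_ge_0 (2 * y - x)). nra.
Qed.

Lemma decay_pos F K : decay F K -> (0 <= K)%R.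
Proof.
  intros H. specialize (H 0%R). pose proof (Cmod_ge_0 (F 0)).
  replace (K / (1 + 0 ^ 2))%R with K in H by (simpl; field). lra.
Qed.

Lemma riemann_bound (F : Z -> C) K h : (0 < h <= 1)%R ->
  (forall k, (Cmod (F k) <= K / (1 + (IZR k * h) ^ 2))%R) -> (0 <= K)%R ->
  forall l, NoDup l -> (rsum (fun k => Cmod (RtoC h * F k)) l <= 6 * K)%R.
Proof.
  intros Hh HF HK l N.
  apply Rle_trans with (rsum (fun k => K * (h / (1 + (IZR k * h) ^ 2)))%R l).
  - apply rsum_le. intros k _. rewrite Cmod_mult, Cmod_R, Rabs_pos_eq by lra.
    specialize (HF k). apply (Rmult_le_compat_l h) in HF; [|lra].
    eapply Rle_trans; [exact HF|]. right. unfold Rdiv. ring.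
  - rewrite rsum_scal, Rmult_comm. apply Rmult_le_compat_r; auto. now apply riemann_inv_quad.
Qed.

Lemma riemann_summable (F : Z -> C) K h : (0 < h <= 1)%R ->
  (forall k, (Cmod (F k) <= K / (1 + (IZR k * h) ^ 2))%R) -> (0 <= K)%R -> summable F.
Proof.
  intros Hh HF HK.
  apply summable_ext with (fun k => RtoC (/ h) * (RtoC h * F k)).
  - intros k. rewrite Cmult_assoc, <- RtoC_mult, Rinv_l by lra. ring.
  - apply summable_scal. exists (6 * K)%R. now apply riemann_bound.
Qed.

Lemma summable_decay F K h b : (0 < h <= 1)%R -> (Rabs b <= 1)%R -> decay F K ->
  summable (fun k : Z => F (RtoC (IZR k * h + b))).
Proof.
  intros Hh Hb HF. pose proof (decay_pos _ _ HF). apply riemann_summable with (K * 3)%R h; auto; [|lra].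
  intros k. eapply Rle_trans; [apply HF|]. unfold Rdiv. rewrite Rmult_assoc.
  apply Rmult_le_compat_l; auto. apply inv_quad_near.
  now replace (IZR k * h + b - IZR k * h)%R with b by ring.
Qed.

Lemma summable_decay0 F K h : (0 < h <= 1)%R -> decay F K ->
  summable (fun k : Z => F (RtoC (IZR k * h))).
Proof.
  intros Hh HF. apply summable_ext with (fun k : Z => F (RtoC (IZR k * h + 0))).
  - intros k. now rewrite Rplus_0_r.
  - apply summable_decay with K; auto. rewrite Rabs_R0. lra.
Qed.

Lemma taylor_decay (F F' F'' : C -> C) K x h : (forall z, Cder F z (F' z)) ->
  (forall z, Cder F' z (F'' z)) -> decay F'' K -> (Rabs h <= 1)%R ->
  (Cmod (F (RtoC (x + h)) - F (RtoC x) - RtoC h * F' (RtoC x)) <= (3 * K * h ^ 2) / (1 + x ^ 2))%R.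
Proof.
  intros H1 H2 HK Hh. pose proof (decay_pos _ _ HK).
  pose proof (taylor_ineq F F' F'' (RtoC x) (RtoC (x + h)) (3 * K / (1 + x ^ 2))) as T.
  replace (RtoC (x + h) - RtoC x) with (RtoC h) in T by (rewrite <- RtoC_minus; f_equal; ring).
  rewrite Cmod_R, pow2_abs in T.
  eapply Rle_trans; [apply T|]; auto.
  - intros s Hs. replace (RtoC x + RtoC s * RtoC h) with (RtoC (x + s * h)) by (rewrite RtoC_plus, RtoC_mult; auto).
    eapply Rle_trans; [apply HK|]. replace (3 * K / (1 + x ^ 2))%R with (K * (3 / (1 + x ^ 2)))%R.
    + apply Rmult_le_compat_l; auto. apply inv_quad_near.
      replace (x + s * h - x)%R with (s * h)%R by ring. rewrite Rabs_mult, (Rabs_pos_eq s) by lra.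
      pose proof (Rabs_pos h). nra.
    + unfold Rdiv. ring.
  - right. unfold Rdiv. ring.
Qed.

Lemma usum_shift (f : Z -> C) c : summable f -> usum (fun k => f (k + c)%Z) = usum f.
Proof.
  intros H. symmetry. apply (usum_bij f (fun k => (k + c)%Z) (fun k => (k - c)%Z)); auto; intros; lia.
Qed.

Lemma summable_shift (f : Z -> C) c : summable f -> summable (fun k => f (k + c)%Z).
Proof. intros H. apply (summable_inj f (fun k => (k + c)%Z)); auto. intros; lia. Qed.

(* Riemann sums of a derivative almost telescope. *)
Lemma riemann_sum_derivative (W W' W'' : C -> C) K0 K1 K2 h : (forall z, Cder W z (W' z)) ->
  (forall z, Cder W' z (W'' z)) -> decay W K0 -> decay W' K1 -> decay W'' K2 -> (0 < h <= 1)%R ->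
  Cmod (usum (fun k : Z => RtoC h * W' (RtoC (IZR k * h)))) <= (18 * K2 * h)%R.
Proof.
  intros D1 D2 H0 H1 H2 Hh. pose proof (decay_pos _ _ H2).
  assert (S0 : summable (fun k : Z => W (RtoC (IZR k * h)))) by now apply summable_decay0 with K0.
  assert (S1 : summable (fun k : Z => W' (RtoC (IZR k * h)))) by now apply summable_decay0 with K1.
  set (D := fun k : Z => (W (RtoC (IZR (k + 1) * h)) - W (RtoC (IZR k * h)))
     - RtoC h * W' (RtoC (IZR k * h))).
  assert (E : usum (fun k : Z => RtoC h * W' (RtoC (IZR k * h))) = - usum D).
  { unfold D. rewrite !usum_minus; auto using summable_scal, summable_minus.
    - rewrite (usum_shift (fun k => W (RtoC (IZR k * h))) 1) by auto. ring.
    - exact (summable_shift (fun k => W (RtoC (IZR k * h))) 1 S0).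
    - apply summable_minus; auto. exact (summable_shift (fun k => W (RtoC (IZR k * h))) 1 S0). }
  rewrite E, Cmod_opp.
  replace D with (fun k => RtoC h * (RtoC (/ h) * D k)).
  - apply usum_bound. intros l N.
    replace (18 * K2 * h)%R with (6 * (3 * K2 * h))%R by ring. apply riemann_bound; auto.
    + intros k. rewrite Cmod_mult, Cmod_R, Rabs_pos_eq by (left; apply Rinv_0_lt_compat; lra).
      pose proof (taylor_decay W W' W'' K2 (IZR k * h) h D1 D2 H2) as T.
      rewrite (Rabs_pos_eq h) in T by lra. specialize (T ltac:(lra)).
      apply (Rmult_le_compat_l (/ h)) in T; [|left; apply Rinv_0_lt_compat; lra].
      unfold D. rewrite plus_IZR. replace ((IZR k + 1) * h)%R with (IZR k * h + h)%R by ring.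
      eapply Rle_trans; [exact T|]. right. field. pose proof (pow2_ge_0 (IZR k * h)). split; lra.
    + apply Rmult_le_pos; lra.
  - apply functional_extensionality. intros k. rewrite Cmult_assoc, <- RtoC_mult, Rinv_r by lra. ring.
Qed.

(** Half-open, hence a complete system of residues modulo [2 * n]: the frequencies of the finite
    Fourier inversion. *)
Definition zrange (n : nat) : list Z := map (fun i => (Z.of_nat i - Z.of_nat n)%Z) (seq 0 (2 * n)).

Lemma in_zrange n k : In k (zrange n) <-> (- Z.of_nat n <= k < Z.of_nat n)%Z.
Proof.
  unfold zrange. rewrite in_map_iff. split.
  - intros (i & <- & Hi). apply in_seq in Hi. lia.
  - intros H. exists (Z.to_nat (k + Z.of_nat n)). rewrite in_seq. lia.
Qed.

Lemma NoDup_zrange n : NoDup (zrange n).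
Proof. apply FinFun.Injective_map_NoDup; [intros a b; lia|apply seq_NoDup]. Qed.

Lemma lsum_telescope (f : Z -> C) n :
  lsum (fun k => f (k + 1)%Z - f k) (zrange n) = f (Z.of_nat n) - f (- Z.of_nat n)%Z.
Proof.
  unfold zrange. rewrite lsum_map.
  assert (A : forall m, lsum (fun i => f (Z.of_nat i - Z.of_nat n + 1)%Z - f (Z.of_nat i - Z.of_nat n)%Z) (seq 0 m)
     = f (Z.of_nat m - Z.of_nat n)%Z - f (- Z.of_nat n)%Z).
  { induction m as [|m IH]; [simpl; ring|].
    rewrite seq_S, lsum_app, IH. simpl lsum.
    replace (Z.of_nat m - Z.of_nat n + 1)%Z with (Z.of_nat (S m) - Z.of_nat n)%Z by lia. ring. }
  rewrite A. f_equal. f_equal. lia.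
Qed.

Lemma Cder_lsum {I : Type} (f f' : I -> C -> C) l z : (forall i, Cder (f i) z (f' i z)) ->
  Cder (fun w => lsum (fun i => f i w) l) z (lsum (fun i => f' i z) l).
Proof.
  intros H. induction l as [|a l IH]; [exact (Cder_const 0 z)|].
  exact (Cder_plus _ _ _ _ _ (H a) IH).
Qed.

Lemma le_of_eventually_inv (a b c h : R) : (0 < h)%R -> (0 <= c)%R ->
  (forall n : nat, a <= b + c / (1 + (INR n * h) ^ 2))%R -> (a <= b)%R.
Proof.
  intros Hh Hc H. apply le_epsilon. intros eps He.
  destruct (nfloor_ex ((c / eps + 1) / h)) as [n Hn].
  { apply Rdiv_le_0_compat; auto. pose proof (Rdiv_le_0_compat c eps Hc He). lra. }
  eapply Rle_trans; [apply (H (S n))|]. apply Rplus_le_compat_l. rewrite S_INR.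
  assert (A : (c / eps + 1 < (INR n + 1) * h)%R).
  { apply (Rmult_lt_reg_r (/ h)); [now apply Rinv_0_lt_compat|]. rewrite Rmult_assoc, Rinv_r by lra.
    unfold Rdiv in Hn. lra. }
  pose proof (Rdiv_le_0_compat c eps Hc He).
  set (y := ((INR n + 1) * h)%R) in *.
  assert (B : (c / eps < 1 + y ^ 2)%R) by nra.
  apply (Rmult_le_reg_r (1 + y ^ 2)); [lra|]. unfold Rdiv. rewrite Rmult_assoc, Rinv_l by lra.
  apply (Rmult_lt_compat_r eps) in B; auto. unfold Rdiv in B. rewrite Rmult_assoc, Rinv_l in B by lra. lra.
Qed.

(* Deforming Gaussians along a path replaces the contour shift of the usual proof of Poisson summation. *)
Lemma riemann_sum_deformation (G : C -> C -> C) (W W' W'' : C -> C -> C) KG K h :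
  (forall s x, Cder (fun u => G u x) s (W' s x)) ->
  (forall s z, Cder (W s) z (W' s z)) -> (forall s z, Cder (W' s) z (W'' s z)) ->
  (forall s : R, (0 <= s <= 1)%R -> decay (G (RtoC s)) KG /\ decay (W (RtoC s)) K /\ decay (W'' (RtoC s)) K) ->
  (0 < h <= 1)%R ->
  Cmod (usum (fun k : Z => RtoC h * G 1 (RtoC (IZR k * h)))
       - usum (fun k : Z => RtoC h * G 0 (RtoC (IZR k * h)))) <= (18 * K * h)%R.
Proof.
  intros DG DW DW' Hd Hh.
  assert (K0 : (0 <= K)%R) by (apply (decay_pos (W (RtoC 0))); apply (Hd 0%R); lra).
  assert (SG : forall s : R, (0 <= s <= 1)%R -> summable (fun k : Z => RtoC h * G (RtoC s) (RtoC (IZR k * h)))).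
  { intros s Hs. apply summable_scal. apply summable_decay0 with KG; auto. now apply Hd. }
  pose proof (SG 1%R ltac:(lra)) as S1. pose proof (SG 0%R ltac:(lra)) as S0.
  (* Mean value inequality in [s] for the truncated sum. Its derivative in [s] is a Riemann sum of
     the [z]-derivative of [W s], which telescopes up to [18 * K * h], leaving the two boundary
     values of [W s]. *)
  assert (B : forall n, Cmod (lsum (fun k : Z => RtoC h * G 1 (RtoC (IZR k * h))) (zrange n)
       - lsum (fun k : Z => RtoC h * G 0 (RtoC (IZR k * h))) (zrange n))
       <= (18 * K * h + 2 * K / (1 + (INR n * h) ^ 2))%R).
  { intros n.
    pose proof (mean_value_ineq (fun s => lsum (fun k : Z => RtoC h * G s (RtoC (IZR k * h))) (zrange n))
      (fun s => lsum (fun k : Z => RtoC h * W' s (RtoC (IZR k * h))) (zrange n)) (RtoC 0) (RtoC 1)) as MV.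
    cbv beta in MV. specialize (MV (18 * K * h + 2 * K / (1 + (INR n * h) ^ 2))%R).
    replace (RtoC 1 - RtoC 0) with (RtoC 1) in MV by ring. rewrite Cmod_1, Rmult_1_r in MV.
    apply MV.
    - intros s Hs. apply (Cder_lsum (fun k s => RtoC h * G s (RtoC (IZR k * h)))
        (fun k s => RtoC h * W' s (RtoC (IZR k * h)))). intros k. apply Cder_scal, DG.
    - intros s Hs. replace (RtoC 0 + RtoC s * 1) with (RtoC s) by ring.
      destruct (Hd s Hs) as (_ & Hw & Hw'').
      set (w := fun k : Z => W (RtoC s) (RtoC (IZR k * h))).
      set (R1 := fun k : Z => RtoC (/ h) * (w (k + 1)%Z - w k - RtoC h * W' (RtoC s) (RtoC (IZR k * h)))).
      rewrite (lsum_ext_in _ (fun k => (w (k + 1)%Z - w k) + RtoC (-1) * (RtoC h * R1 k))).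
      + rewrite lsum_plus, lsum_telescope, lsum_scal.
        eapply Rle_trans; [apply Cmod_triangle|]. rewrite Rplus_comm. apply Rplus_le_compat.
        * rewrite Cmod_mult, Cmod_R. replace (Rabs (-1)) with 1%R by (rewrite Rabs_left; lra). rewrite Rmult_1_l.
          eapply Rle_trans; [apply Cmod_lsum|].
          replace (18 * K * h)%R with (6 * (3 * K * h))%R by ring.
          apply riemann_bound; auto using NoDup_zrange.
          -- intros k. unfold R1. rewrite Cmod_mult, Cmod_R, Rabs_pos_eq by (left; apply Rinv_0_lt_compat; lra).
             pose proof (taylor_decay (W (RtoC s)) (W' (RtoC s)) (W'' (RtoC s)) K (IZR k * h) h (DW _) (DW' _) Hw'') as T.
             rewrite (Rabs_pos_eq h) in T by lra. specialize (T ltac:(lra)).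
             apply (Rmult_le_compat_l (/ h)) in T; [|left; apply Rinv_0_lt_compat; lra].
             unfold w. rewrite plus_IZR. replace ((IZR k + 1) * h)%R with (IZR k * h + h)%R by ring.
             eapply Rle_trans; [exact T|]. right. field. pose proof (pow2_ge_0 (IZR k * h)). split; lra.
          -- apply Rmult_le_pos; lra.
        * unfold Cminus. eapply Rle_trans; [apply Cmod_triangle|]. rewrite Cmod_opp. unfold w.
          rewrite opp_IZR, <- INR_IZR_INZ.
          pose proof (Hw (INR n * h)%R). pose proof (Hw (- INR n * h)%R).
          replace ((- INR n * h) ^ 2)%R with ((INR n * h) ^ 2)%R in H0 by ring.
          replace (2 * K / (1 + (INR n * h) ^ 2))%R with (K / (1 + (INR n * h) ^ 2) + K / (1 + (INR n * h) ^ 2))%R.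
          -- lra.
          -- unfold Rdiv. ring.
      + intros k _. unfold R1. rewrite (Cmult_assoc (RtoC h)), <- RtoC_mult, Rinv_r by lra.
        replace (RtoC (-1)) with (- RtoC 1) by (rewrite <- RtoC_opp; f_equal; lra). ring. }
  assert (L : forall f : Z -> C, summable f -> Climseq (fun n => lsum f (zrange n)) (usum f)).
  { intros f Sf eps He. destruct (summable_is_usum f Sf eps He) as (l0 & N0 & L0).
    exists (S (list_max (map Z.abs_nat l0))). intros n Hn. apply L0; auto using NoDup_zrange.
    intros z Hz. apply in_zrange.
    pose proof (proj1 (list_max_le (map Z.abs_nat l0) _) (le_n _)) as Hm.
    rewrite Forall_forall in Hm. specialize (Hm _ (in_map Z.abs_nat _ _ Hz)). lia. }
  apply le_epsilon. intros eps He.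
  destruct (L _ S1 (eps / 2)%R) as [N1 L1]; [lra|]. destruct (L _ S0 (eps / 2)%R) as [N2 L2]; [lra|].
  (* The boundary values vanish as the truncation grows with the mesh fixed. *)
  apply le_of_eventually_inv with (2 * K)%R h; [lra|lra|]. intros n0.
  set (n := (N1 + N2 + n0)%nat).
  specialize (L1 n ltac:(unfold n; lia)). specialize (L2 n ltac:(unfold n; lia)). specialize (B n).
  set (l1 := lsum _ (zrange n)) in L1. set (l2 := lsum _ (zrange n)) in L2. fold l1 l2 in B.
  set (u1 := usum _) in *. set (u2 := usum (fun k : Z => RtoC h * G 0 _)) in *.
  replace (u1 - u2) with ((l1 - l2) + - (l1 - u1) + (l2 - u2)) by ring.
  eapply Rle_trans; [apply Cmod_triangle|].
  eapply Rle_trans; [apply Rplus_le_compat_r, Cmod_triangle|]. rewrite Cmod_opp.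
  assert (2 * K / (1 + (INR n * h) ^ 2) <= 2 * K / (1 + (INR n0 * h) ^ 2))%R; [|lra].
  unfold Rdiv. apply Rmult_le_compat_l; [lra|]. apply Rinv_le_contravar.
  - pose proof (pow2_ge_0 (INR n0 * h)). lra.
  - apply Rplus_le_compat_l. apply pow_incr. split.
    + apply Rmult_le_pos; [apply pos_INR|lra].
    + apply Rmult_le_compat_r; [lra|]. apply le_INR. unfold n. lia.
Qed.

(** * Gaussians *)

(** The linear factor covers three uses: [u = 0] for the even theta sum, [v = 0] for the odd one,
    and [u = al - 1], [v = be] for the function whose [z]-derivative is the derivative of the
    Gaussian along the path of parameters. *)
Definition gaussP (u v al be z : C) : C := (u * z + v) * Cexp (- RtoC PI * (al * z + be) ^ 2).
Definition gaussP' (u v al be z : C) : C :=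
  (u - RtoC (2 * PI) * al * (al * z + be) * (u * z + v)) * Cexp (- RtoC PI * (al * z + be) ^ 2).
Definition gaussP'' (u v al be z : C) : C :=
  (- RtoC (2 * PI) * al * (al * (u * z + v) + (al * z + be) * u)
   - RtoC (2 * PI) * al * (al * z + be) * (u - RtoC (2 * PI) * al * (al * z + be) * (u * z + v)))
  * Cexp (- RtoC PI * (al * z + be) ^ 2).

Lemma Cder_affine a b z : Cder (fun w => a * w + b) z a.
Proof.
  eapply Cder_eq; [|exact (Cder_plus _ _ _ _ _ (Cder_scal a _ _ _ (Cder_id z)) (Cder_const b z))].
  cbv beta; ring.
Qed.

Lemma Cder_gauss_exp al be z : Cder (fun w => Cexp (- RtoC PI * (al * w + be) ^ 2)) z
  (- RtoC (2 * PI) * al * (al * z + be) * Cexp (- RtoC PI * (al * z + be) ^ 2)).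
Proof.
  pose proof (Cder_mult _ _ _ _ _ (Cder_affine al be z) (Cder_affine al be z)) as H.
  apply (Cder_scal (- RtoC PI)), Cder_exp in H.
  apply Cder_ext with (g := fun w => Cexp (- RtoC PI * (al * w + be) ^ 2)) in H.
  - eapply Cder_eq; [|exact H]. cbv beta. rewrite RtoC_mult.
    replace ((al * z + be) ^ 2) with ((al * z + be) * (al * z + be)) by ring. ring.
  - intros w. f_equal. ring.
Qed.

Lemma Cder_gaussP u v al be z : Cder (gaussP u v al be) z (gaussP' u v al be z).
Proof.
  eapply Cder_eq; [|exact (Cder_mult _ _ _ _ _ (Cder_affine u v z) (Cder_gauss_exp al be z))].
  unfold gaussP'. cbv beta. ring.
Qed.

Lemma Cder_gaussP' u v al be z : Cder (gaussP' u v al be) z (gaussP'' u v al be z).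
Proof.
  pose proof (Cder_mult _ _ _ _ _ (Cder_affine al be z) (Cder_affine u v z)) as H1.
  apply (Cder_scal (- RtoC (2 * PI) * al)) in H1.
  pose proof (Cder_plus _ _ _ _ _ (Cder_const u z) H1) as H2.
  pose proof (Cder_mult _ _ _ _ _ H2 (Cder_gauss_exp al be z)) as H3.
  apply Cder_ext with (g := gaussP' u v al be) in H3.
  - eapply Cder_eq; [|exact H3]. unfold gaussP''. cbv beta. ring.
  - intros w. unfold gaussP'. f_equal. ring.
Qed.

(** The exponent 3 is what is needed: against a cubic polynomial, at most 4 (1 + x^2)^2, the bound
    (1 + x^2)^(-3) leaves a factor 1/(1 + x^2). *)
Lemma exp_neg_cube y : (0 <= y)%R -> (exp (- y) <= / (1 + y / 3) ^ 3)%R.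
Proof.
  intros Hy. rewrite exp_Ropp. apply Rinv_le_contravar; [apply pow_lt; lra|].
  replace y with (y / 3 + y / 3 + y / 3)%R at 2 by field. rewrite !exp_plus.
  pose proof (exp_ineq1_le (y / 3)) as E. set (e := exp (y / 3)) in *.
  replace (e * e * e)%R with (e ^ 3)%R by ring. apply pow_incr. lra.
Qed.

Lemma PI_bounds : (3 < PI <= 4)%R.
Proof. split; [pose proof PI2_3_2; lra|apply PI_4]. Qed.

(** The real part of (al x + be)^2 has leading coefficient Re (al^2) >= [delta]. Half of [delta] x^2
    absorbs the linear term by completing the square, the other half remains. *)
Lemma gauss_exp_bound A delta al be x : (1 <= A)%R -> (0 < delta)%R ->
  (Cmod al <= A)%R -> (Cmod be <= A)%R -> (delta <= Re al ^ 2 - Im al ^ 2)%R ->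
  Cmod (Cexp (- RtoC PI * (al * RtoC x + be) ^ 2)) <=
    (exp (PI * (2 * A ^ 4 / delta + A ^ 2)) * exp (- (PI * delta * x ^ 2 / 2)))%R.
Proof.
  intros HA Hd Hal Hbe Hre. rewrite Cmod_Cexp, <- exp_plus.
  assert (Q : (delta * x ^ 2 / 2 - (2 * A ^ 4 / delta + A ^ 2) <= Re ((al * RtoC x + be) ^ 2)%C)%R).
  { assert (B1 : (Rabs (Re (al * be)%C) <= A ^ 2)%R).
    { eapply Rle_trans; [apply re_le_Cmod|]. rewrite Cmod_mult. simpl. rewrite Rmult_1_r.
      apply Rmult_le_compat; auto using Cmod_ge_0. }
    assert (B2 : (- A ^ 2 <= Re be ^ 2 - Im be ^ 2)%R).
    { pose proof (Cmod2_alt be). pose proof (Cmod_ge_0 be). pose proof (pow2_ge_0 (Re be)). nra. }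
    destruct al as [a b], be as [c d]. simpl Re in *. simpl Im in *.
    apply Rabs_le_between in B1. set (e := (a * c - b * d)%R) in *.
    assert (B3 : (- (delta * x ^ 2 / 2 + 2 * A ^ 4 / delta) <= 2 * e * x)%R).
    { assert (0 <= delta / 2 * (x + 2 * e / delta) ^ 2)%R.
      { apply Rmult_le_pos; [lra|apply pow2_ge_0]. }
      replace (delta / 2 * (x + 2 * e / delta) ^ 2)%R with
        (delta * x ^ 2 / 2 + 2 * e * x + 2 * e ^ 2 / delta)%R in H by (field; lra).
      assert (2 * e ^ 2 / delta <= 2 * A ^ 4 / delta)%R; [|lra].
      apply Rmult_le_compat_r; [left; now apply Rinv_0_lt_compat|].
      assert (e ^ 2 <= A ^ 4)%R; [|lra]. replace (A ^ 4)%R with ((A ^ 2) ^ 2)%R by ring.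
      nra. }
    assert (B4 : (delta * x ^ 2 <= (a ^ 2 - b ^ 2) * x ^ 2)%R) by (apply Rmult_le_compat_r; [apply pow2_ge_0|exact Hre]).
    
    apply Rle_trans with ((a ^ 2 - b ^ 2) * x ^ 2 + 2 * e * x + (c ^ 2 - d ^ 2))%R; [lra|].
    right. unfold e. ring. }
  assert (E : Re (- RtoC PI * (al * RtoC x + be) ^ 2) = (- PI * Re ((al * RtoC x + be) ^ 2)%C)%R).
  { rewrite <- RtoC_opp, re_scal_l. reflexivity. }
  rewrite E.
  assert (M : (- PI * Re ((al * RtoC x + be) ^ 2)%C <=
    PI * (2 * A ^ 4 / delta + A ^ 2) + - (PI * delta * x ^ 2 / 2))%R).
  { pose proof PI_RGT_0. apply (Rmult_le_compat_l PI) in Q; [|lra]. lra. }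
  destruct M as [M|M]; [left; now apply exp_increasing|right; now rewrite M].
Qed.

(** One constant serves a whole bounded set of parameters, as a deformation along a path requires.
    The number 88 bounds the polynomial factor of the second derivative, and 352 is 4 times 88. *)
Lemma gaussP_decay A delta : (1 <= A)%R -> (0 < delta)%R -> exists K : R,
  forall u v al be, (Cmod u <= A)%R -> (Cmod v <= A)%R -> (Cmod al <= A)%R -> (Cmod be <= A)%R ->
    (delta <= Re al ^ 2 - Im al ^ 2)%R ->
    decay (gaussP u v al be) K /\ decay (gaussP' u v al be) K /\ decay (gaussP'' u v al be) K.
Proof.
  intros HA Hd. set (N := exp (PI * (2 * A ^ 4 / delta + A ^ 2))).
  set (c := Rmin 1 (PI * delta / 6)).
  pose proof PI_bounds as Hpi.
  assert (Hc : (0 < c)%R). { unfold c. apply Rmin_glb_lt; [lra|]. apply Rdiv_lt_0_compat; nra. }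
  exists (352 * A ^ 5 * N / c ^ 3)%R.
  intros u v al be Hu Hv Hal Hbe Hre.
  assert (HA2 : (1 <= A ^ 2)%R) by nra. assert (HA3 : (1 <= A ^ 3)%R) by nra.
  assert (HA5 : (A ^ 3 <= A ^ 5)%R) by (replace (A ^ 5)%R with (A ^ 3 * A ^ 2)%R by ring; nra).
  assert (HA1 : (A <= A ^ 3)%R) by nra.
  assert (X : forall (x : R) (q : C), (Cmod q <= 88 * A ^ 5 * (1 + Rabs x) ^ 3)%R ->
    Cmod (q * Cexp (- RtoC PI * (al * RtoC x + be) ^ 2)) <= (352 * A ^ 5 * N / c ^ 3 / (1 + x ^ 2))%R).
  { intros x q Hq. rewrite Cmod_mult.
    pose proof (gauss_exp_bound A delta al be x HA Hd Hal Hbe Hre) as HE. fold N in HE.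
    assert (NP : (0 < N)%R) by apply exp_pos.
    pose proof (pow2_ge_0 x) as X2.
    assert (HF : (exp (- (PI * delta * x ^ 2 / 2)) <= / (c * (1 + x ^ 2)) ^ 3)%R).
    { eapply Rle_trans; [apply exp_neg_cube|].
      - apply Rdiv_le_0_compat; [|lra]. apply Rmult_le_pos; [|lra]. nra.
      - apply Rinv_le_contravar; [apply pow_lt, Rmult_lt_0_compat; lra|].
        apply pow_incr. split; [apply Rmult_le_pos; lra|].
        assert (c <= 1)%R by apply Rmin_l. assert (c <= PI * delta / 6)%R by apply Rmin_r. nra. }
    assert (HQ : ((1 + Rabs x) ^ 3 <= 4 * (1 + x ^ 2) ^ 2)%R).
    { rewrite <- (pow2_abs x). pose proof (Rabs_pos x). set (y := Rabs x) in *.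
      assert ((1 + y) ^ 2 <= 2 * (1 + y ^ 2))%R by (pose proof (pow2_ge_0 (y - 1)); nra).
      assert ((1 + y) ^ 3 <= ((1 + y) ^ 2) ^ 2)%R.
      { assert (0 <= (1 + y) ^ 3)%R by (apply pow_le; lra). nra. }
      assert (((1 + y) ^ 2) ^ 2 <= (2 * (1 + y ^ 2)) ^ 2)%R; [|lra].
      apply pow_incr. split; auto. apply pow_le; lra. }
    apply Rle_trans with (88 * A ^ 5 * (4 * (1 + x ^ 2) ^ 2) * (N * / (c * (1 + x ^ 2)) ^ 3))%R.
    - apply Rmult_le_compat; auto using Cmod_ge_0.
      + eapply Rle_trans; [exact Hq|]. apply Rmult_le_compat_l; [nra|auto].
      + eapply Rle_trans; [exact HE|]. apply Rmult_le_compat_l; [lra|auto].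
    - right. field. split; nra. }
  assert (PU : forall (a b : C) (x : R), (Cmod a <= A)%R -> (Cmod b <= A)%R ->
    Cmod (a * RtoC x + b) <= (A * (1 + Rabs x))%R).
  { intros a b x Ha Hb. eapply Rle_trans; [apply Cmod_triangle|]. rewrite Cmod_mult, Cmod_R.
    pose proof (Rabs_pos x). nra. }
  assert (P2 : Cmod (RtoC (2 * PI)) <= 8%R) by (rewrite Cmod_R, Rabs_pos_eq; lra).
  assert (G1 : forall x : R, Cmod (u - RtoC (2 * PI) * al * (al * RtoC x + be) * (u * RtoC x + v))
     <= (9 * A ^ 3 * (1 + Rabs x) ^ 2)%R).
  { intros x. unfold Cminus. eapply Rle_trans; [apply Cmod_triangle|]. rewrite Cmod_opp, !Cmod_mult.
    pose proof (PU al be x Hal Hbe). pose proof (PU u v x Hu Hv). pose proof (Rabs_pos x).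
    set (q := (1 + Rabs x)%R) in *. assert (1 <= q)%R by (unfold q; lra).
    assert (Cmod (RtoC (2 * PI)) * Cmod al * Cmod (al * RtoC x + be) * Cmod (u * RtoC x + v)
       <= 8 * A * (A * q) * (A * q))%R.
    { repeat apply Rmult_le_compat; auto using Cmod_ge_0; repeat apply Rmult_le_pos; auto using Cmod_ge_0. }
    assert (A <= A ^ 3 * q ^ 2)%R. { assert (1 <= q ^ 2)%R by nra. nra. } lra. }
  repeat split; intros x; apply X; pose proof (Rabs_pos x) as Px;
    set (q := (1 + Rabs x)%R); assert (Hq : (1 <= q)%R) by (unfold q; lra);
    assert (Q2 : (q <= q ^ 2)%R) by nra; assert (Q3 : (q ^ 2 <= q ^ 3)%R) by nra.
  - eapply Rle_trans; [now apply PU|]. fold q. 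
    apply Rle_trans with (A ^ 5 * q ^ 3)%R; [apply Rmult_le_compat; lra|].
    assert (0 <= A ^ 5 * q ^ 3)%R by (apply Rmult_le_pos; lra). lra.
  - eapply Rle_trans; [apply G1|]. fold q.
    apply Rle_trans with (9 * (A ^ 5 * q ^ 3))%R.
    + rewrite Rmult_assoc. apply Rmult_le_compat_l; [lra|]. apply Rmult_le_compat; lra.
    + assert (0 <= A ^ 5 * q ^ 3)%R by (apply Rmult_le_pos; lra). lra.
  - unfold Cminus at 1. eapply Rle_trans; [apply Cmod_triangle|].
    rewrite Cmod_opp, !Cmod_mult, Cmod_opp.
    pose proof (PU al be x Hal Hbe) as K1. pose proof (PU u v x Hu Hv) as K2. fold q in K1, K2.
    specialize (G1 x). fold q in G1.
    assert (T1 : Cmod (al * (u * RtoC x + v) + (al * RtoC x + be) * u) <= (2 * A ^ 2 * q)%R).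
    { eapply Rle_trans; [apply Cmod_triangle|]. rewrite !Cmod_mult.
      assert (Cmod al * Cmod (u * RtoC x + v) <= A * (A * q))%R by (apply Rmult_le_compat; auto using Cmod_ge_0).
      assert (Cmod (al * RtoC x + be) * Cmod u <= A * q * A)%R by (apply Rmult_le_compat; auto using Cmod_ge_0).
      lra. }
    assert (T2 : (Cmod (RtoC (2 * PI)) * Cmod al * Cmod (al * (u * RtoC x + v) + (al * RtoC x + be) * u)
      <= 8 * A * (2 * A ^ 2 * q))%R).
    { repeat apply Rmult_le_compat; auto using Cmod_ge_0; repeat apply Rmult_le_pos; auto using Cmod_ge_0. }
    assert (T3 : (Cmod (RtoC (2 * PI)) * Cmod al * Cmod (al * RtoC x + be)
      * Cmod (u - RtoC (2 * PI) * al * (al * RtoC x + be) * (u * RtoC x + v))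
      <= 8 * A * (A * q) * (9 * A ^ 3 * q ^ 2))%R).
    { repeat apply Rmult_le_compat; auto using Cmod_ge_0; repeat apply Rmult_le_pos; auto using Cmod_ge_0. }
    assert (A ^ 3 * q <= A ^ 5 * q ^ 3)%R by (apply Rmult_le_compat; lra).
    nra.
Qed.

(** * Poisson summation at rational points *)

Definition ex (x : R) : C := Cexp (RtoC (2 * PI * x) * Ci).

Lemma ex_plus x y : ex (x + y) = ex x * ex y.
Proof. unfold ex. rewrite <- Cexp_plus. f_equal. rewrite Rmult_plus_distr_l, RtoC_plus. ring. Qed.

Lemma ex_Z k : ex (IZR k) = 1.
Proof. apply Cexp_2PI_Z. Qed.

Lemma ex_0 : ex 0 = 1.
Proof. apply (ex_Z 0). Qed.

Lemma ex_opp x : ex (- x) = / ex x.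
Proof.
  unfold ex. rewrite <- Cexp_opp. f_equal. rewrite Ropp_mult_distr_r_reverse, RtoC_opp. ring.
Qed.

Lemma ex_nz x : ex x <> 0.
Proof. apply Cexp_nz. Qed.

Lemma Cmod_ex x : Cmod (ex x) = 1%R.
Proof. unfold ex. rewrite Cmod_Cexp. simpl. rewrite <- exp_0. f_equal. ring. Qed.

Lemma ex_cos_sin x : ex x = (cos (2 * PI * x), sin (2 * PI * x)).
Proof.
  unfold ex, Cexp. simpl. replace (2 * PI * x * 0 - 0 * 1)%R with 0%R by ring.
  replace (2 * PI * x * 1 + 0 * 0)%R with (2 * PI * x)%R by ring. rewrite exp_0.
  unfold RtoC, Cmult; simpl. f_equal; ring.
Qed.

(** From y cos y <= sin y at y = x/2, sin x >= x cos^2 (x/2), and cos^2 (x/2) = (1 + cos x)/2 is at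
    least 1/2. *)
Lemma sin_ge_half x : (0 <= x <= PI / 2)%R -> (x / 2 <= sin x)%R.
Proof.
  intros Hx. pose proof PI_RGT_0.
  assert (H1 : forall y, (0 <= y <= PI / 2)%R -> (y * cos y <= sin y)%R).
  { intros y Hy. destruct (MVT_gen sin 0 y cos) as (c & Hc & E).
    - intros t _. apply is_derive_sin.
    - intros t _. apply continuity_sin.
    - rewrite sin_0, !Rminus_0_r in E. rewrite E, Rmult_comm.
      apply Rmult_le_compat_r; [lra|]. unfold Rmin, Rmax in Hc. destruct (Rle_dec 0 y); [|lra].
      apply cos_decr_1; lra. }
  replace x with (2 * (x / 2))%R at 2 by field. rewrite sin_2a.
  specialize (H1 (x / 2)%R ltac:(lra)).
  assert (0 <= cos x)%R by (apply cos_ge_0; lra).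
  replace x with (2 * (x / 2))%R in H0 by field. rewrite cos_2a_cos in H0.
  assert (0 <= cos (x / 2))%R by (apply cos_ge_0; lra).
  nra.
Qed.

(** The second difference multiplies a frequency by -4 sin^2 (pi y), which is bounded below by a
    square only while [y] stays away from the other integers; hence the range of [y]. *)
Lemma ex_second_difference y : (Rabs y <= 1 / 2)%R ->
  (y ^ 2 <= Cmod (ex y + ex (- y) - 2))%R.
Proof.
  intros Hy. pose proof PI_bounds.
  assert (E : ex y + ex (- y) - 2 = RtoC (- (4 * sin (PI * y) ^ 2))).
  { rewrite !ex_cos_sin. replace (2 * PI * - y)%R with (- (2 * PI * y))%R by ring.
    rewrite cos_neg, sin_neg. replace (2 * PI * y)%R with (2 * (PI * y))%R by ring.
    rewrite cos_2a_sin. unfold RtoC, Cminus, Cplus, Copp; simpl. f_equal; ring. }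
  rewrite E, Cmod_R, Rabs_Ropp, Rabs_pos_eq by (pose proof (pow2_ge_0 (sin (PI * y))); lra).
  assert (S : (sin (PI * y) ^ 2 = sin (PI * Rabs y) ^ 2)%R).
  { unfold Rabs. destruct (Rcase_abs y); auto. rewrite Ropp_mult_distr_r_reverse, sin_neg. ring. }
  rewrite S, <- (pow2_abs y). pose proof (Rabs_pos y). set (a := Rabs y) in *.
  pose proof (sin_ge_half (PI * a) ltac:(split; nra)) as B.
  assert (a <= 2 * sin (PI * a))%R by nra. nra.
Qed.

(** Riemann sum of mesh [h] for the Fourier transform of [Phi] at [m]. *)
Definition fcoef (Phi : C -> C) (h : R) (m : Z) : C :=
  usum (fun k : Z => RtoC h * (Phi (RtoC (IZR k * h)) * ex (- (IZR m * (IZR k * h))))).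

Lemma fcoef_summable Phi K h m : (0 < h <= 1)%R -> decay Phi K ->
  summable (fun k : Z => RtoC h * (Phi (RtoC (IZR k * h)) * ex (- (IZR m * (IZR k * h))))).
Proof.
  intros Hh HK. apply summable_scal. apply summable_le with (fun k : Z => Cmod (Phi (RtoC (IZR k * h)))).
  - intros k. rewrite Cmod_mult, Cmod_ex, Rmult_1_r. apply Rle_refl.
  - now apply summable_decay0 with K.
Qed.

Lemma fcoef_bound0 Phi K h m : (0 < h <= 1)%R -> decay Phi K -> (Cmod (fcoef Phi h m) <= 6 * K)%R.
Proof.
  intros Hh HK. apply usum_bound. apply riemann_bound; auto.
  - intros k. rewrite Cmod_mult, Cmod_ex, Rmult_1_r. apply HK.
  - now apply decay_pos with Phi.
Qed.

(** Discrete integration by parts, twice: shifting the index multiplies the coefficient by a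
    character, so the coefficient times the factor of [ex_second_difference] is a Riemann sum of
    second differences, of size h^2. The factors h^2 cancel, which makes the bound uniform in the
    mesh. *)
Lemma fcoef_bound2 (Phi Phi' Phi'' : C -> C) K0 K h m : (0 < h <= 1)%R -> decay Phi K0 ->
  (forall z, Cder Phi z (Phi' z)) -> (forall z, Cder Phi' z (Phi'' z)) -> decay Phi'' K ->
  (Rabs (IZR m * h) <= 1 / 2)%R -> (IZR m ^ 2 * Cmod (fcoef Phi h m) <= 36 * K)%R.
Proof.
  intros Hh H0 D1 D2 HK Hm. pose proof (decay_pos _ _ HK) as KP.
  set (f := fun k : Z => RtoC h * (Phi (RtoC (IZR k * h)) * ex (- (IZR m * (IZR k * h))))).
  assert (Sf : summable f) by now apply fcoef_summable with K0.
  set (D := fun k : Z => RtoC h * ((Phi (RtoC (IZR k * h + h)) + Phi (RtoC (IZR k * h - h))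
     - 2 * Phi (RtoC (IZR k * h))) * ex (- (IZR m * (IZR k * h))))).
  assert (E : (ex (IZR m * h) + ex (- (IZR m * h)) - 2) * fcoef Phi h m = usum D).
  { set (y := (IZR m * h)%R).
    assert (ED : forall k, D k = ex y * f (k + 1)%Z + ex (- y) * f (k + -1)%Z - RtoC 2 * f k).
    { intros k. unfold D, f. rewrite !plus_IZR.
      replace ((IZR k + 1) * h)%R with (IZR k * h + h)%R by ring.
      replace ((IZR k + -1) * h)%R with (IZR k * h - h)%R by ring.
      replace (- (IZR m * (IZR k * h + h)))%R with (- (IZR m * (IZR k * h)) + - y)%R by (unfold y; ring).
      replace (- (IZR m * (IZR k * h - h)))%R with (- (IZR m * (IZR k * h)) + y)%R by (unfold y; ring).
      rewrite !ex_plus, !ex_opp. field. split; apply ex_nz. }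
    rewrite (usum_ext _ _ ED), usum_minus, usum_plus, !usum_scal, !usum_shift;
      auto using summable_scal, summable_shift, summable_plus.
    unfold fcoef. fold f. ring. }
  assert (BD : (Cmod (usum D) <= 36 * K * h ^ 2)%R).
  { apply usum_bound. replace (36 * K * h ^ 2)%R with (6 * (6 * K * h ^ 2))%R by ring.
    apply riemann_bound; auto.
    - intros k. rewrite Cmod_mult, Cmod_ex, Rmult_1_r.
      pose proof (taylor_decay Phi Phi' Phi'' K (IZR k * h) h D1 D2 HK) as T1.
      pose proof (taylor_decay Phi Phi' Phi'' K (IZR k * h) (- h) D1 D2 HK) as T2.
      rewrite Rabs_Ropp in T2. rewrite (Rabs_pos_eq h) in * by lra.
      specialize (T1 ltac:(lra)). specialize (T2 ltac:(lra)).
      set (x := (IZR k * h)%R) in *. replace (x - h)%R with (x + - h)%R by ring.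
      replace (Phi (RtoC (x + h)) + Phi (RtoC (x + - h)) - 2 * Phi (RtoC x)) with
        ((Phi (RtoC (x + h)) - Phi (RtoC x) - RtoC h * Phi' (RtoC x)) +
         (Phi (RtoC (x + - h)) - Phi (RtoC x) - RtoC (- h) * Phi' (RtoC x))) by (rewrite RtoC_opp; ring).
      eapply Rle_trans; [apply Cmod_triangle|].
      replace (6 * K * h ^ 2 / (1 + x ^ 2))%R with
        (3 * K * h ^ 2 / (1 + x ^ 2) + 3 * K * (- h) ^ 2 / (1 + x ^ 2))%R by (unfold Rdiv; ring).
      now apply Rplus_le_compat.
    - apply Rmult_le_pos; [lra|apply pow2_ge_0]. }
  rewrite <- E, Cmod_mult in BD.
  pose proof (ex_second_difference _ Hm) as L.
  pose proof (Cmod_ge_0 (fcoef Phi h m)) as P.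
  apply (Rmult_le_compat_r (Cmod (fcoef Phi h m))) in L; auto.
  apply (Rmult_le_reg_r (h ^ 2)); [apply pow_lt; lra|]. 
  replace (IZR m ^ 2 * Cmod (fcoef Phi h m) * h ^ 2)%R with ((IZR m * h) ^ 2 * Cmod (fcoef Phi h m))%R by ring.
  lra.
Qed.

Lemma Cminus_0_r (z : C) : z - 0 = z.
Proof. ring. Qed.

Lemma usum_lsum {A I : Type} (f : A -> I -> C) l : (forall a, summable (f a)) ->
  summable (fun i => lsum (fun a => f a i) l) /\
  lsum (fun a => usum (f a)) l = usum (fun i => lsum (fun a => f a i) l).
Proof.
  intros H. induction l as [|a l [IH1 IH2]].
  - simpl. destruct (usum_finite (fun _ : I => RtoC 0) nil) as [S E]; auto using NoDup_nil.
  - split; [exact (summable_plus _ _ (H a) IH1)|].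
    rewrite lsum_cons, IH2, <- usum_plus by auto. reflexivity.
Qed.

(** * Finite Fourier inversion and the limit of vanishing mesh *)

Lemma ex_1_integer (j : Z) (L : nat) : (0 < L)%nat -> ex (IZR j * / INR L) = 1 -> (Z.of_nat L | j)%Z.
Proof.
  intros HL E. apply Z.mod_divide; [lia|].
  set (r := (j mod Z.of_nat L)%Z). pose proof (Z.mod_pos_bound j (Z.of_nat L) ltac:(lia)) as Hr. fold r in Hr.
  destruct (Z.eq_dec r 0) as [|n]; auto. exfalso.
  assert (LP : (0 < INR L)%R) by now apply lt_0_INR.
  pose proof (Z.div_mod j (Z.of_nat L) ltac:(lia)) as Ej. fold r in Ej.
  assert (E2 : ex (IZR r * / INR L) = 1).
  { rewrite <- E. rewrite Ej, plus_IZR, mult_IZR, <- INR_IZR_INZ.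
    replace ((INR L * IZR (j / Z.of_nat L) + IZR r) * / INR L)%R with
      (IZR (j / Z.of_nat L) + IZR r * / INR L)%R by (field; lra).
    rewrite ex_plus, ex_Z. ring. }
  rewrite ex_cos_sin in E2. injection E2 as Ec _.
  set (y := (IZR r * / INR L)%R) in *.
  replace (2 * PI * y)%R with (2 * (PI * y))%R in Ec by ring. rewrite cos_2a_sin in Ec.
  assert (Y : (0 < y < 1)%R).
  { unfold y. assert (1 <= r)%Z by lia. apply IZR_le in H. split.
    - apply Rmult_lt_0_compat; [lra|]. now apply Rinv_0_lt_compat.
    - apply (Rmult_lt_reg_r (INR L)); auto. rewrite Rmult_assoc, Rinv_l, Rmult_1_l, Rmult_1_r by lra.
      rewrite INR_IZR_INZ. apply IZR_lt. lia. }
  pose proof PI_RGT_0. pose proof (sin_gt_0 (PI * y) ltac:(nra) ltac:(nra)). nra.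
Qed.

Lemma lsum_const {I : Type} (c : C) (l : list I) : lsum (fun _ => c) l = RtoC (INR (length l)) * c.
Proof.
  induction l as [|a l IH]; [simpl; ring|]. rewrite lsum_cons, IH.
  simpl length. rewrite S_INR, RtoC_plus. ring.
Qed.

Lemma character_sum (j : Z) (M : nat) : (0 < M)%nat ->
  lsum (fun m => ex (IZR m * (IZR j * / INR (2 * M)))) (zrange M) =
  if (j mod Z.of_nat (2 * M) =? 0)%Z then RtoC (INR (2 * M)) else 0.
Proof.
  intros HM. assert (LP : (0 < INR (2 * M))%R) by (apply lt_0_INR; lia).
  assert (MP : (0 < INR M)%R) by (apply lt_0_INR; lia).
  set (y := (IZR j * / INR (2 * M))%R).
  destruct (j mod Z.of_nat (2 * M) =? 0)%Z eqn:Ej.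
  - apply Z.eqb_eq in Ej. apply Z.mod_divide in Ej; [|lia]. destruct Ej as [q ->].
    rewrite (lsum_ext_in _ (fun _ => RtoC 1)).
    + rewrite lsum_const. unfold zrange. rewrite length_map, length_seq. ring.
    + intros m _. rewrite <- (ex_Z (m * q)). f_equal. unfold y.
      rewrite !mult_IZR, <- INR_IZR_INZ. field. lra.
  - assert (N1 : ex y <> 1).
    { intros E. apply ex_1_integer in E; [|lia]. apply Z.mod_divide in E; [|lia]. rewrite E in Ej. easy. }
    pose proof (lsum_telescope (fun m => ex (IZR m * y)) M) as T.
    rewrite (lsum_ext_in _ (fun m => (ex y - 1) * ex (IZR m * y))) in T.
    + rewrite lsum_scal in T.
      replace (ex (IZR (Z.of_nat M) * y) - ex (IZR (- Z.of_nat M) * y)) with (RtoC 0) in T.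
      * apply Cminus_eq_contra in N1. set (S := lsum _ _) in *.
        replace S with ((ex y - 1) * S / (ex y - 1)) by (field; exact N1). rewrite T. unfold Cdiv. ring.
      * replace (IZR (Z.of_nat M) * y)%R with (IZR j + IZR (- Z.of_nat M) * y)%R.
        -- rewrite ex_plus, ex_Z. ring.
        -- unfold y. rewrite opp_IZR, <- INR_IZR_INZ, mult_INR. simpl (INR 2). field. lra.
    + intros m _. rewrite plus_IZR, Rmult_plus_distr_r, Rmult_1_l, ex_plus. ring.
Qed.

(** Orthogonality of the characters modulo [2 * M] keeps the sample points congruent to [k0]; since
    [h] is the inverse of [2 * M], these are the translates of [k0 * h] by integers. The identity is
    exact for every mesh. *)
Lemma fourier_inversion Phi K (M : nat) (k0 : Z) : (0 < M)%nat -> decay Phi K ->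
  let h := (/ INR (2 * M))%R in
  lsum (fun m => fcoef Phi h m * ex (IZR m * (IZR k0 * h))) (zrange M)
  = usum (fun n : Z => Phi (RtoC (IZR n + IZR k0 * h))).
Proof.
  intros HM HK h. assert (LP : (1 <= INR (2 * M))%R) by (apply (le_INR 1); lia).
  assert (Hh : (0 < h <= 1)%R).
  { unfold h. split; [apply Rinv_0_lt_compat; lra|]. rewrite <- Rinv_1. apply Rinv_le_contravar; lra. }
  assert (Sm : forall m : Z, summable (fun k : Z => ex (IZR m * (IZR k0 * h)) *
     (RtoC h * (Phi (RtoC (IZR k * h)) * ex (- (IZR m * (IZR k * h))))))).
  { intros m. apply summable_scal. now apply fcoef_summable with K. }
  rewrite (lsum_ext_in _ (fun m => usum (fun k : Z => ex (IZR m * (IZR k0 * h)) *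
     (RtoC h * (Phi (RtoC (IZR k * h)) * ex (- (IZR m * (IZR k * h)))))))).
  2:{ intros m _. rewrite usum_scal by now apply fcoef_summable with K. unfold fcoef. ring. }
  destruct (usum_lsum _ (zrange M) Sm) as [_ ->].
  set (F := fun k : Z => if ((k0 - k) mod Z.of_nat (2 * M) =? 0)%Z then Phi (RtoC (IZR k * h)) else 0).
  rewrite (usum_ext _ F).
  - destruct (summable_usum_inj F (fun n => (k0 + n * Z.of_nat (2 * M))%Z)) as [_ ->].
    + intros a b E. nia.
    + intros i Hi. unfold F. destruct (_ =? 0)%Z eqn:E; auto. exfalso.
      apply Z.eqb_eq, Z.mod_divide in E; [|lia]. destruct E as [q Eq].
      apply (Hi (- q)%Z). lia.
    + apply summable_inj; [intros a b E; nia|].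
      apply (summable_restrict (fun k => ((k0 - k) mod Z.of_nat (2 * M) =? 0)%Z)).
      now apply summable_decay0 with K.
    + apply usum_ext. intros n. unfold F.
      replace (k0 - (k0 + n * Z.of_nat (2 * M)))%Z with ((- n) * Z.of_nat (2 * M))%Z by ring.
      rewrite Z.mod_mul by lia. simpl (0 =? 0)%Z. cbv iota. do 2 f_equal.
      rewrite plus_IZR, mult_IZR, <- INR_IZR_INZ. unfold h. field. lra.
  - intros k. rewrite (lsum_ext_in _ (fun m => RtoC h * Phi (RtoC (IZR k * h)) *
        ex (IZR m * (IZR (k0 - k) * h)))).
    + rewrite lsum_scal. unfold h at 3. rewrite character_sum by auto. unfold F.
      destruct (_ =? 0)%Z; [|ring].
      rewrite <- Cmult_assoc, (Cmult_comm (Phi _)), Cmult_assoc, <- RtoC_mult. unfold h at 1.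
      rewrite Rinv_l by lra. ring.
    + intros m _. replace (IZR m * (IZR (k0 - k) * h))%R with (IZR m * (IZR k0 * h) + - (IZR m * (IZR k * h)))%R
        by (rewrite minus_IZR; ring).
      rewrite ex_plus. ring.
Qed.

(** Tends to 0 while every [r / d] remains a sample point, namely number [2 * r * S l]. *)
Definition mesh (d l : nat) : R := (/ INR (2 * (d * S l)))%R.

Lemma mesh_pos d l : (0 < d)%nat -> (0 < mesh d l <= 1)%R.
Proof.
  intros Hd. assert (LP : (1 <= INR (2 * (d * S l)))%R) by (apply (le_INR 1); lia).
  unfold mesh. split; [apply Rinv_0_lt_compat; lra|]. rewrite <- Rinv_1. apply Rinv_le_contravar; lra.
Qed.

Lemma mesh_lim d : (0 < d)%nat -> forall K eps, (0 < eps)%R -> exists N, forall l, (N <= l)%nat -> (K * mesh d l < eps)%R.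
Proof.
  intros Hd K eps He. destruct (nfloor_ex (Rabs K / eps)) as [N HN].
  { apply Rdiv_le_0_compat; auto. apply Rabs_pos. }
  exists N. intros l Hl. unfold mesh.
  assert (A : (Rabs K / eps < INR (2 * (d * S l)))%R).
  { eapply Rlt_le_trans; [apply HN|]. rewrite <- S_INR. apply le_INR. nia. }
  assert (P : (0 < INR (2 * (d * S l)))%R) by (apply lt_0_INR; lia).
  apply (Rmult_lt_reg_r (INR (2 * (d * S l)))); auto. rewrite Rmult_assoc, Rinv_l by lra.
  apply (Rmult_lt_compat_r eps) in A; auto. unfold Rdiv in A. rewrite Rmult_assoc, Rinv_l in A by lra.
  pose proof (Rle_abs K). lra.
Qed.

Lemma Climseq_mesh d u c K : (0 < d)%nat -> (forall l, (Cmod (u l - c) <= K * mesh d l)%R) -> Climseq u c.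
Proof.
  intros Hd H eps He. destruct (mesh_lim d Hd K eps He) as [N HN]. exists N. intros l Hl.
  eapply Rle_lt_trans; [apply H|]. auto.
Qed.

Lemma summableR_inv_quad K : summableR (fun m : Z => K / (1 + IZR m ^ 2))%R.
Proof.
  apply summableR_le with (fun m : Z => Rabs K * (1 / (1 + (IZR m * 1) ^ 2)))%R.
  - intros m. rewrite Rmult_1_r. unfold Rdiv. rewrite Rmult_1_l.
    apply Rmult_le_compat_r; [|apply Rle_abs]. left. apply Rinv_0_lt_compat.
    pose proof (pow2_ge_0 (IZR m)). lra.
  - apply summableR_scal; [apply Rabs_pos|]. exists 6%R. apply riemann_inv_quad. lra.
Qed.

(** The finitely many frequencies of the inversion, extended by zero to all integers so that
    Tannery's theorem applies. Inside the range |m| h <= 1/2, which is where [fcoef_bound2]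
    holds. *)
Definition trunc_coef Phi d l (m : Z) : C :=
  if ((- Z.of_nat (d * S l) <=? m) && (m <? Z.of_nat (d * S l)))%Z%bool then fcoef Phi (mesh d l) m else 0.

Lemma trunc_coef_bound (Phi Phi' Phi'' : C -> C) K0 K d l m : (0 < d)%nat ->
  (forall z, Cder Phi z (Phi' z)) -> (forall z, Cder Phi' z (Phi'' z)) ->
  decay Phi K0 -> decay Phi'' K -> (Cmod (trunc_coef Phi d l m) <= (6 * K0 + 36 * K) / (1 + IZR m ^ 2))%R.
Proof.
  intros Hd D1 D2 H0 H2. pose proof (pow2_ge_0 (IZR m)).
  apply (Rmult_le_reg_r (1 + IZR m ^ 2)); [lra|]. unfold Rdiv at 1. rewrite (Rmult_assoc _ (/ _)), Rinv_l, Rmult_1_r by lra.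
  unfold trunc_coef. destruct (_ && _)%bool eqn:E.
  - apply andb_prop in E. destruct E as [E1 E2]. apply Z.leb_le in E1. apply Z.ltb_lt in E2.
    pose proof (fcoef_bound0 Phi K0 (mesh d l) m (mesh_pos d l Hd) H0).
    pose proof (fcoef_bound2 Phi Phi' Phi'' K0 K (mesh d l) m (mesh_pos d l Hd) H0 D1 D2 H2) as B.
    assert (Rabs (IZR m * mesh d l) <= 1 / 2)%R; [|specialize (B H3); lra].
    rewrite Rabs_mult, (Rabs_pos_eq (mesh d l)) by (apply Rlt_le, mesh_pos; auto).
    unfold mesh. rewrite mult_INR. simpl (INR 2).
    assert (P : (0 < INR (d * S l))%R) by (apply lt_0_INR; lia).
    apply (Rmult_le_reg_r (2 * INR (d * S l))); [lra|]. rewrite Rmult_assoc, Rinv_l by lra.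
    rewrite <- abs_IZR. replace (1 / 2 * (2 * INR (d * S l)))%R with (INR (d * S l)) by field.
    rewrite Rmult_1_r, INR_IZR_INZ. apply IZR_le. lia.
  - rewrite Cmod_0, Rmult_0_l. pose proof (decay_pos _ _ H0). pose proof (decay_pos _ _ H2). lra.
Qed.

Lemma trunc_coef_sum Phi K d l (r : Z) : (0 < d)%nat -> decay Phi K ->
  usum (fun m => trunc_coef Phi d l m * ex (IZR m * (IZR r / INR d)))
  = usum (fun n : Z => Phi (RtoC (IZR n + IZR r / INR d))).
Proof.
  intros Hd HK.
  assert (Er : (IZR r / INR d = IZR (2 * r * Z.of_nat (S l)) * mesh d l)%R).
  { unfold mesh. rewrite !mult_IZR, <- INR_IZR_INZ, !mult_INR. simpl (INR 2). field.
    split; apply Rgt_not_eq, lt_0_INR; lia. }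
  rewrite Er. pose proof (fourier_inversion Phi K (d * S l) (2 * r * Z.of_nat (S l)) ltac:(lia) HK) as FI.
  cbv zeta in FI. fold (mesh d l) in FI. rewrite <- FI.
  destruct (usum_finite (fun m => trunc_coef Phi d l m * ex (IZR m * (IZR (2 * r * Z.of_nat (S l)) * mesh d l)))
    (zrange (d * S l))) as [_ ->].
  - apply NoDup_zrange.
  - intros i Hi. rewrite in_zrange in Hi. unfold trunc_coef. destruct (_ && _)%bool eqn:E; [|ring].
    apply andb_prop in E. rewrite Z.leb_le, Z.ltb_lt in E. lia.
  - apply lsum_ext_in. intros i Hi. apply in_zrange in Hi. unfold trunc_coef.
    rewrite (proj2 (Z.leb_le _ _)), (proj2 (Z.ltb_lt _ _)) by lia. reflexivity.
Qed.

Lemma trunc_coef_lim Phi d m c : (0 < d)%nat -> Climseq (fun l => fcoef Phi (mesh d l) m) c ->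
  Climseq (fun l => trunc_coef Phi d l m) c.
Proof.
  intros Hd. apply Climseq_ext_ev. exists (Z.abs_nat m). intros l Hl. unfold trunc_coef.
  rewrite (proj2 (Z.leb_le _ _)), (proj2 (Z.ltb_lt _ _)) by nia. reflexivity.
Qed.

(** The periodized side does not vary with the mesh, and on the other side the coefficients are
    dominated by a multiple of 1/(1 + m^2); only their limits [c m] remain to be identified. *)
Lemma poisson (Phi Phi' Phi'' : C -> C) K0 K d (r : Z) (c : Z -> C) : (0 < d)%nat ->
  (forall z, Cder Phi z (Phi' z)) -> (forall z, Cder Phi' z (Phi'' z)) ->
  decay Phi K0 -> decay Phi'' K ->
  (forall m, Climseq (fun l => fcoef Phi (mesh d l) m) (c m)) ->
  summable (fun m => c m * ex (IZR m * (IZR r / INR d))) /\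
  usum (fun n : Z => Phi (RtoC (IZR n + IZR r / INR d))) = usum (fun m => c m * ex (IZR m * (IZR r / INR d))).
Proof.
  intros Hd D1 D2 H0 H2 Hc.
  destruct (Climseq_usum (fun l m => trunc_coef Phi d l m * ex (IZR m * (IZR r / INR d)))
    (fun m => c m * ex (IZR m * (IZR r / INR d))) (fun m => (6 * K0 + 36 * K) / (1 + IZR m ^ 2))%R) as [S L].
  - intros l m. rewrite Cmod_mult, Cmod_ex, Rmult_1_r. now apply trunc_coef_bound with Phi' Phi''.
  - apply summableR_inv_quad.
  - intros m. apply Climseq_mult; [|apply Climseq_const]. now apply trunc_coef_lim.
  - split; auto. apply Climseq_unique with (2 := L).
    apply Climseq_ext_ev with (2 := Climseq_const _). exists 0%nat. intros l _.
    symmetry. now apply trunc_coef_sum with K0.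
Qed.

(** * The Jacobi identity *)

(** Riemann sum for the integral of al exp (-pi (al x + be)^2), which is 1 whatever [al] and
    [be]. *)
Definition gsum (al be : C) (h : R) : C :=
  usum (fun k : Z => RtoC h * (al * Cexp (- RtoC PI * (al * RtoC (IZR k * h) + be) ^ 2))).

(** The parameters move along the segment from (1, 0) to (al, be). The derivative of the Gaussian
    along the segment is the [x]-derivative of ((al - 1) x + be) times the exponential, so
    [riemann_sum_deformation] applies. *)
Lemma gsum_path (al be : C) : (0 < Re al)%R -> (0 < Re al ^ 2 - Im al ^ 2)%R ->
  exists K, forall h, (0 < h <= 1)%R -> (Cmod (gsum al be h - gsum 1 0 h) <= K * h)%R.
Proof.
  intros Hre Hre2.
  assert (Hb : (Rabs (Im al) < Re al)%R).
  { apply Rabs_def1; nra. }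
  (* Margin by which the segment stays in the cone |Im| < Re: both Re - Im and Re + Im are at least
     [m] along it, so Re^2 - Im^2 is at least [m ^ 2]. *)
  set (m := Rmin 1 (Re al - Rabs (Im al))).
  assert (Hm : (0 < m)%R) by (unfold m; apply Rmin_glb_lt; lra).
  set (A := (2 + Cmod al + Cmod be)%R).
  pose proof (Cmod_ge_0 al) as Pa. pose proof (Cmod_ge_0 be) as Pb.
  destruct (gaussP_decay A (m ^ 2)) as [K HK]; [unfold A; lra|apply pow_lt; auto|].
  set (a := fun s : C => (al - 1) * s + 1). set (b := fun s : C => be * s + 0).
  assert (Bd : forall s : R, (0 <= s <= 1)%R -> (Cmod (a (RtoC s)) <= A)%R /\ (Cmod (b (RtoC s)) <= A)%R /\
    (m ^ 2 <= Re (a (RtoC s)) ^ 2 - Im (a (RtoC s)) ^ 2)%R).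
  { intros s Hs. split; [|split].
    - unfold a. replace ((al - 1) * RtoC s + 1) with (RtoC s * al + RtoC (1 - s)) by (rewrite RtoC_minus; ring).
      eapply Rle_trans; [apply Cmod_triangle|]. rewrite Cmod_mult, !Cmod_R, !Rabs_pos_eq by lra. unfold A. nra.
    - unfold b. replace (be * RtoC s + 0) with (RtoC s * be) by ring.
      rewrite Cmod_mult, !Cmod_R, !Rabs_pos_eq by lra. unfold A. nra.
    - assert (E1 : Re (a (RtoC s)) = (1 - s + s * Re al)%R) by (unfold a, Re, Im; simpl; ring).
      assert (E2 : Im (a (RtoC s)) = (s * Im al)%R) by (unfold a, Re, Im; simpl; ring).
      rewrite E1, E2. set (x := Re al) in *. set (y := Im al) in *.
      assert (m <= 1)%R by apply Rmin_l. assert (m <= x - Rabs y)%R by apply Rmin_r.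
      pose proof (Rle_abs y). pose proof (Rle_abs (- y)) as H2. rewrite Rabs_Ropp in H2.
      assert (m <= (1 - s + s * x) - s * y)%R by nra.
      assert (m <= (1 - s + s * x) + s * y)%R by nra.
      replace ((1 - s + s * x) ^ 2 - (s * y) ^ 2)%R with
        (((1 - s + s * x) - s * y) * ((1 - s + s * x) + s * y))%R by ring.
      replace (m ^ 2)%R with (m * m)%R by ring. apply Rmult_le_compat; lra. }
  exists (18 * K)%R. intros h Hh.
  pose proof (riemann_sum_deformation (fun s => gaussP 0 (a s) (a s) (b s))
    (fun s => gaussP (al - 1) be (a s) (b s)) (fun s => gaussP' (al - 1) be (a s) (b s))
    (fun s => gaussP'' (al - 1) be (a s) (b s)) K K h) as D.
  assert (E : forall s, gsum (a s) (b s) h = usum (fun k : Z => RtoC h * gaussP 0 (a s) (a s) (b s) (RtoC (IZR k * h)))).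
  { intros s. apply usum_ext. intros k. unfold gaussP. ring. }
  replace (gsum al be h) with (gsum (a 1) (b 1) h) by (unfold a, b; f_equal; ring).
  replace (gsum 1 0 h) with (gsum (a 0) (b 0) h) by (unfold a, b; f_equal; ring).
  rewrite !E. apply D; auto.
  - intros s x. unfold gaussP, gaussP'.
    assert (H1 : Cder (fun u => a u * x + b u) s ((al - 1) * x + be)).
    { apply Cder_plus; [|apply Cder_affine].
      eapply Cder_eq; [|exact (Cder_mult _ _ _ _ _ (Cder_affine (al - 1) 1 s) (Cder_const x s))]. cbv beta; ring. }
    pose proof (Cder_exp _ _ _ (Cder_scal (- RtoC PI) _ _ _ (Cder_mult _ _ _ _ _ H1 H1))) as H2.
    pose proof (Cder_mult _ _ _ _ _ (Cder_affine (al - 1) 1 s) H2) as H3.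
    apply Cder_ext with (g := fun u => (0 * x + a u) * Cexp (- RtoC PI * (a u * x + b u) ^ 2)) in H3.
    + eapply Cder_eq; [|exact H3]. cbv beta. fold (a s).
      replace ((a s * x + b s) ^ 2) with ((a s * x + b s) * (a s * x + b s)) by ring.
      rewrite RtoC_mult. ring.
    + intros w. unfold a. f_equal; [ring|]. f_equal. ring.
  - intros; apply Cder_gaussP.
  - intros; apply Cder_gaussP'.
  - intros s Hs. destruct (Bd s Hs) as (B1 & B2 & B3).
    assert (P1 : (Cmod (al - 1) <= A)%R).
    { unfold Cminus. eapply Rle_trans; [apply Cmod_triangle|]. rewrite Cmod_opp, Cmod_1. unfold A. lra. }
    assert (P2 : (Cmod be <= A)%R) by (unfold A; lra).
    assert (P3 : (Cmod 0 <= A)%R) by (rewrite Cmod_0; unfold A; lra).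
    destruct (HK 0 (a (RtoC s)) (a (RtoC s)) (b (RtoC s))) as (X & _ & _); auto.
    destruct (HK (al - 1) be (a (RtoC s)) (b (RtoC s))) as (Y & _ & Z); auto.
Qed.

Lemma gauss_decay_exists u v al be : (0 < Re al ^ 2 - Im al ^ 2)%R -> exists K,
  decay (gaussP u v al be) K /\ decay (gaussP' u v al be) K /\ decay (gaussP'' u v al be) K.
Proof.
  intros H. set (A := (1 + Cmod u + Cmod v + Cmod al + Cmod be)%R).
  pose proof (Cmod_ge_0 u). pose proof (Cmod_ge_0 v). pose proof (Cmod_ge_0 al). pose proof (Cmod_ge_0 be).
  destruct (gaussP_decay A (Re al ^ 2 - Im al ^ 2)) as [K HK]; [unfold A; lra|auto|].
  exists K. apply HK; unfold A; lra.
Qed.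

(** Completing the square: a character only moves the centre of the Gaussian to an imaginary point,
    which is why [be] must be allowed to be complex. *)
Lemma gauss_square (al : C) (m x : R) : al <> 0 ->
  Cexp (- RtoC PI * (al * RtoC x + 0) ^ 2) * ex (- (m * x))
  = Cexp (- RtoC (PI * m ^ 2) / al ^ 2) * Cexp (- RtoC PI * (al * RtoC x + Ci * RtoC m / al) ^ 2).
Proof.
  intros Ha. unfold ex. rewrite <- !Cexp_plus. f_equal.
  rewrite !RtoC_mult, RtoC_opp, RtoC_pow, RtoC_mult.
  replace (- RtoC PI * (al * RtoC x + Ci * RtoC m / al) ^ 2) with
    (- RtoC PI * (al ^ 2 * RtoC x ^ 2) - 2 * RtoC PI * Ci * RtoC m * RtoC x - RtoC PI * (Ci * Ci) * RtoC m ^ 2 / al ^ 2)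
    by (field; auto).
  replace (Ci * Ci) with (- RtoC 1) by (unfold Ci, RtoC, Copp, Cmult; simpl; f_equal; ring). field. auto.
Qed.

Lemma gsum_0_coef (al : C) (m : Z) h K : al <> 0 -> (0 < h <= 1)%R ->
  decay (gaussP 0 1 al (Ci * RtoC (IZR m) / al)) K ->
  fcoef (gaussP 0 1 al 0) h m
  = Cexp (- RtoC (PI * IZR m ^ 2) / al ^ 2) / al * gsum al (Ci * RtoC (IZR m) / al) h.
Proof.
  intros Ha Hh HK. unfold fcoef, gsum. rewrite <- usum_scal.
  - apply usum_ext. intros k. unfold gaussP.
    replace ((0 * RtoC (IZR k * h) + 1) * Cexp (- RtoC PI * (al * RtoC (IZR k * h) + 0) ^ 2) *
      ex (- (IZR m * (IZR k * h)))) with (Cexp (- RtoC PI * (al * RtoC (IZR k * h) + 0) ^ 2) *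
      ex (- (IZR m * (IZR k * h)))) by ring.
    rewrite gauss_square by auto. field. auto.
  - apply summable_scal, summable_scal.
    apply summable_ext with (2 := summable_decay0 _ _ h Hh HK). intros k. unfold gaussP. ring.
Qed.

Lemma Re_sqr_pos_nz (al : C) : (0 < Re al)%R -> al <> 0.
Proof. intros H E. rewrite E in H. simpl in H. lra. Qed.

Lemma usum_RtoC {I : Type} (g : I -> R) i0 : (forall i, 0 <= g i)%R -> summable (fun i => RtoC (g i)) ->
  (g i0 <= Re (usum (fun i => RtoC (g i))))%R.
Proof.
  intros Hg Hs. apply le_epsilon. intros eps He.
  destruct (summable_is_usum _ Hs eps He) as (l0 & N0 & L0).
  destruct (common_nodup l0 (i0 :: nil)) as (l & N & I1 & I2).
  specialize (L0 l N I1). rewrite lsum_RtoC in L0.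
  pose proof (rsum_incl g (i0 :: nil) l Hg ltac:(constructor; [easy|constructor]) N I2) as B. simpl in B.
  pose proof (re_le_Cmod (RtoC (rsum g l) - usum (fun i => RtoC (g i)))) as T.
  set (u := usum (fun i => RtoC (g i))) in *.
  replace (Re (RtoC (rsum g l) - u)) with (rsum g l - Re u)%R in T by (unfold Re; simpl; ring).
  apply Rabs_le_between in T. lra.
Qed.

(** The normalization of the Gaussian, without its integral. For small mesh each truncated
    coefficient at [m] is close to [G m] times the Riemann sum [e l]; the coefficients add up to
    [usum G] exactly, by inversion at 0. Hence [usum G * (1 - e l)] tends to 0, and [usum G] is not
    0. *)
Lemma gsum_lim_1 d : (0 < d)%nat -> Climseq (fun l => gsum 1 0 (mesh d l)) 1.
Proof.
  intros Hd.
  assert (N1 : RtoC 1 <> RtoC 0) by apply C1_nz.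
  assert (H1 : (0 < Re (RtoC 1) ^ 2 - Im (RtoC 1) ^ 2)%R) by (simpl; lra).
  assert (H2 : (0 < Re (RtoC 1))%R) by (simpl; lra).
  destruct (gauss_decay_exists 0 1 1 0 H1) as (K & K0 & K1 & K2).
  set (G := fun m : Z => Cexp (- RtoC (PI * IZR m ^ 2) / RtoC 1 ^ 2)).
  assert (EG : forall m : Z, G m = gaussP 0 1 1 0 (RtoC (IZR m))).
  { intros m. unfold G, gaussP. replace (0 * RtoC (IZR m) + 1) with (RtoC 1) by ring. rewrite Cmult_1_l.
    f_equal. rewrite RtoC_mult, RtoC_pow. field. }
  assert (GB : forall m, (Cmod (G m) <= K / (1 + IZR m ^ 2))%R) by (intros m; rewrite EG; apply K0).
  assert (SG : summable G) by (apply summable_le with (1 := GB), summableR_inv_quad).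
  set (e := fun l => gsum 1 0 (mesh d l)).
  assert (eB : forall l, (Cmod (e l) <= 6 * K)%R).
  { intros l. apply usum_bound. apply riemann_bound; [now apply mesh_pos| |now apply decay_pos with (gaussP 0 1 1 0)].
    intros k. specialize (K0 (IZR k * mesh d l)%R). unfold gaussP in K0.
    replace (0 * RtoC (IZR k * mesh d l) + 1) with (RtoC 1) in K0 by ring. exact K0. }
  destruct (Climseq_usum (fun l m => trunc_coef (gaussP 0 1 1 0) d l m - G m * e l) (fun _ => RtoC 0)
    (fun m => (6 * K + 36 * K + K * (6 * K)) / (1 + IZR m ^ 2))%R) as [_ L].
  - intros l m. unfold Cminus. eapply Rle_trans; [apply Cmod_triangle|]. rewrite Cmod_opp, Cmod_mult.
    replace ((6 * K + 36 * K + K * (6 * K)) / (1 + IZR m ^ 2))%R with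
     ((6 * K + 36 * K) / (1 + IZR m ^ 2) + K / (1 + IZR m ^ 2) * (6 * K))%R by (unfold Rdiv; ring).
    apply Rplus_le_compat.
    + apply trunc_coef_bound with (gaussP' 0 1 1 0) (gaussP'' 0 1 1 0); auto using Cder_gaussP, Cder_gaussP'.
    + apply Rmult_le_compat; auto using Cmod_ge_0.
  - apply summableR_inv_quad.
  - intros m. destruct (gsum_path 1 (Ci * RtoC (IZR m) / 1) H2 H1) as [K' HK'].
    destruct (gauss_decay_exists 0 1 1 (Ci * RtoC (IZR m) / 1) H1) as (K3 & K30 & _).
    apply Climseq_ext_ev with (fun l => G m * (gsum 1 (Ci * RtoC (IZR m) / 1) (mesh d l) - gsum 1 0 (mesh d l))).
    + exists (Z.abs_nat m). intros l Hl. unfold trunc_coef.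
      rewrite (proj2 (Z.leb_le _ _)), (proj2 (Z.ltb_lt _ _)) by nia. simpl andb. cbv iota.
      rewrite (gsum_0_coef 1 m (mesh d l) K3) by (auto using mesh_pos).
      unfold G, e. field.
    + assert (X : Climseq (fun l => gsum 1 (Ci * RtoC (IZR m) / 1) (mesh d l) - gsum 1 0 (mesh d l)) 0).
      { apply Climseq_mesh with d K'; auto. intros l. rewrite Cminus_0_r. apply HK'. now apply mesh_pos. }
      apply (Climseq_scal (G m)) in X. now rewrite Cmult_0_r in X.
  - destruct (usum_finite (fun _ : Z => RtoC 0) nil) as [_ E0]; auto using NoDup_nil.
    rewrite E0 in L. simpl in L.
    (* All terms are positive reals, so the sum is at least its term at 0. *)
    assert (T : usum G <> 0).
    { intros E.
      assert (ER : forall m, G m = RtoC (exp (- (PI * IZR m ^ 2)))).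
      { intros m. unfold G. replace (- RtoC (PI * IZR m ^ 2) / RtoC 1 ^ 2) with (RtoC (- (PI * IZR m ^ 2))) by (rewrite RtoC_opp; field).
        unfold Cexp. simpl. rewrite cos_0, sin_0. unfold RtoC, Cmult; simpl. f_equal; ring. }
      pose proof (usum_RtoC (fun m : Z => exp (- (PI * IZR m ^ 2))) 0%Z) as B.
      cbv beta in B. rewrite <- (usum_ext _ _ ER), E in B. simpl Re in B.
      assert (exp (- (PI * 0 ^ 2)) <= 0)%R.
      { apply B; [intros; left; apply exp_pos|]. now apply summable_ext with (1 := ER). }
      pose proof (exp_pos (- (PI * 0 ^ 2))). lra. }
    assert (EL : forall l, usum (fun m => trunc_coef (gaussP 0 1 1 0) d l m - G m * e l) = usum G * (1 - e l)).
    { intros l. rewrite usum_minus.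
      - rewrite (usum_ext (fun m => G m * e l) (fun m => e l * G m)) by (intros; ring).
        rewrite usum_scal by auto.
        pose proof (trunc_coef_sum (gaussP 0 1 1 0) K d l 0 Hd K0) as TS.
        rewrite (usum_ext (trunc_coef (gaussP 0 1 1 0) d l) (fun m => trunc_coef (gaussP 0 1 1 0) d l m * ex (IZR m * (IZR 0 / INR d)))).
        + rewrite TS. rewrite (usum_ext _ G); [ring|]. intros m. rewrite EG. f_equal. f_equal. unfold Rdiv. ring.
        + intros m. replace (IZR m * (IZR 0 / INR d))%R with 0%R by (unfold Rdiv; ring). rewrite ex_0. ring.
      - apply summable_le with (fun m => (6 * K + 36 * K) / (1 + IZR m ^ 2))%R; [|apply summableR_inv_quad].
        intros m. apply trunc_coef_bound with (gaussP' 0 1 1 0) (gaussP'' 0 1 1 0); auto using Cder_gaussP, Cder_gaussP'.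
      - apply summable_ext with (fun m => e l * G m); [intros; ring|]. now apply summable_scal. }
    pose proof (Climseq_plus _ _ _ _ (Climseq_const 1) (Climseq_scal (- / usum G) _ _ L)) as F.
    replace (1 + - / usum G * 0) with (RtoC 1) in F by ring.
    apply Climseq_ext_ev with (2 := F). exists 0%nat. intros l _. rewrite EL. unfold e. field. exact T.
Qed.

Lemma gsum_lim al be d : (0 < d)%nat -> (0 < Re al)%R -> (0 < Re al ^ 2 - Im al ^ 2)%R ->
  Climseq (fun l => gsum al be (mesh d l)) 1.
Proof.
  intros Hd H1 H2. destruct (gsum_path al be H1 H2) as [K HK].
  assert (L : Climseq (fun l => gsum al be (mesh d l) - gsum 1 0 (mesh d l)) 0).
  { apply Climseq_mesh with d K; auto. intros l.
    rewrite Cminus_0_r. now apply HK, mesh_pos. }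
  pose proof (Climseq_plus _ _ _ _ L (gsum_lim_1 d Hd)) as F.
  replace (0 + 1) with (RtoC 1) in F by ring. apply Climseq_ext_ev with (2 := F).
  exists 0%nat. intros l _. ring.
Qed.

(** By [gauss_square] the coefficient at [m] is its expected value times a [gsum] with shifted
    centre, and [gsum] tends to 1. *)
Lemma jacobi (al : C) d (r : Z) : (0 < d)%nat -> (0 < Re al)%R -> (0 < Re al ^ 2 - Im al ^ 2)%R ->
  let b := (IZR r / INR d)%R in
  summable (fun m : Z => Cexp (- RtoC (PI * IZR m ^ 2) / al ^ 2) / al * ex (IZR m * b)) /\
  usum (fun n : Z => Cexp (- RtoC (PI * (IZR n + b) ^ 2) * al ^ 2))
  = usum (fun m : Z => Cexp (- RtoC (PI * IZR m ^ 2) / al ^ 2) / al * ex (IZR m * b)).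
Proof.
  intros Hd H1 H2 b. pose proof (Re_sqr_pos_nz al H1) as Ha.
  destruct (gauss_decay_exists 0 1 al 0 H2) as (K & K0 & _ & K2).
  destruct (poisson (gaussP 0 1 al 0) (gaussP' 0 1 al 0) (gaussP'' 0 1 al 0) K K d r
    (fun m => Cexp (- RtoC (PI * IZR m ^ 2) / al ^ 2) / al)) as [S E]; auto using Cder_gaussP, Cder_gaussP'.
  - intros m. destruct (gauss_decay_exists 0 1 al (Ci * RtoC (IZR m) / al) H2) as (K3 & K30 & _).
    pose proof (Climseq_scal (Cexp (- RtoC (PI * IZR m ^ 2) / al ^ 2) / al) _ _
      (gsum_lim al (Ci * RtoC (IZR m) / al) d Hd H1 H2)) as F. rewrite Cmult_1_r in F.
    apply Climseq_ext_ev with (2 := F). exists 0%nat. intros l _. symmetry.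
    apply gsum_0_coef with K3; auto using mesh_pos.
  - fold b in S, E. split; auto. rewrite <- E. apply usum_ext. intros n. unfold gaussP.
    replace (0 * RtoC (IZR n + b) + 1) with (RtoC 1) by ring. rewrite Cmult_1_l. f_equal.
    rewrite RtoC_mult, RtoC_pow. ring.
Qed.

(** Writing x = ((al x + be) - be)/al splits x times the shifted Gaussian into a multiple of its
    derivative, whose Riemann sums tend to 0, and a multiple of the Gaussian itself, with limit
    given by [gsum_lim]. *)
Lemma jacobi_odd (al : C) d (r : Z) : (0 < d)%nat -> (0 < Re al)%R -> (0 < Re al ^ 2 - Im al ^ 2)%R ->
  let b := (IZR r / INR d)%R in
  summable (fun m : Z => - (Ci * RtoC (IZR m)) / al ^ 3 * Cexp (- RtoC (PI * IZR m ^ 2) / al ^ 2) * ex (IZR m * b)) /\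
  usum (fun n : Z => RtoC (IZR n + b) * Cexp (- RtoC (PI * (IZR n + b) ^ 2) * al ^ 2))
  = usum (fun m : Z => - (Ci * RtoC (IZR m)) / al ^ 3 * Cexp (- RtoC (PI * IZR m ^ 2) / al ^ 2) * ex (IZR m * b)).
Proof.
  intros Hd H1 H2 b. pose proof (Re_sqr_pos_nz al H1) as Ha.
  destruct (gauss_decay_exists 1 0 al 0 H2) as (K & K0 & _ & K2).
  destruct (poisson (gaussP 1 0 al 0) (gaussP' 1 0 al 0) (gaussP'' 1 0 al 0) K K d r
    (fun m => - (Ci * RtoC (IZR m)) / al ^ 3 * Cexp (- RtoC (PI * IZR m ^ 2) / al ^ 2))) as [S E];
    auto using Cder_gaussP, Cder_gaussP'.
  - intros m. set (be := Ci * RtoC (IZR m) / al).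
    destruct (gauss_decay_exists 0 1 al be H2) as (K3 & K30 & K31 & K32).
    set (E0 := Cexp (- RtoC (PI * IZR m ^ 2) / al ^ 2)).
    set (T := fun h => usum (fun k : Z => RtoC h * gaussP' 0 1 al be (RtoC (IZR k * h)))).
    assert (LT : Climseq (fun l => T (mesh d l)) 0).
    { apply Climseq_mesh with d (18 * K3)%R; auto. intros l.
      rewrite Cminus_0_r.
      apply riemann_sum_derivative with (gaussP 0 1 al be) (gaussP'' 0 1 al be) K3 K3;
        auto using Cder_gaussP, Cder_gaussP', mesh_pos. }
    pose proof (Climseq_plus _ _ _ _ (Climseq_scal (- E0 / (RtoC (2 * PI) * al ^ 2)) _ _ LT)
      (Climseq_scal (- E0 * be / al ^ 2) _ _ (gsum_lim al be d Hd H1 H2))) as F.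
    replace (- (Ci * RtoC (IZR m)) / al ^ 3 * E0) with
      (- E0 / (RtoC (2 * PI) * al ^ 2) * 0 + - E0 * be / al ^ 2 * 1).
    2:{ unfold be. field. split; auto. intros X. apply RtoC_inj in X. pose proof PI_RGT_0. lra. }
    apply Climseq_ext_ev with (2 := F). exists 0%nat. intros l _.
    pose proof (mesh_pos d l Hd) as Hh. set (h := mesh d l) in *.
    unfold T, gsum, fcoef.
    pose proof (summable_scal (RtoC h) _ (summable_decay0 _ _ h Hh K31)) as S1.
    assert (S2 : summable (fun k : Z => RtoC h * (al * Cexp (- RtoC PI * (al * RtoC (IZR k * h) + be) ^ 2)))).
    { apply summable_scal, summable_scal. apply summable_ext with (2 := summable_decay0 _ _ h Hh K30).
      intros k. unfold gaussP. ring. }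
    rewrite <- (usum_scal (- E0 / (RtoC (2 * PI) * al ^ 2))), <- (usum_scal (- E0 * be / al ^ 2)), <- usum_plus;
      auto using summable_scal.
    apply usum_ext. intros k. set (x := (IZR k * h)%R).
    unfold gaussP, gaussP'.
    replace ((1 * RtoC x + 0) * Cexp (- RtoC PI * (al * RtoC x + 0) ^ 2) * ex (- (IZR m * x))) with
      (RtoC x * (Cexp (- RtoC PI * (al * RtoC x + 0) ^ 2) * ex (- (IZR m * x)))) by ring.
    rewrite gauss_square by auto. fold be. fold E0. field. split; auto.
    intros X. apply RtoC_inj in X. pose proof PI_RGT_0. lra.
  - fold b in S, E. split; auto. rewrite <- E. apply usum_ext. intros n. unfold gaussP.
    replace (1 * RtoC (IZR n + b) + 0) with (RtoC (IZR n + b)) by ring. f_equal. f_equal.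
    rewrite RtoC_mult, RtoC_pow. ring.
Qed.

(** * Quadratic residues *)

Module QuadraticResidues.

Import all_boot all_order all_algebra cyclic finfield ring.
Import GRing.Theory.
Local Open Scope ring_scope.

Section PrimeField.

Variable q : nat.
Hypothesis q_prime : prime q.
Hypothesis q_odd : (2 < q)%N.

Let F := 'F_q.

Lemma natF_eq0 (n : nat) : (n%:R == 0 :> F) = (q %| n)%N.
Proof. by rewrite (dvdn_pcharf (pchar_Fp q_prime)). Qed.

Lemma natF_surj (x : F) : exists n : nat, x = n%:R.
Proof. by exists (x : nat); rewrite natr_Zp. Qed.

Lemma expF_unit (x : F) : x != 0 -> x ^+ q.-1 = 1.
Proof.
move=> x0; apply: (mulfI x0); rewrite -exprS mulr1 prednK ?prime_gt0 //.
by have := expf_card x; rewrite card_Fp.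
Qed.

Lemma prim_root_exists : exists g : F, (q.-1).-primitive_root g.
Proof.
pose rs := enum [set x : F | x != 0].
have srs : size rs = q.-1.
  rewrite -cardE.
  have -> : [set x : F | x != 0] = ~: [set 0] by apply/setP=> x; rewrite !inE.
  by rewrite cardsC1 card_Fp.
have /hasP [g _ gP] : has (q.-1).-primitive_root rs.
  apply: has_prim_root; rewrite ?srs ?enum_uniq //.
  - by rewrite -subn1 subn_gt0 prime_gt1.
  - by apply/allP=> x; rewrite mem_enum inE unity_rootE => x0; rewrite expF_unit.
by exists g.
Qed.

Lemma q1_even : ~~ odd q.-1.
Proof. by case: (even_prime q_prime) q_odd => [->//|]; case: (q) => [|n] //=. Qed.

Lemma odd_modq n : odd (n %% q.-1) = odd n.
Proof. by rewrite [in RHS](divn_eq n q.-1) oddD oddM (negbTE q1_even) andbF. Qed.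

(** Squares are the even powers of a primitive root; the parity of the exponent is well defined
    because its period [q.-1] is even. *)
Lemma sqrt_cases (g x : F) : (q.-1).-primitive_root g -> x != 0 ->
  exists2 k : nat, x = g ^+ k & (exists y, x = y ^+ 2) <-> ~~ odd k.
Proof.
move=> gP x0; have [k xk] := prim_rootP gP (expF_unit _ x0).
exists k => //; split=> [[y yx]|ek]; last first.
  by exists (g ^+ k./2); rewrite -exprM muln2 xk -[in LHS](odd_double_half k) (negbTE ek).
have y0 : y != 0 by apply: contraNneq x0 => y0; rewrite yx y0 expr0n.
have [j yj] := prim_rootP gP (expF_unit _ y0).
have : g ^+ k == g ^+ (j * 2) by rewrite exprM -yj -yx xk.
rewrite (eq_prim_root_expr gP) => /eqP kj.
have : odd (k %% q.-1) = odd ((j * 2) %% q.-1) by rewrite kj.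
by rewrite !odd_modq oddM andbF => ->.
Qed.

Lemma sqr_mul (g x y : F) : (q.-1).-primitive_root g -> x != 0 -> y != 0 ->
  (exists z, x * y = z ^+ 2) <-> ((exists z, x = z ^+ 2) <-> (exists z, y = z ^+ 2)).
Proof.
move=> gP x0 y0; have [k xk ->] := sqrt_cases _ _ gP x0; have [j yj ->] := sqrt_cases _ _ gP y0.
have xy0 : x * y != 0 by rewrite mulf_neq0.
have [i xyi ->] := sqrt_cases _ _ gP xy0.
have : g ^+ i == g ^+ (k + j) by rewrite -xyi xk yj exprD.
rewrite (eq_prim_root_expr gP) => /eqP E.
have -> : odd i = odd k (+) odd j by rewrite -oddD -odd_modq E odd_modq.
have nf : ~ is_true false by [].
by have tt : is_true true by []; case: (odd k); case: (odd j) => /=; tauto.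
Qed.

(** With -1 = g^k, the order forces [k] to be an odd multiple of (q - 1)/2, so [k] is even exactly
    when 4 divides q - 1. *)
Lemma sqr_m1 : (exists z : F, -1 = z ^+ 2) <-> (4 %| q.-1)%N.
Proof.
have [g gP] := prim_root_exists.
have m10 : (-1 : F) != 0 by rewrite oppr_eq0 oner_eq0.
have [k xk ->] := sqrt_cases _ _ gP m10.
have kd : (q.-1 %| k * 2)%N by rewrite (prim_order_dvd gP) exprM -xk sqrrN expr1n.
have kn : ~~ (q.-1 %| k)%N.
  rewrite (prim_order_dvd gP) -xk -subr_eq0 -opprD oppr_eq0 -(natrD _ 1 1) natF_eq0.
  by apply/negP=> /(@dvdn_leq q 2 isT); rewrite leqNgt q_odd.
have [h qh] : exists h, q.-1 = (h * 2)%N.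
  by exists (q.-1)./2; rewrite muln2 -[LHS]odd_double_half (negbTE q1_even).
move: kd kn; rewrite qh dvdn_pmul2r // => /dvdnP [c kc] kn.
have oc : odd c.
  apply: contraR kn => ec; rewrite kc -[c]odd_double_half (negbTE ec) add0n -muln2 -mulnA.
  by rewrite [(2 * _)%N]mulnC dvdn_mull.
by rewrite kc oddM oc /= (@dvdn_pmul2r 2 2 h) // dvdn2.
Qed.

(** Square roots of -3 and primitive cube roots of unity determine each other through z = 2 w + 1,
    since z^2 + 3 = 4 (w^2 + w + 1). *)
Lemma sqr_m3 : (3 < q)%N -> (exists z : F, - 3%:R = z ^+ 2) <-> (3 %| q.-1)%N.
Proof.
move=> q3; have [g gP] := prim_root_exists.
have two0 : (2%:R : F) != 0.
  by rewrite natF_eq0; apply/negP=> /(@dvdn_leq q 2 isT); rewrite leqNgt q_odd.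
have three0 : (3%:R : F) != 0.
  by rewrite natF_eq0; apply/negP=> /(@dvdn_leq q 3 isT); rewrite leqNgt q3.
split=> [[z zE]|d3].
- pose w := (z - 1) / 2%:R.
  have w2 : w * 2%:R = z - 1 by rewrite mulfVK.
  have wq : w ^+ 2 + w + 1 = 0.
    apply: (mulfI (mulf_neq0 two0 two0)); rewrite mulr0.
    have -> : 2%:R * 2%:R * (w ^+ 2 + w + 1) = (w * 2%:R) ^+ 2 + (w * 2%:R) *+ 2 + 4%:R :> F.
      by ring.
    rewrite w2.
    have -> : (z - 1) ^+ 2 + (z - 1) *+ 2 + 4%:R = z ^+ 2 + 3%:R by ring.
    by rewrite -zE addNr.
  have w3 : w ^+ 3 = 1 by apply/eqP; rewrite -subr_eq0; apply/eqP; rewrite -[RHS](mulr0 (w - 1)) -wq; ring.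
  have w1 : w != 1.
    apply: contraNneq three0 => w1; have := wq; rewrite w1 expr1n => <-; apply/eqP; ring.
  have w0 : w != 0 by apply/eqP=> w00; move/eqP: w3; rewrite w00 expr0n /= eq_sym oner_eq0.
  have [k xk _] := sqrt_cases _ _ gP w0.
  case: (boolP (3 %| q.-1)%N) => // n3.
  have co : coprime q.-1 3 by rewrite coprime_sym prime_coprime.
  have : (q.-1 %| k * 3)%N by rewrite (prim_order_dvd gP) exprM -xk w3.
  by rewrite Gauss_dvdl // (prim_order_dvd gP) -xk (negbTE w1).
- pose w := g ^+ (q.-1 %/ 3).
  have wP := dvdn_prim_root gP d3.
  have w3 : w ^+ 3 = 1 by apply: prim_expr_order wP.
  have w1 : w != 1 by have := prim_order_dvd wP 1; rewrite expr1 => <-.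
  have wq : w ^+ 2 + w + 1 = 0.
    have wE : (w - 1) * (w ^+ 2 + w + 1) = w ^+ 3 - 1 by ring.
    have : (w - 1) * (w ^+ 2 + w + 1) = 0 by rewrite wE w3 subrr.
    by move/eqP; rewrite mulf_eq0 subr_eq0 (negbTE w1) => /eqP.
  exists (w *+ 2 + 1). 
  have -> : (w *+ 2 + 1) ^+ 2 = 4%:R * (w ^+ 2 + w + 1) - 3%:R by ring.
  by rewrite wq mulr0 sub0r.
Qed.

Lemma sqr_nat (c : nat) (x : F) : x + c%:R = 0 ->
  (exists z : F, x = z ^+ 2) <-> exists y k : nat, (y * y + c = k * q)%N.
Proof.
move=> xc; have xE : x = - c%:R by apply/eqP; rewrite -addr_eq0 xc.
split=> [[z zE]|[y [k E]]].
- have [y yE] := natF_surj z; exists y.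
  have /dvdnP [k kE] : (q %| y * y + c)%N.
    by rewrite -natF_eq0 natrD natrM -yE -expr2 -zE xc.
  by exists k.
- exists y%:R; rewrite xE; apply/eqP; rewrite eq_sym -addr_eq0 expr2 -natrM -natrD E.
  by rewrite natF_eq0 dvdn_mull.
Qed.

End PrimeField.

Lemma prime_nat (q : nat) : Znumtheory.prime (Z.of_nat q) -> prime q.
Proof.
move=> qp; apply/primeP; split.
  by have := prime_ge_2 _ qp => ?; apply/leP; lia.
move=> d /dvdnP [k E].
have : Z.divide (Z.of_nat d) (Z.of_nat q) by exists (Z.of_nat k); rewrite E -multE; lia.
have := prime_ge_2 _ qp => q2.
case/(prime_divisors _ qp) => [|[|[|]]] H; apply/orP; [lia|left|right|lia]; apply/eqP; lia.
Qed.

Lemma minus_one_residue (q : nat) : Znumtheory.prime (Z.of_nat q) -> Nat.lt 2 q ->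
  (exists y k : nat, Nat.add (Nat.mul y y) 1 = Nat.mul k q) <-> Nat.modulo q 4 = 1%N.
Proof.
move=> /prime_nat qp /ltP q2.
have m1 : (-1 : 'F_q) + 1%:R = 0 by rewrite addNr.
rewrite -(sqr_nat q qp 1 (-1) m1) (sqr_m1 q qp q2).
have q1 : q = q.-1.+1 by rewrite prednK ?prime_gt0.
split=> [/dvdnP [k E]|E].
- have -> : q = Nat.add 1 (Nat.mul k 4) by rewrite q1 E -multE; lia.
  by rewrite Nat.Div0.mod_add.
- apply/dvdnP; exists (Nat.div q 4); rewrite -multE.
  by have := Nat.div_mod q 4; lia.
Qed.

(** As 3 = (-1)(-3), it is a square exactly when -1 and -3 are both squares or both non-squares. In
    the equation [3 * (q - 1)] stands for -3. *)
Lemma three_residue (q : nat) : Znumtheory.prime (Z.of_nat q) -> Nat.lt 3 q ->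
  (exists y k : nat, Nat.add (Nat.mul y y) (Nat.mul 3 (Nat.sub q 1)) = Nat.mul k q) <->
  (Nat.modulo q 4 = 1%N <-> Nat.modulo q 3 = 1%N).
Proof.
move=> /prime_nat qp /ltP q3; have q2 : (2 < q)%N by apply: ltnW.
have [g gP] := prim_root_exists q qp.
have q1 : q = q.-1.+1 by rewrite prednK ?prime_gt0.
have c3 : (3%:R : 'F_q) + (3 * (q - 1))%N%:R = 0.
  by apply/eqP; rewrite -natrD natF_eq0 // mulnBr muln1 subnKC ?dvdn_mull // leq_pmulr ?prime_gt0.
rewrite -(sqr_nat q qp _ _ c3).
have E3 : (3%:R : 'F_q) = (-1) * (- 3%:R) by rewrite mulrNN mul1r.
have three0 : (3%:R : 'F_q) != 0.
  by rewrite natF_eq0 //; apply/negP=> /(@dvdn_leq q 3 isT); rewrite leqNgt q3.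
have m10 : (-1 : 'F_q) != 0 by rewrite oppr_eq0 oner_eq0.
have m30 : (- 3%:R : 'F_q) != 0 by rewrite oppr_eq0.
have H := sqr_mul q qp q2 g _ _ gP m10 m30; rewrite -E3 in H.
rewrite H (sqr_m1 q qp q2) (sqr_m3 q qp q2 q3).
have dv n : (0 < n)%N -> (n %| q.-1)%N <-> Nat.modulo q n = Nat.modulo 1 n.
  move=> n0; split=> [/dvdnP [k E]|E].
  - have -> : q = Nat.add 1 (Nat.mul k n) by rewrite q1 E -multE; lia.
    by rewrite Nat.Div0.mod_add.
  - apply/dvdnP; exists (Nat.sub (Nat.div q n) (Nat.div 1 n)); rewrite -multE.
    have := Nat.div_mod q n; have := Nat.div_mod 1 n; rewrite E.
    have : n <> 0%N by move=> n00; rewrite n00 in n0.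
    have := Nat.Div0.div_le_mono 1 q n.
    by move: q2 => /ltP q2; nia.
by rewrite (dv 4%N) // (dv 3%N).
Qed.

End QuadraticResidues.

(** * The characters modulo 12 and modulo 4 *)

(** Periodic and decidable by cases; [kronecker_12] identifies it with the symbol (12/n), as
    [kronecker_m4] does for [chi4] and (-4/n). *)
Definition chi12 (n : Z) : Z :=
  let r := (n mod 12)%Z in
  if ((r =? 1) || (r =? 11))%Z%bool then 1%Z
  else if ((r =? 5) || (r =? 7))%Z%bool then (-1)%Z else 0%Z.

Definition chi4 (n : Z) : Z :=
  let r := (n mod 4)%Z in if (r =? 1)%Z then 1%Z else if (r =? 3)%Z then (-1)%Z else 0%Z.

Lemma chi12_mod n : chi12 (n mod 12) = chi12 n.
Proof. unfold chi12. now rewrite Z.mod_mod by lia. Qed.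

Lemma chi4_mod n : chi4 (n mod 4) = chi4 n.
Proof. unfold chi4. now rewrite Z.mod_mod by lia. Qed.

Definition zseq (m : nat) : list Z := map Z.of_nat (seq 0 m).

Lemma in_zseq m a : In a (zseq m) <-> (0 <= a < Z.of_nat m)%Z.
Proof.
  unfold zseq. rewrite in_map_iff. split.
  - intros (x & <- & Hx). apply in_seq in Hx. lia.
  - intros H. exists (Z.to_nat a). rewrite in_seq. lia.
Qed.

Lemma NoDup_zseq m : NoDup (zseq m).
Proof. apply FinFun.Injective_map_NoDup; [intros a b; lia|apply seq_NoDup]. Qed.

Lemma zseq_forall (m : nat) (P : Z -> bool) : forallb P (zseq m) = true ->
  forall a, (0 <= a < Z.of_nat m)%Z -> P a = true.
Proof. intros H a Ha. rewrite forallb_forall in H. apply H. now apply in_zseq. Qed.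

Lemma chi12_mul a b : chi12 (a * b) = (chi12 a * chi12 b)%Z.
Proof.
  rewrite <- (chi12_mod (a * b)), Zmult_mod, chi12_mod, <- (chi12_mod a), <- (chi12_mod b).
  pose proof (Z.mod_pos_bound a 12 ltac:(lia)). pose proof (Z.mod_pos_bound b 12 ltac:(lia)).
  generalize dependent (a mod 12)%Z. generalize dependent (b mod 12)%Z. intros y Hy x Hx.
  assert (K : forallb (fun x => forallb (fun y => (chi12 (x * y) =? chi12 x * chi12 y)%Z) (zseq 12)) (zseq 12) = true)
    by reflexivity.
  pose proof (zseq_forall 12 _ K x Hx) as K1. cbv beta in K1.
  now apply Z.eqb_eq, (zseq_forall 12 _ K1 y Hy).
Qed.

Lemma chi4_mul a b : chi4 (a * b) = (chi4 a * chi4 b)%Z.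
Proof.
  rewrite <- (chi4_mod (a * b)), Zmult_mod, chi4_mod, <- (chi4_mod a), <- (chi4_mod b).
  pose proof (Z.mod_pos_bound a 4 ltac:(lia)). pose proof (Z.mod_pos_bound b 4 ltac:(lia)).
  generalize dependent (a mod 4)%Z. generalize dependent (b mod 4)%Z. intros y Hy x Hx.
  assert (K : forallb (fun x => forallb (fun y => (chi4 (x * y) =? chi4 x * chi4 y)%Z) (zseq 4)) (zseq 4) = true)
    by reflexivity.
  pose proof (zseq_forall 4 _ K x Hx) as K1. cbv beta in K1.
  now apply Z.eqb_eq, (zseq_forall 4 _ K1 y Hy).
Qed.

Lemma chi12_opp n : chi12 (- n) = chi12 n.
Proof. replace (- n)%Z with (-1 * n)%Z by ring. rewrite chi12_mul. change (chi12 (-1)) with 1%Z. lia. Qed.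

Lemma chi4_opp n : chi4 (- n) = (- chi4 n)%Z.
Proof. replace (- n)%Z with (-1 * n)%Z by ring. rewrite chi4_mul. change (chi4 (-1)) with (-1)%Z. lia. Qed.

Lemma legendre_spec a q : (1 < q)%Z -> (a mod q <> 0)%Z ->
  legendre a q = if excluded_middle_informative (exists x, (q | x * x - a)%Z) then 1%Z else (-1)%Z.
Proof.
  intros Hq Ha. unfold legendre. rewrite (proj2 (Z.eqb_neq _ _) Ha).
  destruct (existsb _ _) eqn:E; destruct (excluded_middle_informative _) as [e|n]; auto; exfalso.
  - apply n. apply existsb_exists in E. destruct E as (x & _ & Hx). exists (Z.of_nat x).
    apply Z.eqb_eq in Hx. now apply Z.mod_divide; [lia|].
  - destruct e as [x Hx]. enough (true = false) by easy. rewrite <- E. symmetry. apply existsb_exists.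
    exists (Z.to_nat (x mod q)). pose proof (Z.mod_pos_bound x q ltac:(lia)). split.
    + apply in_seq. lia.
    + rewrite Z2Nat.id by lia. apply Z.eqb_eq. apply Z.mod_divide; [lia|].
      rewrite (Z.div_mod x q) in Hx by lia. destruct Hx as [c Hc].
      exists (c - (x / q) * (2 * (x mod q) + q * (x / q)))%Z. nia.
Qed.

Lemma prime_coprime_mod12 q : prime q -> (3 < q)%Z ->
  (q mod 12 = 1 \/ q mod 12 = 5 \/ q mod 12 = 7 \/ q mod 12 = 11)%Z.
Proof.
  intros Hp H3. pose proof (Z.mod_pos_bound q 12 ltac:(lia)). pose proof (Z.div_mod q 12 ltac:(lia)) as E.
  assert (N2 : ~ (2 | q)%Z). { intros D. apply prime_divisors with (1 := Hp) in D. lia. }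
  assert (N3 : ~ (3 | q)%Z). { intros D. apply prime_divisors with (1 := Hp) in D. lia. }
  set (r := (q mod 12)%Z) in *. set (k := (q / 12)%Z) in *.
  assert (r = 0 \/ r = 1 \/ r = 2 \/ r = 3 \/ r = 4 \/ r = 5 \/ r = 6 \/ r = 7 \/ r = 8 \/ r = 9 \/ r = 10 \/ r = 11)%Z as D by lia.
  repeat (destruct D as [D|D]); auto; exfalso; rewrite D in E;
    first [apply N2; exists (q / 2)%Z; pose proof (Z.div_mod q 2 ltac:(lia)); pose proof (Z.mod_pos_bound q 2 ltac:(lia)); lia
          |apply N3; exists (q / 3)%Z; pose proof (Z.div_mod q 3 ltac:(lia)); pose proof (Z.mod_pos_bound q 3 ltac:(lia)); lia].
Qed.

Lemma halve_residue q a : prime q -> q <> 2%Z ->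
  (exists x, (q | x * x - 4 * a)%Z) <-> (exists y, (q | y * y - a)%Z).
Proof.
  intros Hp Hn. pose proof (prime_ge_2 q Hp) as H2.
  assert (Ho : (q mod 2 = 1)%Z).
  { pose proof (Z.mod_pos_bound q 2 ltac:(lia)). destruct (Z.eq_dec (q mod 2) 0) as [e|]; [|lia].
    apply Z.mod_divide in e; [|lia]. apply prime_divisors with (1 := Hp) in e. lia. }
  pose proof (Z.div_mod q 2 ltac:(lia)) as Eq. rewrite Ho in Eq. set (h := (q / 2)%Z) in *.
  split.
  (* [h + 1] is the inverse of 2 modulo [q = 2 * h + 1]. *)
  - intros [x [c Hc]]. exists (x * (h + 1))%Z.
    assert (D : (q | 4 * (x * (h + 1) * (x * (h + 1)) - a))%Z).
    { exists (c + x * x * (q + 2))%Z.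
      replace (4 * (x * (h + 1) * (x * (h + 1)) - a))%Z with (x * x * ((2 * h + 2) * (2 * h + 2)) - 4 * a)%Z by ring.
      replace (2 * h + 2)%Z with (q + 1)%Z by lia. nia. }
    apply Gauss with (1 := D). apply prime_rel_prime; auto.
    intros D'. assert (q <= 4)%Z by (apply Z.divide_pos_le in D'; lia). destruct D' as [k Hk].
    assert (E3 : (q = 3)%Z) by lia. rewrite E3 in Hk. lia.
  - intros [y [k E]]. exists (2 * y)%Z, (4 * k)%Z. lia.
Qed.

Lemma nat_mod_Z (q : Z) (m : nat) (r : nat) : (0 <= q)%Z -> (0 < m)%nat ->
  (Z.to_nat q mod m = r)%nat <-> (q mod Z.of_nat m = Z.of_nat r)%Z.
Proof.
  intros Hq Hm. rewrite <- (Z2Nat.id q) at 2 by lia. rewrite <- Nat2Z.inj_mod. lia.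
Qed.

Lemma kronecker_prime_m4 q : prime q -> kronecker_prime (-4) q = chi4 q.
Proof.
  intros Hp. pose proof (prime_ge_2 q Hp) as H2. unfold kronecker_prime.
  destruct (q =? 2)%Z eqn:E2; [apply Z.eqb_eq in E2; now subst|].
  apply Z.eqb_neq in E2.
  assert (Ho : (q mod 2 = 1)%Z).
  { pose proof (Z.mod_pos_bound q 2 ltac:(lia)). destruct (Z.eq_dec (q mod 2) 0) as [e|]; [|lia].
    apply Z.mod_divide in e; [|lia]. apply prime_divisors with (1 := Hp) in e. lia. }
  pose proof (QuadraticResidues.minus_one_residue (Z.to_nat q)) as R.
  rewrite Z2Nat.id in R by lia. specialize (R Hp ltac:(lia)).
  rewrite (nat_mod_Z q 4 1) in R by lia. simpl Z.of_nat in R.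
  assert (Q : (exists x, (q | x * x - -4)%Z) <-> (q mod 4 = 1)%Z).
  { change (-4)%Z with (4 * -1)%Z. rewrite halve_residue by auto. rewrite <- R. split.
    - intros [y [k E]]. exists (Z.abs_nat y), (Z.to_nat k). nia.
    - intros (y & k & E). exists (Z.of_nat y), (Z.of_nat k). nia. }
  rewrite legendre_spec; [|lia|].
  - unfold chi4. destruct (excluded_middle_informative _) as [e|n].
    + now rewrite (proj1 Q e).
    + assert (q mod 4 <> 1)%Z by tauto. rewrite (proj2 (Z.eqb_neq _ _) H).
      assert (q mod 4 = 3)%Z. { pose proof (Z.mod_pos_bound q 4 ltac:(lia)). pose proof (Z.div_mod q 4 ltac:(lia)). pose proof (Z.div_mod q 2 ltac:(lia)). lia. }
      now rewrite H0.
  - intros e. apply Z.mod_divide in e; [|lia]. apply Z.divide_opp_r in e. simpl in e.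
    assert (q <= 4)%Z by (apply Z.divide_pos_le in e; lia). destruct e as [k Hk].
    pose proof (Z.div_mod q 2 ltac:(lia)). assert (E3 : (q = 3)%Z) by lia. rewrite E3 in Hk. lia.
Qed.

(** Since 12 = 4 times 3, the question is whether 3 is a square: [q] = 1 modulo 4 and [q] = 1 modulo
    3 must hold together or fail together, which singles out 1 and 11 among the classes modulo
    12. *)
Lemma kronecker_prime_12 q : prime q -> kronecker_prime 12 q = chi12 q.
Proof.
  intros Hp. pose proof (prime_ge_2 q Hp) as H2. unfold kronecker_prime.
  destruct (q =? 2)%Z eqn:E2; [apply Z.eqb_eq in E2; now subst|].
  apply Z.eqb_neq in E2. destruct (Z.eq_dec q 3) as [->|E3]; [reflexivity|].
  assert (H3 : (3 < q)%Z) by lia.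
  pose proof (QuadraticResidues.three_residue (Z.to_nat q)) as R.
  rewrite Z2Nat.id in R by lia. specialize (R Hp ltac:(lia)).
  rewrite (nat_mod_Z q 4 1), (nat_mod_Z q 3 1) in R by lia. simpl Z.of_nat in R.
  assert (Q : (exists x, (q | x * x - 12)%Z) <-> (q mod 4 = 1 <-> q mod 3 = 1)%Z).
  { change 12%Z with (4 * 3)%Z. rewrite halve_residue by auto. rewrite <- R. split.
    - intros [y [k E]]. exists (Z.abs_nat y), (Z.to_nat (k + 3)). nia.
    - intros (y & k & E). exists (Z.of_nat y), (Z.of_nat k - 3)%Z. nia. }
  pose proof (prime_coprime_mod12 q Hp H3) as M.
  assert (M4 : (q mod 4 = (q mod 12) mod 4)%Z) by (apply (Zmod_div_mod 4 12); [lia|lia|now exists 3%Z]).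
  assert (M3 : (q mod 3 = (q mod 12) mod 3)%Z) by (apply (Zmod_div_mod 3 12); [lia|lia|now exists 4%Z]).
  rewrite M4, M3 in Q.
  rewrite legendre_spec; [|lia|].
  - unfold chi12. destruct M as [M|[M|[M|M]]]; rewrite M in *; simpl in *;
    destruct (excluded_middle_informative _) as [e|n]; auto; exfalso.
    + apply n, Q. vm_compute. tauto.
    + apply Q in e. vm_compute in e. destruct e as [e _]. now specialize (e eq_refl).
    + apply Q in e. vm_compute in e. destruct e as [_ e]. now specialize (e eq_refl).
    + apply n, Q. vm_compute. split; intros; discriminate.
  - intros e. apply Z.mod_divide in e; [|lia].
    assert (q <= 12)%Z by (apply Z.divide_pos_le in e; lia). destruct e as [k Hk].
    destruct M as [M|[M|[M|M]]]; pose proof (Z.div_mod q 12 ltac:(lia)); assert (q = 5 \/ q = 7 \/ q = 11)%Z by lia; lia.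
Qed.

(** * From primes to all integers by multiplicativity *)

Lemma valuation_spec q n v u : (2 <= q)%Z -> (1 <= n)%Z -> n = (q ^ Z.of_nat v * u)%Z -> ~ (q | u)%Z ->
  valuation q n = v.
Proof.
  intros Hq Hn E Hu. unfold valuation.
  assert (D : forall k, (n mod q ^ Z.of_nat k =? 0)%Z = (k <=? v)%nat).
  { intros k. assert (P : (0 < q ^ Z.of_nat k)%Z) by (apply Z.pow_pos_nonneg; lia).
    destruct (k <=? v)%nat eqn:Ek.
    - apply Nat.leb_le in Ek. apply Z.eqb_eq, Z.mod_divide; [lia|]. rewrite E.
      replace (Z.of_nat v) with (Z.of_nat (v - k) + Z.of_nat k)%Z by lia. rewrite Z.pow_add_r by lia.
      exists (q ^ Z.of_nat (v - k) * u)%Z. ring.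
    - apply Nat.leb_gt in Ek. apply Z.eqb_neq. intros H. apply Z.mod_divide in H; [|lia].
      apply Hu. destruct H as [c Hc]. exists (q ^ Z.of_nat (k - v - 1) * c)%Z.
      assert (P' : (0 < q ^ Z.of_nat v)%Z) by (apply Z.pow_pos_nonneg; lia).
      apply (Z.mul_reg_l _ _ (q ^ Z.of_nat v)); [lia|]. rewrite <- E, Hc.
      replace (Z.of_nat k) with (Z.of_nat v + Z.of_nat (k - v - 1) + 1)%Z by lia.
      rewrite !Z.pow_add_r by lia. ring. }
  (* The list of candidate exponents stops at [n], which suffices because v < q^v <= n. *)
  assert (V : (v <= Z.to_nat n)%nat).
  { assert (Z.of_nat v < q ^ Z.of_nat v)%Z by (apply Z.pow_gt_lin_r; lia).
    set (w := (q ^ Z.of_nat v)%Z) in *. assert (1 <= u)%Z by nia. assert (w <= n)%Z by nia. lia. }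
  rewrite (filter_ext _ _ D).
  replace (Z.to_nat n) with (v + (Z.to_nat n - v))%nat by lia. rewrite seq_app, filter_app, length_app.
  assert (F1 : filter (fun k => k <=? v)%nat (seq 1 v) = seq 1 v).
  { apply forallb_filter_id. apply forallb_forall. intros k Hk. apply in_seq in Hk. apply Nat.leb_le. lia. }
  assert (F2 : forall l, (forall k, In k l -> (v < k)%nat) -> filter (fun k => k <=? v)%nat l = nil).
  { induction l as [|a l IH]; intros H; auto. simpl. rewrite (proj2 (Nat.leb_gt _ _)) by (apply H; now left).
    apply IH. intros; apply H; now right. }
  rewrite F1, F2, length_seq; simpl; [lia|]. intros k Hk. apply in_seq in Hk. lia.
Qed.

Lemma valuation_exists q n : (2 <= q)%Z -> (1 <= n)%Z -> exists v u, n = (q ^ Z.of_nat v * u)%Z /\ ~ (q | u)%Z.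
Proof.
  intros Hq. revert n. apply (well_founded_induction_type (Zwf_well_founded 0) (fun n => (1 <= n)%Z -> _)).
  intros n IH Hn. destruct (Zdivide_dec q n) as [[m Hm]|D].
  - assert (M1 : (1 <= m)%Z) by nia.
    destruct (IH m) as (v & u & E & Hu); [unfold Zwf; split; nia|lia|].
    exists (S v), u. split; auto. rewrite Hm, E, Nat2Z.inj_succ, Z.pow_succ_r by lia. ring.
  - exists 0%nat, n. split; auto. change (Z.of_nat 0) with 0%Z. rewrite Z.pow_0_r. ring.
Qed.

(** The range [N] of primes is kept apart from [n], so that an induction on [n] can leave it
    fixed. *)
Definition prime_power_product (g : Z -> Z) (N : nat) (n : Z) : Z :=
  fold_right Z.mul 1%Z (map (fun q => if prime_dec (Z.of_nat q)
     then (g (Z.of_nat q) ^ Z.of_nat (valuation (Z.of_nat q) n))%Z else 1%Z) (seq 2 N)).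

Lemma prime_divisor_exists n : (1 < n)%Z -> exists q, prime q /\ (q | n)%Z.
Proof.
  revert n. apply (well_founded_induction_type (Zwf_well_founded 0) (fun n => (1 < n)%Z -> _)).
  intros n IH Hn. destruct (prime_dec n) as [P|P].
  - exists n. split; auto. apply Z.divide_refl.
  - destruct (not_prime_divide n Hn P) as (d & Hd & Dd). destruct (IH d) as (q & Pq & Dq); [unfold Zwf; lia|lia|].
    exists q. split; auto. now apply Z.divide_trans with d.
Qed.

Lemma valuation_mul_prime q q0 m : prime q -> prime q0 -> (1 <= m)%Z ->
  valuation q (q0 * m) = ((if Z.eq_dec q q0 then 1 else 0) + valuation q m)%nat.
Proof.
  intros Pq P0 Hm. pose proof (prime_ge_2 _ Pq). pose proof (prime_ge_2 _ P0).
  destruct (valuation_exists q m) as (v & u & E & Hu); auto.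
  rewrite (valuation_spec q m v u) by auto. destruct (Z.eq_dec q q0) as [e|n].
  - subst q0. apply valuation_spec with u; auto; [nia|]. simpl plus. rewrite Nat2Z.inj_succ, Z.pow_succ_r by lia. lia.
  - apply valuation_spec with (q0 * u)%Z; auto; [nia| |].
    + simpl. rewrite E. ring.
    + intros D. apply prime_mult in D; auto. destruct D as [D|D]; auto.
      apply prime_div_prime in D; auto.
Qed.

(** Strong induction, splitting off one prime divisor [q0]: every valuation stays the same except
    the one at [q0], so the product gains exactly one factor [g q0]. *)
Lemma prime_power_product_mult (g : Z -> Z) : g 1%Z = 1%Z -> (forall a b, g (a * b)%Z = (g a * g b)%Z) ->
  forall n N, (1 <= n)%Z -> (n <= Z.of_nat N)%Z -> prime_power_product g N n = g n.
Proof.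
  intros g1 gm.
  apply (well_founded_induction_type (Zwf_well_founded 0)
    (fun n => forall N, (1 <= n)%Z -> (n <= Z.of_nat N)%Z -> prime_power_product g N n = g n)).
  intros n IH N Hn HN. destruct (Z.eq_dec n 1) as [->|Hn1].
  - rewrite g1. unfold prime_power_product. generalize (seq 2 N). induction l as [|a l IHl]; auto.
    simpl map. simpl fold_right. rewrite IHl. destruct (prime_dec (Z.of_nat a)) as [P|]; [|lia].
    pose proof (prime_ge_2 _ P). rewrite (valuation_spec (Z.of_nat a) 1 0 1); [simpl; lia|lia|lia|simpl; lia|].
    intros D. apply Z.divide_pos_le in D; lia.
  - destruct (prime_divisor_exists n) as (q0 & P0 & m & Em); [lia|]. pose proof (prime_ge_2 _ P0).
    assert (Hm : (1 <= m)%Z) by nia.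
    replace n with (q0 * m)%Z by lia. rewrite gm, <- (IH m) with (N := N); [|unfold Zwf; split; nia|lia|nia].
    assert (G : forall l, NoDup l -> fold_right Z.mul 1%Z (map (fun q => if prime_dec (Z.of_nat q)
         then (g (Z.of_nat q) ^ Z.of_nat (valuation (Z.of_nat q) (q0 * m)))%Z else 1%Z) l)
       = ((if in_dec Nat.eq_dec (Z.to_nat q0) l then g q0 else 1) * fold_right Z.mul 1%Z (map (fun q => if prime_dec (Z.of_nat q)
         then (g (Z.of_nat q) ^ Z.of_nat (valuation (Z.of_nat q) m))%Z else 1%Z) l))%Z).
    { induction l as [|a l IHl]; intros Nd; [reflexivity|]. inversion_clear Nd.
      simpl map. simpl fold_right. rewrite IHl by auto.
      assert (Ea : (if prime_dec (Z.of_nat a) then (g (Z.of_nat a) ^ Z.of_nat (valuation (Z.of_nat a) (q0 * m)))%Z else 1%Z)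
        = ((if Nat.eq_dec a (Z.to_nat q0) then g q0 else 1) * (if prime_dec (Z.of_nat a) then (g (Z.of_nat a) ^ Z.of_nat (valuation (Z.of_nat a) m))%Z else 1%Z))%Z).
      { destruct (prime_dec (Z.of_nat a)) as [Pa|Pa].
        - rewrite valuation_mul_prime by auto. destruct (Z.eq_dec (Z.of_nat a) q0); destruct (Nat.eq_dec a (Z.to_nat q0)); try (exfalso; lia).
          2: (simpl plus; rewrite Z.mul_1_l; reflexivity).
          rewrite Nat2Z.inj_add, Z.pow_add_r by lia. rewrite e. simpl Z.of_nat. rewrite Z.pow_1_r. reflexivity.
        - destruct (Nat.eq_dec a (Z.to_nat q0)) as [e|]; [|reflexivity]. exfalso. apply Pa. subst a. now rewrite Z2Nat.id by lia. }
      rewrite Ea. destruct (in_dec Nat.eq_dec (Z.to_nat q0) l) as [i|i];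
        destruct (in_dec Nat.eq_dec (Z.to_nat q0) (a :: l)) as [j|j];
        destruct (Nat.eq_dec a (Z.to_nat q0)) as [e|e]; try (subst; contradiction); simpl in j; try (exfalso; tauto); try ring.
    }
    unfold prime_power_product. rewrite G by apply seq_NoDup.
    destruct (in_dec Nat.eq_dec (Z.to_nat q0) (seq 2 N)) as [i|i]; [reflexivity|].
    exfalso. apply i, in_seq. nia.
Qed.

Lemma kronecker_abs a (chi : Z -> Z) n : n <> 0%Z -> chi 1%Z = 1%Z ->
  (forall x y, chi (x * y)%Z = (chi x * chi y)%Z) ->
  (forall q, prime q -> kronecker_prime a q = chi q) ->
  kronecker a n = ((if ((n <? 0)%Z && (a <? 0)%Z)%bool then -1 else 1) * chi (Z.abs n))%Z.
Proof.
  intros Hn c1 cm Hk. unfold kronecker. rewrite (proj2 (Z.eqb_neq n 0) Hn). f_equal.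
  rewrite <- (prime_power_product_mult chi c1 cm (Z.abs n) (Z.abs_nat n)) by lia.
  unfold prime_power_product. f_equal. apply map_ext. intros q.
  destruct (prime_dec (Z.of_nat q)); auto. now rewrite Hk.
Qed.

Lemma kronecker_12 n : kronecker 12 n = chi12 n.
Proof.
  destruct (Z.eq_dec n 0) as [->|Hn]; [reflexivity|].
  rewrite (kronecker_abs 12 chi12) by (auto using chi12_mul, kronecker_prime_12).
  rewrite andb_false_r. destruct (Z_le_dec 0 n).
  - rewrite Z.abs_eq by lia. lia.
  - rewrite Z.abs_neq, chi12_opp by lia. lia.
Qed.

Lemma kronecker_m4 n : kronecker (-4) n = chi4 n.
Proof.
  destruct (Z.eq_dec n 0) as [->|Hn]; [reflexivity|].
  rewrite (kronecker_abs (-4) chi4) by (auto using chi4_mul, kronecker_prime_m4).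
  destruct (Z_le_dec 0 n).
  - rewrite (proj2 (Z.ltb_ge n 0)), Z.abs_eq by lia. simpl andb. cbv iota. lia.
  - rewrite (proj2 (Z.ltb_lt n 0)), Z.abs_neq, chi4_opp by lia. change (-4 <? 0)%Z with true. simpl andb. cbv iota. lia.
Qed.

(** * Theta series and the inversion of the upper half-plane *)

Lemma Ci_sqr : Ci * Ci = - RtoC 1.
Proof. unfold Ci, RtoC, Copp, Cmult; simpl; f_equal; ring. Qed.

Lemma Qpow_plus tau a b : Qpow tau (a + b) = Qpow tau a * Qpow tau b.
Proof. unfold Qpow. rewrite <- Cexp_plus. f_equal. rewrite !RtoC_mult, RtoC_plus. ring. Qed.

Lemma Qpow_0 tau : Qpow tau 0 = 1.
Proof. unfold Qpow. rewrite Rmult_0_r, !Cmult_0_l. apply Cexp_0. Qed.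

Lemma Qpow_nz tau a : Qpow tau a <> 0.
Proof. apply Cexp_nz. Qed.

Lemma Qpow_opp tau a : Qpow tau (- a) = / Qpow tau a.
Proof.
  assert (H : Qpow tau (- a) * Qpow tau a = 1).
  { rewrite <- Qpow_plus. replace (- a + a)%R with 0%R by ring. apply Qpow_0. }
  rewrite <- (Cmult_1_l (/ _)), <- H. field. apply Qpow_nz.
Qed.

Lemma Qpow_INR tau n : Qpow tau (INR n) = Qof tau ^ n.
Proof.
  unfold Qof, Qpow. rewrite Cexp_pow. f_equal. rewrite !RtoC_mult. ring.
Qed.

Lemma Cmod_Qpow tau a : Cmod (Qpow tau a) = exp (- (2 * PI * a * Im tau)).
Proof. unfold Qpow. rewrite Cmod_Cexp. f_equal. destruct tau; simpl. ring. Qed.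

Lemma Qof_lt_1 tau : (0 < Im tau)%R -> (Cmod (Qof tau) < 1)%R.
Proof.
  intros H. unfold Qof. rewrite Cmod_Qpow. apply Rlt_le_trans with (exp 0); [|rewrite exp_0; lra].
  apply exp_increasing. pose proof PI_RGT_0. nra.
Qed.

Lemma gauss_summable y : (0 < y)%R -> summableR (fun n : Z => (1 + Rabs (IZR n)) * exp (- (y * IZR n ^ 2)))%R.
Proof.
  intros Hy. pose proof PI_RGT_0 as HP. set (a := sqrt (y / PI)).
  assert (Ha : (a * a = y / PI)%R) by (apply sqrt_sqrt; apply Rlt_le, Rdiv_lt_0_compat; lra).
  assert (Ha0 : (0 < a)%R) by (apply sqrt_lt_R0, Rdiv_lt_0_compat; lra).
  assert (H2 : (0 < Re (RtoC a) ^ 2 - Im (RtoC a) ^ 2)%R) by (simpl; nra).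
  assert (E : forall n : Z, Cmod (Cexp (- RtoC PI * (RtoC a * RtoC (IZR n) + 0) ^ 2)) = exp (- (y * IZR n ^ 2))).
  { intros n. rewrite Cmod_Cexp. f_equal. simpl.
    replace y with (PI * (a * a))%R by (rewrite Ha; field; lra). ring. }
  destruct (gauss_decay_exists 1 0 (RtoC a) 0 H2) as (K & K0 & _).
  destruct (gauss_decay_exists 0 1 (RtoC a) 0 H2) as (K' & K0' & _).
  apply summableR_le with (fun n : Z => (K' / (1 + IZR n ^ 2) + K / (1 + IZR n ^ 2))%R).
  - intros n. specialize (K0 (IZR n)). specialize (K0' (IZR n)). unfold gaussP in K0, K0'.
    rewrite Cmod_mult, E in K0, K0'.
    replace (1 * RtoC (IZR n) + 0) with (RtoC (IZR n)) in K0 by ring.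
    replace (0 * RtoC (IZR n) + 1) with (RtoC 1) in K0' by ring.
    rewrite Cmod_R in K0. rewrite Cmod_1 in K0'. lra.
  - apply summableR_plus; apply summableR_inv_quad.
Qed.

Lemma Qpow_quad_bound tau a y n : (0 < Im tau)%R -> (y <= 2 * PI * a * Im tau)%R ->
  (Cmod (Qpow tau (IZR n ^ 2 * a)) <= exp (- (y * IZR n ^ 2)))%R.
Proof.
  intros Ht Hy. rewrite Cmod_Qpow.
  assert (H : (- (2 * PI * (IZR n ^ 2 * a) * Im tau) <= - (y * IZR n ^ 2))%R).
  { pose proof (Rmult_le_compat_r (IZR n ^ 2) _ _ (pow2_ge_0 (IZR n)) Hy). lra. }
  destruct H as [H|H]; [left; now apply exp_increasing|right; now rewrite H].
Qed.

Lemma summable_theta_gen (f : Z -> C) tau a : (0 < Im tau)%R -> (0 < a)%R ->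
  (forall n, Cmod (f n) <= 1 + Rabs (IZR n))%R -> summable (fun n : Z => f n * Qpow tau (IZR n ^ 2 * a)).
Proof.
  intros Ht Ha Hf. pose proof PI_RGT_0.
  assert (Hy : (0 < 2 * PI * a * Im tau)%R) by (apply Rmult_lt_0_compat; [apply Rmult_lt_0_compat; lra|lra]).
  apply summable_le with (2 := gauss_summable _ Hy). intros n. rewrite Cmod_mult.
  apply Rmult_le_compat; auto using Cmod_ge_0. apply Qpow_quad_bound; auto. lra.
Qed.

(** * Sums over residue classes *)

Lemma mod_eqb_iff (n x : Z) (p : nat) : (0 < p)%nat ->
  ((n - x) mod Z.of_nat p =? 0)%Z = true <-> exists k, n = (x + k * Z.of_nat p)%Z.
Proof.
  intros Hp. rewrite Z.eqb_eq, Z.mod_divide by lia. split; intros [k Hk]; exists k; lia.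
Qed.

Lemma usum_residues (M : nat) (g : Z -> C) : (0 < M)%nat -> summable g ->
  usum g = lsum (fun s => usum (fun n => if ((n - s) mod Z.of_nat M =? 0)%Z then g n else 0)) (zseq M).
Proof.
  intros HM Hs.
  destruct (usum_lsum (fun s n => if ((n - s) mod Z.of_nat M =? 0)%Z then g n else 0) (zseq M)) as [_ ->].
  - intros s. now apply (summable_restrict (fun n => ((n - s) mod Z.of_nat M =? 0)%Z)).
  - apply usum_ext. intros n. set (r := (n mod Z.of_nat M)%Z).
    pose proof (Z.mod_pos_bound n (Z.of_nat M) ltac:(lia)) as Hr. fold r in Hr.
    rewrite (lsum_ext_in _ (fun s => if Z.eq_dec s r then g n else 0)).
    + assert (K : forall l, NoDup l -> lsum (fun s => if Z.eq_dec s r then g n else 0) l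
        = if in_dec Z.eq_dec r l then g n else 0).
      { induction l as [|a l IH]; intros Nd; [reflexivity|]. inversion_clear Nd.
        rewrite lsum_cons, IH by auto. destruct (Z.eq_dec a r) as [->|Ha].
        - destruct (in_dec Z.eq_dec r l); [contradiction|].
          destruct (in_dec Z.eq_dec r (r :: l)) as [|N]; [ring|]. exfalso; apply N; now left.
        - destruct (in_dec Z.eq_dec r l) as [i|i]; destruct (in_dec Z.eq_dec r (a :: l)) as [j|j];
            simpl in j; try ring; exfalso; tauto. }
      rewrite K by apply NoDup_zseq. destruct (in_dec Z.eq_dec r (zseq M)) as [|N]; auto.
      exfalso. apply N. apply in_zseq. lia.
    + intros s Hs'. apply in_zseq in Hs'. destruct (_ =? 0)%Z eqn:E.
      * apply mod_eqb_iff in E; auto. destruct E as [k Ek].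
        destruct (Z.eq_dec s r) as [|N]; auto. exfalso. apply N. unfold r. rewrite Ek, Z.mod_add by lia.
        symmetry. apply Z.mod_small. lia.
      * destruct (Z.eq_dec s r) as [->|]; auto. exfalso. rewrite <- not_true_iff_false in E. apply E.
        apply mod_eqb_iff; auto. exists (n / Z.of_nat M)%Z. unfold r.
        pose proof (Z.div_mod n (Z.of_nat M) ltac:(lia)). lia.
Qed.

Lemma usum_class (p : nat) (x : Z) (g : Z -> C) : (0 < p)%nat ->
  summable (fun k => g (x + k * Z.of_nat p)%Z) ->
  usum (fun n => if ((n - x) mod Z.of_nat p =? 0)%Z then g n else 0) = usum (fun k => g (x + k * Z.of_nat p)%Z).
Proof.
  intros Hp Hs. set (G := fun n => if ((n - x) mod Z.of_nat p =? 0)%Z then g n else 0).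
  assert (E : forall k, G (x + k * Z.of_nat p)%Z = g (x + k * Z.of_nat p)%Z).
  { intros k. unfold G. now rewrite (proj2 (mod_eqb_iff _ _ _ Hp)) by now exists k. }
  destruct (summable_usum_inj G (fun k => (x + k * Z.of_nat p)%Z)) as [_ ->].
  - intros a b H. nia.
  - intros i Hi. unfold G. destruct (_ =? 0)%Z eqn:Ei; auto. apply mod_eqb_iff in Ei; auto.
    destruct Ei as [k ->]. now destruct (Hi k).
  - now apply summable_ext with (2 := Hs).
  - now apply usum_ext.
Qed.

Definition tauS (tau : C) : C := - / tau.

Lemma Im_pos_nz (tau : C) : (0 < Im tau)%R -> tau <> 0.
Proof. intros H E. rewrite E in H. simpl in H. lra. Qed.

Lemma Im_tauS tau : (0 < Im tau)%R -> (0 < Im (tauS tau))%R.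
Proof.
  intros H. destruct tau as [a b]. unfold tauS. simpl in *.
  assert (0 < a * (a * 1) + b * (b * 1))%R by nra.
  replace (- (- b / (a * (a * 1) + b * (b * 1))))%R with (b / (a * (a * 1) + b * (b * 1)))%R by (field; lra).
  now apply Rdiv_lt_0_compat.
Qed.

Lemma tauS_tauS (tau : C) : tau <> 0 -> tauS (tauS tau) = tau.
Proof. intros H. unfold tauS. field. exact H. Qed.

(** The root of -i tau in the right half-plane, hence the principal one. Inversion factors of weight
    k/2 are written [w ^ k], and [Csqrt] is only needed to exhibit such a [w]. *)
Definition root_of_tau (w tau : C) : Prop := (0 < Re w)%R /\ w ^ 2 = - Ci * tau.

Lemma root_of_tau_nz w tau : root_of_tau w tau -> w <> 0.
Proof. intros [H _]. now apply Re_sqr_pos_nz. Qed.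

Lemma Re_inv_pos (w : C) : (0 < Re w)%R -> (0 < Re (/ w))%R.
Proof.
  intros H. destruct w as [a b]. simpl in *. apply Rdiv_lt_0_compat; nra.
Qed.

(** The parameter that turns the Gaussian of [jacobi] into powers of Q at -1/tau. Its admissibility,
    Re (al^2) > 0, says that -1/tau lies in the upper half-plane. *)
Lemma root_alpha w tau (N : nat) : (0 < N)%nat -> (0 < Im tau)%R -> root_of_tau w tau ->
  let al := RtoC (sqrt (INR N)) / w in
  (0 < Re al)%R /\ (0 < Re al ^ 2 - Im al ^ 2)%R /\ al ^ 2 = RtoC (INR N) * Ci / tau.
Proof.
  intros HN Ht [Hw Ew] al. pose proof (Re_sqr_pos_nz w Hw) as W0. pose proof (Im_pos_nz tau Ht) as T0.
  assert (NP : (0 < INR N)%R) by now apply lt_0_INR.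
  assert (E : al ^ 2 = RtoC (INR N) * Ci / tau).
  { unfold al. replace ((RtoC (sqrt (INR N)) / w) ^ 2) with (RtoC (sqrt (INR N)) ^ 2 / w ^ 2) by (field; auto).
    rewrite Ew, <- RtoC_pow. replace (sqrt (INR N) ^ 2)%R with (INR N) by (rewrite <- Rsqr_pow2, Rsqr_sqrt; lra).
    assert (C0 : Ci <> 0) by apply Ci_nz.
    replace (RtoC (INR N) / (- Ci * tau)) with (RtoC (INR N) * Ci / (- (Ci * Ci) * tau)) by (field; auto).
    rewrite Ci_sqr. field. auto. }
  split; [|split; [|exact E]].
  - unfold al, Cdiv. rewrite re_scal_l. apply Rmult_lt_0_compat; [now apply sqrt_lt_R0|]. now apply Re_inv_pos.
  - replace (Re al ^ 2 - Im al ^ 2)%R with (Re (al ^ 2)) by (destruct al; simpl; ring). rewrite E.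
    pose proof (Im_tauS tau Ht) as P. unfold tauS in P. unfold Cdiv. rewrite <- Cmult_assoc, re_scal_l.
    apply Rmult_lt_0_compat; auto. destruct (/ tau) as [a b]. simpl in *. lra.
Qed.

Lemma Qpow_tauS (tau : C) x (N : nat) : (0 < N)%nat -> tau <> 0 ->
  Qpow (tauS tau) ((INR N * x) ^ 2 / (2 * INR N)) = Cexp (- RtoC (PI * x ^ 2) * (RtoC (INR N) * Ci / tau)).
Proof.
  intros HN T0. assert (NP : (0 < INR N)%R) by now apply lt_0_INR.
  unfold Qpow, tauS. f_equal.
  replace (2 * PI * ((INR N * x) ^ 2 / (2 * INR N)))%R with (PI * x ^ 2 * INR N)%R by (field; lra).
  rewrite (RtoC_mult _ (INR N)). field. auto.
Qed.

(** Splitting [s] modulo [M], where [chi] is constant, leaves sums over progressions of step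
    [M * p], to which the Jacobi identity [HJ] applies; summing the resulting characters over the
    classes gives the Gauss sum, that is [gam] times [chi m]. The weights [g], [g'] and the factor
    [e] let the even and odd identities share this argument. *)
Lemma gauss_theta_aux (M p : nat) (c : Z) (chi : Z -> Z) (gam : C) w tau :
  (0 < M)%nat -> (0 < p)%nat -> (0 < Im tau)%R -> root_of_tau w tau ->
  (forall n k, chi (n + k * Z.of_nat M)%Z = chi n) -> (forall n, (Z.abs (chi n) <= 1)%Z) ->
  (forall m, lsum (fun s => RtoC (IZR (chi s)) * ex (IZR m * (IZR s / INR M))) (zseq M) = gam * RtoC (IZR (chi m))) ->
  forall (g g' : Z -> C) (e : C),
  (forall n, Cmod (g n) <= 1 + Rabs (IZR n))%R ->
  (forall r : Z, let b := (IZR r / INR (M * p))%R in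
    usum (fun k => g (r + k * Z.of_nat (M * p))%Z * Qpow (tauS tau) (IZR (r + k * Z.of_nat (M * p)) ^ 2 * (/ (2 * INR (M * p)))))
    = usum (fun m => e * g' m * Qpow tau (IZR m ^ 2 * (/ (2 * INR (M * p)))) * ex (IZR m * b))) ->
  (forall n, Cmod (g' n) <= 1 + Rabs (IZR n))%R ->
  usum (fun s => RtoC (IZR (chi s)) * (g (c + s * Z.of_nat p)%Z * Qpow (tauS tau) (IZR (c + s * Z.of_nat p) ^ 2 * (/ (2 * INR (M * p))))))
  = e * gam * usum (fun m => RtoC (IZR (chi m)) * ex (IZR m * (IZR c / INR (M * p))) * (g' m * Qpow tau (IZR m ^ 2 * (/ (2 * INR (M * p)))))).
Proof.
  intros HM Hp Ht Hw Hper Hchi Hg g g' e Bg HJ Bg'.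
  assert (NP : (0 < INR (M * p))%R) by (apply lt_0_INR; nia).
  set (a := (/ (2 * INR (M * p)))%R). assert (Ha : (0 < a)%R) by (apply Rinv_0_lt_compat; lra).
  pose proof (Im_tauS tau Ht) as Ht'.
  assert (Bc : forall n, (Cmod (RtoC (IZR (chi n))) <= 1)%R).
  { intros n. rewrite Cmod_R, <- abs_IZR. apply (IZR_le _ 1). auto. }
  assert (S1 : summable (fun n : Z => g n * Qpow (tauS tau) (IZR n ^ 2 * a))) by now apply summable_theta_gen.
  assert (S2 : summable (fun n : Z => g' n * Qpow tau (IZR n ^ 2 * a))) by now apply summable_theta_gen.
  assert (Bmul : forall (I : Type) (f h : I -> C), (forall i, Cmod (h i) <= 1)%R -> summable f -> summable (fun i => h i * f i)).
  { intros I f h Hh Hf. apply summableR_le with (2 := Hf). intros i. rewrite Cmod_mult.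
    pose proof (Cmod_ge_0 (f i)). specialize (Hh i). nra. }
  assert (S3 : summable (fun s => g (c + s * Z.of_nat p)%Z * Qpow (tauS tau) (IZR (c + s * Z.of_nat p) ^ 2 * a))).
  { apply (summable_inj (fun n : Z => g n * Qpow (tauS tau) (IZR n ^ 2 * a)) (fun s => (c + s * Z.of_nat p)%Z)); auto.
    intros x y E. nia. }
  rewrite (usum_residues M) by auto.
  rewrite (lsum_ext_in _ (fun s => usum (fun m => RtoC (IZR (chi s)) * ex (IZR m * (IZR s / INR M)) *
    (e * (ex (IZR m * (IZR c / INR (M * p))) * (g' m * Qpow tau (IZR m ^ 2 * a))))))).
  - destruct (usum_lsum (fun s m => RtoC (IZR (chi s)) * ex (IZR m * (IZR s / INR M)) *
    (e * (ex (IZR m * (IZR c / INR (M * p))) * (g' m * Qpow tau (IZR m ^ 2 * a))))) (zseq M)) as [_ ->].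
    + intros s. apply Bmul.
      * intros m. rewrite Cmod_mult, Cmod_ex, Rmult_1_r. auto.
      * apply summable_scal. apply Bmul; auto. intros m. rewrite Cmod_ex. lra.
    + rewrite <- usum_scal.
      * apply usum_ext. intros m.
        rewrite (lsum_ext_in _ (fun s => (e * (ex (IZR m * (IZR c / INR (M * p))) * (g' m * Qpow tau (IZR m ^ 2 * a)))) *
          (RtoC (IZR (chi s)) * ex (IZR m * (IZR s / INR M))))) by (intros; ring).
        rewrite lsum_scal, Hg. ring.
      * apply Bmul; auto. intros m. rewrite Cmod_mult, Cmod_ex, Rmult_1_r. auto.
  - intros s _.
    rewrite (usum_class M s (fun n => RtoC (IZR (chi n)) * (g (c + n * Z.of_nat p)%Z * Qpow (tauS tau) (IZR (c + n * Z.of_nat p) ^ 2 * a)))).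
    + rewrite (usum_ext _ (fun k => RtoC (IZR (chi s)) * (g ((c + s * Z.of_nat p) + k * Z.of_nat (M * p))%Z
        * Qpow (tauS tau) (IZR ((c + s * Z.of_nat p) + k * Z.of_nat (M * p)) ^ 2 * a)))).
      * rewrite usum_scal.
        -- unfold a at 1. rewrite HJ. fold a. rewrite <- usum_scal.
           ++ apply usum_ext. intros m.
              replace (IZR m * (IZR (c + s * Z.of_nat p) / INR (M * p)))%R with
                (IZR m * (IZR s / INR M) + IZR m * (IZR c / INR (M * p)))%R.
              ** rewrite ex_plus. ring.
              ** rewrite plus_IZR, mult_IZR, <- INR_IZR_INZ, mult_INR. field.
                 split; apply Rgt_not_eq, lt_0_INR; lia.
           ++ apply summable_ext with (fun m => ex (IZR m * (IZR (c + s * Z.of_nat p) / INR (M * p))) * (e * (g' m * Qpow tau (IZR m ^ 2 * a)))).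
              ** intros m. ring.
              ** apply Bmul; [intros m; rewrite Cmod_ex; lra|]. now apply summable_scal.
        -- apply (summable_inj (fun n : Z => g n * Qpow (tauS tau) (IZR n ^ 2 * a))
             (fun k => ((c + s * Z.of_nat p) + k * Z.of_nat (M * p))%Z)); auto. intros x y E.
           apply (Z.mul_reg_r _ _ (Z.of_nat (M * p))); nia.
      * intros k. rewrite Hper. replace (c + (s + k * Z.of_nat M) * Z.of_nat p)%Z with
          ((c + s * Z.of_nat p) + k * Z.of_nat (M * p))%Z by (rewrite Nat2Z.inj_mul; ring). reflexivity.
    + exact HM.
    + refine (summable_inj (fun n : Z => RtoC (IZR (chi n)) * (g (c + n * Z.of_nat p)%Z * Qpow (tauS tau) (IZR (c + n * Z.of_nat p) ^ 2 * a)))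
        (fun k => (s + k * Z.of_nat M)%Z) _ _).
      * intros x y E. nia.
      * exact (Bmul Z _ (fun n => RtoC (IZR (chi n))) Bc S3).
Qed.

Lemma gauss_theta_even (M p : nat) (c : Z) (chi : Z -> Z) (gam : C) w tau :
  (0 < M)%nat -> (0 < p)%nat -> (0 < Im tau)%R -> root_of_tau w tau ->
  (forall n k, chi (n + k * Z.of_nat M)%Z = chi n) -> (forall n, (Z.abs (chi n) <= 1)%Z) ->
  (forall m, lsum (fun s => RtoC (IZR (chi s)) * ex (IZR m * (IZR s / INR M))) (zseq M) = gam * RtoC (IZR (chi m))) ->
  usum (fun s => RtoC (IZR (chi s)) * Qpow (tauS tau) (IZR (c + s * Z.of_nat p) ^ 2 * (/ (2 * INR (M * p)))))
  = w / RtoC (sqrt (INR (M * p))) * gam * usum (fun m => RtoC (IZR (chi m)) * ex (IZR m * (IZR c / INR (M * p))) * Qpow tau (IZR m ^ 2 * (/ (2 * INR (M * p))))).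
Proof.
  intros HM Hp Ht Hw Hper Hchi Hg.
  assert (NP : (0 < INR (M * p))%R) by (apply lt_0_INR; nia).
  assert (B1 : forall n : Z, (Cmod 1 <= 1 + Rabs (IZR n))%R).
  { intros n. rewrite Cmod_1. pose proof (Rabs_pos (IZR n)). lra. }
  pose proof (gauss_theta_aux M p c chi gam w tau HM Hp Ht Hw Hper Hchi Hg (fun _ => RtoC 1) (fun _ => RtoC 1)
    (w / RtoC (sqrt (INR (M * p)))) B1) as H.
  rewrite (usum_ext _ (fun s => RtoC (IZR (chi s)) * (1 * Qpow (tauS tau) (IZR (c + s * Z.of_nat p) ^ 2 * (/ (2 * INR (M * p)))))))
    by (intros; ring).
  rewrite H; auto.
  - f_equal. apply usum_ext. intros m. ring.
  - intros r b. destruct (root_alpha w tau (M * p) ltac:(nia) Ht Hw) as (A1 & A2 & A3).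
    pose proof (Im_pos_nz tau Ht) as T0. pose proof (root_of_tau_nz _ _ Hw) as W0.
    set (al := RtoC (sqrt (INR (M * p))) / w) in *.
    assert (A0 : al <> 0) by now apply Re_sqr_pos_nz.
    assert (SN : RtoC (sqrt (INR (M * p))) <> 0).
    { intros E. apply RtoC_inj in E. pose proof (sqrt_lt_R0 _ NP). lra. }
    destruct (jacobi al (M * p) r ltac:(nia) A1 A2) as [_ J]. cbv zeta in J. fold b in J.
    rewrite A3 in J.
    transitivity (usum (fun n : Z => Cexp (- RtoC (PI * (IZR n + b) ^ 2) * (RtoC (INR (M * p)) * Ci / tau)))).
    + apply usum_ext. intros k. rewrite Cmult_1_l, <- (Qpow_tauS tau) by (auto; nia). f_equal.
      rewrite plus_IZR, mult_IZR, <- INR_IZR_INZ. unfold b. field. lra.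
    + rewrite J. apply usum_ext. intros m. rewrite Cmult_1_r.
      replace (Cexp (- RtoC (PI * IZR m ^ 2) / (RtoC (INR (M * p)) * Ci / tau))) with (Qpow tau (IZR m ^ 2 * / (2 * INR (M * p)))).
      * unfold al. field. auto.
      * unfold Qpow. f_equal. replace (2 * PI * (IZR m ^ 2 * / (2 * INR (M * p))))%R with (PI * IZR m ^ 2 / INR (M * p))%R by (field; lra).
        rewrite RtoC_div by lra. assert (N0 : RtoC (INR (M * p)) <> 0) by (intros E; apply RtoC_inj in E; lra).
        assert (C0 : Ci <> 0) by apply Ci_nz.
        transitivity (RtoC (PI * IZR m ^ 2) * (Ci * Ci) * tau / (RtoC (INR (M * p)) * Ci)); [field; auto|].
        rewrite Ci_sqr. field. auto.
Qed.

Lemma gauss_theta_odd (M p : nat) (c : Z) (chi : Z -> Z) (gam : C) w tau :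
  (0 < M)%nat -> (0 < p)%nat -> (0 < Im tau)%R -> root_of_tau w tau ->
  (forall n k, chi (n + k * Z.of_nat M)%Z = chi n) -> (forall n, (Z.abs (chi n) <= 1)%Z) ->
  (forall m, lsum (fun s => RtoC (IZR (chi s)) * ex (IZR m * (IZR s / INR M))) (zseq M) = gam * RtoC (IZR (chi m))) ->
  usum (fun s => RtoC (IZR (chi s)) * (RtoC (IZR (c + s * Z.of_nat p)) * Qpow (tauS tau) (IZR (c + s * Z.of_nat p) ^ 2 * (/ (2 * INR (M * p))))))
  = - Ci * w ^ 3 / RtoC (sqrt (INR (M * p))) * gam * usum (fun m => RtoC (IZR (chi m)) * ex (IZR m * (IZR c / INR (M * p))) * (RtoC (IZR m) * Qpow tau (IZR m ^ 2 * (/ (2 * INR (M * p)))))).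
Proof.
  intros HM Hp Ht Hw Hper Hchi Hg.
  assert (NP : (0 < INR (M * p))%R) by (apply lt_0_INR; nia).
  assert (B1 : forall n : Z, (Cmod (RtoC (IZR n)) <= 1 + Rabs (IZR n))%R).
  { intros n. rewrite Cmod_R. lra. }
  apply (gauss_theta_aux M p c chi gam w tau HM Hp Ht Hw Hper Hchi Hg (fun n => RtoC (IZR n)) (fun n => RtoC (IZR n))); auto.
  intros r b. destruct (root_alpha w tau (M * p) ltac:(nia) Ht Hw) as (A1 & A2 & A3).
  pose proof (Im_pos_nz tau Ht) as T0. pose proof (root_of_tau_nz _ _ Hw) as W0.
  set (al := RtoC (sqrt (INR (M * p))) / w) in *.
  assert (A0 : al <> 0) by now apply Re_sqr_pos_nz.
  assert (SN : RtoC (sqrt (INR (M * p))) <> 0).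
  { intros E. apply RtoC_inj in E. pose proof (sqrt_lt_R0 _ NP). lra. }
  assert (N0 : RtoC (INR (M * p)) <> 0) by (intros E; apply RtoC_inj in E; lra).
  assert (C0 : Ci <> 0) by apply Ci_nz.
  destruct (jacobi_odd al (M * p) r ltac:(nia) A1 A2) as [JS J]. cbv zeta in J, JS. fold b in J, JS.
  rewrite A3 in J, JS.
  transitivity (usum (fun n : Z => RtoC (INR (M * p)) * (RtoC (IZR n + b) * Cexp (- RtoC (PI * (IZR n + b) ^ 2) * (RtoC (INR (M * p)) * Ci / tau))))).
  - apply usum_ext. intros k. rewrite <- (Qpow_tauS tau) by (auto; nia).
    rewrite Cmult_assoc, <- RtoC_mult. rewrite plus_IZR, mult_IZR, <- INR_IZR_INZ.
    f_equal; [f_equal; unfold b; field; lra|]. f_equal. unfold b. field. lra.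
  - rewrite usum_scal.
    + rewrite J, <- usum_scal by exact JS. apply usum_ext. intros m.
      replace (Cexp (- RtoC (PI * IZR m ^ 2) / (RtoC (INR (M * p)) * Ci / tau))) with (Qpow tau (IZR m ^ 2 * / (2 * INR (M * p)))).
      * replace (RtoC (INR (M * p))) with (RtoC (sqrt (INR (M * p))) ^ 2) by (rewrite <- RtoC_pow; f_equal; rewrite <- Rsqr_pow2, Rsqr_sqrt; lra).
        unfold al. field. auto.
      * unfold Qpow. f_equal. replace (2 * PI * (IZR m ^ 2 * / (2 * INR (M * p))))%R with (PI * IZR m ^ 2 / INR (M * p))%R by (field; lra).
        rewrite RtoC_div by lra.
        transitivity (RtoC (PI * IZR m ^ 2) * (Ci * Ci) * tau / (RtoC (INR (M * p)) * Ci)); [field; auto|].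
        rewrite Ci_sqr. field. auto.
    + assert (S0 : summable (fun n : Z => RtoC (IZR n) * Qpow (tauS tau) (IZR n ^ 2 * / (2 * INR (M * p))))).
      { apply summable_theta_gen; auto; [now apply Im_tauS|apply Rinv_0_lt_compat; lra]. }
      apply (summable_inj _ (fun k => (r + k * Z.of_nat (M * p))%Z)) in S0; [|intros x y E; apply (Z.mul_reg_r _ _ (Z.of_nat (M * p))); nia].
      apply (summable_scal (/ RtoC (INR (M * p)))) in S0.
      apply summable_ext with (2 := S0). intros k. rewrite <- (Qpow_tauS tau) by (auto; nia).
      replace (INR (M * p) * (IZR k + b))%R with (IZR (r + k * Z.of_nat (M * p))).
      * replace (IZR k + b)%R with (/ INR (M * p) * IZR (r + k * Z.of_nat (M * p)))%R.
        -- rewrite RtoC_mult, RtoC_inv by lra. ring_simplify. reflexivity.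
        -- rewrite plus_IZR, mult_IZR, <- INR_IZR_INZ. unfold b. field. lra.
      * rewrite plus_IZR, mult_IZR, <- INR_IZR_INZ. unfold b. field. lra.
Qed.

(** * Gauss sums modulo 12 and 4 *)

(** The twelfth roots of unity in closed form, so that both Gauss sums reduce to a finite
    computation with [sqrt 3]; fourth roots of unity are the entries at multiples of 3. *)
Definition root12 (k : Z) : C :=
  let s := sqrt 3 in
  nth (Z.to_nat k)
   ((1, 0) :: (s / 2, 1 / 2) :: (1 / 2, s / 2) :: (0, 1) :: (- (1 / 2), s / 2) :: (- (s / 2), 1 / 2) ::
    (- 1, 0) :: (- (s / 2), - (1 / 2)) :: (- (1 / 2), - (s / 2)) :: (0, - 1) :: (1 / 2, - (s / 2)) ::
    (s / 2, - (1 / 2)) :: nil)%R (RtoC 0).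

Lemma ex_12 (k : Z) : ex (IZR k / 12) = root12 (k mod 12).
Proof.
  assert (S3 : (sqrt 3 * sqrt 3 = 3)%R) by (apply sqrt_sqrt; lra).
  assert (Z1 : ex (1 / 12) = (sqrt 3 / 2, 1 / 2)%R).
  { rewrite ex_cos_sin. replace (2 * PI * (1 / 12))%R with (PI / 6)%R by field. now rewrite cos_PI6, sin_PI6. }
  assert (P : forall n, (n < 12)%nat -> ex (INR n / 12) = root12 (Z.of_nat n)).
  { induction n as [|n IH]; intros Hn.
    - simpl. unfold Rdiv. rewrite Rmult_0_l. apply ex_0.
    - rewrite S_INR. replace ((INR n + 1) / 12)%R with (INR n / 12 + 1 / 12)%R by field.
      rewrite ex_plus, IH, Z1 by lia.
      do 11 (destruct n as [|n]; [unfold root12; simpl; unfold RtoC, Cmult; simpl; f_equal; nra|]). lia. }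
  pose proof (Z.div_mod k 12 ltac:(lia)) as E. pose proof (Z.mod_pos_bound k 12 ltac:(lia)) as B.
  rewrite E at 1. rewrite plus_IZR, mult_IZR.
  replace ((12 * IZR (k / 12) + IZR (k mod 12)) / 12)%R with (IZR (k / 12) + IZR (k mod 12) / 12)%R by field.
  rewrite ex_plus, ex_Z, Cmult_1_l.
  rewrite <- (Z2Nat.id (k mod 12)) by lia. rewrite <- INR_IZR_INZ. apply P. lia.
Qed.

Lemma sqrt_12 : sqrt 12 = (2 * sqrt 3)%R.
Proof.
  replace 12%R with (2 * 2 * 3)%R by ring. rewrite sqrt_mult_alt by lra. f_equal. apply sqrt_square. lra.
Qed.

Lemma mod12_cases (P : Z -> Prop) : P 0%Z -> P 1%Z -> P 2%Z -> P 3%Z -> P 4%Z -> P 5%Z -> P 6%Z ->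
  P 7%Z -> P 8%Z -> P 9%Z -> P 10%Z -> P 11%Z -> forall m, (0 <= m < 12)%Z -> P m.
Proof.
  intros ? ? ? ? ? ? ? ? ? ? ? ? m Hm.
  assert (m = 0 \/ m = 1 \/ m = 2 \/ m = 3 \/ m = 4 \/ m = 5 \/ m = 6 \/ m = 7 \/ m = 8 \/ m = 9 \/ m = 10 \/ m = 11)%Z as D by lia.
  repeat destruct D as [->|D]; auto; subst; auto.
Qed.

Lemma gauss_sum_12 m :
  lsum (fun s => RtoC (IZR (chi12 s)) * ex (IZR m * (IZR s / INR 12))) (zseq 12)
  = RtoC (sqrt 12) * RtoC (IZR (chi12 m)).
Proof.
  rewrite (lsum_ext_in _ (fun s => RtoC (IZR (chi12 s)) * root12 (((m mod 12) * s) mod 12))).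
  - rewrite <- (chi12_mod m). rewrite sqrt_12.
    pose proof (Z.mod_pos_bound m 12 ltac:(lia)) as B. revert B. generalize (m mod 12)%Z. clear m.
    apply mod12_cases; unfold zseq; simpl map; unfold lsum; simpl fold_right;
      unfold chi12, root12; simpl; unfold RtoC, Cmult, Cplus; simpl; f_equal; lra.
  - intros s _. f_equal. rewrite Zmult_mod_idemp_l, <- ex_12. f_equal. rewrite mult_IZR.
    replace (INR 12) with 12%R by (simpl; lra). unfold Rdiv. ring.
Qed.

Lemma gauss_sum_4 m :
  lsum (fun s => RtoC (IZR (chi4 s)) * ex (IZR m * (IZR s / INR 4))) (zseq 4)
  = (RtoC 2 * Ci) * RtoC (IZR (chi4 m)).
Proof.
  rewrite (lsum_ext_in _ (fun s => RtoC (IZR (chi4 s)) * root12 (((m mod 12) * (3 * s)) mod 12))).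
  - assert (M4 : (m mod 4 = (m mod 12) mod 4)%Z) by (apply (Zmod_div_mod 4 12); [lia|lia|now exists 3%Z]).
    rewrite <- (chi4_mod m), M4.
    pose proof (Z.mod_pos_bound m 12 ltac:(lia)) as B. revert B. generalize (m mod 12)%Z. clear m M4.
    apply mod12_cases; unfold zseq; simpl map; unfold lsum; simpl fold_right;
      unfold chi4, root12; simpl; unfold Ci, RtoC, Cmult, Cplus; simpl; f_equal; lra.
  - intros s _. f_equal. rewrite Zmult_mod_idemp_l, <- ex_12. f_equal. rewrite !mult_IZR.
    replace (INR 4) with 4%R by (simpl; lra). field.
Qed.

Lemma RtoC_nz (x : R) : x <> 0%R -> RtoC x <> 0.
Proof. intros H E. now apply RtoC_inj in E. Qed.

(** * Inversion formulas for theta series in residue classes *)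

Definition class_theta (M p : nat) (chi : Z -> Z) (g : Z -> C) (x : Z) (tau : C) : C :=
  usum (fun n => if ((n - x) mod Z.of_nat p =? 0)%Z
     then RtoC (IZR (chi n)) * (g n * Qpow tau (IZR n ^ 2 * (/ (2 * INR (M * p))))) else 0).

Lemma class_theta_summable M p chi g tau : (0 < M)%nat -> (0 < p)%nat -> (0 < Im tau)%R ->
  (forall n, (Z.abs (chi n) <= 1)%Z) -> (forall n, Cmod (g n) <= 1 + Rabs (IZR n))%R ->
  summable (fun n => RtoC (IZR (chi n)) * (g n * Qpow tau (IZR n ^ 2 * (/ (2 * INR (M * p)))))).
Proof.
  intros HM Hp Ht Hc Hg. apply summable_ext with (fun n => (RtoC (IZR (chi n)) * g n) * Qpow tau (IZR n ^ 2 * (/ (2 * INR (M * p))))).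
  - intros n. ring.
  - apply summable_theta_gen; auto.
    + apply Rinv_0_lt_compat. assert (0 < INR (M * p))%R by (apply lt_0_INR; nia). lra.
    + intros n. rewrite Cmod_mult, Cmod_R, <- abs_IZR. specialize (Hc n). apply IZR_le in Hc.
      pose proof (Cmod_ge_0 (g n)). specialize (Hg n).
      assert (0 <= IZR (Z.abs (chi n)))%R by (apply (IZR_le 0); lia). nra.
Qed.

Lemma class_theta_mod M p chi g x y tau : (0 < p)%nat -> (x mod Z.of_nat p = y mod Z.of_nat p)%Z ->
  class_theta M p chi g x tau = class_theta M p chi g y tau.
Proof.
  intros Hp E. apply usum_ext. intros n.
  rewrite (Zminus_mod n x), (Zminus_mod n y), E. reflexivity.
Qed.

Lemma class_theta_opp M p chi g x tau : (0 < M)%nat -> (0 < p)%nat -> (0 < Im tau)%R ->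
  (forall n, (Z.abs (chi n) <= 1)%Z) -> (forall n, Cmod (g n) <= 1 + Rabs (IZR n))%R ->
  (forall n, RtoC (IZR (chi (- n)%Z)) * g (- n)%Z = - (RtoC (IZR (chi n)) * g n)) ->
  class_theta M p chi g (- x) tau = - class_theta M p chi g x tau.
Proof.
  intros HM Hp Ht Hc Hg Ho. unfold class_theta.
  pose proof (class_theta_summable M p chi g tau HM Hp Ht Hc Hg) as S.
  rewrite <- usum_opp.
  - rewrite (usum_bij _ Z.opp Z.opp) by (intros; try lia;
      now apply (summable_restrict (fun n => ((n - - x) mod Z.of_nat p =? 0)%Z))).
    apply usum_ext. intros n.
    assert (E : ((- n - - x) mod Z.of_nat p =? 0)%Z = ((n - x) mod Z.of_nat p =? 0)%Z).
    { apply eq_true_iff_eq. rewrite !mod_eqb_iff by auto. split; intros [k Hk]; exists (- k)%Z; lia. }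
    rewrite E. clear E. destruct ((n - x) mod Z.of_nat p =? 0)%Z; [|ring].
    rewrite Cmult_assoc, Ho. rewrite opp_IZR. replace ((- IZR n) ^ 2)%R with (IZR n ^ 2)%R by ring. ring.
  - now apply (summable_restrict (fun n => ((n - x) mod Z.of_nat p =? 0)%Z)).
Qed.

(** As [M a] is 1 modulo [p], the class of [x] modulo [p] contains the multiple [c = M a x] of [M].
    On c + s p the character is chi (p) chi (s), so the class sum becomes the twisted sum of [HS].
    On the dual side e(m c/(M p)) = e(a x m/p) depends on [m] modulo [p] only, and regrouping by
    classes gives the finite Fourier transform. *)
Lemma class_theta_S (M p : nat) (chi : Z -> Z) (g : Z -> C) (gam e : C) (a x : Z) tau :
  (0 < M)%nat -> (0 < p)%nat -> (0 < Im tau)%R ->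
  (forall n, (Z.abs (chi n) <= 1)%Z) -> (forall n, Cmod (g n) <= 1 + Rabs (IZR n))%R ->
  (forall n k, chi (n + k * Z.of_nat M)%Z = chi n) -> (forall m n, chi (m * n)%Z = (chi m * chi n)%Z) ->
  (forall c, usum (fun s => RtoC (IZR (chi s)) * (g (c + s * Z.of_nat p)%Z * Qpow (tauS tau) (IZR (c + s * Z.of_nat p) ^ 2 * (/ (2 * INR (M * p))))))
  = e * gam * usum (fun m => RtoC (IZR (chi m)) * ex (IZR m * (IZR c / INR (M * p))) * (g m * Qpow tau (IZR m ^ 2 * (/ (2 * INR (M * p))))))) ->
  (exists k, Z.of_nat M * a = 1 + k * Z.of_nat p)%Z ->
  class_theta M p chi g x (tauS tau) = e * gam * RtoC (IZR (chi (Z.of_nat p)))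
    * lsum (fun y => ex (IZR (a * x) * (IZR y / INR p)) * class_theta M p chi g y tau) (zseq p).
Proof.
  intros HM Hp Ht Hc Hg Hper Hmul HS [ka Hka].
  assert (PP : (0 < INR p)%R) by now apply lt_0_INR. assert (MP : (0 < INR M)%R) by now apply lt_0_INR.
  pose proof (class_theta_summable M p chi g tau HM Hp Ht Hc Hg) as S0.
  pose proof (class_theta_summable M p chi g (tauS tau) HM Hp (Im_tauS _ Ht) Hc Hg) as S1.
  set (c := (Z.of_nat M * a * x)%Z).
  rewrite (class_theta_mod M p chi g x c) by (auto; unfold c; rewrite Hka;
    replace ((1 + ka * Z.of_nat p) * x)%Z with (x + ka * x * Z.of_nat p)%Z by ring; now rewrite Z.mod_add by lia).
  unfold class_theta at 1.
  rewrite (usum_class p c (fun n => RtoC (IZR (chi n)) * (g n * Qpow (tauS tau) (IZR n ^ 2 * (/ (2 * INR (M * p)))))) Hp).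
  2:{ refine (summable_inj _ (fun k => (c + k * Z.of_nat p)%Z) _ S1). intros u v E. nia. }
  rewrite (usum_ext _ (fun s => RtoC (IZR (chi (Z.of_nat p))) * (RtoC (IZR (chi s)) *
     (g (c + s * Z.of_nat p)%Z * Qpow (tauS tau) (IZR (c + s * Z.of_nat p) ^ 2 * (/ (2 * INR (M * p)))))))).
  2:{ intros s. replace (chi (c + s * Z.of_nat p)%Z) with (chi (Z.of_nat p) * chi s)%Z.
      - rewrite mult_IZR, RtoC_mult. ring.
      - rewrite <- Hmul. unfold c. replace (Z.of_nat M * a * x + s * Z.of_nat p)%Z with (Z.of_nat p * s + (a * x) * Z.of_nat M)%Z by ring.
        now rewrite Hper. }
  rewrite usum_scal.
  - rewrite HS, (usum_residues p); auto.
    + rewrite (lsum_ext_in _ (fun y => ex (IZR (a * x) * (IZR y / INR p)) * class_theta M p chi g y tau)); [ring|].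
      intros y _. unfold class_theta. rewrite <- usum_scal.
      * apply usum_ext. intros m. destruct (_ =? 0)%Z eqn:E; [|ring].
        apply mod_eqb_iff in E; auto. destruct E as [k ->].
        replace (IZR (y + k * Z.of_nat p) * (IZR c / INR (M * p)))%R with (IZR (a * x) * (IZR y / INR p) + IZR (k * (a * x)))%R.
        -- rewrite ex_plus, ex_Z. ring.
        -- unfold c. rewrite plus_IZR, !mult_IZR, <- !INR_IZR_INZ, mult_INR. field. lra.
      * now apply (summable_restrict (fun n => ((n - y) mod Z.of_nat p =? 0)%Z)).
    + apply summable_ext with (fun m => ex (IZR m * (IZR c / INR (M * p))) * (RtoC (IZR (chi m)) * (g m * Qpow tau (IZR m ^ 2 * (/ (2 * INR (M * p))))))).
      * intros; ring.
      * apply summableR_le with (2 := S0). intros m. rewrite Cmod_mult, Cmod_ex, Rmult_1_l. apply Rle_refl.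
  - assert (S2 : summable (fun s => g (c + s * Z.of_nat p)%Z * Qpow (tauS tau) (IZR (c + s * Z.of_nat p) ^ 2 * (/ (2 * INR (M * p)))))).
    { assert (S3 : summable (fun n => g n * Qpow (tauS tau) (IZR n ^ 2 * (/ (2 * INR (M * p)))))).
      { apply summable_theta_gen; auto; [now apply Im_tauS|]. apply Rinv_0_lt_compat.
        assert (0 < INR (M * p))%R by (apply lt_0_INR; nia). lra. }
      refine (summable_inj _ (fun k => (c + k * Z.of_nat p)%Z) _ S3). intros u v E. nia. }
    apply summableR_le with (2 := S2). intros s. rewrite Cmod_mult, Cmod_R, <- abs_IZR.
    specialize (Hc s). apply IZR_le in Hc. set (z := g _ * _). pose proof (Cmod_ge_0 z). nra.
Qed.

Lemma zseq_half (p : nat) : (p mod 2 = 1)%nat ->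
  Permutation (zseq p) (0%Z :: map Z.of_nat (seq 1 (ell p)) ++ map (fun k => (Z.of_nat p - Z.of_nat k)%Z) (seq 1 (ell p))).
Proof.
  intros Ho. assert (El : (p = 2 * ell p + 1)%nat).
  { unfold ell. pose proof (Nat.div_mod p 2 ltac:(lia)). rewrite Ho in H.
    replace (p - 1)%nat with (p / 2 * 2)%nat by lia. rewrite Nat.div_mul by lia. lia. }
  apply NoDup_Permutation; [apply NoDup_zseq| |].
  - constructor.
    + rewrite in_app_iff, !in_map_iff. intros [(k & E & Hk)|(k & E & Hk)]; apply in_seq in Hk; lia.
    + apply NoDup_app; try (apply FinFun.Injective_map_NoDup; [intros a b; lia|apply seq_NoDup]).
      intros a Ha Hb. apply in_map_iff in Ha, Hb. destruct Ha as (k & E & Hk), Hb as (k' & E' & Hk').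
      apply in_seq in Hk, Hk'. lia.
  - intros a. rewrite in_zseq. simpl. rewrite in_app_iff, !in_map_iff. split.
    + intros Ha. destruct (Z.eq_dec a 0) as [->|]; [now left|right].
      destruct (Z_le_dec a (Z.of_nat (ell p))).
      * left. exists (Z.to_nat a). rewrite in_seq. lia.
      * right. exists (Z.to_nat (Z.of_nat p - a)). rewrite in_seq. lia.
    + intros [<-|[(k & <- & Hk)|(k & <- & Hk)]]; try apply in_seq in Hk; lia.
Qed.

Lemma zseq_mul_perm (p : nat) (v : Z) : (0 < p)%nat -> rel_prime v (Z.of_nat p) ->
  Permutation (map (fun k => ((v * k) mod Z.of_nat p)%Z) (zseq p)) (zseq p).
Proof.
  intros Hp Hv. apply NoDup_Permutation_bis.
  - apply NoDup_map_NoDup_ForallPairs; [|apply NoDup_zseq].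
    intros a b Ha Hb E. apply in_zseq in Ha, Hb.
    assert (D : (Z.of_nat p | v * (a - b))%Z).
    { replace (v * (a - b))%Z with (v * a - v * b)%Z by ring. apply Z.mod_divide; [lia|].
      rewrite Zminus_mod, E, Z.sub_diag. apply Z.mod_0_l. lia. }
    apply Gauss in D; [|now apply rel_prime_sym]. destruct D as [k Hk].
    assert (k = 0)%Z by nia. lia.
  - rewrite length_map. lia.
  - intros y Hy. apply in_map_iff in Hy. destruct Hy as (k & <- & _). apply in_zseq.
    apply Z.mod_pos_bound. lia.
Qed.

Lemma ex_minus_ex (x : R) : ex x - ex (- x) = RtoC 2 * Ci * RtoC (sin (2 * PI * x)).
Proof.
  rewrite !ex_cos_sin. replace (2 * PI * - x)%R with (- (2 * PI * x))%R by ring. rewrite cos_neg, sin_neg.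
  unfold Ci, RtoC, Cmult, Cminus, Cplus, Copp; simpl. f_equal; ring.
Qed.

(** After the substitution y = v k, the pairing of [k] with [p - k] turns exponentials into sines.
    The unit [v] is left free: with [v = 6 * s] the classes become those of s x_k. *)
Lemma odd_character_sum (p : nat) (b v : Z) (T : Z -> C) : (p mod 2 = 1)%nat -> rel_prime v (Z.of_nat p) ->
  (forall x y, (x mod Z.of_nat p = y mod Z.of_nat p)%Z -> T x = T y) -> (forall x, T (- x)%Z = - T x) ->
  lsum (fun y => ex (IZR b * (IZR y / INR p)) * T y) (zseq p)
  = lsum (fun k => RtoC 2 * Ci * RtoC (sin (2 * PI * (IZR (b * v * Z.of_nat k) / INR p))) * T (v * Z.of_nat k)%Z) (seq 1 (ell p)).
Proof.
  intros Ho Hv Tmod Topp.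
  assert (Hp : (0 < p)%nat) by (destruct p; [easy|lia]). assert (PP : (0 < INR p)%R) by now apply lt_0_INR.
  assert (T0 : T 0%Z = 0).
  { pose proof (Topp 0%Z) as E. simpl in E. assert (H : T 0%Z + T 0%Z = 0) by (rewrite E at 2; ring).
    replace (T 0%Z) with (/ RtoC 2 * (T 0%Z + T 0%Z)) by (field; apply RtoC_nz; lra). rewrite H. ring. }
  assert (Emod : forall x y, (x mod Z.of_nat p = y mod Z.of_nat p)%Z -> ex (IZR b * (IZR x / INR p)) = ex (IZR b * (IZR y / INR p))).
  { intros x y E. pose proof (Z.div_mod x (Z.of_nat p) ltac:(lia)) as Ex. pose proof (Z.div_mod y (Z.of_nat p) ltac:(lia)) as Ey.
    rewrite E in Ex. replace (IZR b * (IZR x / INR p))%R with (IZR b * (IZR y / INR p) + IZR (b * (x / Z.of_nat p - y / Z.of_nat p)))%R.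
    - rewrite ex_plus, ex_Z. ring.
    - replace x with (y + Z.of_nat p * (x / Z.of_nat p - y / Z.of_nat p))%Z at 2 by lia.
      rewrite !mult_IZR, plus_IZR, mult_IZR, <- INR_IZR_INZ. field. lra. }
  rewrite <- (lsum_perm _ _ _ (zseq_mul_perm p v Hp Hv)), lsum_map.
  rewrite (lsum_ext_in _ (fun k => ex (IZR b * (IZR (v * k) / INR p)) * T (v * k)%Z)).
  2:{ intros k _. f_equal; [apply Emod|apply Tmod]; apply Z.mod_mod; lia. }
  rewrite (lsum_perm _ _ _ (zseq_half p Ho)), lsum_cons, lsum_app, !lsum_map, <- lsum_plus.
  rewrite Z.mul_0_r, T0, Cmult_0_r, Cplus_0_l. apply lsum_ext_in. intros k _.
  rewrite (Tmod (v * (Z.of_nat p - Z.of_nat k))%Z (- (v * Z.of_nat k))%Z), Topp.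
  2:{ replace (v * (Z.of_nat p - Z.of_nat k))%Z with (- (v * Z.of_nat k) + v * Z.of_nat p)%Z by ring. apply Z.mod_add. lia. }
  rewrite (Emod (v * (Z.of_nat p - Z.of_nat k))%Z (- (v * Z.of_nat k))%Z).
  2:{ replace (v * (Z.of_nat p - Z.of_nat k))%Z with (- (v * Z.of_nat k) + v * Z.of_nat p)%Z by ring. apply Z.mod_add. lia. }
  rewrite <- ex_minus_ex. rewrite opp_IZR.
  replace (IZR b * (- IZR (v * Z.of_nat k) / INR p))%R with (- (IZR (b * v * Z.of_nat k) / INR p))%R by (rewrite !mult_IZR; unfold Rdiv; ring).
  replace (IZR b * (IZR (v * Z.of_nat k) / INR p))%R with (IZR (b * v * Z.of_nat k) / INR p)%R by (rewrite !mult_IZR; unfold Rdiv; ring).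
  ring.
Qed.

Lemma chi12_abs n : (Z.abs (chi12 n) <= 1)%Z.
Proof. unfold chi12. destruct (_ || _)%bool; [lia|]. destruct (_ || _)%bool; lia. Qed.

Lemma chi4_abs n : (Z.abs (chi4 n) <= 1)%Z.
Proof. unfold chi4. destruct (_ =? _)%Z; [lia|]. destruct (_ =? _)%Z; lia. Qed.

Lemma chi12_per n k : chi12 (n + k * Z.of_nat 12) = chi12 n.
Proof. unfold chi12. now rewrite Z.mod_add by lia. Qed.

Lemma chi4_per n k : chi4 (n + k * Z.of_nat 4) = chi4 n.
Proof. unfold chi4. now rewrite Z.mod_add by lia. Qed.

Definition Th p x tau := class_theta 12 p chi12 (fun n => RtoC (IZR n)) x tau.
Definition th p x tau := class_theta 4 p chi4 (fun _ => RtoC 1) x tau.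

Lemma IZR_bound n : (Cmod (RtoC (IZR n)) <= 1 + Rabs (IZR n))%R.
Proof. rewrite Cmod_R. lra. Qed.

Lemma one_bound n : (Cmod (RtoC 1) <= 1 + Rabs (IZR n))%R.
Proof. rewrite Cmod_1. pose proof (Rabs_pos (IZR n)). lra. Qed.

Lemma Th_mod p x y tau : (0 < p)%nat -> (x mod Z.of_nat p = y mod Z.of_nat p)%Z -> Th p x tau = Th p y tau.
Proof. apply class_theta_mod. Qed.

Lemma th_mod p x y tau : (0 < p)%nat -> (x mod Z.of_nat p = y mod Z.of_nat p)%Z -> th p x tau = th p y tau.
Proof. apply class_theta_mod. Qed.

Lemma Th_opp p x tau : (0 < p)%nat -> (0 < Im tau)%R -> Th p (- x) tau = - Th p x tau.
Proof.
  intros Hp Ht. apply class_theta_opp; auto using chi12_abs, IZR_bound; try lia.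
  intros n. rewrite chi12_opp, opp_IZR, RtoC_opp. ring.
Qed.

Lemma th_opp p x tau : (0 < p)%nat -> (0 < Im tau)%R -> th p (- x) tau = - th p x tau.
Proof.
  intros Hp Ht. apply class_theta_opp; auto using chi4_abs, one_bound; try lia.
  intros n. rewrite chi4_opp, opp_IZR, RtoC_opp. ring.
Qed.

Lemma sqrt_mult_INR (M p : nat) : sqrt (INR (M * p)) = (sqrt (INR M) * sqrt (INR p))%R.
Proof. rewrite mult_INR. apply sqrt_mult_alt. apply pos_INR. Qed.

(** The Gauss sum sqrt 12 cancels against the sqrt (12 p) of Poisson summation, and -i meets the 2 i
    of the sines. In [th_S] the Gauss sum is 2 i, whence the opposite sign. *)
Lemma Th_S p a v x w tau : (p mod 2 = 1)%nat -> (0 < Im tau)%R -> root_of_tau w tau ->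
  rel_prime v (Z.of_nat p) -> (exists k, 12 * a = 1 + k * Z.of_nat p)%Z ->
  Th p x (tauS tau) = RtoC (2 * IZR (chi12 (Z.of_nat p)) / sqrt (INR p)) * w ^ 3 *
    lsum (fun k => RtoC (sin (2 * PI * (IZR (a * x * v * Z.of_nat k) / INR p))) * Th p (v * Z.of_nat k) tau) (seq 1 (ell p)).
Proof.
  intros Ho Ht Hw Hv Ha.
  assert (Hp : (0 < p)%nat) by (destruct p; [easy|lia]).
  assert (PP : (0 < sqrt (INR p))%R) by now apply sqrt_lt_R0, lt_0_INR.
  assert (P12 : (0 < sqrt 12)%R) by (apply sqrt_lt_R0; lra).
  unfold Th at 1. rewrite (class_theta_S 12 p chi12 _ (RtoC (sqrt 12)) (- Ci * w ^ 3 / RtoC (sqrt (INR (12 * p)))) a);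
    auto using chi12_abs, IZR_bound, chi12_per, chi12_mul; try lia.
  - change (class_theta 12 p chi12 (fun n => RtoC (IZR n))) with (Th p). rewrite (odd_character_sum p (a * x) v (fun y => Th p y tau)); auto.
    + rewrite (lsum_ext_in _ (fun k => RtoC 2 * Ci * (RtoC (sin (2 * PI * (IZR (a * x * v * Z.of_nat k) / INR p))) * Th p (v * Z.of_nat k) tau)))
        by (intros; ring).
      rewrite lsum_scal, sqrt_mult_INR. replace (INR 12) with 12%R by (simpl; lra).
      rewrite RtoC_div, !RtoC_mult by lra.
      set (L := lsum _ _). replace L with (- (Ci * Ci) * L) at 2 by (rewrite Ci_sqr; ring).
      field. split; apply RtoC_nz; lra.
    + intros; now apply Th_mod.
    + intros; now apply Th_opp.
  - intros c. apply gauss_theta_odd; auto using chi12_abs, chi12_per; try lia.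
    apply gauss_sum_12.
Qed.

Lemma th_S p a v x w tau : (p mod 2 = 1)%nat -> (0 < Im tau)%R -> root_of_tau w tau ->
  rel_prime v (Z.of_nat p) -> (exists k, 4 * a = 1 + k * Z.of_nat p)%Z ->
  th p x (tauS tau) = - RtoC (2 * IZR (chi4 (Z.of_nat p)) / sqrt (INR p)) * w *
    lsum (fun k => RtoC (sin (2 * PI * (IZR (a * x * v * Z.of_nat k) / INR p))) * th p (v * Z.of_nat k) tau) (seq 1 (ell p)).
Proof.
  intros Ho Ht Hw Hv Ha.
  assert (Hp : (0 < p)%nat) by (destruct p; [easy|lia]).
  assert (PP : (0 < sqrt (INR p))%R) by now apply sqrt_lt_R0, lt_0_INR.
  assert (P4 : sqrt 4 = 2%R) by (replace 4%R with (2 * 2)%R by ring; apply sqrt_square; lra).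
  unfold th at 1. rewrite (class_theta_S 4 p chi4 _ (RtoC 2 * Ci) (w / RtoC (sqrt (INR (4 * p)))) a);
    auto using chi4_abs, one_bound, chi4_per, chi4_mul; try lia.
  - change (class_theta 4 p chi4 (fun _ => RtoC 1)) with (th p). rewrite (odd_character_sum p (a * x) v (fun y => th p y tau)); auto.
    + rewrite (lsum_ext_in _ (fun k => RtoC 2 * Ci * (RtoC (sin (2 * PI * (IZR (a * x * v * Z.of_nat k) / INR p))) * th p (v * Z.of_nat k) tau)))
        by (intros; ring).
      rewrite lsum_scal, sqrt_mult_INR. replace (INR 4) with 4%R by (simpl; lra). rewrite P4.
      rewrite RtoC_div, !RtoC_mult by lra.
      set (L := lsum _ _).
      transitivity (RtoC 2 * RtoC (IZR (chi4 (Z.of_nat p))) / RtoC (sqrt (INR p)) * w * ((Ci * Ci) * L)).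
      * field. apply RtoC_nz; lra.
      * rewrite Ci_sqr. field. apply RtoC_nz; lra.
    + intros; now apply th_mod.
    + intros; now apply th_opp.
  - intros c. rewrite (usum_ext _ (fun s => RtoC (IZR (chi4 s)) * Qpow (tauS tau) (IZR (c + s * Z.of_nat p) ^ 2 * (/ (2 * INR (4 * p))))))
      by (intros; ring).
    rewrite (gauss_theta_even 4 p c chi4 (RtoC 2 * Ci) w tau); auto using chi4_abs, chi4_per, gauss_sum_4; try lia.
    f_equal. apply usum_ext. intros; ring.
Qed.

(** * Identification of [Theta] and [theta] with unconditional class sums *)

Lemma Theta_term p (n : Z) tau : (0 < p)%nat ->
  RtoC (IZR (n * kronecker 12 n)) * Qpow tau (IZR (n ^ 2) / (24 * INR p))
  = RtoC (IZR (chi12 n)) * (RtoC (IZR n) * Qpow tau (IZR n ^ 2 * / (2 * INR (12 * p)))).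
Proof.
  intros Hp. assert (PP : (0 < INR p)%R) by now apply lt_0_INR.
  rewrite kronecker_12, mult_IZR, RtoC_mult.
  replace (IZR (n ^ 2) / (24 * INR p))%R with (IZR n ^ 2 * / (2 * INR (12 * p)))%R; [ring|].
  rewrite mult_INR. replace (INR 12) with 12%R by (simpl; lra). rewrite pow_IZR. change (Z.of_nat 2) with 2%Z. field. lra.
Qed.

Lemma Theta_summable p tau : (0 < p)%nat -> (0 < Im tau)%R ->
  summable (fun n => RtoC (IZR (n * kronecker 12 n)) * Qpow tau (IZR (n ^ 2) / (24 * INR p))).
Proof.
  intros Hp Ht. apply summable_ext with (1 := fun n => eq_sym (Theta_term p n tau Hp)).
  apply class_theta_summable; auto using chi12_abs, IZR_bound; lia.
Qed.

Lemma Theta_Th p x tau : (0 < p)%nat -> (0 < Im tau)%R -> Theta p x tau = Th p x tau.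
Proof.
  intros Hp Ht. unfold Theta, CSeries_mod, Th, class_theta.
  rewrite CSeriesZ_usum by (apply (summable_restrict (fun n => ((n - x) mod Z.of_nat p =? 0)%Z)), Theta_summable; auto).
  apply usum_ext. intros n. destruct (_ =? 0)%Z; auto. now apply Theta_term.
Qed.

Lemma theta_th p x tau : (0 < p)%nat -> (0 < Im tau)%R -> theta p x tau = th p x tau.
Proof.
  intros Hp Ht. assert (PP : (0 < INR p)%R) by now apply lt_0_INR.
  unfold theta, CSeries_mod, th, class_theta.
  assert (E : forall n : Z, RtoC (IZR (kronecker (-4) n)) * Qpow tau (IZR (n ^ 2) / (8 * INR p))
    = RtoC (IZR (chi4 n)) * (RtoC 1 * Qpow tau (IZR n ^ 2 * / (2 * INR (4 * p))))).
  { intros n. rewrite kronecker_m4.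
    replace (IZR (n ^ 2) / (8 * INR p))%R with (IZR n ^ 2 * / (2 * INR (4 * p)))%R; [ring|].
    rewrite mult_INR. replace (INR 4) with 4%R by (simpl; lra). rewrite pow_IZR. change (Z.of_nat 2) with 2%Z. field. lra. }
  rewrite CSeriesZ_usum.
  - apply usum_ext. intros n. destruct (_ =? 0)%Z; auto.
  - apply (summable_restrict (fun n => ((n - x) mod Z.of_nat p =? 0)%Z)).
    apply summable_ext with (1 := fun n => eq_sym (E n)).
    apply class_theta_summable; auto using chi4_abs, one_bound; lia.
Qed.

(** * Power series on the unit disc *)

Definition psum (a : nat -> C) (q : C) : C := usum (fun n => a n * q ^ n).

Definition conv1 (a : nat -> C) : Prop :=
  forall q, (Cmod q < 1)%R -> summable (fun n => a n * q ^ n).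

Lemma summableR_geom x : (0 <= x < 1)%R -> summableR (fun n : nat => x ^ n)%R.
Proof.
  intros Hx. apply summableR_nat with (1 / (1 - x))%R; [intros; now apply pow_le|].
  assert (E : forall n, rsum (fun n : nat => x ^ n)%R (seq 0 n) = ((1 - x ^ n) / (1 - x))%R).
  { induction n as [|n IH]; [simpl; field; lra|]. rewrite rsum_seq_S, IH. simpl. field. lra. }
  intros n. rewrite E. apply Rmult_le_compat_r; [left; apply Rinv_0_lt_compat; lra|].
  assert (0 <= x ^ n)%R by now apply pow_le. lra.
Qed.

(** Bernoulli's inequality gives (1 + n) h <= 2 (1 + h)^n, and [h] is small enough for x (1 + h)^2
    to stay below 1. *)
Lemma summableR_sqr_geom x : (0 <= x < 1)%R -> summableR (fun n : nat => (1 + INR n) ^ 2 * x ^ n)%R.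
Proof.
  intros Hx. set (h := ((1 - x) / 4)%R). assert (Hh : (0 < h <= 1)%R) by (unfold h; lra).
  set (y := (x * (1 + h) ^ 2)%R).
  assert (Hy : (0 <= y < 1)%R).
  { unfold y. split; [apply Rmult_le_pos; [lra|apply pow2_ge_0]|]. unfold h. nra. }
  apply summableR_le with (fun n : nat => (4 / h ^ 2) * y ^ n)%R.
  - intros n. unfold y. rewrite Rpow_mult_distr, (Rmult_comm (x ^ n)), <- Rmult_assoc.
    apply Rmult_le_compat_r; [now apply pow_le|].
    pose proof (poly n h ltac:(lra)) as P. pose proof (pos_INR n).
    assert (Q : ((1 + INR n) * h <= 2 * (1 + h) ^ n)%R) by nra.
    replace (((1 + h) ^ 2) ^ n)%R with (((1 + h) ^ n) ^ 2)%R by (rewrite <- !pow_mult; f_equal; lia).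
    set (z := ((1 + h) ^ n)%R) in *.
    apply (Rmult_le_reg_r (h ^ 2)); [apply pow_lt; lra|].
    replace (4 / h ^ 2 * z ^ 2 * h ^ 2)%R with ((2 * z) ^ 2)%R by (field; lra).
    replace ((1 + INR n) ^ 2 * h ^ 2)%R with (((1 + INR n) * h) ^ 2)%R by ring.
    apply pow_incr. split; auto. apply Rmult_le_pos; lra.
  - apply summableR_scal; [|now apply summableR_geom]. apply Rlt_le, Rdiv_lt_0_compat; [lra|apply pow_lt; lra].
Qed.

Lemma summableR_bounded {I : Type} (g : I -> R) : (forall i, 0 <= g i)%R -> summableR g ->
  exists M, (0 <= M)%R /\ forall i, (g i <= M)%R.
Proof.
  intros Hg [M HM]. exists M. split.
  - apply (HM nil). constructor.
  - intros i. specialize (HM (i :: nil) ltac:(constructor; [easy|constructor])). simpl in HM. lra.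
Qed.

(** Terms are bounded at an intermediate radius [s], and (r/s)^n absorbs the polynomial. The weight
    (1 + n)^2 covers a first derivative and the second-order remainder. *)
Lemma conv1_sqr a r : conv1 a -> (0 <= r < 1)%R -> summableR (fun n => Cmod (a n) * (1 + INR n) ^ 2 * r ^ n)%R.
Proof.
  intros Ha Hr. set (s := ((1 + r) / 2)%R).
  assert (Hs : (0 < s < 1)%R) by (unfold s; lra).
  assert (S : summable (fun n => a n * RtoC s ^ n)) by (apply Ha; rewrite Cmod_R, Rabs_pos_eq; lra).
  destruct (summableR_bounded _ (fun n => Cmod_ge_0 _) S) as (M & M0 & HM).
  apply summableR_le with (fun n => M * ((1 + INR n) ^ 2 * (r / s) ^ n))%R.
  - intros n. specialize (HM n). rewrite Cmod_mult, Cmod_pow, Cmod_R, Rabs_pos_eq in HM by lra.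
    assert (E : (r ^ n = s ^ n * (r / s) ^ n)%R) by (rewrite <- Rpow_mult_distr; f_equal; field; lra).
    rewrite E. replace (Cmod (a n) * (1 + INR n) ^ 2 * (s ^ n * (r / s) ^ n))%R with
      (Cmod (a n) * s ^ n * ((1 + INR n) ^ 2 * (r / s) ^ n))%R by ring.
    apply Rmult_le_compat_r; auto. apply Rmult_le_pos; [apply pow2_ge_0|]. apply pow_le.
    apply Rdiv_le_0_compat; lra.
  - apply summableR_scal; auto. apply summableR_sqr_geom. split; [apply Rdiv_le_0_compat; lra|].
    apply (Rmult_lt_reg_r s); [lra|]. unfold Rdiv. rewrite Rmult_assoc, Rinv_l; unfold s in *; lra.
Qed.

Lemma conv1_euler a : conv1 a -> conv1 (fun n => RtoC (INR n) * a n).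
Proof.
  intros Ha q Hq. apply summable_le with (2 := conv1_sqr a (Cmod q) Ha (conj (Cmod_ge_0 q) Hq)).
  intros n. rewrite !Cmod_mult, Cmod_pow, Cmod_R, Rabs_pos_eq by apply pos_INR.
  pose proof (pos_INR n). apply Rmult_le_compat_r; [apply pow_le, Cmod_ge_0|].
  rewrite Rmult_comm. apply Rmult_le_compat_l; [apply Cmod_ge_0|]. nra.
Qed.

Lemma psum_Cder_gen a q : conv1 a -> (Cmod q < 1)%R ->
  summable (fun n => a n * (RtoC (INR n) * q ^ (n - 1))) /\
  Cder (psum a) q (usum (fun n => a n * (RtoC (INR n) * q ^ (n - 1)))).
Proof.
  intros Ha Hq. set (r := ((1 + Cmod q) / 2)%R). pose proof (Cmod_ge_0 q) as Q0.
  assert (Hr : (0 < r < 1)%R) by (unfold r; lra).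
  pose proof (conv1_sqr a r Ha ltac:(lra)) as SQ.
  assert (Spre : summable (fun n => a n * (RtoC (INR n) * q ^ (n - 1)))).
  { apply summable_le with (fun n => / r * (Cmod (a n) * (1 + INR n) ^ 2 * r ^ n))%R.
    - assert (B : forall n, (INR n * Cmod q ^ (n - 1) <= / r * ((1 + INR n) ^ 2 * r ^ n))%R).
      { intros n. pose proof (pos_INR n). assert (R1 : (0 < / r)%R) by (apply Rinv_0_lt_compat; lra).
        destruct n as [|n].
        - simpl INR. rewrite Rmult_0_l. apply Rmult_le_pos; [lra|].
          apply Rmult_le_pos; [apply pow2_ge_0|apply pow_le; lra].
        - replace (/ r * ((1 + INR (S n)) ^ 2 * r ^ S n))%R
            with ((1 + INR (S n)) ^ 2 * r ^ n)%R by (simpl; field; lra).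
          replace (S n - 1)%nat with n by lia.
          apply Rmult_le_compat; [lra|apply pow_le; lra|nra|]. apply pow_incr. unfold r. lra. }
      intros n. rewrite !Cmod_mult, Cmod_pow, Cmod_R, Rabs_pos_eq by apply pos_INR.
      replace (/ r * (Cmod (a n) * (1 + INR n) ^ 2 * r ^ n))%R with (Cmod (a n) * (/ r * ((1 + INR n) ^ 2 * r ^ n)))%R by ring.
      apply Rmult_le_compat_l; [apply Cmod_ge_0|auto].
    - apply summableR_scal; [left; apply Rinv_0_lt_compat; lra|exact SQ]. }
  split; auto.
  apply (Cder_usum (fun n w => a n * w ^ n) (fun n => a n * (RtoC (INR n) * q ^ (n - 1)))
    (fun n => / r ^ 2 * (Cmod (a n) * (1 + INR n) ^ 2 * r ^ n))%R q ((1 - Cmod q) / 2)%R); auto; [lra| | |].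
  - intros w Hw. apply Ha.
    replace w with (q + (w - q)) by ring. eapply Rle_lt_trans; [apply Cmod_triangle|]. lra.
  - apply summableR_scal; auto. left. apply Rinv_0_lt_compat, pow_lt. lra.
  - intros n w Hw.
    replace (a n * w ^ n - a n * q ^ n - (w - q) * (a n * (RtoC (INR n) * q ^ (n - 1)))) with
      (a n * (w ^ n - q ^ n - (w - q) * (RtoC (INR n) * q ^ (n - 1)))) by ring.
    rewrite Cmod_mult.
    replace (/ r ^ 2 * (Cmod (a n) * (1 + INR n) ^ 2 * r ^ n) * Cmod (w - q) ^ 2)%R with
      (Cmod (a n) * ((/ r ^ 2 * ((1 + INR n) ^ 2 * r ^ n)) * Cmod (w - q) ^ 2))%R by ring.
    apply Rmult_le_compat_l; [apply Cmod_ge_0|].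
    apply (taylor_ineq (fun z => z ^ n) (fun z => RtoC (INR n) * z ^ (n - 1))
      (fun z => RtoC (INR n) * (RtoC (INR (n - 1)) * z ^ (n - 1 - 1)))).
    + intros; apply Cder_pow.
    + intros; apply Cder_scal, Cder_pow.
    + intros s Hs. rewrite !Cmod_mult, Cmod_pow, !Cmod_R, !Rabs_pos_eq by apply pos_INR.
      assert (Z : (Cmod (q + RtoC s * (w - q)) <= r)%R).
      { eapply Rle_trans; [apply Cmod_triangle|]. rewrite Cmod_mult, Cmod_R, Rabs_pos_eq by lra.
        pose proof (Cmod_ge_0 (w - q)). unfold r. nra. }
      pose proof (Cmod_ge_0 (q + RtoC s * (w - q))) as Z0.
      assert (R2 : (0 < / r ^ 2)%R) by (apply Rinv_0_lt_compat, pow_lt; lra).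
      destruct n as [|[|n]].
      * simpl INR. rewrite !Rmult_0_l. simpl. apply Rmult_le_pos; [simpl in R2; lra|lra].
      * simpl INR. rewrite Rmult_0_l, Rmult_0_r. simpl. apply Rmult_le_pos; [simpl in R2; lra|].
        apply Rmult_le_pos; lra.
      * replace (/ r ^ 2 * ((1 + INR (S (S n))) ^ 2 * r ^ S (S n)))%R with ((1 + INR (S (S n))) ^ 2 * r ^ n)%R by (simpl; field; lra).
        replace (S (S n) - 1 - 1)%nat with n by lia. replace (S (S n) - 1)%nat with (S n) by lia.
        rewrite <- Rmult_assoc. apply Rmult_le_compat.
        -- apply Rmult_le_pos; apply pos_INR.
        -- now apply pow_le.
        -- rewrite !S_INR. pose proof (pos_INR n). nra.
        -- apply pow_incr. lra.
Qed.

(** The derivative is recorded through [q * d]: the Euler operator multiplies the n-th coefficient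
    by n without shifting indices, and it is what d/dtau becomes in the variable Q. *)
Lemma psum_Cder a q : conv1 a -> (Cmod q < 1)%R ->
  exists d, Cder (psum a) q d /\ q * d = psum (fun n => RtoC (INR n) * a n) q.
Proof.
  intros Ha Hq. destruct (psum_Cder_gen a q Ha Hq) as [SQ D]. eexists. split; [exact D|].
  rewrite <- usum_scal by exact SQ. apply usum_ext. intros n.
  destruct n as [|n]; [simpl; ring|]. replace (S n - 1)%nat with n by lia. rewrite Cpow_S. ring.
Qed.

(** Functions given by a power series on the open unit disc: an algebra stable under the Euler
    operator. *)
Definition DS (f : C -> C) : Prop := exists a, conv1 a /\ forall q, (Cmod q < 1)%R -> f q = psum a q.

Lemma DS_ext f g : (forall q, (Cmod q < 1)%R -> f q = g q) -> DS f -> DS g.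
Proof. intros E (a & Ha & Hf). exists a. split; auto. intros q Hq. now rewrite <- E, Hf. Qed.

Lemma DS_const c : DS (fun _ => c).
Proof.
  set (a := fun n => match n with O => c | _ => RtoC 0 end).
  assert (K : forall q, summable (fun n => a n * q ^ n) /\ usum (fun n => a n * q ^ n) = lsum (fun n => a n * q ^ n) (0%nat :: nil)).
  { intros q. apply usum_finite; [constructor; [easy|constructor]|].
    intros [|n] H; [exfalso; apply H; now left|]. unfold a. ring. }
  exists a. split.
  - intros q _. apply K.
  - intros q _. unfold psum. rewrite (proj2 (K q)). simpl. ring.
Qed.

Lemma DS_plus f g : DS f -> DS g -> DS (fun q => f q + g q).
Proof.
  intros (a & Ha & Hf) (b & Hb & Hg). exists (fun n => a n + b n).
  assert (E : forall q, (fun n => (a n + b n) * q ^ n) = (fun n => a n * q ^ n + b n * q ^ n)).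
  { intros q. apply functional_extensionality. intros n. ring. }
  split.
  - intros q Hq. rewrite E. apply summable_plus; auto.
  - intros q Hq. unfold psum. rewrite E, usum_plus, Hf, Hg; auto.
Qed.

Lemma cauchy_product (a b : nat -> C) q : summable (fun n => a n * q ^ n) -> summable (fun n => b n * q ^ n) ->
  let c := fun n => lsum (fun k => a k * b (n - k)%nat) (seq 0 (S n)) in
  summable (fun n => c n * q ^ n) /\
  usum (fun n => c n * q ^ n) = usum (fun n => a n * q ^ n) * usum (fun n => b n * q ^ n).
Proof.
  intros Ha Hb c.
  pose proof (summable_mult _ _ Ha Hb) as SQ. rewrite <- (usum_mult _ _ Ha Hb).
  set (F := fun p : nat * nat => a (fst p) * q ^ fst p * (b (snd p) * q ^ snd p)) in *.
  destruct (usum_fibre (fun p : nat * nat => (fst p + snd p)%nat) F SQ) as [S1 E1].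
  assert (E : forall n, usum (fibre (fun p : nat * nat => (fst p + snd p)%nat) F n) = c n * q ^ n).
  { intros n. destruct (usum_finite (fibre (fun p : nat * nat => (fst p + snd p)%nat) F n)
      (map (fun k => (k, (n - k)%nat)) (seq 0 (S n)))) as [_ ->].
    - apply FinFun.Injective_map_NoDup; [intros x y E; congruence|apply seq_NoDup].
    - intros [x y] H. unfold fibre. destruct (classic_eq_dec _ _) as [e|]; auto. simpl in e. exfalso. apply H.
      apply in_map_iff. exists x. split; [f_equal; lia|apply in_seq; lia].
    - rewrite lsum_map. unfold c. rewrite Cmult_comm, <- lsum_scal. apply lsum_ext_in. intros k Hk.
      apply in_seq in Hk. unfold fibre. destruct (classic_eq_dec _ _) as [e|ne]; [|exfalso; apply ne; simpl; lia].
      unfold F. simpl fst. simpl snd. replace n with (k + (n - k))%nat at 3 by lia. rewrite Cpow_add_r. ring. }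
  split.
  - apply summable_ext with (2 := S1). exact E.
  - rewrite E1. apply usum_ext. intros n. now rewrite E.
Qed.

Lemma DS_mult f g : DS f -> DS g -> DS (fun q => f q * g q).
Proof.
  intros (a & Ha & Hf) (b & Hb & Hg).
  exists (fun n => lsum (fun k => a k * b (n - k)%nat) (seq 0 (S n))). split.
  - intros q Hq. apply cauchy_product; auto.
  - intros q Hq. unfold psum. rewrite (proj2 (cauchy_product a b q (Ha q Hq) (Hb q Hq))), Hf, Hg; auto.
Qed.

Lemma DS_scal c f : DS f -> DS (fun q => c * f q).
Proof. intros H. apply DS_mult; auto. apply DS_const. Qed.

Lemma DS_pow f n : DS f -> DS (fun q => f q ^ n).
Proof. intros H. induction n as [|n IH]; [exact (DS_const 1)|]. exact (DS_mult _ _ H IH). Qed.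

Lemma Cder_unique f z d e : Cder f z d -> Cder f z e -> d = e.
Proof. intros H1 H2. rewrite <- (Cder_C_derive f z d H1). now apply Cder_C_derive. Qed.

Lemma disc_ball q w : (Cmod q < 1)%R -> (Cmod (w - q) < 1 - Cmod q)%R -> (Cmod w < 1)%R.
Proof.
  intros Hq Hw. replace w with (q + (w - q)) by ring. eapply Rle_lt_trans; [apply Cmod_triangle|]. lra.
Qed.

Lemma DS_Cder f : DS f -> exists g, DS g /\ forall q, (Cmod q < 1)%R -> exists d, Cder f q d /\ q * d = g q.
Proof.
  intros (a & Ha & Hf). exists (psum (fun n => RtoC (INR n) * a n)). split.
  - exists (fun n => RtoC (INR n) * a n). split; auto. now apply conv1_euler.
  - intros q Hq. destruct (psum_Cder a q Ha Hq) as (d & D & E). exists d. split; auto.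
    apply Cder_ext_loc with (psum a) (1 - Cmod q)%R; auto; [lra|].
    intros w Hw. symmetry. apply Hf. now apply disc_ball with q.
Qed.

Lemma DS_holomorphic f : DS f -> holomorphic_Qseries f.
Proof.
  intros H. split.
  - intros q Hq. destruct (DS_Cder f H) as (g & _ & Hg). destruct (Hg q Hq) as (d & D & _).
    exists d. now apply Cder_is_derive.
  - destruct H as (a & Ha & Hf). exists a. intros q Hq. rewrite Hf by auto.
    apply summable_is_series. auto.
Qed.

Lemma Cder_Qpow tau r : Cder (fun u => Qpow u r) tau (RtoC (2 * PI * r) * Ci * Qpow tau r).
Proof.
  unfold Qpow.
  pose proof (Cder_exp _ _ _ (Cder_scal (RtoC (2 * PI * r) * Ci) _ _ _ (Cder_id tau))) as H.
  rewrite Cmult_1_r in H. exact H.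
Qed.

Lemma two_pi_i_nz : RtoC (2 * PI) * Ci <> 0.
Proof. apply Cmult_neq_0; [|apply Ci_nz]. apply RtoC_nz. pose proof PI_RGT_0. lra. Qed.

Lemma Cder_half_plane f g tau d : (0 < Im tau)%R ->
  (forall u, (0 < Im u)%R -> f u = g u) -> Cder f tau d -> Cder g tau d.
Proof.
  intros Ht E. apply Cder_ext_loc with (Im tau); auto. intros w Hw. apply E.
  pose proof (im_le_Cmod (w - tau)) as B. apply Rabs_le_between in B.
  replace (Im (w - tau)) with (Im w - Im tau)%R in B by (unfold Im; simpl; ring). lra.
Qed.

Lemma Cder_Q_series f g tau r : (forall q, (Cmod q < 1)%R -> exists d, Cder f q d /\ q * d = g q) ->
  (0 < Im tau)%R ->
  Cder (fun u => Qpow u r * f (Qof u)) tau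
    (RtoC (2 * PI) * Ci * (Qpow tau r * (RtoC r * f (Qof tau) + g (Qof tau)))).
Proof.
  intros Hf Ht. destruct (Hf (Qof tau) (Qof_lt_1 tau Ht)) as (d & D & E).
  pose proof (Cder_comp f Qof tau d _ D (Cder_Qpow tau 1)) as D1.
  pose proof (Cder_mult _ _ _ _ _ (Cder_Qpow tau r) D1) as D2.
  eapply Cder_eq; [|exact D2]. cbv beta. rewrite <- E. unfold Qof. rewrite !RtoC_mult. ring.
Qed.

(** * Euler's pentagonal number theorem *)

Lemma one_minus_pow_nz q n : (Cmod q < 1)%R -> 1 - q ^ S n <> 0.
Proof.
  intros Hq E. assert (H : q ^ S n = 1) by (replace (q ^ S n) with (1 - (1 - q ^ S n)) by ring; rewrite E; ring).
  apply (f_equal Cmod) in H. rewrite Cmod_pow, Cmod_1 in H.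
  pose proof (pow_lt_1_compat (Cmod q) (S n) (conj (Cmod_ge_0 q) Hq) ltac:(lia)). lra.
Qed.

Lemma Qpoch_partial_S q n : Qpoch_partial q (S n) = Qpoch_partial q n * (1 - q ^ S n).
Proof. reflexivity. Qed.

Lemma Qpoch_partial_nz q n : (Cmod q < 1)%R -> Qpoch_partial q n <> 0.
Proof.
  intros Hq. induction n as [|n IH]; [exact C1_nz|].
  rewrite Qpoch_partial_S. apply Cmult_neq_0; auto. now apply one_minus_pow_nz.
Qed.

Fixpoint tri (n : nat) : nat := match n with O => O | S m => (tri m + n)%nat end.

(** Summand of Shanks' finite form of the pentagonal number theorem. The term [s = 0] is the finite
    Euler product itself, the others are of order q^n. *)
Definition shanks_term (q : C) (n s : nat) : C :=
  (-1) ^ s * (Qpoch_partial q n / Qpoch_partial q s) * q ^ (s * n + tri s).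

Definition shanks (q : C) (n : nat) : C := lsum (shanks_term q n) (seq 0 (S n)).

(** The difference between consecutive values of [n] telescopes in [s]. For [m = n] the right-hand
    side is [pent2 q n], while the new top term of the sum is [pent1 q (S n)]. *)
Lemma shanks_telescope q n m : (Cmod q < 1)%R -> (m <= n)%nat ->
  lsum (fun s => shanks_term q (S n) s - shanks_term q n s) (seq 0 (S m))
  = - ((-1) ^ m * (Qpoch_partial q n / Qpoch_partial q m) * q ^ (S m * S n + tri m)).
Proof.
  intros Hq. induction m as [|m IH]; intros Hm.
  - simpl seq. unfold lsum. simpl fold_right. unfold shanks_term.
    rewrite Qpoch_partial_S. simpl (tri 0). simpl (Qpoch_partial q 0).
    replace (0 * S n + 0)%nat with 0%nat by lia. replace (0 * n + 0)%nat with 0%nat by lia.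
    replace (1 * S n + 0)%nat with (S n) by lia. simpl (q ^ 0). simpl ((-1) ^ 0). field.
  - rewrite (seq_S (S m)), lsum_app, IH by lia. simpl (0 + S m)%nat. rewrite lsum_cons. unfold lsum, fold_right.
    unfold shanks_term. set (X := q ^ (S m * n + tri (S m))).
    replace (q ^ (S m * S n + tri m)) with X by (unfold X; f_equal; simpl; nia).
    replace (q ^ (S m * S n + tri (S m))) with (X * q ^ S m) by (unfold X; rewrite <- Cpow_add_r; f_equal; nia).
    replace (q ^ (S (S m) * S n + tri (S m))) with (X * q ^ S m * q ^ S n) by (unfold X; rewrite <- !Cpow_add_r; f_equal; nia).
    rewrite (Qpoch_partial_S q m), (Qpoch_partial_S q n), (Cpow_S (-1) m).
    replace (RtoC (-1)) with (- RtoC 1) by (rewrite <- RtoC_opp; f_equal; lra).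
    field. split; [now apply one_minus_pow_nz|now apply Qpoch_partial_nz].
Qed.

(** The exponents are j (3 j + 1)/2 here, and k (3 k - 1)/2 with k = j + 1 in [pent2]. *)
Definition pent1 (q : C) (j : nat) : C := (-1) ^ j * q ^ (j * j + tri j).
Definition pent2 (q : C) (j : nat) : C := (-1) ^ S j * q ^ (S j * S j + tri j).

Lemma shanks_pentagonal q n : (Cmod q < 1)%R ->
  shanks q n = lsum (pent1 q) (seq 0 (S n)) + lsum (pent2 q) (seq 0 n).
Proof.
  intros Hq. induction n as [|n IH].
  - unfold shanks, lsum. simpl. unfold shanks_term, pent1. simpl. field.
  - assert (E : shanks q (S n) = shanks q n + (lsum (fun s => shanks_term q (S n) s - shanks_term q n s) (seq 0 (S n)))
       + shanks_term q (S n) (S n)).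
    { unfold shanks. rewrite (seq_S (S n)), lsum_app. unfold Cminus. rewrite lsum_plus.
      replace (lsum (fun i => - shanks_term q n i) (seq 0 (S n))) with (- lsum (shanks_term q n) (seq 0 (S n))).
      - simpl (0 + S n)%nat. rewrite (lsum_cons _ (S n) nil). simpl (lsum _ nil). ring.
      - rewrite (lsum_ext_in (fun i => - shanks_term q n i) (fun i => (- RtoC 1) * shanks_term q n i)) by (intros; ring).
        rewrite lsum_scal. ring. }
    rewrite E, IH, shanks_telescope by auto.
    rewrite (seq_S (S n)), (seq_S n), !lsum_app. simpl (0 + _)%nat. rewrite !(lsum_cons _ _ nil). simpl (lsum _ nil).
    unfold shanks_term, pent1, pent2. rewrite (Cpow_S (-1) n).
    replace (RtoC (-1)) with (- RtoC 1) by (rewrite <- RtoC_opp; f_equal; lra).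
    field. split; now apply Qpoch_partial_nz.
Qed.

Lemma geom_partial r n : (0 <= r < 1)%R -> (rsum (fun i : nat => r ^ i) (seq 0 n) <= 1 / (1 - r))%R.
Proof.
  intros Hr.
  assert (E : rsum (fun n : nat => r ^ n)%R (seq 0 n) = ((1 - r ^ n) / (1 - r))%R).
  { induction n as [|n IH]; [simpl; field; lra|]. rewrite rsum_seq_S, IH. simpl. field. lra. }
  rewrite E. apply Rmult_le_compat_r; [left; apply Rinv_0_lt_compat; lra|].
  assert (0 <= r ^ n)%R by (apply pow_le; lra). lra.
Qed.

Lemma exp_le_compat x y : (x <= y)%R -> (exp x <= exp y)%R.
Proof. intros [H|H]; [left; now apply exp_increasing|right; now rewrite H]. Qed.

Lemma pow_le_pow r m n : (0 <= r <= 1)%R -> (m <= n)%nat -> (r ^ n <= r ^ m)%R.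
Proof.
  intros Hr Hmn. replace n with (m + (n - m))%nat by lia. rewrite pow_add.
  assert (0 <= r ^ m)%R by (apply pow_le; lra).
  assert (r ^ (n - m) <= 1)%R by (rewrite <- (pow1 (n - m)); apply pow_incr; lra).
  assert (0 <= r ^ (n - m))%R by (apply pow_le; lra). nra.
Qed.

Lemma Qpoch_ratio_bound q s d : (Cmod q < 1)%R ->
  (Cmod (Qpoch_partial q (s + d) / Qpoch_partial q s) <= exp (1 / (1 - Cmod q)))%R.
Proof.
  intros Hq. pose proof (Cmod_ge_0 q) as Q0. pose proof (Qpoch_partial_nz q s Hq) as Ns.
  apply Rle_trans with (exp (rsum (fun i : nat => Cmod q ^ i)%R (seq 0 d))).
  - induction d as [|d IH].
    + rewrite Nat.add_0_r. replace (Qpoch_partial q s / Qpoch_partial q s) with (RtoC 1) by (field; auto).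
      rewrite Cmod_1. simpl. rewrite exp_0. lra.
    + rewrite Nat.add_succ_r, Qpoch_partial_S, rsum_seq_S, exp_plus.
      replace (Qpoch_partial q (s + d) * (1 - q ^ S (s + d)) / Qpoch_partial q s) with
        (Qpoch_partial q (s + d) / Qpoch_partial q s * (1 - q ^ S (s + d))) by (field; auto).
      rewrite Cmod_mult. apply Rmult_le_compat; auto using Cmod_ge_0.
      unfold Cminus. eapply Rle_trans; [apply Cmod_triangle|]. rewrite Cmod_1, Cmod_opp, Cmod_pow.
      pose proof (exp_ineq1_le (Cmod q ^ d)). pose proof (pow_le_pow (Cmod q) d (S (s + d)) ltac:(lra) ltac:(lia)). lra.
  - apply exp_le_compat. apply geom_partial. lra.
Qed.

Lemma pow_Climseq r : (0 <= r < 1)%R -> forall K, Climseq (fun n => RtoC (K * r ^ n)) 0.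
Proof.
  intros Hr K eps He.
  destruct (pow_lt_1_zero r ltac:(rewrite Rabs_pos_eq; lra) (eps / (Rabs K + 1))%R) as [N HN].
  { apply Rdiv_lt_0_compat; auto. pose proof (Rabs_pos K). lra. }
  exists N. intros n Hn. rewrite Cminus_0_r, Cmod_R, Rabs_mult. specialize (HN n Hn).
  pose proof (Rabs_pos K). apply (Rmult_lt_compat_l (Rabs K + 1)) in HN; [|lra].
  field_simplify in HN; [|lra]. pose proof (Rabs_pos (r ^ n)). nra.
Qed.

Lemma Climseq_squeeze u v : (forall n, (Cmod (u n) <= Cmod (v n))%R) -> Climseq v 0 -> Climseq u 0.
Proof.
  intros H Hv eps He. destruct (Hv eps He) as [N HN]. exists N. intros n Hn. specialize (HN n Hn).
  rewrite Cminus_0_r in *. eapply Rle_lt_trans; [apply H|exact HN].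
Qed.

Lemma summable_pow_ge (c : nat -> C) (e : nat -> nat) q : (Cmod q < 1)%R -> (forall n, (n <= e n)%nat) ->
  (forall n, (Cmod (c n) <= 1)%R) -> summable (fun n => c n * q ^ e n).
Proof.
  intros Hq He Hc. apply summable_le with (fun n => (Cmod q ^ n)%R).
  - intros n. rewrite Cmod_mult, Cmod_pow. pose proof (Cmod_ge_0 q).
    pose proof (pow_le_pow (Cmod q) n (e n) ltac:(lra) (He n)).
    assert (0 <= Cmod q ^ e n)%R by (apply pow_le; lra). specialize (Hc n). pose proof (Cmod_ge_0 (c n)). nra.
  - apply summableR_geom. split; [apply Cmod_ge_0|auto].
Qed.

Lemma Cmod_m1_pow n : (Cmod ((-1) ^ n) <= 1)%R.
Proof.
  rewrite Cmod_pow, Cmod_R. replace (Rabs (-1)) with 1%R by (rewrite Rabs_left; lra). rewrite pow1. lra.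
Qed.

Lemma pent_summable q : (Cmod q < 1)%R -> summable (pent1 q) /\ summable (pent2 q).
Proof.
  intros Hq. split.
  - apply (summable_pow_ge (fun n => (-1) ^ n)); auto using Cmod_m1_pow. intros n. nia.
  - apply (summable_pow_ge (fun n => (-1) ^ S n)); auto using Cmod_m1_pow. intros n. nia.
Qed.

Lemma pentagonal q : (Cmod q < 1)%R ->
  Climseq (Qpoch_partial q) (usum (pent1 q) + usum (pent2 q)).
Proof.
  intros Hq. destruct (pent_summable q Hq) as [S1 S2]. pose proof (Cmod_ge_0 q) as Q0.
  assert (L : Climseq (shanks q) (usum (pent1 q) + usum (pent2 q))).
  { pose proof (Climseq_plus _ _ _ _ (Climseq_sum_n _ S1) (Climseq_partial _ S2)) as H.
    apply Climseq_ext_ev with (2 := H). exists 0%nat. intros n _. rewrite sum_n_lsum. symmetry. now apply shanks_pentagonal. }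
  (* For s >= 1 the exponent s n + s (s + 1)/2 is at least n + s, and ratios of finite products are
     bounded, so these terms add up to at most a constant times |q|^n. *)
  assert (D : Climseq (fun n => shanks q n - Qpoch_partial q n) 0).
  { set (K := (exp (1 / (1 - Cmod q)) * (1 / (1 - Cmod q)))%R).
    apply Climseq_squeeze with (fun n => RtoC (K * Cmod q ^ n)); [|apply pow_Climseq; lra].
    intros n. unfold shanks. simpl seq. rewrite lsum_cons.
    replace (shanks_term q n 0) with (Qpoch_partial q n) by (unfold shanks_term; simpl; field).
    replace (Qpoch_partial q n + lsum (shanks_term q n) (seq 1 n) - Qpoch_partial q n) with (lsum (shanks_term q n) (seq 1 n)) by ring.
    assert (E1 : (0 < 1 / (1 - Cmod q))%R) by (apply Rdiv_lt_0_compat; lra).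
    assert (P : (0 <= Cmod q ^ n)%R) by (apply pow_le; lra).
    rewrite Cmod_R, Rabs_pos_eq.
    2:{ unfold K. pose proof (exp_pos (1 / (1 - Cmod q))). apply Rmult_le_pos; [|lra]. apply Rmult_le_pos; lra. }
    eapply Rle_trans; [apply Cmod_lsum|].
    eapply Rle_trans; [apply rsum_le with (g := fun s => (exp (1 / (1 - Cmod q)) * Cmod q ^ n * Cmod q ^ s)%R)|].
    - intros s Hs. apply in_seq in Hs. unfold shanks_term. rewrite !Cmod_mult, (Cmod_pow q).
      rewrite Rmult_assoc. pose proof (Cmod_m1_pow s) as M1. pose proof (Cmod_ge_0 ((-1) ^ s)).
      pose proof (Qpoch_ratio_bound q s (n - s) Hq) as R1. replace (s + (n - s))%nat with n in R1 by lia.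
      assert (R2 : (Cmod q ^ (s * n + tri s) <= Cmod q ^ n * Cmod q ^ s)%R).
      { rewrite <- pow_add. apply pow_le_pow; [lra|]. destruct s as [|s]; [lia|]. simpl. nia. }
      rewrite (Rmult_assoc (exp _)).
      rewrite <- (Rmult_1_l (exp (1 / (1 - Cmod q)) * _)).
      apply Rmult_le_compat; auto; [apply Rmult_le_pos; [apply Cmod_ge_0|apply pow_le; lra]|].
      apply Rmult_le_compat; auto; [apply Cmod_ge_0|apply pow_le; lra].
    - rewrite rsum_scal. unfold K.
      assert (rsum (fun s => Cmod q ^ s)%R (seq 1 n) <= 1 / (1 - Cmod q))%R.
      { eapply Rle_trans; [|apply (geom_partial (Cmod q) (S n)); lra]. simpl seq. rewrite rsum_cons. simpl. lra. }
      pose proof (exp_pos (1 / (1 - Cmod q))).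
      assert (P2 : (0 <= exp (1 / (1 - Cmod q)) * Cmod q ^ n)%R) by (apply Rmult_le_pos; lra).
      eapply Rle_trans; [apply Rmult_le_compat_l; [exact P2|exact H]|]. right. unfold Rdiv. ring. }
  pose proof (Climseq_plus _ _ _ _ L (Climseq_scal (- RtoC 1) _ _ D)) as H.
  replace (usum (pent1 q) + usum (pent2 q) + - RtoC 1 * 0) with (usum (pent1 q) + usum (pent2 q)) in H by ring.
  apply Climseq_ext_ev with (2 := H). exists 0%nat. intros n _. ring.
Qed.

Lemma Qpoch_pent q : (Cmod q < 1)%R -> Qpoch q = usum (pent1 q) + usum (pent2 q).
Proof. intros Hq. now apply Climseq_CLim_seq, pentagonal. Qed.

Lemma tri_sqr j : (2 * tri j = j * j + j)%nat.
Proof. induction j as [|j IH]; simpl in *; nia. Qed.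

Lemma chi12_6j j : RtoC (IZR (chi12 (1 + 6 * Z.of_nat j))) = (-1) ^ j /\ RtoC (IZR (chi12 (1 + 6 * - Z.of_nat j))) = (-1) ^ j.
Proof.
  assert (E : forall k, chi12 (1 + 6 * (k + 1)) = (- chi12 (1 + 6 * k))%Z).
  { intros k. rewrite <- (chi12_mod (1 + 6 * (k + 1))), <- (chi12_mod (1 + 6 * k)).
    destruct (Z.Even_or_Odd k) as [[m ->]|[m ->]].
    - replace (1 + 6 * (2 * m + 1))%Z with (7 + m * 12)%Z by ring. replace (1 + 6 * (2 * m))%Z with (1 + m * 12)%Z by ring.
      now rewrite !Z.mod_add by lia.
    - replace (1 + 6 * (2 * m + 1 + 1))%Z with (1 + (m + 1) * 12)%Z by ring. replace (1 + 6 * (2 * m + 1))%Z with (7 + m * 12)%Z by ring.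
      now rewrite !Z.mod_add by lia. }
  induction j as [|j [IH1 IH2]]; [split; reflexivity|]. rewrite Cpow_S. split.
  - rewrite Nat2Z.inj_succ. unfold Z.succ. rewrite E, opp_IZR, RtoC_opp, IH1.
    replace (RtoC (-1)) with (- RtoC 1) by (rewrite <- RtoC_opp; f_equal; lra). ring.
  - pose proof (E (- Z.of_nat (S j))%Z) as E'. replace (- Z.of_nat (S j) + 1)%Z with (- Z.of_nat j)%Z in E' by lia.
    rewrite E' in IH2. rewrite opp_IZR, RtoC_opp in IH2. rewrite <- IH2.
    replace (RtoC (-1)) with (- RtoC 1) by (rewrite <- RtoC_opp; f_equal; lra). ring.
Qed.

(** (1 + 6 k)^2/24 is 1/24 plus the pentagonal number of [k], and [chi12] alternates in sign along 1
    + 6 k. Nonnegative [k] give [pent1], negative ones [pent2]. *)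
Lemma eta_theta tau : (0 < Im tau)%R ->
  eta tau = usum (fun k : Z => RtoC (IZR (chi12 (1 + 6 * k))) * Qpow tau (IZR (1 + 6 * k) ^ 2 * / 24)).
Proof.
  intros Ht. pose proof (Qof_lt_1 tau Ht) as Hq. destruct (pent_summable _ Hq) as [S1 S2].
  unfold eta. rewrite Qpoch_pent by auto.
  assert (E1 : forall j, Qpow tau (1 / 24) * pent1 (Qof tau) j
    = RtoC (IZR (chi12 (1 + 6 * Z.of_nat j))) * Qpow tau (IZR (1 + 6 * Z.of_nat j) ^ 2 * / 24)).
  { intros j. rewrite (proj1 (chi12_6j j)). unfold pent1. rewrite <- Qpow_INR.
    replace (IZR (1 + 6 * Z.of_nat j) ^ 2 * / 24)%R with (1 / 24 + INR (j * j + tri j))%R; [rewrite Qpow_plus; ring|].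
    rewrite plus_IZR, mult_IZR, <- INR_IZR_INZ, plus_INR, mult_INR.
    pose proof (f_equal INR (tri_sqr j)) as T. rewrite mult_INR, plus_INR, mult_INR in T. simpl (INR 2) in T. lra. }
  assert (E2 : forall j, Qpow tau (1 / 24) * pent2 (Qof tau) j
    = RtoC (IZR (chi12 (1 + 6 * - Z.of_nat (S j)))) * Qpow tau (IZR (1 + 6 * - Z.of_nat (S j)) ^ 2 * / 24)).
  { intros j. rewrite (proj2 (chi12_6j (S j))). unfold pent2. rewrite <- Qpow_INR.
    replace (IZR (1 + 6 * - Z.of_nat (S j)) ^ 2 * / 24)%R with (1 / 24 + INR (S j * S j + tri j))%R; [rewrite Qpow_plus; ring|].
    rewrite plus_IZR, mult_IZR, opp_IZR, <- INR_IZR_INZ, plus_INR, mult_INR.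
    pose proof (f_equal INR (tri_sqr j)) as T. rewrite mult_INR, plus_INR, mult_INR in T. simpl (INR 2) in T.
    rewrite S_INR. lra. }
  rewrite Cmult_plus_distr_l, <- !usum_scal by auto.
  rewrite (usum_ext _ _ E1), (usum_ext _ _ E2). symmetry.
  apply (usum_Z (fun k : Z => RtoC (IZR (chi12 (1 + 6 * k))) * Qpow tau (IZR (1 + 6 * k) ^ 2 * / 24))).
  - apply summable_ext with (1 := E1). now apply summable_scal.
  - apply summable_ext with (1 := E2). now apply summable_scal.
Qed.

(** [chi12] lives on the classes 1 and 5 modulo 6, which the sign change of [n] exchanges; each
    contributes [eta]. *)
Lemma eta_double tau : (0 < Im tau)%R ->
  usum (fun n : Z => RtoC (IZR (chi12 n)) * Qpow tau (IZR n ^ 2 * / 24)) = RtoC 2 * eta tau.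
Proof.
  intros Ht. set (g := fun n : Z => RtoC (IZR (chi12 n)) * Qpow tau (IZR n ^ 2 * / 24)).
  assert (Sg : summable g).
  { apply (summable_theta_gen (fun n => RtoC (IZR (chi12 n)))); auto; [lra|].
    intros n. rewrite Cmod_R, <- abs_IZR. pose proof (chi12_abs n) as H. apply IZR_le in H.
    pose proof (Rabs_pos (IZR n)). lra. }
  assert (Cl : forall x, usum (fun n => if ((n - x) mod Z.of_nat 6 =? 0)%Z then g n else 0) = usum (fun k => g (x + k * Z.of_nat 6)%Z)).
  { intros x. apply (usum_class 6 x g); [lia|]. refine (summable_inj g (fun k => (x + k * Z.of_nat 6)%Z) _ Sg). intros; lia. }
  rewrite (usum_residues 6) by (auto; lia). unfold zseq. simpl map. rewrite !lsum_cons. simpl (lsum _ nil).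
  pose proof (Cl 0%Z) as C0. pose proof (Cl 1%Z) as C1. pose proof (Cl 2%Z) as C2. pose proof (Cl 3%Z) as C3.
  pose proof (Cl 4%Z) as C4. pose proof (Cl 5%Z) as C5. simpl Z.of_nat in *.
  rewrite C0, C1, C2, C3, C4, C5.
  assert (V : forall x, (forall k, chi12 (x + k * 6) = 0%Z) -> usum (fun k => g (x + k * 6)%Z) = 0).
  { intros x Hx. rewrite (usum_ext _ (fun k => 0 * g k)).
    - rewrite usum_scal by auto. ring.
    - intros k. unfold g. rewrite Hx. ring. }
  assert (N : forall x, (x = 0 \/ x = 2 \/ x = 3 \/ x = 4)%Z -> forall k, chi12 (x + k * 6) = 0%Z).
  { intros x Hx k. rewrite <- chi12_mod.
    destruct (Z.Even_or_Odd k) as [[m ->]|[m ->]].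
    - replace (x + 2 * m * 6)%Z with (x + m * 12)%Z by ring. rewrite Z.mod_add by lia.
      destruct Hx as [->|[->|[->| ->]]]; reflexivity.
    - replace (x + (2 * m + 1) * 6)%Z with ((x + 6) + m * 12)%Z by ring. rewrite Z.mod_add by lia.
      destruct Hx as [->|[->|[->| ->]]]; reflexivity. }
  rewrite (V 0%Z), (V 2%Z), (V 3%Z), (V 4%Z) by (apply N; auto).
  assert (S1 : summable (fun k => g (1 + k * 6)%Z)).
  { refine (summable_inj g (fun k => (1 + k * 6)%Z) _ Sg). intros; lia. }
  assert (E1 : usum (fun k => g (1 + k * 6)%Z) = eta tau).
  { rewrite eta_theta by auto. apply usum_ext. intros k. unfold g. now rewrite Z.mul_comm. }
  assert (E5 : usum (fun k => g (5 + k * 6)%Z) = eta tau).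
  { rewrite <- E1. rewrite (usum_bij (fun k => g (1 + k * 6)%Z) (fun k => (- (k + 1))%Z) (fun k => (- k - 1)%Z)); auto; try (intros; lia).
    apply usum_ext. intros k. unfold g. replace (1 + - (k + 1) * 6)%Z with (- (5 + k * 6))%Z by ring.
    rewrite chi12_opp, opp_IZR. do 2 f_equal. ring. }
  rewrite E1, E5. ring.
Qed.

(** The even theta inversion with [M = 12], [p = 1] and shift 0, where the Gauss sum cancels the
    square root. *)
Lemma eta_S w tau : (0 < Im tau)%R -> root_of_tau w tau -> eta (tauS tau) = w * eta tau.
Proof.
  intros Ht Hw.
  pose proof (gauss_theta_even 12 1 0 chi12 (RtoC (sqrt 12)) w tau ltac:(lia) ltac:(lia) Ht Hw chi12_per chi12_abs gauss_sum_12) as G.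
  assert (P12 : (0 < sqrt 12)%R) by (apply sqrt_lt_R0; lra).
  replace (12 * 1)%nat with 12%nat in G by lia. replace (INR 12) with 12%R in G by (simpl; lra).
  replace (2 * 12)%R with 24%R in G by ring.
  rewrite (usum_ext _ (fun n : Z => RtoC (IZR (chi12 n)) * Qpow (tauS tau) (IZR n ^ 2 * / 24))) in G
    by (intros s; replace (0 + s * Z.of_nat 1)%Z with s by lia; reflexivity).
  rewrite (usum_ext (fun m : Z => RtoC (IZR (chi12 m)) * ex (IZR m * (0 / 12)) * _)
     (fun n : Z => RtoC (IZR (chi12 n)) * Qpow tau (IZR n ^ 2 * / 24))) in G.
  - rewrite !eta_double in G by auto using Im_tauS.
    replace (eta (tauS tau)) with (/ RtoC 2 * (RtoC 2 * eta (tauS tau))) by (field; apply RtoC_nz; lra).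
    rewrite G. field. apply RtoC_nz; lra.
  - intros m. replace (IZR m * (0 / 12))%R with 0%R by field. rewrite ex_0. ring.
Qed.

(** * The partition generating function *)

Lemma usum_nat_S (f : nat -> C) : summable f -> usum f = f 0%nat + usum (fun n => f (S n)).
Proof.
  intros Hs. rewrite (usum_split f (0%nat :: nil)); auto; [|constructor; [easy|constructor]].
  rewrite lsum_cons. simpl (lsum f nil). rewrite Cplus_0_r. f_equal.
  set (F := fun i => if notin (0%nat :: nil) i then f i else RtoC 0).
  assert (E : forall n, F (S n) = f (S n)).
  { intros n. unfold F. rewrite (proj2 (notin_true (0%nat :: nil) (S n))); auto. intros [H|[]]. discriminate. }
  destruct (summable_usum_inj F S) as [_ ->].
  - intros; lia.
  - intros [|i] Hi; [|now destruct (Hi i)]. unfold F. destruct (notin _ _) eqn:En; auto.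
    apply notin_true in En. simpl in En. tauto.
  - apply summable_ext with (1 := fun n => eq_sym (E n)). exact (summable_inj f S eq_add_S Hs).
  - apply usum_ext. exact E.
Qed.

Lemma geom_summable q : (Cmod q < 1)%R -> summable (fun n => q ^ n).
Proof.
  intros Hq. apply summable_le with (fun n => (Cmod q ^ n)%R).
  - intros n. rewrite Cmod_pow. lra.
  - apply summableR_geom. split; auto. apply Cmod_ge_0.
Qed.

Lemma one_minus_nz q : (Cmod q < 1)%R -> 1 - q <> 0.
Proof. intros Hq. rewrite <- (Cpow_1_r q). now apply (one_minus_pow_nz q 0). Qed.

Lemma geom_usum q : (Cmod q < 1)%R -> usum (fun n => q ^ n) = / (1 - q).
Proof.
  intros Hq. pose proof (geom_summable q Hq) as S. pose proof (one_minus_nz q Hq).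
  set (u := usum (fun n => q ^ n)).
  assert (E : u = 1 + q * u).
  { unfold u at 1. rewrite (usum_nat_S _ S). f_equal. unfold u. rewrite <- usum_scal by auto. reflexivity. }
  assert (H0 : u * (1 - q) = 1).
  { replace (u * (1 - q)) with (u - q * u) by ring. rewrite E at 1. ring. }
  replace u with (u * (1 - q) / (1 - q)) by (field; auto). rewrite H0. field. auto.
Qed.

Definition gco (i n : nat) : R := if (n mod i =? 0)%nat then 1%R else 0%R.

Lemma gco_series i q : (0 < i)%nat -> (Cmod q < 1)%R ->
  summable (fun n => RtoC (gco i n) * q ^ n) /\ usum (fun n => RtoC (gco i n) * q ^ n) = / (1 - q ^ i).
Proof.
  intros Hi Hq.
  assert (Hqi : (Cmod (q ^ i) < 1)%R).
  { rewrite Cmod_pow. apply pow_lt_1_compat; auto. split; auto. apply Cmod_ge_0. }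
  assert (E : forall k, RtoC (gco i (i * k)) * q ^ (i * k) = (q ^ i) ^ k).
  { intros k. unfold gco. rewrite Nat.mul_comm, Nat.Div0.mod_mul. simpl. rewrite Nat.mul_comm, Cpow_mult_r. ring. }
  destruct (summable_usum_inj (fun n => RtoC (gco i n) * q ^ n) (fun k => (i * k)%nat)) as [S Eu].
  - intros a b H. nia.
  - intros n Hn. unfold gco. destruct (n mod i =? 0)%nat eqn:En; [|ring]. exfalso.
    apply Nat.eqb_eq, Nat.Div0.mod_divides in En. destruct En as [k ->]. now apply (Hn k).
  - apply summable_ext with (1 := fun k => eq_sym (E k)). now apply geom_summable.
  - split; auto. rewrite Eu, (usum_ext _ _ E). now apply geom_usum.
Qed.

(** Number of partitions of [n] into parts at most [N]: the coefficients of the inverse of the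
    finite Euler product. They increase with [N] and are constant from [N = n] on. *)
Fixpoint pcoef (N n : nat) : R :=
  match N with
  | O => if (n =? 0)%nat then 1%R else 0%R
  | S N' => rsum (fun k => pcoef N' k * gco (S N') (n - k))%R (seq 0 (S n))
  end.

Lemma gco_ge0 i n : (0 <= gco i n)%R.
Proof. unfold gco. destruct (_ =? 0)%nat; lra. Qed.

Lemma pcoef_ge0 N n : (0 <= pcoef N n)%R.
Proof.
  revert n. induction N as [|N IH]; intros n.
  - simpl. destruct (n =? 0)%nat; lra.
  - change (0 <= rsum (fun k => pcoef N k * gco (S N) (n - k))%R (seq 0 (S n)))%R.
    apply rsum_ge0. intros k. apply Rmult_le_pos; auto using gco_ge0.
Qed.

Lemma pcoef_S N n : pcoef (S N) n = rsum (fun k => pcoef N k * gco (S N) (n - k))%R (seq 0 (S n)).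
Proof. reflexivity. Qed.

Lemma pcoef_mono N n : (pcoef N n <= pcoef (S N) n)%R.
Proof.
  rewrite pcoef_S, rsum_seq_S, Nat.sub_diag.
  assert (gco (S N) 0 = 1%R) by (unfold gco; now rewrite Nat.Div0.mod_0_l). rewrite H, Rmult_1_r.
  pose proof (rsum_ge0 (fun k => pcoef N k * gco (S N) (n - k))%R (seq 0 n)
    (fun k => Rmult_le_pos _ _ (pcoef_ge0 N k) (gco_ge0 _ _))). lra.
Qed.

Lemma pcoef_stable N n : (n <= N)%nat -> pcoef N n = pcoef n n.
Proof.
  intros H. induction N as [|N IH].
  - now replace n with 0%nat by lia.
  - destruct (Nat.eq_dec n (S N)) as [->|Hn]; auto. rewrite <- IH by lia.
    rewrite pcoef_S, rsum_seq_S, Nat.sub_diag.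
    assert (gco (S N) 0 = 1%R) by (unfold gco; now rewrite Nat.Div0.mod_0_l). rewrite H0, Rmult_1_r.
    assert (Z : (rsum (fun k => pcoef N k * gco (S N) (n - k))%R (seq 0 n) <= 0)%R).
    { apply Rle_trans with (rsum (fun _ => 0 * 0)%R (seq 0 n)); [|rewrite rsum_scal; lra].
      apply rsum_le. intros k Hk. apply in_seq in Hk. unfold gco.
      rewrite Nat.mod_small by lia. rewrite (proj2 (Nat.eqb_neq (n - k) 0)) by lia. lra. }
    pose proof (rsum_ge0 (fun k => pcoef N k * gco (S N) (n - k))%R (seq 0 n)
      (fun k => Rmult_le_pos _ _ (pcoef_ge0 N k) (gco_ge0 _ _))). lra.
Qed.

Lemma pcoef_le N n : (pcoef N n <= pcoef n n)%R.
Proof.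
  destruct (Nat.le_gt_cases n N) as [H|H]; [rewrite pcoef_stable; auto; lra|].
  replace n with (N + (n - N))%nat at 2 by lia. generalize (n - N)%nat. intros d.
  induction d as [|d IH]; [rewrite Nat.add_0_r; lra|]. rewrite Nat.add_succ_r. pose proof (pcoef_mono (N + d) n). lra.
Qed.

Lemma pcoef_series N q : (Cmod q < 1)%R ->
  summable (fun n => RtoC (pcoef N n) * q ^ n) /\ usum (fun n => RtoC (pcoef N n) * q ^ n) = / Qpoch_partial q N.
Proof.
  intros Hq. induction N as [|N [IHs IHe]].
  - destruct (usum_finite (fun n => RtoC (pcoef 0 n) * q ^ n) (0%nat :: nil)) as [S E].
    + constructor; [easy|constructor].
    + intros [|n] Hn; [exfalso; apply Hn; now left|]. simpl. ring.
    + split; auto. rewrite E. simpl. field.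
  - destruct (gco_series (S N) q ltac:(lia) Hq) as [Gs Ge].
    destruct (cauchy_product _ _ q IHs Gs) as [Cs Ce]. cbv zeta in Cs, Ce.
    assert (E : forall n, lsum (fun k => RtoC (pcoef N k) * RtoC (gco (S N) (n - k))) (seq 0 (S n)) * q ^ n
      = RtoC (pcoef (S N) n) * q ^ n).
    { intros n. rewrite pcoef_S, <- lsum_RtoC. f_equal. apply lsum_ext_in. intros; now rewrite RtoC_mult. }
    split.
    + apply summable_ext with (1 := E). exact Cs.
    + rewrite <- (usum_ext _ _ E), Ce, IHe, Ge, Qpoch_partial_S. field.
      split; [now apply one_minus_pow_nz|now apply Qpoch_partial_nz].
Qed.

(** With x = r^(N+1), 1/(1 - x) = 1 + x/(1 - x) <= exp (r^N/(1 - r)), and the exponents form a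
    geometric series. *)
Lemma Qpoch_inv_bound r N : (0 <= r < 1)%R -> (Cmod (/ Qpoch_partial (RtoC r) N) <= exp (1 / (1 - r) * (1 / (1 - r))))%R.
Proof.
  intros Hr. assert (Hq : (Cmod (RtoC r) < 1)%R) by (rewrite Cmod_R, Rabs_pos_eq; lra).
  assert (P : (0 < 1 / (1 - r))%R) by (apply Rdiv_lt_0_compat; lra).
  apply Rle_trans with (exp (1 / (1 - r) * rsum (fun i => r ^ i)%R (seq 0 N))).
  - induction N as [|N IH].
    + simpl. rewrite Rmult_0_r, exp_0. replace (/ RtoC 1) with (RtoC 1) by field. rewrite Cmod_1. lra.
    + rewrite Qpoch_partial_S, rsum_seq_S, Rmult_plus_distr_l, exp_plus.
      pose proof (Qpoch_partial_nz _ N Hq). pose proof (one_minus_pow_nz _ N Hq) as N1.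
      replace (/ (Qpoch_partial (RtoC r) N * (1 - RtoC r ^ S N))) with
        (/ Qpoch_partial (RtoC r) N * / (1 - RtoC r ^ S N)) by (field; auto).
      rewrite Cmod_mult. apply Rmult_le_compat; auto using Cmod_ge_0.
      rewrite Cmod_inv by auto.
      rewrite <- RtoC_pow, <- RtoC_minus, Cmod_R in *.
      assert (B : (0 <= r ^ S N <= r)%R).
      { split; [apply pow_le; lra|]. pose proof (pow_le_pow r 1 (S N) ltac:(lra) ltac:(lia)). lra. }
      assert (B' : (r ^ S N <= r ^ N)%R) by (apply pow_le_pow; [lra|lia]).
      rewrite Rabs_pos_eq by lra. eapply Rle_trans; [|apply exp_ineq1_le].
      set (x := (r ^ S N)%R) in *.
      assert (/ (1 - x) = 1 + x * / (1 - x))%R by (field; lra). rewrite H0.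
      apply Rplus_le_compat_l. rewrite Rmult_comm. apply Rmult_le_compat; try lra.
      * left. apply Rinv_0_lt_compat. lra.
      * unfold Rdiv. rewrite Rmult_1_l. apply Rinv_le_contravar; lra.
  - apply exp_le_compat, Rmult_le_compat_l; [lra|]. now apply geom_partial.
Qed.

Definition part (n : nat) : C := RtoC (pcoef n n).

(** By positivity and stability, the first [K] terms at radius [r] are bounded by the whole series
    of the inverse of the [K]-th product, hence by a bound independent of [K]. This also gives the
    nonvanishing of the Euler product, in [Qpoch_nz]. *)
Lemma part_conv1 : conv1 part.
Proof.
  intros q Hq. set (r := Cmod q). assert (Hr : (0 <= r < 1)%R) by (split; [apply Cmod_ge_0|auto]).
  assert (Hq' : (Cmod (RtoC r) < 1)%R) by (rewrite Cmod_R, Rabs_pos_eq; lra).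
  apply summable_le with (fun n => (pcoef n n * r ^ n)%R).
  - intros n. unfold part. rewrite Cmod_mult, Cmod_pow, Cmod_R, Rabs_pos_eq by apply pcoef_ge0. apply Rle_refl.
  - apply summableR_nat with (exp (1 / (1 - r) * (1 / (1 - r)))).
    + intros n. apply Rmult_le_pos; [apply pcoef_ge0|apply pow_le; lra].
    + intros K. destruct (pcoef_series K (RtoC r) Hq') as [S E].
      eapply Rle_trans; [|apply (Qpoch_inv_bound r K Hr)]. rewrite <- E.
      eapply Rle_trans; [|apply re_le_Cmod]. eapply Rle_trans; [|apply Rle_abs].
      rewrite (usum_ext _ (fun n => RtoC (pcoef K n * r ^ n))) in * by (intros; now rewrite RtoC_mult, RtoC_pow).
      apply le_epsilon. intros eps He.
      assert (S' : summable (fun n => RtoC (pcoef K n * r ^ n))).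
      { apply summable_ext with (2 := S). intros; now rewrite RtoC_mult, RtoC_pow. }
      destruct (summable_is_usum _ S' eps He) as (l0 & N0 & L0).
      destruct (common_nodup l0 (seq 0 K)) as (l & N & I1 & I2).
      specialize (L0 l N I1). rewrite lsum_RtoC in L0.
      pose proof (rsum_incl (fun n => pcoef K n * r ^ n)%R (seq 0 K) l
        (fun n => Rmult_le_pos _ _ (pcoef_ge0 K n) (pow_le _ _ (proj1 Hr))) (seq_NoDup _ _) N I2) as B.
      assert (rsum (fun n => pcoef n n * r ^ n)%R (seq 0 K) <= rsum (fun n => pcoef K n * r ^ n)%R (seq 0 K))%R.
      { apply rsum_le. intros n Hn. apply in_seq in Hn. rewrite (pcoef_stable K n) by lia. lra. }
      set (u := usum (fun n => RtoC (pcoef K n * r ^ n))) in *.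
      pose proof (re_le_Cmod (RtoC (rsum (fun n => pcoef K n * r ^ n)%R l) - u)) as T.
      replace (Re (RtoC (rsum (fun n => pcoef K n * r ^ n)%R l) - u)) with (rsum (fun n => pcoef K n * r ^ n)%R l - Re u)%R in T
        by (unfold Re; simpl; ring).
      apply Rabs_le_between in T. lra.
Qed.

Definition Bser (q : C) : C := psum part q.

Lemma pcoef_tannery (c : nat -> C) q : (Cmod q < 1)%R -> (forall n, (Cmod (c n) <= 1 + INR n)%R) ->
  Climseq (fun N => usum (fun n => c n * (RtoC (pcoef N n) * q ^ n))) (usum (fun n => c n * (part n * q ^ n))).
Proof.
  intros Hq Hc.
  destruct (Climseq_usum (fun N n => c n * (RtoC (pcoef N n) * q ^ n)) (fun n => c n * (part n * q ^ n))
    (fun n => Cmod (part n) * (1 + INR n) ^ 2 * Cmod q ^ n)%R) as [_ L]; auto.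
  - intros N n. rewrite !Cmod_mult, Cmod_pow. unfold part. rewrite !Cmod_R, !Rabs_pos_eq by apply pcoef_ge0.
    rewrite <- Rmult_assoc. apply Rmult_le_compat_r; [apply pow_le, Cmod_ge_0|].
    rewrite Rmult_comm. apply Rmult_le_compat; auto using Cmod_ge_0, pcoef_ge0, pcoef_le.
    eapply Rle_trans; [apply Hc|]. pose proof (pos_INR n). nra.
  - apply conv1_sqr; [apply part_conv1|]. split; auto. apply Cmod_ge_0.
  - intros n. apply Climseq_ext_ev with (2 := Climseq_const _). exists n. intros N HN.
    unfold part. now rewrite (pcoef_stable N n).
Qed.

Lemma Bser_lim q : (Cmod q < 1)%R -> Climseq (fun N => / Qpoch_partial q N) (Bser q).
Proof.
  intros Hq.
  assert (H1 : forall n : nat, (Cmod (RtoC 1) <= 1 + INR n)%R) by (intros n; rewrite Cmod_1; pose proof (pos_INR n); lra).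
  pose proof (pcoef_tannery (fun _ => RtoC 1) q Hq H1) as L.
  unfold Bser, psum. rewrite (usum_ext _ (fun n => 1 * (part n * q ^ n))) by (intros; ring).
  apply Climseq_ext_ev with (2 := L).
  exists 0%nat. intros N _. rewrite <- (proj2 (pcoef_series N q Hq)). apply usum_ext. intros; ring.
Qed.

Lemma Qpoch_Bser q : (Cmod q < 1)%R -> Qpoch q * Bser q = 1.
Proof.
  intros Hq. rewrite Qpoch_pent by auto.
  pose proof (Climseq_mult _ _ _ _ (pentagonal q Hq) (Bser_lim q Hq)) as L.
  apply Climseq_unique with (1 := L). apply Climseq_ext_ev with (2 := Climseq_const _).
  exists 0%nat. intros N _. field. now apply Qpoch_partial_nz.
Qed.

Lemma Qpoch_nz q : (Cmod q < 1)%R -> Qpoch q <> 0.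
Proof. intros Hq E. pose proof (Qpoch_Bser q Hq) as H. rewrite E, Cmult_0_l in H. now apply C1_nz. Qed.

Lemma Bser_inv q : (Cmod q < 1)%R -> / Qpoch q = Bser q.
Proof.
  intros Hq. rewrite <- (Cmult_1_r (/ Qpoch q)), <- (Qpoch_Bser q Hq). field. now apply Qpoch_nz.
Qed.

Lemma DS_Bser : DS Bser.
Proof. exists part. split; [apply part_conv1|reflexivity]. Qed.

(* Meaningful for [k >= 1] only. *)
Definition lam (q : C) (k : nat) : C := q ^ k / (1 - q ^ k).

Lemma lam_bound q k : (Cmod q < 1)%R -> (Cmod (lam q (S k)) <= 1 / (1 - Cmod q) * Cmod q ^ S k)%R.
Proof.
  intros Hq. unfold lam. pose proof (Cmod_ge_0 q) as Q0.
  rewrite Cmod_div, Cmod_pow by now apply one_minus_pow_nz.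
  rewrite Rmult_comm. unfold Rdiv at 1 2. rewrite Rmult_1_l.
  apply Rmult_le_compat_l; [now apply pow_le|]. apply Rinv_le_contravar; [lra|].
  pose proof (Cmod_triangle (1 - q ^ S k) (q ^ S k)) as T.
  replace (1 - q ^ S k + q ^ S k) with (RtoC 1) in T by ring. rewrite Cmod_1, Cmod_pow in T.
  pose proof (pow_le_pow (Cmod q) 1 (S k) ltac:(lra) ltac:(lia)). lra.
Qed.

(** * Lambert series and the logarithmic derivative of the Euler product *)

Lemma summableR_poly_geom d x : (0 <= x < 1)%R -> summableR (fun n : nat => (1 + INR n) ^ d * x ^ n)%R.
Proof.
  revert x. induction d as [|d IH]; intros x Hx.
  - apply summableR_le with (2 := summableR_geom x Hx). intros n. simpl. lra.
  - set (s := sqrt x). assert (Es : (s * s = x)%R) by (apply sqrt_sqrt; lra).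
    assert (Hs : (0 <= s < 1)%R).
    { split; [apply sqrt_pos|]. rewrite <- sqrt_1. apply sqrt_lt_1; lra. }
    destruct (summableR_bounded (fun n : nat => (1 + INR n) ^ 2 * s ^ n)%R) as (M & M0 & HM).
    + intros n. apply Rmult_le_pos; [apply pow2_ge_0|apply pow_le; lra].
    + now apply summableR_sqr_geom.
    + apply summableR_le with (fun n => M * ((1 + INR n) ^ d * s ^ n))%R.
      * intros n. specialize (HM n). rewrite <- Es, Rpow_mult_distr. simpl ((1 + INR n) ^ S d)%R.
        assert (P : (0 <= (1 + INR n) ^ d * s ^ n)%R).
        { apply Rmult_le_pos; apply pow_le; [pose proof (pos_INR n)|]; lra. }
        replace ((1 + INR n) * (1 + INR n) ^ d * (s ^ n * s ^ n))%R with ((1 + INR n) * s ^ n * ((1 + INR n) ^ d * s ^ n))%R by ring.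
        apply Rmult_le_compat_r; auto. eapply Rle_trans; [|exact HM].
        apply Rmult_le_compat_r; [apply pow_le; lra|]. pose proof (pos_INR n). nra.
      * now apply summableR_scal, IH.
Qed.

Lemma lam_summable (c : nat -> C) d q : (Cmod q < 1)%R -> (forall n, (Cmod (c n) <= (1 + INR n) ^ d)%R) ->
  summable (fun n => c n * lam q (S n)).
Proof.
  intros Hq Hc. pose proof (Cmod_ge_0 q) as Q0.
  apply summable_le with (fun n => (1 / (1 - Cmod q)) * ((1 + INR n) ^ d * Cmod q ^ n))%R.
  - intros n. rewrite Cmod_mult. pose proof (lam_bound q n Hq) as B.
    assert (P : (0 < 1 / (1 - Cmod q))%R) by (apply Rdiv_lt_0_compat; lra).
    pose proof (pow_le_pow (Cmod q) n (S n) ltac:(lra) ltac:(lia)).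
    assert (B' : (Cmod (lam q (S n)) <= 1 / (1 - Cmod q) * Cmod q ^ n)%R).
    { eapply Rle_trans; [exact B|]. apply Rmult_le_compat_l; lra. }
    replace (1 / (1 - Cmod q) * ((1 + INR n) ^ d * Cmod q ^ n))%R with
      ((1 + INR n) ^ d * (1 / (1 - Cmod q) * Cmod q ^ n))%R by ring.
    apply Rmult_le_compat; auto using Cmod_ge_0.
  - apply summableR_scal; [apply Rlt_le, Rdiv_lt_0_compat; lra|]. apply summableR_poly_geom. lra.
Qed.

(** Lambert series: the generating function of the divisor sums sigma_d. *)
Definition Lsum (d : nat) (q : C) : C := usum (fun n => RtoC (INR (S n) ^ d) * lam q (S n)).

Lemma INR_pow_bound d n : (Cmod (RtoC (INR (S n) ^ d)) <= (1 + INR n) ^ d)%R.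
Proof.
  rewrite Cmod_R, Rabs_pos_eq by (apply pow_le, pos_INR). rewrite S_INR, Rplus_comm. lra.
Qed.

Lemma Lsum_summable d q : (Cmod q < 1)%R -> summable (fun n => RtoC (INR (S n) ^ d) * lam q (S n)).
Proof. intros Hq. apply lam_summable with d; auto using INR_pow_bound. Qed.

(** Logarithmic differentiation: the factor 1 - q^n contributes n q^n/(1 - q^n) to the inverse
    product. *)
Lemma Cder_Qpoch_inv q N : (Cmod q < 1)%R -> exists d, Cder (fun z => / Qpoch_partial z N) q d /\
  q * d = / Qpoch_partial q N * lsum (fun n => RtoC (INR (S n) ^ 1) * lam q (S n)) (seq 0 N).
Proof.
  intros Hq. induction N as [|N (d & D & E)].
  - exists 0. split; [|simpl; ring]. exact (Cder_const (/ RtoC 1) q).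
  - pose proof (Qpoch_partial_nz q N Hq) as N0. pose proof (one_minus_pow_nz q N Hq) as N1.
    pose proof (Cder_minus _ _ _ _ _ (Cder_const 1 q) (Cder_pow (S N) q)) as D1.
    pose proof (Cder_comp Cinv _ q _ _ (Cder_inv _ N1) D1) as D2.
    pose proof (Cder_mult _ _ _ _ _ D D2) as D3.
    eexists. split.
    + apply Cder_ext_loc with (3 := D3) (delta := (1 - Cmod q)%R); [lra|].
      intros w Hw. apply disc_ball in Hw; auto. rewrite Qpoch_partial_S. field.
      split; [now apply one_minus_pow_nz|now apply Qpoch_partial_nz].
    + cbv beta. rewrite seq_S, lsum_app, (lsum_cons _ _ nil). simpl (lsum _ nil). simpl (0 + N)%nat.
      rewrite Cmult_plus_distr_l, (Cmult_assoc q d), E, Qpoch_partial_S.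
      replace (S N - 1)%nat with N by lia. unfold lam. rewrite pow_1, Cpow_S. field. rewrite <- Cpow_S. auto.
Qed.

(** The derivative is passed to the limit on coefficients, where Tannery's theorem applies because
    [pcoef] is dominated by [part]; no theorem on limits of holomorphic functions is involved. *)
Lemma Bser_euler q : (Cmod q < 1)%R -> psum (fun n => RtoC (INR n) * part n) q = Bser q * Lsum 1 q.
Proof.
  intros Hq.
  assert (L1 : Climseq (fun N => usum (fun n => RtoC (INR n) * (RtoC (pcoef N n) * q ^ n))) (psum (fun n => RtoC (INR n) * part n) q)).
  { unfold psum. rewrite (usum_ext _ (fun n => RtoC (INR n) * (part n * q ^ n))) by (intros; ring).
    apply pcoef_tannery; auto. intros n. rewrite Cmod_R, Rabs_pos_eq by apply pos_INR. lra. }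
  pose proof (Climseq_mult _ _ _ _ (Bser_lim q Hq) (Climseq_partial _ (Lsum_summable 1 q Hq))) as L2.
  apply Climseq_unique with (1 := L1). apply Climseq_ext_ev with (2 := L2). exists 0%nat. intros N _.
  destruct (Cder_Qpoch_inv q N Hq) as (d & D & E). rewrite <- E.
  assert (Ca : conv1 (fun n => RtoC (pcoef N n))) by (intros z Hz; now apply pcoef_series).
  destruct (psum_Cder _ q Ca Hq) as (d' & D' & E').
  assert (d = d').
  { apply Cder_unique with (1 := D). apply Cder_ext_loc with (3 := D') (delta := (1 - Cmod q)%R); [lra|].
    intros w Hw. apply disc_ball in Hw; auto. now apply pcoef_series. }
  rewrite H, E'. apply usum_ext. intros n. ring.
Qed.

Lemma Cder_Bser q : (Cmod q < 1)%R -> exists d, Cder Bser q d /\ q * d = Bser q * Lsum 1 q.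
Proof. intros Hq. rewrite <- Bser_euler by auto. apply psum_Cder; auto. apply part_conv1. Qed.

(** * Collecting equal powers *)

Section Collect.

Context {I : Type} (c : I -> C) (e : I -> nat).
Hypothesis e_fin : forall n, exists l, NoDup l /\ forall i, e i = n -> In i l.
Hypothesis c_sum : forall q, (Cmod q < 1)%R -> summable (fun i => c i * q ^ e i).

Lemma collect_fibre_summable n (d : I -> C) : summable (fibre e d n).
Proof.
  destruct (e_fin n) as (l & N & Hl). apply (usum_finite (fibre e d n) l N).
  intros i Hi. unfold fibre. destruct (classic_eq_dec (e i) n); auto. exfalso; auto.
Qed.

(** Each exponent is attained finitely often, so coefficients of equal powers may be added; a family
    of monomials over any index type thereby becomes a power series. *)
Lemma collect : conv1 (fun n => usum (fibre e c n)) /\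
  forall q, (Cmod q < 1)%R -> usum (fun i => c i * q ^ e i) = psum (fun n => usum (fibre e c n)) q.
Proof.
  assert (E : forall q n, usum (fibre e (fun i => c i * q ^ e i) n) = usum (fibre e c n) * q ^ n).
  { intros q n. rewrite Cmult_comm, <- usum_scal by apply collect_fibre_summable.
    apply usum_ext. intros i. unfold fibre. destruct (classic_eq_dec (e i) n) as [<-|]; ring. }
  split; intros q Hq; destruct (usum_fibre e _ (c_sum q Hq)) as [S1 E1].
  - apply summable_ext with (2 := S1). apply E.
  - rewrite E1. apply usum_ext. apply E.
Qed.

Lemma DS_collect : DS (fun q => usum (fun i => c i * q ^ e i)).
Proof. eexists. exact collect. Qed.

End Collect.

Lemma Cder_collect {I : Type} (c : I -> C) (e : I -> nat) :
  (forall n, exists l, NoDup l /\ forall i, e i = n -> In i l) ->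
  (forall q, (Cmod q < 1)%R -> summable (fun i => c i * q ^ e i)) ->
  (forall q, (Cmod q < 1)%R -> summable (fun i => RtoC (INR (e i)) * c i * q ^ e i)) ->
  forall q, (Cmod q < 1)%R -> exists d, Cder (fun q => usum (fun i => c i * q ^ e i)) q d /\
    q * d = usum (fun i => RtoC (INR (e i)) * c i * q ^ e i).
Proof.
  intros Hf S1 S2 q Hq. destruct (collect c e Hf S1) as [C1 E1].
  destruct (collect (fun i => RtoC (INR (e i)) * c i) e Hf S2) as [C2 E2].
  destruct (psum_Cder _ q C1 Hq) as (d & D & Ed). exists d. split.
  - apply Cder_ext_loc with (3 := D) (delta := (1 - Cmod q)%R); [lra|].
    intros w Hw. apply disc_ball in Hw; auto. symmetry. now apply E1.
  - rewrite Ed, E2 by auto. apply usum_ext. intros n. f_equal.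
    rewrite <- usum_scal by (apply collect_fibre_summable; auto).
    apply usum_ext. intros i. unfold fibre. destruct (classic_eq_dec (e i) n) as [<-|]; ring.
Qed.

(** * Lambert series *)

(** Pairs of positive factors, each shifted by one; the fibre over [n] corresponds to the
    factorizations of [n]. *)
Definition pair_exp (p : nat * nat) : nat := (S (fst p) * S (snd p))%nat.

Lemma pair_exp_fin n : exists l, NoDup l /\ forall p, pair_exp p = n -> In p l.
Proof.
  exists (list_prod (seq 0 n) (seq 0 n)). split; [apply NoDup_list_prod; apply seq_NoDup|].
  intros [a b] <-. unfold pair_exp. simpl fst. simpl snd. apply in_prod_iff. rewrite !in_seq. nia.
Qed.

Lemma pair_exp_summable i j q : (Cmod q < 1)%R ->
  summable (fun p => RtoC (INR (S (fst p)) ^ i) * RtoC (INR (S (snd p)) ^ j) * q ^ pair_exp p).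
Proof.
  intros Hq. pose proof (Cmod_ge_0 q) as Q0.
  assert (S0 : forall d, summable (fun n : nat => RtoC ((1 + INR n) ^ d * Cmod q ^ n))).
  { intros d. apply summable_le with (2 := summableR_poly_geom d (Cmod q) (conj Q0 Hq)).
    intros n. rewrite Cmod_R, Rabs_pos_eq; [lra|]. apply Rmult_le_pos; apply pow_le; [pose proof (pos_INR n); lra|auto]. }
  apply summableR_le with (2 := summable_mult _ _ (S0 i) (S0 j)).
  intros [a b]. simpl fst. simpl snd. rewrite !Cmod_mult, Cmod_pow, !Cmod_R, !S_INR.
  pose proof (pos_INR a). pose proof (pos_INR b).
  assert (Pa : (0 <= (1 + INR a) ^ i)%R) by (apply pow_le; lra).
  assert (Pb : (0 <= (1 + INR b) ^ j)%R) by (apply pow_le; lra).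
  assert (Qa : (0 <= Cmod q ^ a)%R) by (now apply pow_le). assert (Qb : (0 <= Cmod q ^ b)%R) by (now apply pow_le).
  rewrite !(Rplus_comm _ 1), !Rabs_pos_eq by (auto; now apply Rmult_le_pos).
  assert (B : (Cmod q ^ pair_exp (a, b) <= Cmod q ^ a * Cmod q ^ b)%R).
  { rewrite <- pow_add. apply pow_le_pow; [lra|]. unfold pair_exp. simpl fst. simpl snd. nia. }
  replace ((1 + INR a) ^ i * Cmod q ^ a * ((1 + INR b) ^ j * Cmod q ^ b))%R with
    ((1 + INR a) ^ i * (1 + INR b) ^ j * (Cmod q ^ a * Cmod q ^ b))%R by ring.
  apply Rmult_le_compat_l; auto. now apply Rmult_le_pos.
Qed.

Lemma pow_S_lt_1 q k : (Cmod q < 1)%R -> (Cmod (q ^ S k) < 1)%R.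
Proof. intros Hq. rewrite Cmod_pow. apply pow_lt_1_compat; [split; auto; apply Cmod_ge_0|lia]. Qed.

Lemma lam_geom q k : (Cmod q < 1)%R -> usum (fun b => q ^ (S k * S b)) = lam q (S k).
Proof.
  intros Hq. pose proof (pow_S_lt_1 q k Hq) as Hx.
  rewrite (usum_ext _ (fun b => q ^ S k * (q ^ S k) ^ b)) by (intros b; rewrite Cpow_mult_r; reflexivity).
  rewrite usum_scal, geom_usum by auto using geom_summable. reflexivity.
Qed.

Lemma geom_sqr q : (Cmod q < 1)%R -> summable (fun n => RtoC (INR (S n)) * q ^ n) /\
  usum (fun n => RtoC (INR (S n)) * q ^ n) = / (1 - q) * / (1 - q).
Proof.
  intros Hq. pose proof (geom_summable q Hq) as S0.
  assert (S1 : summable (fun n => 1 * q ^ n)) by (apply summable_ext with (2 := S0); intros; ring).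
  destruct (cauchy_product (fun _ => RtoC 1) (fun _ => RtoC 1) q S1 S1) as [S2 E2]. cbv zeta in *.
  assert (E : forall n, lsum (fun _ => 1 * 1) (seq 0 (S n)) * q ^ n = RtoC (INR (S n)) * q ^ n).
  { intros n. rewrite lsum_const, length_seq. ring. }
  split; [now apply summable_ext with (1 := E)|].
  rewrite <- (usum_ext _ _ E), E2, (usum_ext _ (fun n => q ^ n)) by (intros; ring).
  now rewrite geom_usum.
Qed.

Lemma lam_geom_sqr q k : (Cmod q < 1)%R ->
  usum (fun b => RtoC (INR (S b)) * q ^ (S k * S b)) = lam q (S k) + lam q (S k) ^ 2.
Proof.
  intros Hq. pose proof (pow_S_lt_1 q k Hq) as Hx. destruct (geom_sqr _ Hx) as [S1 E1].
  rewrite (usum_ext _ (fun b => q ^ S k * (RtoC (INR (S b)) * (q ^ S k) ^ b))) by (intros b; rewrite Cpow_mult_r, (Cpow_S (q ^ S k)); ring).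
  rewrite usum_scal, E1 by auto. unfold lam. field. now apply one_minus_pow_nz.
Qed.

Lemma Lsum_pairs d q : (Cmod q < 1)%R ->
  Lsum d q = usum (fun p => RtoC (INR (S (fst p)) ^ d) * RtoC (INR (S (snd p)) ^ 0) * q ^ pair_exp p).
Proof.
  intros Hq. destruct (usum_prod _ (pair_exp_summable d 0 q Hq)) as (S1 & _ & ->).
  apply usum_ext. intros a. simpl fst. simpl snd. rewrite <- lam_geom by auto.
  assert (S2 : summable (fun b => q ^ (S a * S b))).
  { assert (N : RtoC (INR (S a) ^ d) <> 0) by (apply RtoC_nz, pow_nonzero, not_0_INR; lia).
    apply summable_ext with (2 := summable_scal (/ RtoC (INR (S a) ^ d)) _ (S1 a)).
    intros b. simpl fst. simpl snd. unfold pair_exp. simpl fst. simpl snd. simpl ((INR (S b)) ^ 0)%R. field. auto. }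
  rewrite <- usum_scal by auto. apply usum_ext. intros b. unfold pair_exp. simpl fst. simpl snd.
  simpl ((INR (S b)) ^ 0)%R. ring.
Qed.

(** Image of [Lsum 1] under the Euler operator, which takes x/(1 - x) with x = q^n to n times itself
    plus its square. *)
Definition DLsum (q : C) : C := usum (fun n => RtoC (INR (S n) ^ 2) * (lam q (S n) + lam q (S n) ^ 2)).

Lemma Cder_Lsum q : (Cmod q < 1)%R -> exists d, Cder (Lsum 1) q d /\ q * d = DLsum q.
Proof.
  intros Hq.
  assert (E : forall q p, RtoC (INR (pair_exp p)) * (RtoC (INR (S (fst p)) ^ 1) * RtoC (INR (S (snd p)) ^ 0)) * q ^ pair_exp p
     = RtoC (INR (S (fst p)) ^ 2) * RtoC (INR (S (snd p)) ^ 1) * q ^ pair_exp p).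
  { intros z p. f_equal. rewrite <- !RtoC_mult. f_equal. unfold pair_exp. rewrite mult_INR. ring. }
  destruct (Cder_collect (fun p => RtoC (INR (S (fst p)) ^ 1) * RtoC (INR (S (snd p)) ^ 0)) pair_exp pair_exp_fin) with (q := q) as (d & D & Ed); auto.
  - intros; now apply pair_exp_summable.
  - intros z Hz. apply summable_ext with (1 := fun p => eq_sym (E z p)). now apply pair_exp_summable.
  - exists d. split.
    + apply Cder_ext_loc with (3 := D) (delta := (1 - Cmod q)%R); [lra|].
      intros w Hw. apply disc_ball in Hw; auto. symmetry. now apply Lsum_pairs.
    + rewrite Ed, (usum_ext _ _ (E q)). destruct (usum_prod _ (pair_exp_summable 2 1 q Hq)) as (S1 & _ & ->).
      apply usum_ext. intros a. simpl fst. simpl snd. rewrite <- lam_geom_sqr by auto.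
      assert (N : RtoC (INR (S a) ^ 2) <> 0) by (apply RtoC_nz, pow_nonzero, not_0_INR; lia).
      assert (S2 : summable (fun b => RtoC (INR (S b)) * q ^ (S a * S b))).
      { apply summable_ext with (2 := summable_scal (/ RtoC (INR (S a) ^ 2)) _ (S1 a)).
        intros b. unfold pair_exp. simpl fst. simpl snd. rewrite pow_1. field. auto. }
      rewrite <- usum_scal by auto. apply usum_ext. intros b. unfold pair_exp. simpl fst. simpl snd.
      rewrite pow_1. ring.
Qed.

Lemma sigma3_fibre n : usum (fibre pair_exp (fun p => RtoC (INR (S (fst p)) ^ 3) * RtoC (INR (S (snd p)) ^ 0)) (S n))
  = RtoC (INR (sigma3 (S n))).
Proof.
  set (L := filter (fun d => (S n) mod d =? 0)%nat (seq 1 (S n))).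
  assert (HL : forall d, In d L <-> (1 <= d <= S n)%nat /\ exists k, S n = (k * d)%nat).
  { intros d. unfold L. rewrite filter_In, in_seq, Nat.eqb_eq. split.
    - intros [H1 H2]. split; [lia|]. apply Nat.Div0.mod_divides in H2. destruct H2 as [k Hk]. exists k. lia.
    - intros [H1 [k Hk]]. split; [lia|]. rewrite Hk. apply Nat.Div0.mod_mul. }
  destruct (usum_finite (fibre pair_exp (fun p => RtoC (INR (S (fst p)) ^ 3) * RtoC (INR (S (snd p)) ^ 0)) (S n))
    (map (fun d => (d - 1, (S n) / d - 1)%nat) L)) as [_ ->].
  - apply NoDup_map_NoDup_ForallPairs; [|apply NoDup_filter, seq_NoDup].
    intros a b Ha Hb E. apply HL in Ha, Hb. injection E as E _. lia.
  - intros [a b] H. unfold fibre. destruct (classic_eq_dec _ _) as [e|]; auto. exfalso. apply H.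
    unfold pair_exp in e. simpl in e. apply in_map_iff. exists (S a). split.
    + replace (S n) with (S b * S a)%nat by nia. rewrite Nat.div_mul by lia. f_equal; lia.
    + apply HL. split; [nia|]. exists (S b). nia.
  - rewrite lsum_map. unfold sigma3. fold L.
    assert (K : forall l, incl l L -> lsum (fun d => fibre pair_exp (fun p => RtoC (INR (S (fst p)) ^ 3) * RtoC (INR (S (snd p)) ^ 0))
       (S n) (d - 1, S n / d - 1)%nat) l = RtoC (INR (list_sum (map (fun d => d ^ 3)%nat l)))).
    { induction l as [|d l IH]; intros Hi; [reflexivity|].
      rewrite lsum_cons, IH by (intros x Hx; apply Hi; now right).
      change (list_sum (map (fun d => d ^ 3)%nat (d :: l))) with (d ^ 3 + list_sum (map (fun d => d ^ 3)%nat l))%nat.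
      rewrite plus_INR, RtoC_plus. f_equal. specialize (Hi d (or_introl eq_refl)). apply HL in Hi. destruct Hi as [H1 [k Hk]].
      unfold fibre. destruct (classic_eq_dec _ _) as [e|ne].
      - simpl fst. simpl snd. simpl (INR (S (S n / d - 1)) ^ 0)%R. rewrite Cmult_1_r, pow_INR. do 3 f_equal. lia.
      - exfalso. apply ne. unfold pair_exp. simpl fst. simpl snd. rewrite Hk, Nat.div_mul by lia. nia. }
    apply K, incl_refl.
Qed.

Lemma E4_Lsum tau : (0 < Im tau)%R -> E4 tau = 1 + RtoC 240 * Lsum 3 (Qof tau).
Proof.
  intros Ht. pose proof (Qof_lt_1 tau Ht) as Hq. unfold E4. f_equal. f_equal.
  destruct (collect _ pair_exp pair_exp_fin (fun q Hq => pair_exp_summable 3 0 q Hq)) as [C1 E1].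
  rewrite Lsum_pairs, E1 by auto. unfold psum. specialize (C1 _ Hq).
  rewrite (usum_nat_S _ C1).
  assert (Z0 : usum (fibre pair_exp (fun p => RtoC (INR (S (fst p)) ^ 3) * RtoC (INR (S (snd p)) ^ 0)) 0%nat) = 0).
  { apply (usum_finite _ nil); [constructor|]. intros [a b] _. unfold fibre. destruct (classic_eq_dec _ _); auto.
    unfold pair_exp in *. simpl in *. lia. }
  rewrite Z0, Cmult_0_l, Cplus_0_l.
  assert (E : forall n, usum (fibre pair_exp (fun p => RtoC (INR (S (fst p)) ^ 3) * RtoC (INR (S (snd p)) ^ 0)) (S n)) * Qof tau ^ S n
     = RtoC (INR (sigma3 (S n))) * Qof tau ^ S n) by (intros n; now rewrite sigma3_fibre).
  rewrite (usum_ext _ _ E). apply CSeries_usum. apply summable_ext with (1 := E).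
  exact (summable_inj _ S eq_add_S C1).
Qed.

Lemma usum_diag (F : nat * nat -> C) : summable F ->
  summable (fun t => lsum (fun a => F (a, (t - a)%nat)) (seq 0 (S t))) /\
  usum F = usum (fun t => lsum (fun a => F (a, (t - a)%nat)) (seq 0 (S t))).
Proof.
  intros SF. destruct (usum_fibre (fun p : nat * nat => (fst p + snd p)%nat) F SF) as [S1 E1].
  assert (E : forall n, usum (fibre (fun p : nat * nat => (fst p + snd p)%nat) F n) = lsum (fun a => F (a, (n - a)%nat)) (seq 0 (S n))).
  { intros n. destruct (usum_finite (fibre (fun p : nat * nat => (fst p + snd p)%nat) F n)
      (map (fun k => (k, (n - k)%nat)) (seq 0 (S n)))) as [_ ->].
    - apply FinFun.Injective_map_NoDup; [intros x y E; congruence|apply seq_NoDup].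
    - intros [x y] H. unfold fibre. destruct (classic_eq_dec _ _) as [e|]; auto. simpl in e. exfalso. apply H.
      apply in_map_iff. exists x. split; [f_equal; lia|apply in_seq; lia].
    - rewrite lsum_map. apply lsum_ext_in. intros k Hk. apply in_seq in Hk. unfold fibre.
      destruct (classic_eq_dec _ _) as [e|ne]; [reflexivity|exfalso; apply ne; simpl; lia]. }
  split; [now apply summable_ext with (1 := E)|]. rewrite E1. now apply usum_ext.
Qed.

(** * Ramanujan's differential equation for [E2] *)

(** The addition rule that drives the whole computation: a product of two terms is linear in terms
    at the sum of the indices. *)
Lemma lam_mul q m n : (Cmod q < 1)%R ->
  lam q (S m) * lam q (S n) = lam q (S m + S n) * (1 + lam q (S m) + lam q (S n)).
Proof.
  intros Hq. unfold lam.
  pose proof (one_minus_pow_nz q m Hq). pose proof (one_minus_pow_nz q n Hq).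
  pose proof (one_minus_pow_nz q (m + S n) Hq) as H1. replace (S (m + S n)) with (S m + S n)%nat in H1 by lia.
  rewrite Cpow_add_r in *. field. auto.
Qed.

Definition Upart (q : C) (n : nat) : C := lsum (fun i => lam q (S i)) (seq 0 n).
Definition Utail (q : C) (n : nat) : C := usum (fun b => lam q (S b + n)).

Lemma Upart_S q n : Upart q (S n) = Upart q n + lam q (S n).
Proof. unfold Upart. rewrite seq_S, lsum_app, (lsum_cons _ _ nil). simpl (lsum _ nil). simpl (0 + n)%nat. ring. Qed.

Lemma lam_summable0 q n : (Cmod q < 1)%R -> summable (fun b => lam q (S b + n)).
Proof.
  intros Hq.
  assert (S0 : summable (fun b => lam q (S b))).
  { apply summable_ext with (fun n => 1 * lam q (S n)); [intros; ring|].
    apply lam_summable with 0%nat; auto. intros k. rewrite Cmod_1. simpl. lra. }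
  refine (summable_inj (fun b => lam q (S b)) (fun b => (b + n)%nat) _ S0). intros; lia.
Qed.

Lemma Utail_S q n : (Cmod q < 1)%R -> Utail q 0 = Upart q n + Utail q n.
Proof.
  intros Hq. induction n as [|n IH]; [unfold Upart; simpl; ring|].
  rewrite IH, Upart_S. unfold Utail. rewrite (usum_nat_S _ (lam_summable0 q n Hq)).
  rewrite (usum_ext (fun b => lam q (S b + S n)) (fun b => lam q (S (S b) + n))) by (intros b; f_equal; lia).
  replace (1 + n)%nat with (S n) by lia. ring.
Qed.

(** [lam_mul] rewrites the summand as lam_c (lam_b - lam_(b+c)) - lam_(b+c); the difference
    telescopes to the first [S c] terms. *)
Lemma lam_tail_sum q c : (Cmod q < 1)%R ->
  summable (fun b => lam q (S b) * lam q (S b + S c)) /\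
  usum (fun b => lam q (S b) * lam q (S b + S c)) = lam q (S c) * Upart q (S c) - Utail q (S c).
Proof.
  intros Hq.
  assert (S0 : summable (fun b => lam q (S b))).
  { apply summable_ext with (2 := lam_summable0 q 0 Hq). intros b. f_equal. lia. }
  pose proof (lam_summable0 q (S c) Hq) as S1.
  assert (E : forall b, lam q (S c) * (lam q (S b) - lam q (S b + S c)) - lam q (S b + S c) = lam q (S b) * lam q (S b + S c)).
  { intros b. pose proof (lam_mul q b c Hq) as M.
    replace (lam q (S c) * (lam q (S b) - lam q (S b + S c)) - lam q (S b + S c)) with
      (lam q (S b) * lam q (S c) - lam q (S b + S c) * lam q (S c) - lam q (S b + S c)) by ring.
    rewrite M. ring. }
  split.
  - apply summable_ext with (1 := E). auto using summable_minus, summable_scal.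
  - rewrite <- (usum_ext _ _ E), usum_minus, usum_scal, usum_minus; auto using summable_minus, summable_scal.
    fold (Utail q (S c)).
    replace (usum (fun b => lam q (S b))) with (Utail q 0) by (apply usum_ext; intros b; f_equal; lia).
    rewrite (Utail_S q (S c)) by auto. ring.
Qed.

Lemma pair_bound (F : nat * nat -> C) q K : (Cmod q < 1)%R ->
  (forall a b, (Cmod (F (a, b)) <= K * ((1 + INR a) ^ 2 * Cmod q ^ a) * ((1 + INR b) ^ 2 * Cmod q ^ b))%R) -> summable F.
Proof.
  intros Hq HF. pose proof (Cmod_ge_0 q) as Q0.
  assert (S0 : forall k, summable (fun n : nat => RtoC (k * ((1 + INR n) ^ 2 * Cmod q ^ n)))).
  { intros k. apply summable_ext with (fun n : nat => RtoC k * RtoC ((1 + INR n) ^ 2 * Cmod q ^ n)); [intros; now rewrite <- RtoC_mult|].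
    apply summable_scal. apply summable_le with (2 := summableR_poly_geom 2 (Cmod q) (conj Q0 Hq)).
    intros n. rewrite Cmod_R, Rabs_pos_eq; [lra|]. apply Rmult_le_pos; apply pow_le; [pose proof (pos_INR n); lra|auto]. }
  apply summableR_le with (2 := summable_mult _ _ (S0 K) (S0 1%R)).
  intros [a b]. simpl fst. simpl snd. eapply Rle_trans; [apply HF|].
  rewrite <- RtoC_mult, Cmod_R, Rmult_1_l. apply Rle_abs.
Qed.

Lemma INR_pair a b : (INR a + INR b + 2 <= 2 * ((1 + INR a) * (1 + INR b)))%R.
Proof. pose proof (pos_INR a). pose proof (pos_INR b). nra. Qed.

Lemma lam_bound' q : (Cmod q < 1)%R -> exists K, (0 < K)%R /\ forall a, (Cmod (lam q (S a)) <= K * Cmod q ^ a)%R.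
Proof.
  intros Hq. pose proof (Cmod_ge_0 q) as Q0. assert (P : (0 < 1 / (1 - Cmod q))%R) by (apply Rdiv_lt_0_compat; lra).
  exists (1 / (1 - Cmod q))%R. split; auto.
  intros a. eapply Rle_trans; [apply lam_bound; auto|]. apply Rmult_le_compat_l; [lra|].
  apply pow_le_pow; [lra|lia].
Qed.

Lemma lam_pair_summable (c : nat * nat -> R) q : (Cmod q < 1)%R ->
  (forall a b, (Rabs (c (a, b)) <= (INR a + INR b + 2) ^ 2)%R) ->
  summable (fun p => RtoC (c p) * (lam q (S (fst p)) * lam q (S (snd p)))).
Proof.
  intros Hq Hc. destruct (lam_bound' q Hq) as (K & K0 & HK).
  apply pair_bound with q (4 * (K * K))%R; auto. intros a b. simpl fst. simpl snd. rewrite !Cmod_mult, Cmod_R.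
  pose proof (pos_INR a). pose proof (pos_INR b).
  replace (4 * (K * K) * ((1 + INR a) ^ 2 * Cmod q ^ a) * ((1 + INR b) ^ 2 * Cmod q ^ b))%R with
    ((2 * ((1 + INR a) * (1 + INR b))) ^ 2 * (K * Cmod q ^ a * (K * Cmod q ^ b)))%R by ring.
  apply Rmult_le_compat; [apply Rabs_pos|apply Rmult_le_pos; apply Cmod_ge_0| |].
  - eapply Rle_trans; [apply Hc|]. apply pow_incr. split; [lra|apply INR_pair].
  - apply Rmult_le_compat; auto using Cmod_ge_0.
Qed.

Lemma sum_squares n : lsum (fun i => RtoC (INR (S i) ^ 2)) (seq 0 n) = RtoC (INR n * (INR n + 1) * (2 * INR n + 1) / 6).
Proof.
  rewrite lsum_RtoC. f_equal. induction n as [|n IH]; [simpl; field|].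
  rewrite rsum_seq_S, IH, S_INR. field.
Qed.

Lemma lsum_rev_seq (f : nat -> C) t : lsum (fun a => f (t - a)%nat) (seq 0 (S t)) = lsum f (seq 0 (S t)).
Proof.
  transitivity (lsum f (map (fun a => (t - a)%nat) (seq 0 (S t)))); [now rewrite lsum_map|].
  apply lsum_perm. apply NoDup_Permutation_bis.
  - apply NoDup_map_NoDup_ForallPairs; [|apply seq_NoDup]. intros a b Ha Hb E. apply in_seq in Ha, Hb. lia.
  - rewrite length_map. lia.
  - intros x Hx. apply in_map_iff in Hx. destruct Hx as (a & <- & Ha). apply in_seq in Ha. apply in_seq. lia.
Qed.

(** Collected along m + n = N, each product is lam_N (1 + lam_m + lam_n) by [lam_mul], and there are
    N - 1 of them. *)
Lemma ramanujan_sum_part q : (Cmod q < 1)%R ->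
  summable (fun n => RtoC (INR (S n) ^ 2) * (lam q (S n) * (RtoC (INR n) + 2 * Upart q n))) /\
  usum (fun p => RtoC ((INR (fst p) + INR (snd p) + 2) ^ 2) * (lam q (S (fst p)) * lam q (S (snd p))))
  = usum (fun n => RtoC (INR (S n) ^ 2) * (lam q (S n) * (RtoC (INR n) + 2 * Upart q n))).
Proof.
  intros Hq.
  assert (SF : summable (fun p => RtoC ((INR (fst p) + INR (snd p) + 2) ^ 2) * (lam q (S (fst p)) * lam q (S (snd p))))).
  { apply (lam_pair_summable (fun p => (INR (fst p) + INR (snd p) + 2) ^ 2)%R); auto. intros a b. simpl fst. simpl snd.
    rewrite Rabs_pos_eq by apply pow2_ge_0. lra. }
  destruct (usum_diag _ SF) as [S1 E1].
  assert (E : forall t, lsum (fun a => RtoC ((INR (fst (a, (t - a)%nat)) + INR (snd (a, (t - a)%nat)) + 2) ^ 2) *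
      (lam q (S (fst (a, (t - a)%nat))) * lam q (S (snd (a, (t - a)%nat))))) (seq 0 (S t))
    = RtoC (INR (S (S t)) ^ 2) * (lam q (S (S t)) * (RtoC (INR (S t)) + 2 * Upart q (S t)))).
  { intros t. rewrite (lsum_ext_in _ (fun a => RtoC (INR (S (S t)) ^ 2) * lam q (S (S t)) *
      ((1 + lam q (S a)) + lam q (S (t - a))))).
    - rewrite lsum_scal, !lsum_plus, lsum_const, length_seq, (lsum_rev_seq (fun a => lam q (S a))).
      fold (Upart q (S t)). ring.
    - intros a Ha. apply in_seq in Ha. simpl fst. simpl snd. rewrite lam_mul by auto.
      replace (S a + S (t - a))%nat with (S (S t)) by lia.
      replace (INR a + INR (t - a) + 2)%R with (INR (S (S t))); [ring|].
      rewrite minus_INR, !S_INR by lia. ring. }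
  set (G := fun n => RtoC (INR (S n) ^ 2) * (lam q (S n) * (RtoC (INR n) + 2 * Upart q n))).
  assert (SG : summable G).
  { assert (S2 : summable (fun t => G (S t))) by now apply summable_ext with (1 := E).
    destruct S2 as [M HM]. apply summableR_nat with (Cmod (G 0%nat) + M)%R; [intros; apply Cmod_ge_0|].
    intros n. destruct n as [|n]; [simpl; pose proof (Cmod_ge_0 (G 0%nat)); specialize (HM nil ltac:(constructor)); simpl in HM; lra|].
    simpl seq. rewrite rsum_cons, <- seq_shift, rsum_map. specialize (HM (seq 0 n) (seq_NoDup _ _)). lra. }
  split; auto. rewrite E1, (usum_ext _ _ E), (usum_nat_S G SG).
  replace (G 0%nat) with (RtoC 0); [rewrite Cplus_0_l; reflexivity|]. unfold G, Upart. simpl. ring.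
Qed.

(** Exchanging the sums attaches to lam_N the squares of all c < N. *)
Lemma ramanujan_tail_part q : (Cmod q < 1)%R ->
  summable (fun c => RtoC (INR (S c) ^ 2) * Utail q (S c)) /\
  usum (fun c => RtoC (INR (S c) ^ 2) * Utail q (S c))
  = usum (fun n => RtoC (INR n * (INR n + 1) * (2 * INR n + 1) / 6) * lam q (S n)).
Proof.
  intros Hq. destruct (lam_bound' q Hq) as (K & K0 & HK). pose proof (Cmod_ge_0 q) as Q0.
  assert (SF : summable (fun p : nat * nat => RtoC (INR (S (fst p)) ^ 2) * lam q (S (snd p) + S (fst p)))).
  { apply pair_bound with q K; auto. intros a b. simpl fst. simpl snd.
    rewrite Cmod_mult, Cmod_R, Rabs_pos_eq by apply pow2_ge_0. rewrite S_INR, (Rplus_comm (INR a)).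
    replace (S b + S a)%nat with (S (S b + a)) by lia. specialize (HK (S b + a)%nat).
    pose proof (pos_INR a). pose proof (pos_INR b).
    assert (B : (Cmod q ^ (S b + a) <= Cmod q ^ a * Cmod q ^ b)%R) by (rewrite <- pow_add; apply pow_le_pow; [lra|lia]).
    assert (P1 : (0 <= Cmod q ^ a)%R) by now apply pow_le. assert (P2 : (0 <= Cmod q ^ b)%R) by now apply pow_le.
    assert (P3 : (0 <= (1 + INR a) ^ 2)%R) by apply pow2_ge_0. assert (P4 : (1 <= (1 + INR b) ^ 2)%R) by nra.
    replace (K * ((1 + INR a) ^ 2 * Cmod q ^ a) * ((1 + INR b) ^ 2 * Cmod q ^ b))%R with
      ((1 + INR a) ^ 2 * (K * (Cmod q ^ a * Cmod q ^ b) * (1 + INR b) ^ 2))%R by ring.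
    apply Rmult_le_compat_l; auto. eapply Rle_trans; [exact HK|].
    assert (K * Cmod q ^ (S b + a) <= K * (Cmod q ^ a * Cmod q ^ b))%R by (apply Rmult_le_compat_l; lra).
    assert (0 <= K * (Cmod q ^ a * Cmod q ^ b))%R by (apply Rmult_le_pos; [lra|now apply Rmult_le_pos]). nra. }
  assert (EU : forall c, usum (fun b => RtoC (INR (S c) ^ 2) * lam q (S b + S c)) = RtoC (INR (S c) ^ 2) * Utail q (S c)).
  { intros c. rewrite usum_scal by now apply lam_summable0. reflexivity. }
  destruct (usum_prod _ SF) as (_ & S2 & E2). simpl fst in *. simpl snd in *.
  split; [now apply summable_ext with (1 := EU)|].
  rewrite <- (usum_ext _ _ EU), <- E2. destruct (usum_diag _ SF) as [S1 E1]. rewrite E1.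
  assert (SG : summable (fun n => RtoC (INR n * (INR n + 1) * (2 * INR n + 1) / 6) * lam q (S n))).
  { apply lam_summable with 3%nat; auto. intros n. pose proof (pos_INR n). rewrite Cmod_R, Rabs_pos_eq; [nra|].
    apply Rdiv_le_0_compat; [|lra]. apply Rmult_le_pos; [apply Rmult_le_pos|]; lra. }
  rewrite (usum_nat_S _ SG). simpl (INR 0). replace (RtoC (0 * (0 + 1) * (2 * 0 + 1) / 6)) with (RtoC 0) by (f_equal; field).
  rewrite Cmult_0_l, Cplus_0_l. apply usum_ext. intros t. simpl fst. simpl snd.
  rewrite (lsum_ext_in _ (fun a => lam q (S (S t)) * RtoC (INR (S a) ^ 2))).
  - rewrite lsum_scal, sum_squares. ring.
  - intros a Ha. apply in_seq in Ha. replace (S (t - a) + S a)%nat with (S (S t)) by lia. ring.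
Qed.

(** The diagonal vanishes and the two triangles are mirror images; within one, the sum at fixed
    difference is [lam_tail_sum]. *)
Lemma ramanujan_diff_part q : (Cmod q < 1)%R ->
  summable (fun c => RtoC (INR (S c) ^ 2) * (lam q (S c) * Upart q (S c) - Utail q (S c))) /\
  usum (fun p => RtoC ((INR (fst p) - INR (snd p)) ^ 2) * (lam q (S (fst p)) * lam q (S (snd p))))
  = 2 * usum (fun c => RtoC (INR (S c) ^ 2) * (lam q (S c) * Upart q (S c) - Utail q (S c))).
Proof.
  intros Hq.
  set (F := fun p => RtoC ((INR (fst p) - INR (snd p)) ^ 2) * (lam q (S (fst p)) * lam q (S (snd p)))).
  assert (SF : summable F).
  { apply (lam_pair_summable (fun p => (INR (fst p) - INR (snd p)) ^ 2)%R); auto. intros a b. simpl fst. simpl snd.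
    rewrite Rabs_pos_eq by apply pow2_ge_0. pose proof (pos_INR a). pose proof (pos_INR b). nra. }
  set (G := fun p : nat * nat => RtoC (INR (S (fst p)) ^ 2) * (lam q (S (snd p)) * lam q (S (snd p) + S (fst p)))).
  set (psi1 := fun p : nat * nat => ((snd p + S (fst p))%nat, snd p)).
  set (psi2 := fun p : nat * nat => (snd p, (snd p + S (fst p))%nat)).
  assert (G1 : forall p, F (psi1 p) = G p).
  { intros [c b]. unfold F, G, psi1. simpl fst. simpl snd. replace (S (b + S c)) with (S b + S c)%nat by lia.
    replace (INR (b + S c) - INR b)%R with (INR (S c)) by (rewrite plus_INR; ring). ring. }
  assert (G2 : forall p, F (psi2 p) = G p).
  { intros [c b]. unfold F, G, psi2. simpl fst. simpl snd. replace (S (b + S c)) with (S b + S c)%nat by lia.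
    replace ((INR b - INR (b + S c)) ^ 2)%R with (INR (S c) ^ 2)%R by (rewrite plus_INR; ring). ring. }
  assert (I1 : forall p p', psi1 p = psi1 p' -> p = p').
  { intros [c b] [c' b'] E. unfold psi1 in E. simpl in E. injection E as E1 E2. f_equal; lia. }
  assert (I2 : forall p p', psi2 p = psi2 p' -> p = p').
  { intros [c b] [c' b'] E. unfold psi2 in E. simpl in E. injection E as E1 E2. f_equal; lia. }
  assert (SG : summable G) by (apply summable_ext with (1 := G1); exact (summable_inj F psi1 I1 SF)).
  set (Fa := fun p : nat * nat => if (snd p <? fst p)%nat then F p else RtoC 0).
  set (Fb := fun p : nat * nat => if (fst p <? snd p)%nat then F p else RtoC 0).
  assert (SA : summable Fa) by now apply (summable_restrict (fun p : nat * nat => (snd p <? fst p)%nat)).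
  assert (SB : summable Fb) by now apply (summable_restrict (fun p : nat * nat => (fst p <? snd p)%nat)).
  assert (Ea : forall p, Fa (psi1 p) = G p).
  { intros [c b]. unfold Fa. rewrite G1. unfold psi1. simpl fst. simpl snd. now rewrite (proj2 (Nat.ltb_lt _ _)) by lia. }
  assert (Eb : forall p, Fb (psi2 p) = G p).
  { intros [c b]. unfold Fb. rewrite G2. unfold psi2. simpl fst. simpl snd. now rewrite (proj2 (Nat.ltb_lt _ _)) by lia. }
  assert (EF : usum F = 2 * usum G).
  { rewrite (usum_ext F (fun p => Fa p + Fb p)).
    - rewrite usum_plus by auto.
      destruct (summable_usum_inj Fa psi1 I1) as [_ ->].
      + intros [a b] H. unfold Fa. simpl fst. simpl snd. destruct (b <? a)%nat eqn:E; auto. apply Nat.ltb_lt in E. exfalso.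
        apply (H ((a - b - 1)%nat, b)). unfold psi1. simpl. f_equal. lia.
      + now apply summable_ext with (1 := fun p => eq_sym (Ea p)).
      + destruct (summable_usum_inj Fb psi2 I2) as [_ ->].
        * intros [a b] H. unfold Fb. simpl fst. simpl snd. destruct (a <? b)%nat eqn:E; auto. apply Nat.ltb_lt in E. exfalso.
          apply (H ((b - a - 1)%nat, a)). unfold psi2. simpl. f_equal. lia.
        * now apply summable_ext with (1 := fun p => eq_sym (Eb p)).
        * rewrite (usum_ext _ _ Ea), (usum_ext _ _ Eb). ring.
    - intros [a b]. unfold Fa, Fb. simpl fst. simpl snd.
      destruct (b <? a)%nat eqn:E1; destruct (a <? b)%nat eqn:E2; try ring.
      + apply Nat.ltb_lt in E1, E2. lia.
      + apply Nat.ltb_ge in E1, E2. assert (a = b) by lia. subst. unfold F. simpl fst. simpl snd.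
        replace ((INR b - INR b) ^ 2)%R with 0%R by ring. ring. }
  destruct (usum_prod G SG) as (_ & S2 & E2).
  assert (EU : forall c, usum (fun b => G (c, b)) = RtoC (INR (S c) ^ 2) * (lam q (S c) * Upart q (S c) - Utail q (S c))).
  { intros c. unfold G. simpl fst. simpl snd. destruct (lam_tail_sum q c Hq) as [S3 E3].
    rewrite usum_scal, E3 by auto. reflexivity. }
  split; [now apply summable_ext with (1 := EU)|].
  fold F. rewrite EF, E2, (usum_ext _ _ EU). reflexivity.
Qed.

(* From [4 m n = (m + n)^2 - (m - n)^2] and [lam_mul]. *)
Lemma ramanujan_P q : (Cmod q < 1)%R ->
  RtoC 12 * Lsum 1 q ^ 2 = RtoC 5 * Lsum 3 q + Lsum 1 q - RtoC 6 * DLsum q.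
Proof.
  intros Hq.
  destruct (ramanujan_sum_part q Hq) as [SA EA]. destruct (ramanujan_diff_part q Hq) as [SB EB].
  destruct (ramanujan_tail_part q Hq) as [ST ET].
  pose proof (Lsum_summable 1 q Hq) as S1. pose proof (Lsum_summable 3 q Hq) as S3.
  assert (Sq : RtoC 4 * Lsum 1 q ^ 2 =
     usum (fun p => RtoC ((INR (fst p) + INR (snd p) + 2) ^ 2) * (lam q (S (fst p)) * lam q (S (snd p))))
     - usum (fun p => RtoC ((INR (fst p) - INR (snd p)) ^ 2) * (lam q (S (fst p)) * lam q (S (snd p))))).
  { rewrite <- usum_minus.
    - replace (Lsum 1 q ^ 2) with (Lsum 1 q * Lsum 1 q) by ring. unfold Lsum at 1 2.
      rewrite <- (usum_mult _ _ S1 S1), <- usum_scal by exact (summable_mult _ _ S1 S1).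
      apply usum_ext. intros [a b]. simpl fst. simpl snd. rewrite !pow_1, !S_INR.
      rewrite !RtoC_pow, !RtoC_minus, !RtoC_plus. ring.
    - apply (lam_pair_summable (fun p => (INR (fst p) + INR (snd p) + 2) ^ 2)%R); auto. intros a b. simpl fst. simpl snd.
      rewrite Rabs_pos_eq by apply pow2_ge_0. lra.
    - apply (lam_pair_summable (fun p => (INR (fst p) - INR (snd p)) ^ 2)%R); auto. intros a b. simpl fst. simpl snd.
      rewrite Rabs_pos_eq by apply pow2_ge_0. pose proof (pos_INR a). pose proof (pos_INR b). nra. }
  assert (SD : summable (fun n => RtoC (INR (S n) ^ 2) * (lam q (S n) + lam q (S n) ^ 2))).
  { destruct (lam_bound' q Hq) as (K & K0 & HK).
    apply summable_le with (fun n => (1 + K) * Cmod (RtoC (INR (S n) ^ 2) * lam q (S n)))%R.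
    - intros n. replace (lam q (S n) + lam q (S n) ^ 2) with ((1 + lam q (S n)) * lam q (S n)) by ring.
      rewrite !Cmod_mult. pose proof (Cmod_triangle 1 (lam q (S n))) as T. rewrite Cmod_1 in T.
      assert (B : (Cmod (lam q (S n)) <= K)%R).
      { eapply Rle_trans; [apply HK|]. pose proof (pow_le_pow (Cmod q) 0 n ltac:(pose proof (Cmod_ge_0 q); lra) ltac:(lia)) as Z.
        simpl in Z. nra. }
      pose proof (Cmod_ge_0 (lam q (S n))). pose proof (Cmod_ge_0 (RtoC (INR (S n) ^ 2))).
      assert (0 <= Cmod (RtoC (INR (S n) ^ 2)) * Cmod (lam q (S n)))%R by now apply Rmult_le_pos. nra.
    - apply summableR_scal; [lra|]. now apply (Lsum_summable 2 q). }
  assert (Tot : RtoC 3 * (RtoC 4 * Lsum 1 q ^ 2) = RtoC 5 * Lsum 3 q + Lsum 1 q - RtoC 6 * DLsum q).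
  { rewrite Sq, EA, EB.
    set (T3 := fun n => RtoC (INR n * (INR n + 1) * (2 * INR n + 1) / 6) * lam q (S n)) in *.
    assert (ST3 : summable T3).
    { apply lam_summable with 3%nat; auto. intros n. pose proof (pos_INR n). rewrite Cmod_R, Rabs_pos_eq; [nra|].
      apply Rdiv_le_0_compat; [|lra]. apply Rmult_le_pos; [apply Rmult_le_pos|]; lra. }
    (* Twice the tail sum is subtracted in one form and added in the other, which removes [Utail].
       What remains is a termwise identity: [Upart] cancels up to one [lam], and the coefficient of
       [lam] at N is 5 N^3 - 6 N^2 + N. *)
    transitivity (RtoC 3 * (usum (fun n => RtoC (INR (S n) ^ 2) * (lam q (S n) * (RtoC (INR n) + 2 * Upart q n)))
      - 2 * (usum (fun c => RtoC (INR (S c) ^ 2) * (lam q (S c) * Upart q (S c) - Utail q (S c)))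
      + usum (fun c => RtoC (INR (S c) ^ 2) * Utail q (S c))) + 2 * usum T3)).
    { rewrite ET. ring. }
    rewrite <- (usum_plus _ _ SB ST).
    rewrite <- (usum_scal 2 _ (summable_plus _ _ SB ST)), <- usum_minus by auto using summable_plus, summable_scal.
    rewrite <- (usum_scal 2 T3) by auto.
    rewrite <- usum_plus by auto using summable_minus, summable_plus, summable_scal.
    rewrite <- usum_scal by auto using summable_minus, summable_plus, summable_scal.
    unfold Lsum, DLsum. rewrite <- (usum_scal (RtoC 5)), <- (usum_scal (RtoC 6)), <- usum_plus, <- usum_minus
      by auto using summable_minus, summable_plus, summable_scal.
    apply usum_ext. intros n. rewrite Upart_S. unfold T3. rewrite S_INR.
    rewrite RtoC_div by lra. rewrite !RtoC_pow, !RtoC_mult, !RtoC_plus, RtoC_mult. field. }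
  rewrite <- Tot, Cmult_assoc, <- RtoC_mult. f_equal. f_equal. ring.
Qed.

(** * Inversion formulas for [eta] and [E4] *)

Lemma Csqrt_spec z : (0 < Re z)%R -> (0 < Re (Csqrt z))%R /\ Csqrt z ^ 2 = z.
Proof.
  intros Hz. pose proof (re_le_Cmod z) as B. pose proof (Cmod2_alt z) as N. pose proof (Cmod_ge_0 z) as M0.
  rewrite Rabs_pos_eq in B by lra. destruct z as [x y]. simpl Re in *. simpl Im in *. set (m := Cmod (x, y)) in *.
  unfold Csqrt. simpl Re. simpl Im. fold m.
  assert (A1 : (0 < (m + x) / 2)%R) by lra. assert (A2 : (0 <= (m - x) / 2)%R) by lra.
  split; [now apply sqrt_lt_R0|].
  set (a := sqrt ((m + x) / 2)). set (b := sqrt ((m - x) / 2)).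
  assert (Ea : (a * a = (m + x) / 2)%R) by (apply sqrt_sqrt; lra).
  assert (Eb : (b * b = (m - x) / 2)%R) by (apply sqrt_sqrt; lra).
  assert (Eab : (a * b = Rabs y / 2)%R).
  { unfold a, b. rewrite <- sqrt_mult by lra. replace ((m + x) / 2 * ((m - x) / 2))%R with ((y / 2) * (y / 2))%R by nra.
    change (y / 2 * (y / 2))%R with (Rsqr (y / 2)). rewrite sqrt_Rsqr_abs.
    unfold Rdiv. rewrite Rabs_mult, (Rabs_pos_eq (/ 2)); lra. }
  unfold Rabs in Eab. destruct (Rlt_dec y 0) as [Hy|Hy]; destruct (Rcase_abs y); try lra;
    simpl; unfold Cmult; simpl; f_equal; nra.
Qed.

Lemma Csqrt_root tau : (0 < Im tau)%R -> root_of_tau (Csqrt (- Ci * tau)) tau.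
Proof.
  intros Ht. apply Csqrt_spec. destruct tau as [a b]. simpl in *. lra.
Qed.

Lemma eta_nz tau : (0 < Im tau)%R -> eta tau <> 0.
Proof. intros Ht. apply Cmult_neq_0; [apply Qpow_nz|]. now apply Qpoch_nz, Qof_lt_1. Qed.

Lemma eta_inv tau : (0 < Im tau)%R -> / eta tau = Qpow tau (- (1 / 24)) * Bser (Qof tau).
Proof.
  intros Ht. rewrite <- Bser_inv, Qpow_opp by now apply Qof_lt_1. unfold eta. field.
  split; [now apply Qpoch_nz, Qof_lt_1|apply Qpow_nz].
Qed.

Lemma Qpow_pow tau r n : Qpow tau r ^ n = Qpow tau (INR n * r).
Proof. unfold Qpow. rewrite Cexp_pow. f_equal. rewrite !RtoC_mult. ring. Qed.

Lemma eta_inv_pow tau n : (0 < Im tau)%R -> / eta tau ^ n = Qpow tau (- (INR n / 24)) * Bser (Qof tau) ^ n.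
Proof.
  intros Ht. rewrite <- Cpow_inv by now apply eta_nz. rewrite eta_inv, Cpow_mult_l, Qpow_pow by auto.
  f_equal. f_equal. field.
Qed.

Definition E2 (tau : C) : C := 1 - RtoC 24 * Lsum 1 (Qof tau).

(** Ramanujan's equation in the form E4 = E2^2 - 12 D E2, as D E2 is -24 [DLsum]. *)
Lemma E4_E2 tau : (0 < Im tau)%R -> E4 tau = E2 tau ^ 2 - RtoC 12 * (- RtoC 24 * DLsum (Qof tau)).
Proof.
  intros Ht. rewrite E4_Lsum by auto. unfold E2. pose proof (ramanujan_P (Qof tau) (Qof_lt_1 _ Ht)) as R.
  set (S1 := Lsum 1 (Qof tau)) in *. set (S3 := Lsum 3 (Qof tau)) in *. set (D := DLsum (Qof tau)) in *.
  replace ((1 - RtoC 24 * S1) ^ 2 - RtoC 12 * (- RtoC 24 * D)) with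
    (1 - RtoC 48 * S1 + RtoC 48 * (RtoC 12 * S1 ^ 2) + RtoC 288 * D) by ring.
  rewrite R. ring.
Qed.

Lemma Cder_E2 tau : (0 < Im tau)%R ->
  Cder E2 tau (RtoC (2 * PI) * Ci * (- RtoC 24 * DLsum (Qof tau))).
Proof.
  intros Ht. pose proof (Cder_Q_series (Lsum 1) DLsum tau 0 Cder_Lsum Ht) as D.
  pose proof (Cder_minus _ _ _ _ _ (Cder_const 1 tau) (Cder_scal (RtoC 24) _ _ _ D)) as D1.
  rewrite Qpow_0 in D1. apply Cder_ext with (g := E2) in D1.
  - eapply Cder_eq; [|exact D1]. ring.
  - intros u. unfold E2. rewrite Qpow_0. ring.
Qed.

(** The power -2 has integral weight: its inversion factor is Ci/tau, which can be differentiated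
    without any root of tau. *)
Lemma Cder_eta_inv_sqr tau : (0 < Im tau)%R ->
  Cder (fun u => / eta u ^ 2) tau (- (RtoC (2 * PI) * Ci / RtoC 12) * (/ eta tau ^ 2 * E2 tau)).
Proof.
  intros Ht.
  assert (HB : forall q, (Cmod q < 1)%R -> exists d, Cder (fun q => Bser q ^ 2) q d /\ q * d = RtoC 2 * Bser q ^ 2 * Lsum 1 q).
  { intros q Hq. destruct (Cder_Bser q Hq) as (d & D & E). pose proof (Cder_mult _ _ _ _ _ D D) as D2.
    exists (d * Bser q + Bser q * d). split.
    - apply Cder_ext with (2 := D2). intros; ring.
    - replace (q * (d * Bser q + Bser q * d)) with (2 * Bser q * (q * d)) by ring. rewrite E. ring. }
  pose proof (Cder_Q_series _ _ tau (- (INR 2 / 24)) HB Ht) as D.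
  apply Cder_half_plane with (2 := fun u Hu => eq_sym (eta_inv_pow u 2 Hu)) (1 := Ht).
  eapply Cder_eq; [|exact D]. rewrite eta_inv_pow by auto. unfold E2. cbv beta.
  replace (RtoC (- (INR 2 / 24))) with (- / RtoC 12).
  - field.
  - simpl INR. rewrite <- RtoC_inv, <- RtoC_opp by lra. f_equal. lra.
Qed.

Lemma Cder_tauS (tau : C) : tau <> 0 -> Cder tauS tau (/ (tau * tau)).
Proof.
  intros H. eapply Cder_eq; [|exact (Cder_opp _ _ _ (Cder_inv tau H))]. field. exact H.
Qed.

Lemma eta_sqr_S tau : (0 < Im tau)%R -> / eta (tauS tau) ^ 2 = Ci / tau * / eta tau ^ 2.
Proof.
  intros Ht. pose proof (Csqrt_root tau Ht) as Hw. rewrite (eta_S _ tau Ht Hw).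
  set (w := Csqrt (- Ci * tau)) in *. destruct Hw as [_ Ew].
  pose proof (Im_pos_nz tau Ht). pose proof (eta_nz tau Ht). assert (C0 : Ci <> 0) by apply Ci_nz.
  replace ((w * eta tau) ^ 2) with (w ^ 2 * eta tau ^ 2) by ring. rewrite Ew.
  transitivity (Ci / (- (Ci * Ci) * tau) * / eta tau ^ 2); [field; auto|]. rewrite Ci_sqr. field. auto.
Qed.

(** Both sides of the inversion of [/ eta ^ 2] are differentiated; the factor Ci/tau contributes the
    anomalous term. *)
Lemma E2_S tau : (0 < Im tau)%R -> E2 (tauS tau) = tau ^ 2 * E2 tau + RtoC 6 * tau / (RtoC PI * Ci).
Proof.
  intros Ht. pose proof (Im_pos_nz tau Ht) as T0. pose proof (Im_tauS tau Ht) as Ht'.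
  pose proof (Cder_comp _ tauS tau _ _ (Cder_eta_inv_sqr _ Ht') (Cder_tauS tau T0)) as D1.
  pose proof (Cder_mult _ _ _ _ _ (Cder_scal Ci _ _ _ (Cder_inv tau T0)) (Cder_eta_inv_sqr tau Ht)) as D2.
  apply Cder_half_plane with (g := fun u => / eta (tauS u) ^ 2) in D2; auto.
  2:{ intros u Hu. rewrite eta_sqr_S by auto. reflexivity. }
  pose proof (Cder_unique _ _ _ _ D1 D2) as E. cbv beta in E.
  rewrite eta_sqr_S in E by auto. rewrite !RtoC_mult in E.
  assert (P0 : RtoC PI <> 0) by (apply RtoC_nz; pose proof PI_RGT_0; lra).
  assert (C0 : Ci <> 0) by apply Ci_nz. pose proof (eta_nz tau Ht) as N0.
  set (X := E2 (tauS tau)) in *. set (Y := E2 tau) in *. set (h := eta tau) in *.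
  replace X with ((/ (tau * tau) * (- (RtoC 2 * RtoC PI * Ci / RtoC 12) * (Ci / tau * / h ^ 2 * X)))
    * (- RtoC 6 * tau ^ 3 * h ^ 2 / (RtoC PI * (Ci * Ci)))) by (field; auto).
  rewrite E. field. auto.
Qed.

(** Differentiating [E2_S] gives the inversion of D E2, and in E2^2 - 12 D E2 the anomalous terms
    cancel. *)
Lemma E4_S tau : (0 < Im tau)%R -> E4 (tauS tau) = tau ^ 4 * E4 tau.
Proof.
  intros Ht. pose proof (Im_pos_nz tau Ht) as T0. pose proof (Im_tauS tau Ht) as Ht'.
  pose proof (Cder_comp _ tauS tau _ _ (Cder_E2 _ Ht') (Cder_tauS tau T0)) as D1.
  pose proof (Cder_plus _ _ _ _ _ (Cder_mult _ _ _ _ _ (Cder_pow 2 tau) (Cder_E2 tau Ht))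
     (Cder_scal (RtoC 6 / (RtoC PI * Ci)) _ _ _ (Cder_id tau))) as D2.
  apply Cder_half_plane with (g := fun u => E2 (tauS u)) in D2; auto.
  2:{ intros u Hu. rewrite E2_S by auto. field. split; [apply Ci_nz|apply RtoC_nz; pose proof PI_RGT_0; lra]. }
  pose proof (Cder_unique _ _ _ _ D1 D2) as E. cbv beta in E.
  rewrite !E4_E2, E2_S by auto. rewrite !RtoC_mult in E.
  assert (P0 : RtoC PI <> 0) by (apply RtoC_nz; pose proof PI_RGT_0; lra).
  assert (C0 : Ci <> 0) by apply Ci_nz.
  set (X := DLsum (Qof (tauS tau))) in *. set (Y := E2 tau) in *. set (Z := DLsum (Qof tau)) in *.
  replace (- RtoC 24 * X) with (/ (tau * tau) * (RtoC 2 * RtoC PI * Ci * (- RtoC 24 * X)) * (tau ^ 2 / (RtoC 2 * RtoC PI * Ci))) by (field; auto).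
  rewrite E. simpl (INR 2). replace (2 - 1)%nat with 1%nat by lia. rewrite Cpow_1_r.
  replace (RtoC (1 + 1)) with (RtoC 2) by (f_equal; lra). field. auto.
Qed.

(** * Expansions in powers of [Q] *)

(** A fractional power of Q times a power series in Q: exponents congruent to [r] modulo 1 and
    bounded below by [r]. *)
Definition Qform (f : C -> C) (r : R) : Prop :=
  exists g, DS g /\ forall tau, (0 < Im tau)%R -> f tau = Qpow tau r * g (Qof tau).

Lemma Qform_ext f g r : (forall tau, (0 < Im tau)%R -> f tau = g tau) -> Qform f r -> Qform g r.
Proof. intros E (h & Hh & Hf). exists h. split; auto. intros tau Ht. now rewrite <- E, Hf. Qed.

Lemma Qform_eq f r s : r = s -> Qform f r -> Qform f s.
Proof. now intros ->. Qed.

Lemma Qform_mult f g r s : Qform f r -> Qform g s -> Qform (fun tau => f tau * g tau) (r + s).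
Proof.
  intros (a & Ha & Hf) (b & Hb & Hg). exists (fun q => a q * b q). split; [now apply DS_mult|].
  intros tau Ht. rewrite Hf, Hg, Qpow_plus by auto. ring.
Qed.

Lemma Qform_plus f g r : Qform f r -> Qform g r -> Qform (fun tau => f tau + g tau) r.
Proof.
  intros (a & Ha & Hf) (b & Hb & Hg). exists (fun q => a q + b q). split; [now apply DS_plus|].
  intros tau Ht. rewrite Hf, Hg by auto. ring.
Qed.

Lemma Qform_scal c f r : Qform f r -> Qform (fun tau => c * f tau) r.
Proof.
  intros (a & Ha & Hf). exists (fun q => c * a q). split; [now apply DS_scal|].
  intros tau Ht. rewrite Hf by auto. ring.
Qed.

Lemma DS_id_pow n : DS (fun q => q ^ n).
Proof.
  set (a := fun m => if (m =? n)%nat then RtoC 1 else RtoC 0).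
  assert (K : forall q, summable (fun m => a m * q ^ m) /\ usum (fun m => a m * q ^ m) = lsum (fun m => a m * q ^ m) (n :: nil)).
  { intros q. apply usum_finite; [constructor; [easy|constructor]|].
    intros m H. unfold a. rewrite (proj2 (Nat.eqb_neq m n)); [ring|]. intros ->. apply H. now left. }
  exists a. split.
  - intros q _. apply K.
  - intros q _. unfold psum. rewrite (proj2 (K q)). simpl. unfold a. rewrite Nat.eqb_refl. ring.
Qed.

(** A surplus of [K] in the exponent is moved into the power series. *)
Lemma Qform_shift f r (K : nat) : Qform f (r + INR K) -> Qform f r.
Proof.
  intros (a & Ha & Hf). exists (fun q => q ^ K * a q). split; [apply DS_mult; auto; apply DS_id_pow|].
  intros tau Ht. rewrite Hf, Qpow_plus, Qpow_INR by auto. ring.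
Qed.

Lemma Qform_eta_inv n : Qform (fun tau => / eta tau ^ n) (- (INR n / 24)).
Proof.
  exists (fun q => Bser q ^ n). split; [apply DS_pow, DS_Bser|]. intros tau Ht. now apply eta_inv_pow.
Qed.

Lemma Qform_E4 : Qform E4 0.
Proof.
  exists (fun q => 1 + RtoC 240 * Lsum 3 q). split.
  - apply DS_plus; [apply DS_const|]. apply DS_scal.
    apply DS_ext with (fun q => usum (fun p => RtoC (INR (S (fst p)) ^ 3) * RtoC (INR (S (snd p)) ^ 0) * q ^ pair_exp p)).
    + intros q Hq. symmetry. now apply Lsum_pairs.
    + apply (DS_collect (fun p => RtoC (INR (S (fst p)) ^ 3) * RtoC (INR (S (snd p)) ^ 0)) pair_exp pair_exp_fin).
      intros; now apply pair_exp_summable.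
  - intros tau Ht. rewrite Qpow_0, Cmult_1_l. now apply E4_Lsum.
Qed.

Lemma Qform_Cder f r : Qform f r -> exists f', Qform f' r /\ forall tau, (0 < Im tau)%R ->
  Cder f tau (RtoC (2 * PI) * Ci * f' tau).
Proof.
  intros (g & Hg & Hf). destruct (DS_Cder g Hg) as (g' & Hg' & D).
  exists (fun tau => Qpow tau r * (RtoC r * g (Qof tau) + g' (Qof tau))). split.
  - exists (fun q => RtoC r * g q + g' q). split; [|reflexivity]. apply DS_plus; auto. now apply DS_scal.
  - intros tau Ht. apply Cder_half_plane with (2 := fun u Hu => eq_sym (Hf u Hu)) (1 := Ht).
    now apply Cder_Q_series.
Qed.

Lemma Dtau_Cder f tau d : Cder f tau d -> Dtau f tau = / (RtoC (2 * PI) * Ci) * d.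
Proof. intros H. unfold Dtau. now rewrite (Cder_C_derive f tau d H). Qed.

Lemma Qform_Dtau f r : Qform f r -> Qform (Dtau f) r /\ forall tau, (0 < Im tau)%R ->
  Cder f tau (RtoC (2 * PI) * Ci * Dtau f tau).
Proof.
  intros H. destruct (Qform_Cder f r H) as (f' & H' & D). pose proof two_pi_i_nz as N0.
  assert (E : forall tau, (0 < Im tau)%R -> f' tau = Dtau f tau).
  { intros tau Ht. rewrite (Dtau_Cder _ _ _ (D tau Ht)). field. exact (conj Ci_nz (RtoC_nz (2 * PI) ltac:(pose proof PI_RGT_0; lra))). }
  split; [now apply Qform_ext with (1 := E)|].
  intros tau Ht. rewrite <- E by auto. auto.
Qed.

(** * Fractional exponents of theta series in a residue class *)

Lemma pow_exp_ln r n : (0 < r)%R -> (r ^ n = exp (INR n * ln r))%R.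
Proof. intros Hr. rewrite <- Rpower_pow by auto. reflexivity. Qed.

Lemma summable_quadratic_exp (c : Z -> C) (e : Z -> nat) a b q : (0 < a)%R -> (Cmod q < 1)%R ->
  (forall n, (Cmod (c n) <= 1 + Rabs (IZR n))%R) -> (forall n, (a * IZR n ^ 2 - b <= INR (e n))%R) ->
  summable (fun n => c n * q ^ e n).
Proof.
  (* The floor 1/2 keeps the logarithm of the radius finite at [q = 0]. *)
  intros Ha Hq Hc He. set (r := Rmax (Cmod q) (1 / 2)).
  assert (Hr : (0 < r < 1)%R).
  { split; [eapply Rlt_le_trans; [|apply Rmax_r]; lra|]. apply Rmax_lub_lt; lra. }
  set (lm := (- ln r)%R). assert (Hl : (0 < lm)%R).
  { unfold lm. assert (ln r < 0)%R; [|lra]. rewrite <- ln_1. apply ln_increasing; lra. }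
  apply summable_le with (fun n : Z => (exp (lm * b) * ((1 + Rabs (IZR n)) * exp (- (lm * a * IZR n ^ 2))))%R).
  - intros n. rewrite Cmod_mult, Cmod_pow.
    assert (B : (Cmod q ^ e n <= exp (lm * b) * exp (- (lm * a * IZR n ^ 2)))%R).
    { apply Rle_trans with (r ^ e n)%R; [apply pow_incr; split; [apply Cmod_ge_0|apply Rmax_l]|].
      rewrite pow_exp_ln, <- exp_plus by lra. apply exp_le_compat. specialize (He n). unfold lm in *.
      apply (Rmult_le_compat_l (- ln r)) in He; lra. }
    replace (exp (lm * b) * ((1 + Rabs (IZR n)) * exp (- (lm * a * IZR n ^ 2))))%R with
      ((1 + Rabs (IZR n)) * (exp (lm * b) * exp (- (lm * a * IZR n ^ 2))))%R by ring.
    apply Rmult_le_compat; auto using Cmod_ge_0. apply pow_le, Cmod_ge_0.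
  - apply summableR_scal; [left; apply exp_pos|]. apply gauss_summable. now apply Rmult_lt_0_compat.
Qed.

(** On the class of [y] the squares of the integers not killed by [chi] are all congruent to [rho]
    modulo the denominator 2 M p of the exponents. *)
Lemma Qform_class_theta (M p : nat) (chi : Z -> Z) (g : Z -> C) (y rho : Z) : (0 < M)%nat -> (0 < p)%nat ->
  (forall n, (Z.abs (chi n) <= 1)%Z) -> (forall n, (Cmod (g n) <= 1 + Rabs (IZR n))%R) ->
  (rho < 2 * Z.of_nat (M * p))%Z ->
  (forall n k, n = (y + k * Z.of_nat p)%Z -> chi n <> 0%Z -> (2 * Z.of_nat (M * p) | n ^ 2 - rho)%Z) ->
  Qform (class_theta M p chi g y) (IZR rho / (2 * INR (M * p))).
Proof.
  intros HM Hp Hchi Hg Hrho Hdiv.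
  set (D := (2 * Z.of_nat (M * p))%Z) in *. assert (HD : (0 < D)%Z) by (unfold D; nia).
  assert (ED : IZR D = (2 * INR (M * p))%R) by (unfold D; rewrite mult_IZR, <- INR_IZR_INZ; reflexivity).
  assert (PD : (0 < IZR D)%R) by now apply (IZR_lt 0).
  set (c := fun n : Z => if ((n - y) mod Z.of_nat p =? 0)%Z then RtoC (IZR (chi n)) * g n else 0).
  set (e := fun n : Z => Z.to_nat ((n ^ 2 - rho) / D)).
  assert (Hc : forall n, (Cmod (c n) <= 1 + Rabs (IZR n))%R).
  { intros n. unfold c. destruct (_ =? 0)%Z.
    - rewrite Cmod_mult, Cmod_R, <- abs_IZR. specialize (Hchi n). apply IZR_le in Hchi. specialize (Hg n).
      assert (0 <= IZR (Z.abs (chi n)))%R by (apply (IZR_le 0); lia). pose proof (Cmod_ge_0 (g n)). nra.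
    - rewrite Cmod_0. pose proof (Rabs_pos (IZR n)). lra. }
  assert (Hs : forall q, (Cmod q < 1)%R -> summable (fun n => c n * q ^ e n)).
  { intros q Hq. apply summable_quadratic_exp with (/ IZR D)%R (IZR rho / IZR D + 1)%R; auto.
    - now apply Rinv_0_lt_compat.
    - intros n. unfold e. pose proof (Z.div_mod (n ^ 2 - rho) D ltac:(lia)) as E1.
      pose proof (Z.mod_pos_bound (n ^ 2 - rho) D HD) as E2. set (v := ((n ^ 2 - rho) / D)%Z) in *.
      apply Rle_trans with (IZR v).
      + assert (E3 : (n ^ 2 - rho <= D * v + D)%Z) by lia. apply IZR_le in E3.
        rewrite minus_IZR, plus_IZR, mult_IZR in E3. rewrite pow_IZR. change (Z.of_nat 2) with 2%Z.
        apply (Rmult_le_reg_l (IZR D)); auto.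
        replace (IZR D * (/ IZR D * IZR (n ^ 2) - (IZR rho / IZR D + 1)))%R with (IZR (n ^ 2) - IZR rho - IZR D)%R by (field; lra). lra.
      + rewrite INR_IZR_INZ. apply IZR_le. lia. }
  exists (fun q => usum (fun n => c n * q ^ e n)). split.
  - apply DS_collect.
    + intros m. set (B := Z.to_nat (Z.abs rho + D * (Z.of_nat m + 2))). exists (zrange B). split; [apply NoDup_zrange|].
      intros n <-. apply in_zrange. unfold B, e.
      pose proof (Z.div_mod (n ^ 2 - rho) D ltac:(lia)) as E1. pose proof (Z.mod_pos_bound (n ^ 2 - rho) D HD) as E2.
      set (v := ((n ^ 2 - rho) / D)%Z) in *.
      assert (Z.of_nat (Z.to_nat v) >= v)%Z by lia.
      assert (n ^ 2 < Z.abs rho + D * (Z.of_nat (Z.to_nat v) + 2))%Z by nia.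
      assert (Z.abs n <= n ^ 2)%Z by nia.
      assert (0 <= Z.abs rho + D * (Z.of_nat (Z.to_nat v) + 2))%Z by nia. lia.
    + exact Hs.
  - intros tau Ht. unfold class_theta. rewrite <- usum_scal.
    + apply usum_ext. intros n. unfold c. destruct (_ =? 0)%Z eqn:En; [|ring].
      destruct (Z.eq_dec (chi n) 0) as [E0|E0]; [rewrite E0; ring|].
      apply mod_eqb_iff in En; auto. destruct En as [k Ek]. destruct (Hdiv n k Ek E0) as [m Hm].
      (* From n^2 >= 0 and [rho < D]; this is what the upper bound on [rho] is for, which may be
         negative. *)
      assert (M0 : (0 <= m)%Z). { assert (0 <= n ^ 2)%Z by nia. nia. }
      assert (Ee : e n = Z.to_nat m) by (unfold e; rewrite Hm, Z.div_mul by lia; reflexivity).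
      rewrite Ee, <- Qpow_INR.
      replace (IZR n ^ 2 * / (2 * INR (M * p)))%R with (IZR rho / (2 * INR (M * p)) + INR (Z.to_nat m))%R.
      * rewrite Qpow_plus. ring.
      * rewrite (INR_IZR_INZ (Z.to_nat m)), Z2Nat.id, pow_IZR by lia. change (Z.of_nat 2) with 2%Z. rewrite <- ED.
        replace (n ^ 2)%Z with (m * D + rho)%Z by lia. rewrite plus_IZR, mult_IZR. field. lra.
    + now apply Hs, Qof_lt_1.
Qed.

Lemma chi12_sqr n : chi12 n <> 0%Z -> (n ^ 2 mod 24 = 1)%Z.
Proof.
  intros H. rewrite <- chi12_mod in H.
  pose proof (Z.mod_pos_bound n 12 ltac:(lia)) as B. pose proof (Z.div_mod n 12 ltac:(lia)) as E.
  set (r := (n mod 12)%Z) in *. set (k := (n / 12)%Z) in *.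
  replace (n ^ 2)%Z with (r ^ 2 + (6 * k ^ 2 + k * r) * 24)%Z by (rewrite E; ring). rewrite Z.mod_add by lia.
  clearbody r. clear E k. revert r B H. apply (mod12_cases (fun r => chi12 r <> 0%Z -> (r ^ 2 mod 24 = 1)%Z)); intros H; try reflexivity; now destruct H.
Qed.

Lemma chi4_sqr n : chi4 n <> 0%Z -> (n ^ 2 mod 8 = 1)%Z.
Proof.
  intros H. rewrite <- chi4_mod in H.
  pose proof (Z.mod_pos_bound n 4 ltac:(lia)) as B. pose proof (Z.div_mod n 4 ltac:(lia)) as E.
  set (r := (n mod 4)%Z) in *. set (k := (n / 4)%Z) in *.
  replace (n ^ 2)%Z with (r ^ 2 + (2 * k ^ 2 + k * r) * 8)%Z by (rewrite E; ring). rewrite Z.mod_add by lia.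
  assert (r = 0 \/ r = 1 \/ r = 2 \/ r = 3)%Z as [R|[R|[R|R]]] by lia; rewrite R in *; try reflexivity; now destruct H.
Qed.

Lemma coprime_divide_mul a b n : rel_prime a b -> (a | n)%Z -> (b | n)%Z -> (a * b | n)%Z.
Proof.
  intros Hc [k Hk] Hb. rewrite Hk in Hb. rewrite Z.mul_comm in Hb. apply Gauss in Hb; [|now apply rel_prime_sym].
  destruct Hb as [m Hm]. exists m. rewrite Hk, Hm. ring.
Qed.

Lemma mod_divide_minus a b m : (0 < m)%Z -> (a mod m = b mod m)%Z -> (m | a - b)%Z.
Proof.
  intros Hm E. apply Z.mod_divide; [lia|]. rewrite Zminus_mod, E, Z.sub_diag. apply Z.mod_0_l. lia.
Qed.

Lemma Qform_Th p y rho : (0 < p)%nat -> rel_prime 24 (Z.of_nat p) -> (rho < 24 * Z.of_nat p)%Z ->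
  (rho mod 24 = 1)%Z -> (Z.of_nat p | y ^ 2 - rho)%Z -> Qform (Th p y) (IZR rho / (24 * INR p)).
Proof.
  intros Hp Hc Hr H1 H2.
  apply Qform_eq with (IZR rho / (2 * INR (12 * p)))%R.
  { rewrite mult_INR. replace (INR 12) with 12%R by (simpl; lra). f_equal. ring. }
  apply Qform_class_theta; auto using chi12_abs, IZR_bound; try lia.
  intros n k En Hn. replace (2 * Z.of_nat (12 * p))%Z with (24 * Z.of_nat p)%Z by lia.
  apply coprime_divide_mul; auto.
  - apply mod_divide_minus; [lia|]. rewrite H1. now apply chi12_sqr.
  - destruct H2 as [m Hm]. exists (m + 2 * y * k + k * k * Z.of_nat p)%Z. rewrite En. lia.
Qed.

Lemma Qform_th p y rho : (0 < p)%nat -> rel_prime 8 (Z.of_nat p) -> (rho < 8 * Z.of_nat p)%Z ->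
  (rho mod 8 = 1)%Z -> (Z.of_nat p | y ^ 2 - rho)%Z -> Qform (th p y) (IZR rho / (8 * INR p)).
Proof.
  intros Hp Hc Hr H1 H2.
  apply Qform_eq with (IZR rho / (2 * INR (4 * p)))%R.
  { rewrite mult_INR. replace (INR 4) with 4%R by (simpl; lra). f_equal. ring. }
  apply Qform_class_theta; auto using chi4_abs, one_bound; try lia.
  intros n k En Hn. replace (2 * Z.of_nat (4 * p))%Z with (8 * Z.of_nat p)%Z by lia.
  apply coprime_divide_mul; auto.
  - apply mod_divide_minus; [lia|]. rewrite H1. now apply chi4_sqr.
  - destruct H2 as [m Hm]. exists (m + 2 * y * k + k * k * Z.of_nat p)%Z. rewrite En. lia.
Qed.

(** * Solutions of the homogeneous system *)

Lemma sum_n_m_lsum (a : nat -> C) n : sum_n_m a 1 n = lsum a (seq 1 n).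
Proof.
  induction n as [|n IH].
  - rewrite sum_n_m_zero by lia. reflexivity.
  - rewrite sum_n_Sm, IH by lia. rewrite seq_S, lsum_app, (lsum_cons _ _ nil). simpl (lsum _ nil). simpl (1 + n)%nat.
    unfold plus; simpl. ring.
Qed.

(** Reduction to modular forms: [F j] is Q^(-Delta) times [H j], so the system is the inversion
    formula of a vector of weight 1/2, and the expansion of [F j] is what makes [H j] a function of
    Q. *)
Lemma solve_system (p : nat) (F H : nat -> C -> C) :
  (forall j, (1 <= j <= ell p)%nat -> Qform (F j) (- Delta_pj p j)) ->
  (forall j tau, (1 <= j <= ell p)%nat -> (0 < Im tau)%R -> H j tau = Qpow tau (Delta_pj p j) * F j tau) ->
  (forall j tau w, (1 <= j <= ell p)%nat -> (0 < Im tau)%R -> root_of_tau w tau ->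
     F j (tauS tau) = - w * lsum (fun k => RtoC (Mcoef p j k) * F k tau) (seq 1 (ell p))) ->
  multiples_solve_system p H.
Proof.
  intros HF HH HS.
  (* Chosen simultaneously for all [j]; outside the range of indices the value is irrelevant. *)
  set (h := fun j => epsilon (inhabits (fun _ : C => RtoC 0))
    (fun g => DS g /\ forall tau, (0 < Im tau)%R -> F j tau = Qpow tau (- Delta_pj p j) * g (Qof tau))).
  assert (Hh : forall j, (1 <= j <= ell p)%nat -> DS (h j) /\
    forall tau, (0 < Im tau)%R -> F j tau = Qpow tau (- Delta_pj p j) * h j (Qof tau)).
  { intros j Hj. unfold h. apply epsilon_spec. exact (HF j Hj). }
  exists h. split.
  - intros j tau Hj Ht. rewrite HH, (proj2 (Hh j Hj)), Qpow_opp by auto. field. apply Qpow_nz.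
  - intros c. split.
    + intros j Hj. apply DS_holomorphic, DS_scal, Hh, Hj.
    + intros j t Hj Ht tau.
      assert (PP : RtoC PI <> 0) by (apply RtoC_nz; pose proof PI_RGT_0; lra).
      assert (T0 : t <> 0) by now apply Re_sqr_pos_nz.
      assert (C0 : Ci <> 0) by apply Ci_nz.
      assert (Htau : (0 < Im tau)%R).
      { unfold tau, Cdiv. rewrite <- RtoC_inv by (pose proof PI_RGT_0; lra). rewrite im_scal_r.
        apply Rmult_lt_0_compat; [|apply Rinv_0_lt_compat, PI_RGT_0]. destruct t. simpl in *. lra. }
      pose proof (Im_tauS tau Htau) as Htau'. pose proof (Im_pos_nz tau Htau) as tau0.
      (* The inversion formula is read at -1/tau, so that [F j] at [tau] is on the left and the
         principal root of PI/t is the root [w] belonging to -1/tau. *)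
      assert (Ew : RtoC PI / t = - Ci * tauS tau).
      { unfold tauS, tau. transitivity (RtoC PI * Ci / (Ci * t)); [field; auto|field; auto]. }
      assert (Hw : root_of_tau (Csqrt (RtoC PI / t)) (tauS tau)) by (rewrite Ew; now apply Csqrt_root).
      set (w := Csqrt (RtoC PI / t)) in *.
      assert (EQ : forall r, Q1pow tau r = Qpow (tauS tau) r).
      { intros r. unfold Q1pow, Qpow, tauS. f_equal. field. auto. }
      pose proof (HS j (tauS tau) w Hj Htau' Hw) as E. rewrite tauS_tauS in E by auto.
      rewrite sum_n_m_lsum.
      rewrite (lsum_ext_in _ (fun k => c * (RtoC (Mcoef p j k) * F k (tauS tau)))).
      * rewrite lsum_scal.
        replace (Qpow tau (- Delta_pj p j) * (c * h j (Qof tau))) with (c * F j tau) by (rewrite (proj2 (Hh j Hj)) by auto; ring).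
        rewrite E. ring.
      * intros k Hk. apply in_seq in Hk. rewrite (proj2 (Hh k ltac:(lia))) by auto.
        unfold Q1of. rewrite !EQ. unfold Qof. ring.
Qed.

(** In weight 0 the matrix [c] is constant, and differentiating the relation in tau only brings in
    the derivative 1/tau^2 of -1/tau. *)
Lemma Dtau_S (G : nat -> C -> C) (r : nat -> R) (c : nat -> C) (l : list nat) (j : nat) :
  (forall k, In k (j :: l) -> Qform (G k) (r k)) ->
  (forall tau, (0 < Im tau)%R -> G j (tauS tau) = lsum (fun k => c k * G k tau) l) ->
  forall tau, (0 < Im tau)%R -> Dtau (G j) (tauS tau) = tau ^ 2 * lsum (fun k => c k * Dtau (G k) tau) l.
Proof.
  intros HG HS tau Ht. pose proof (Im_pos_nz tau Ht) as T0. pose proof (Im_tauS tau Ht) as Ht'.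
  pose proof two_pi_i_nz as N0.
  pose proof (Cder_comp _ tauS tau _ _ (proj2 (Qform_Dtau _ _ (HG j (or_introl eq_refl))) _ Ht') (Cder_tauS tau T0)) as D1.
  assert (D2 : Cder (fun u => lsum (fun k => c k * G k u) l) tau (RtoC (2 * PI) * Ci * lsum (fun k => c k * Dtau (G k) tau) l)).
  { assert (HG' : forall k, In k l -> Qform (G k) (r k)) by (intros; apply HG; now right).
    clear - HG' Ht. induction l as [|a l IH].
    - eapply Cder_eq; [|exact (Cder_const 0 tau)]. simpl. ring.
    - pose proof (Cder_plus _ _ _ _ _ (Cder_scal (c a) _ _ _ (proj2 (Qform_Dtau _ _ (HG' a (or_introl eq_refl))) _ Ht))
        (IH (fun k Hk => HG' k (or_intror Hk)))) as D.
      eapply Cder_eq; [|exact D]. rewrite lsum_cons. ring. }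
  apply Cder_half_plane with (g := fun u => G j (tauS u)) in D2; auto.
  2:{ intros u Hu. symmetry. now apply HS. }
  pose proof (Cder_unique _ _ _ _ D1 D2) as E.
  set (X := Dtau (G j) (tauS tau)) in *. set (Y := lsum _ _) in *.
  assert (P2 : RtoC (2 * PI) <> 0) by (apply RtoC_nz; pose proof PI_RGT_0; lra). assert (C0 : Ci <> 0) by apply Ci_nz.
  replace X with (/ (tau * tau) * (RtoC (2 * PI) * Ci * X) * (tau ^ 2 / (RtoC (2 * PI) * Ci))) by (field; auto).
  rewrite E. field. auto.
Qed.

(** The factor tau^2 of the derivative is -w^4, and division by [eta ^ 3] leaves -w. The 1/8 in the
    exponent is the 3/24 of [eta ^ 3]. *)
Lemma solve_system_derivative (p : nat) (G H : nat -> C -> C) :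
  (forall j, (1 <= j <= ell p)%nat -> Qform (G j) (1 / 8 - Delta_pj p j)) ->
  (forall j tau, (1 <= j <= ell p)%nat -> (0 < Im tau)%R ->
     H j tau = Qpow tau (Delta_pj p j) * (/ eta tau ^ 3 * Dtau (G j) tau)) ->
  (forall j tau, (1 <= j <= ell p)%nat -> (0 < Im tau)%R ->
     G j (tauS tau) = lsum (fun k => RtoC (Mcoef p j k) * G k tau) (seq 1 (ell p))) ->
  multiples_solve_system p H.
Proof.
  intros HG HH HS. apply solve_system with (fun j tau => / eta tau ^ 3 * Dtau (G j) tau).
  - intros j Hj. apply Qform_eq with (- (INR 3 / 24) + (1 / 8 - Delta_pj p j))%R; [simpl INR; lra|].
    apply Qform_mult; [apply Qform_eta_inv|]. apply (Qform_Dtau _ _ (HG j Hj)).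
  - exact HH.
  - intros j tau w Hj Ht Hw.
    rewrite (Dtau_S G (fun k => (1 / 8 - Delta_pj p k)%R) (fun k => RtoC (Mcoef p j k)) (seq 1 (ell p)) j); auto.
    + rewrite (eta_S w) by auto. pose proof (root_of_tau_nz _ _ Hw) as W0. destruct Hw as [_ Ew].
      pose proof (eta_nz tau Ht) as N0.
      rewrite (lsum_ext_in (fun k => RtoC (Mcoef p j k) * (/ eta tau ^ 3 * Dtau (G k) tau))
        (fun k => / eta tau ^ 3 * (RtoC (Mcoef p j k) * Dtau (G k) tau))) by (intros; ring).
      rewrite lsum_scal. set (L := lsum _ _).
      replace (tau ^ 2) with (- (w ^ 2) ^ 2).
      * field. auto.
      * rewrite Ew. replace ((- Ci * tau) ^ 2) with ((Ci * Ci) * tau ^ 2) by ring. rewrite Ci_sqr. ring.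
    + intros k [<-|Hk]; auto. apply HG. apply in_seq in Hk. lia.
Qed.

(** * Primes congruent to 1, 5 and 7 modulo 12 *)

Lemma sin_mod (p : nat) (m m' k : Z) : (0 < p)%nat -> (m = m' + k * Z.of_nat p)%Z ->
  sin (2 * PI * (IZR m / INR p)) = sin (2 * PI * (IZR m' / INR p)).
Proof.
  intros Hp ->. assert (PP : (0 < INR p)%R) by now apply lt_0_INR.
  assert (E : ex (IZR (m' + k * Z.of_nat p) / INR p) = ex (IZR m' / INR p)).
  { rewrite plus_IZR, mult_IZR, <- INR_IZR_INZ.
    replace ((IZR m' + IZR k * INR p) / INR p)%R with (IZR m' / INR p + IZR k)%R by (field; lra).
    rewrite ex_plus, ex_Z. ring. }
  rewrite !ex_cos_sin in E. now injection E.
Qed.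

Lemma mod_inverse_exists (d p : Z) : rel_prime d p -> exists a k : Z, (d * a = 1 + k * p)%Z.
Proof.
  intros H. destruct (rel_prime_bezout _ _ H) as [u v E]. exists u, (- v)%Z. lia.
Qed.

(** x_j is 6 j modulo [p]. The congruence on 36 a s^2 covers both cases: it is 3 (12 a) s^2 when 12
    a = 1 and s^2 = -1, and 3 (4 a)(3 s^2) when 4 a = 1 and 3 s^2 = -1. *)
Lemma sin_residue (p : nat) (a s : Z) (j k : nat) : (0 < p)%nat ->
  (exists m, (36 * (a * s ^ 2) = -3 + m * Z.of_nat p)%Z) ->
  sin (2 * PI * (IZR (a * (s * xj p j) * (6 * s) * Z.of_nat k) / INR p))
  = (- sin (6 * PI * INR j * INR k / INR p))%R.
Proof.
  intros Hp [m Hm].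
  rewrite (sin_mod p _ (-3 * (Z.of_nat j * Z.of_nat k)) (m * (Z.of_nat j * Z.of_nat k) - 6 * a * s ^ 2 * Z.of_nat k)); auto.
  - rewrite !mult_IZR, <- !INR_IZR_INZ, <- sin_neg. f_equal. field. apply not_0_INR. lia.
  - unfold xj. replace (a * (s * (6 * Z.of_nat j - Z.of_nat p)) * (6 * s) * Z.of_nat k)%Z with
      (36 * (a * s ^ 2) * (Z.of_nat j * Z.of_nat k) - 6 * a * s ^ 2 * Z.of_nat k * Z.of_nat p)%Z by ring.
    rewrite Hm. ring.
Qed.

Lemma residue_shift (p : nat) (s : Z) (k : nat) : (0 < p)%nat ->
  ((6 * s * Z.of_nat k) mod Z.of_nat p = (s * xj p k) mod Z.of_nat p)%Z.
Proof.
  intros Hp. replace (6 * s * Z.of_nat k)%Z with (s * xj p k + s * Z.of_nat p)%Z by (unfold xj; ring).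
  apply Z.mod_add. lia.
Qed.

Lemma Th_S_xj (p : nat) (s m : Z) (j : nat) w tau : (p mod 2 = 1)%nat -> (0 < Im tau)%R -> root_of_tau w tau ->
  rel_prime 12 (Z.of_nat p) -> (s ^ 2 = -1 + m * Z.of_nat p)%Z ->
  Th p (s * xj p j) (tauS tau) = - RtoC (2 * IZR (chi12 (Z.of_nat p)) / sqrt (INR p)) * w ^ 3
    * lsum (fun k => RtoC (sin (6 * PI * INR j * INR k / INR p)) * Th p (s * xj p k) tau) (seq 1 (ell p)).
Proof.
  intros Ho Ht Hw Hc Hs. assert (Hp : (0 < p)%nat) by (destruct p; [discriminate|lia]).
  destruct (mod_inverse_exists _ _ Hc) as (a & k0 & Ha).
  (* The inverse of 6 s is -2 a s, because 12 a s^2 is -1 modulo [p]. *)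
  assert (Hv : rel_prime (6 * s) (Z.of_nat p)).
  { apply bezout_rel_prime. apply Bezout_intro with (2 * a * - s)%Z (m * (1 + k0 * Z.of_nat p) - k0)%Z.
    replace (2 * a * - s * (6 * s))%Z with (- (12 * a) * s ^ 2)%Z by ring. rewrite Ha, Hs. ring. }
  rewrite (Th_S p a (6 * s) (s * xj p j) w tau) by (auto; now exists k0).
  rewrite (lsum_ext_in _ (fun k => - RtoC 1 * (RtoC (sin (6 * PI * INR j * INR k / INR p)) * Th p (s * xj p k) tau))).
  - rewrite lsum_scal. ring.
  - intros k _. rewrite sin_residue, RtoC_opp, (Th_mod p (6 * s * Z.of_nat k) (s * xj p k)); auto using residue_shift; [ring|].
    exists (3 * (m + k0 * s ^ 2))%Z. replace (36 * (a * s ^ 2))%Z with (3 * ((12 * a) * s ^ 2))%Z by ring. rewrite Ha, Z.mul_add_distr_r, Hs. ring.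
Qed.

Lemma th_S_xj (p : nat) (s m : Z) (j : nat) w tau : (p mod 2 = 1)%nat -> (0 < Im tau)%R -> root_of_tau w tau ->
  rel_prime 4 (Z.of_nat p) -> (3 * s ^ 2 = -1 + m * Z.of_nat p)%Z ->
  th p (s * xj p j) (tauS tau) = RtoC (2 * IZR (chi4 (Z.of_nat p)) / sqrt (INR p)) * w
    * lsum (fun k => RtoC (sin (6 * PI * INR j * INR k / INR p)) * th p (s * xj p k) tau) (seq 1 (ell p)).
Proof.
  intros Ho Ht Hw Hc Hs. assert (Hp : (0 < p)%nat) by (destruct p; [discriminate|lia]).
  destruct (mod_inverse_exists _ _ Hc) as (a & k0 & Ha).
  assert (Hv : rel_prime (6 * s) (Z.of_nat p)).
  { apply bezout_rel_prime. apply Bezout_intro with (2 * a * - s)%Z (m * (1 + k0 * Z.of_nat p) - k0)%Z.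
    replace (2 * a * - s * (6 * s))%Z with (- (4 * a) * (3 * s ^ 2))%Z by ring. rewrite Ha, Hs. ring. }
  rewrite (th_S p a (6 * s) (s * xj p j) w tau) by (auto; now exists k0).
  rewrite (lsum_ext_in _ (fun k => - RtoC 1 * (RtoC (sin (6 * PI * INR j * INR k / INR p)) * th p (s * xj p k) tau))).
  - rewrite lsum_scal. ring.
  - intros k _. rewrite sin_residue, RtoC_opp, (th_mod p (6 * s * Z.of_nat k) (s * xj p k)); auto using residue_shift; [ring|].
    exists (3 * (m + k0 * (3 * s ^ 2)))%Z. replace (36 * (a * s ^ 2))%Z with (3 * ((4 * a) * (3 * s ^ 2)))%Z by ring.
    rewrite Ha, Z.mul_add_distr_r, Hs. ring.
Qed.

Lemma mod_minus_one (a p : Z) : (0 < p)%Z -> (a mod p = (-1) mod p)%Z -> exists m, (a = -1 + m * p)%Z.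
Proof. intros Hp E. destruct (mod_divide_minus _ _ _ Hp E) as [m Hm]. exists m. lia. Qed.

Lemma mod_decompose (p d r : nat) : (d <> 0)%nat -> (p mod d = r)%nat -> exists q, p = (d * q + r)%nat.
Proof. intros Hd <-. exists (p / d)%nat. now apply Nat.div_mod. Qed.

Lemma coprime_24 (p q : nat) (r : Z) : (Z.of_nat p = 12 * Z.of_nat q + r)%Z -> (r = 1 \/ r = 5 \/ r = 7 \/ r = 11)%Z ->
  rel_prime 24 (Z.of_nat p).
Proof.
  intros E Hr. apply bezout_rel_prime. set (n := Z.of_nat p) in *.
  assert (K : (24 | n ^ 2 - 1)%Z).
  { apply mod_divide_minus; [lia|]. apply chi12_sqr. rewrite E.
    replace (12 * Z.of_nat q + r)%Z with (r + Z.of_nat q * Z.of_nat 12)%Z by lia. rewrite chi12_per.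
    destruct Hr as [-> | [-> |[-> | -> ]]]; discriminate. }
  destruct K as [m Hm]. apply Bezout_intro with (- m)%Z n. lia.
Qed.

Lemma rel_prime_div_l a b n : rel_prime (a * b) n -> rel_prime a n.
Proof. intros H. apply rel_prime_div with (a * b)%Z; auto. exists b. ring. Qed.

Lemma xj_sqr (p q j : nat) (r : Z) : (Z.of_nat p = 12 * Z.of_nat q + r)%Z -> (r = 1 \/ r = 5 \/ r = 7 \/ r = 11)%Z ->
  exists m, (xj p j ^ 2 = 1 + 24 * m)%Z.
Proof.
  intros E Hr. destruct (mod_divide_minus (xj p j ^ 2) 1 24 ltac:(lia)) as [m Hm]; [|exists m; lia].
  apply chi12_sqr. unfold xj. rewrite E.
  assert (H6 : exists c d : Z, (Z.of_nat j = 2 * c + d)%Z /\ (d = 0 \/ d = 1)%Z).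
  { exists (Z.of_nat j / 2)%Z, (Z.of_nat j mod 2)%Z. pose proof (Z.div_mod (Z.of_nat j) 2). pose proof (Z.mod_pos_bound (Z.of_nat j) 2). lia. }
  destruct H6 as (c & d & -> & Hd).
  replace (6 * (2 * c + d) - (12 * Z.of_nat q + r))%Z with ((6 * d - r) + (c - Z.of_nat q) * Z.of_nat 12)%Z by lia.
  rewrite chi12_per. destruct Hd as [-> | ->]; destruct Hr as [-> | [-> |[-> | -> ]]]; discriminate.
Qed.

Lemma neg_one_pow_sqr n : ((-1) ^ n * (-1) ^ n = 1)%R.
Proof. rewrite <- pow_add. replace (n + n)%nat with (2 * n)%nat by lia. apply pow_1_even. Qed.

Lemma Mcoef_sign (p j k : nat) (e : R) : ((-1) ^ ((p + 3) / 6) = e)%R ->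
  Mcoef p j k = ((-1) ^ j * (-1) ^ k * (2 * e / sqrt (INR p)) * sin (6 * PI * INR j * INR k / INR p))%R.
Proof. intros <-. unfold Mcoef. rewrite !pow_add. unfold Rdiv. ring. Qed.

(** The signs (-1)^k of the matrix and of the vector cancel, leaving the bare sine transform. *)
Lemma signed_sum (p j : nat) (e : R) (T : nat -> C) (c : C) : ((-1) ^ ((p + 3) / 6) = e)%R ->
  lsum (fun k => RtoC (Mcoef p j k) * (RtoC ((-1) ^ k) * T k * c)) (seq 1 (ell p))
  = RtoC ((-1) ^ j) * c * RtoC (2 * e / sqrt (INR p))
    * lsum (fun k => RtoC (sin (6 * PI * INR j * INR k / INR p)) * T k) (seq 1 (ell p)).
Proof.
  intros He. rewrite <- lsum_scal. apply lsum_ext_in. intros k _.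
  rewrite (Mcoef_sign p j k e He), !RtoC_mult.
  transitivity (RtoC ((-1) ^ k * (-1) ^ k) * (RtoC ((-1) ^ j) * c * RtoC (2 * e / sqrt (INR p))
    * (RtoC (sin (6 * PI * INR j * INR k / INR p)) * T k))).
  - rewrite RtoC_mult. ring.
  - rewrite neg_one_pow_sqr. ring.
Qed.

(** * Agreement of the quotient and series forms of [H] *)

Lemma Theta_shift (p : nat) (y X B : Z) tau : (0 < p)%nat -> (0 < Im tau)%R ->
  CSeries_mod p y (fun n => RtoC (IZR (n * kronecker 12 n)) * Qpow tau (IZR (X + n ^ 2 - B) / (24 * INR p)))
  = Qpow tau (IZR (X - B) / (24 * INR p)) * Theta p y tau.
Proof.
  intros Hp Ht. assert (PP : (0 < INR p)%R) by now apply lt_0_INR.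
  pose proof (summable_restrict (fun n => ((n - y) mod Z.of_nat p =? 0)%Z) _ (Theta_summable p tau Hp Ht)) as Hs.
  unfold Theta, CSeries_mod. rewrite (CSeriesZ_usum _ Hs), <- usum_scal by exact Hs.
  assert (E : forall n, (if ((n - y) mod Z.of_nat p =? 0)%Z then
     RtoC (IZR (n * kronecker 12 n)) * Qpow tau (IZR (X + n ^ 2 - B) / (24 * INR p)) else RtoC 0)
    = Qpow tau (IZR (X - B) / (24 * INR p)) * (if ((n - y) mod Z.of_nat p =? 0)%Z then
     RtoC (IZR (n * kronecker 12 n)) * Qpow tau (IZR (n ^ 2) / (24 * INR p)) else RtoC 0)).
  { intros n. destruct (_ =? 0)%Z; [|ring].
    replace (IZR (X + n ^ 2 - B) / (24 * INR p))%R with (IZR (X - B) / (24 * INR p) + IZR (n ^ 2) / (24 * INR p))%R.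
    - rewrite Qpow_plus. ring.
    - rewrite !minus_IZR, plus_IZR. field. lra. }
  rewrite CSeriesZ_usum.
  - now apply usum_ext.
  - apply summable_ext with (1 := fun n => eq_sym (E n)). now apply summable_scal.
Qed.

Lemma eta_pow_Qpoch (tau : C) n : eta tau ^ n = Qpow tau (INR n / 24) * Qpoch (Qof tau) ^ n.
Proof.
  induction n as [|n IH].
  - simpl. unfold Rdiv. rewrite Rmult_0_l, Qpow_0. ring.
  - rewrite S_INR. replace ((INR n + 1) / 24)%R with (INR n / 24 + 1 / 24)%R by field. rewrite Qpow_plus.
    change (eta tau * eta tau ^ n = Qpow tau (INR n / 24) * Qpow tau (1 / 24) * (Qpoch (Qof tau) * Qpoch (Qof tau) ^ n)).
    rewrite IH. unfold eta. ring.
Qed.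

Lemma H_series_eq (p : nat) (y X : Z) (n : nat) (c : C) tau : (0 < p)%nat -> (0 < Im tau)%R ->
  c * Qpow tau (IZR X / (24 * INR p)) * (Theta p y tau / eta tau ^ n)
  = c / Qpoch (Qof tau) ^ n * CSeries_mod p y (fun m => RtoC (IZR (m * kronecker 12 m))
      * Qpow tau (IZR (X + m ^ 2 - Z.of_nat n * Z.of_nat p) / (24 * INR p))).
Proof.
  intros Hp Ht. assert (PP : (0 < INR p)%R) by now apply lt_0_INR.
  rewrite Theta_shift, eta_pow_Qpoch by auto.
  replace (IZR (X - Z.of_nat n * Z.of_nat p) / (24 * INR p))%R with (IZR X / (24 * INR p) + - (INR n / 24))%R.
  - rewrite Qpow_plus, Qpow_opp. field. split; [apply Qpow_nz|apply Cpow_nz, Qpoch_nz, Qof_lt_1, Ht].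
  - rewrite minus_IZR, mult_IZR, <- !INR_IZR_INZ. field. lra.
Qed.

Lemma mod1_series (p : nat) (s : Z) (j : nat) tau : (0 < p)%nat -> (0 < Im tau)%R ->
  H_mod1 p s j tau = H_mod1_series p s j tau.
Proof. intros Hp Ht. exact (H_series_eq p (s * xj p j) (xj p j ^ 2) 2 (RtoC ((-1) ^ j)) tau Hp Ht). Qed.

Lemma mod5_series (p : nat) (s : Z) (j : nat) tau : (0 < p)%nat -> (0 < Im tau)%R ->
  H_mod5 p s j tau = H_mod5_series p s j tau.
Proof.
  intros Hp Ht.
  transitivity (RtoC ((-1) ^ j) * E4 tau * Qpow tau (Delta_pj p j) * (Theta p (s * xj p j) tau / eta tau ^ 10)).
  - unfold H_mod5. ring.
  - exact (H_series_eq p (s * xj p j) (xj p j ^ 2) 10 (RtoC ((-1) ^ j) * E4 tau) tau Hp Ht).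
Qed.

(** The residue is rho = n p - x_j^2, with [n] the power of [eta] in the denominator. Modulo [p] it
    is -x_j^2 = (s x_j)^2. Modulo 24, n p = n r + 12 n q is 2 because [n] is even, and x_j^2 is 1,
    so rho is 1. *)
Lemma Qform_Th_xj (p q : nat) (r s m n : Z) (j : nat) : (0 < p)%nat -> (Z.of_nat p = 12 * Z.of_nat q + r)%Z ->
  (r = 1 \/ r = 5 \/ r = 7 \/ r = 11)%Z -> (n < 24)%Z -> ((n * r) mod 24 = 2)%Z -> (n mod 2 = 0)%Z ->
  (s ^ 2 = -1 + m * Z.of_nat p)%Z ->
  Qform (Th p (s * xj p j)) (IZR n / 24 - Delta_pj p j).
Proof.
  intros Hp E Hr Hn Hnr He Hs. destruct (xj_sqr p q j r E Hr) as [m' Hx].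
  apply Qform_eq with (IZR (n * Z.of_nat p - xj p j ^ 2) / (24 * INR p))%R.
  { unfold Delta_pj. rewrite minus_IZR, mult_IZR, <- INR_IZR_INZ. field. apply not_0_INR. lia. }
  apply Qform_Th; auto.
  - eapply coprime_24; eauto.
  - nia.
  - rewrite Hx, E. pose proof (Z.div_mod (n * r) 24 ltac:(lia)) as E1. pose proof (Z.div_mod n 2 ltac:(lia)) as E2.
    rewrite Hnr in E1. rewrite He in E2. symmetry.
    apply Zmod_unique with (n / 2 * Z.of_nat q + n * r / 24 - m')%Z; [lia|].
    set (u := (n / 2)%Z) in *. set (v := (n * r / 24)%Z) in *. clearbody u v.
    replace (n * (12 * Z.of_nat q + r))%Z with (12 * n * Z.of_nat q + n * r)%Z by ring. rewrite E1, E2. ring.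
  - exists (m * xj p j ^ 2 - n)%Z. rewrite Z.pow_mul_l, Hs. ring.
Qed.

Lemma root_pow8 w tau : root_of_tau w tau -> w ^ 8 = tau ^ 4.
Proof.
  intros [_ E]. replace (w ^ 8) with ((w ^ 2) ^ 4) by ring. rewrite E.
  replace ((- Ci * tau) ^ 4) with ((Ci * Ci) * (Ci * Ci) * tau ^ 4) by ring. rewrite !Ci_sqr. ring.
Qed.

Lemma odd_pow_neg_one n : ((-1) ^ (2 * n + 1) = -1)%R.
Proof. rewrite pow_add, pow_1_even. ring. Qed.

(** For p = 12 q + 1, (p + 3)/6 = 2 q is even and [chi12] of [p] is 1, so the two signs agree; the
    weights combine to w^3/w^2. *)
Lemma case_mod1 (p : nat) (s : Z) : (p mod 12 = 1)%nat -> (s ^ 2 mod Z.of_nat p = (-1) mod Z.of_nat p)%Z ->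
  multiples_solve_system p (H_mod1 p s).
Proof.
  intros Hp Hs. destruct (mod_decompose p 12 _ (Nat.neq_succ_0 11) Hp) as [q Hq].
  assert (p0 : (0 < p)%nat) by lia. assert (E : (Z.of_nat p = 12 * Z.of_nat q + 1)%Z) by lia.
  destruct (mod_minus_one _ (Z.of_nat p) ltac:(lia) Hs) as [m Hm].
  assert (Hc : rel_prime 12 (Z.of_nat p)) by (apply rel_prime_div_l with 2%Z; eapply coprime_24; eauto).
  apply solve_system with (fun j tau => RtoC ((-1) ^ j) * Th p (s * xj p j) tau * / eta tau ^ 2).
  - intros j Hj. apply Qform_eq with ((IZR 2 / 24 - Delta_pj p j) + - (INR 2 / 24))%R; [simpl INR; lra|].
    apply (Qform_mult (fun tau => RtoC ((-1) ^ j) * Th p (s * xj p j) tau)); [|apply Qform_eta_inv].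
    apply Qform_scal. apply (Qform_Th_xj p q 1 s m 2 j); auto; lia.
  - intros j tau Hj Ht. unfold H_mod1. rewrite Theta_Th by auto. unfold Cdiv. ring.
  - intros j tau w Hj Ht Hw. rewrite (signed_sum p j 1).
    2:{ replace ((p + 3) / 6)%nat with (2 * q)%nat; [apply pow_1_even|]. rewrite Hq.
        replace (12 * q + 1 + 3)%nat with (4 + 2 * q * 6)%nat by lia. now rewrite Nat.div_add. }
    rewrite (Th_S_xj p s m j w tau), (eta_S w) by (auto; rewrite Hq; replace (12 * q + 1)%nat with (1 + 6 * q * 2)%nat by lia; now rewrite Nat.Div0.mod_add).
    replace (chi12 (Z.of_nat p)) with 1%Z.
    2:{ rewrite E. replace (12 * Z.of_nat q + 1)%Z with (1 + Z.of_nat q * Z.of_nat 12)%Z by lia. now rewrite chi12_per. }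
    set (L := lsum _ _). pose proof (root_of_tau_nz _ _ Hw). pose proof (eta_nz tau Ht). field. auto.
Qed.

(** For p = 12 q + 5, (p + 3)/6 = 2 q + 1 is odd and [chi12] of [p] is -1; the weights combine to
    w^3 w^8/w^10. *)
Lemma case_mod5 (p : nat) (s : Z) : (p mod 12 = 5)%nat -> (s ^ 2 mod Z.of_nat p = (-1) mod Z.of_nat p)%Z ->
  multiples_solve_system p (H_mod5 p s).
Proof.
  intros Hp Hs. destruct (mod_decompose p 12 _ (Nat.neq_succ_0 11) Hp) as [q Hq].
  assert (p0 : (0 < p)%nat) by lia. assert (E : (Z.of_nat p = 12 * Z.of_nat q + 5)%Z) by lia.
  destruct (mod_minus_one _ (Z.of_nat p) ltac:(lia) Hs) as [m Hm].
  assert (Hc : rel_prime 12 (Z.of_nat p)) by (apply rel_prime_div_l with 2%Z; eapply coprime_24; eauto).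
  apply solve_system with (fun j tau => RtoC ((-1) ^ j) * Th p (s * xj p j) tau * (E4 tau * / eta tau ^ 10)).
  - intros j Hj. apply Qform_eq with ((IZR 10 / 24 - Delta_pj p j) + (0 + - (INR 10 / 24)))%R; [simpl INR; lra|].
    apply (Qform_mult (fun tau => RtoC ((-1) ^ j) * Th p (s * xj p j) tau)).
    + apply Qform_scal. apply (Qform_Th_xj p q 5 s m 10 j); auto; lia.
    + apply Qform_mult; [apply Qform_E4|apply Qform_eta_inv].
  - intros j tau Hj Ht. unfold H_mod5. rewrite Theta_Th by auto. unfold Cdiv. ring.
  - intros j tau w Hj Ht Hw. rewrite (signed_sum p j (-1)).
    2:{ replace ((p + 3) / 6)%nat with (2 * q + 1)%nat; [apply odd_pow_neg_one|]. rewrite Hq.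
        replace (12 * q + 5 + 3)%nat with (2 + (2 * q + 1) * 6)%nat by lia. now rewrite Nat.div_add. }
    rewrite (Th_S_xj p s m j w tau), (eta_S w), E4_S, <- (root_pow8 w tau) by (auto; rewrite Hq; replace (12 * q + 5)%nat with (1 + (6 * q + 2) * 2)%nat by lia; now rewrite Nat.Div0.mod_add).
    replace (chi12 (Z.of_nat p)) with (-1)%Z.
    2:{ rewrite E. replace (12 * Z.of_nat q + 5)%Z with (5 + Z.of_nat q * Z.of_nat 12)%Z by lia. now rewrite chi12_per. }
    set (L := lsum _ _). pose proof (root_of_tau_nz _ _ Hw). pose proof (eta_nz tau Ht). field. auto.
Qed.

Lemma Dtau_scal c f r tau : Qform f r -> (0 < Im tau)%R -> Dtau (fun u => c * f u) tau = c * Dtau f tau.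
Proof.
  intros Hf Ht. rewrite (Dtau_Cder _ _ _ (Cder_scal c _ _ _ (proj2 (Qform_Dtau f r Hf) tau Ht))).
  field. split; [apply Ci_nz|apply RtoC_nz; pose proof PI_RGT_0; lra].
Qed.

Lemma Dtau_ext f g r tau : Qform f r -> (forall u, (0 < Im u)%R -> g u = f u) -> (0 < Im tau)%R ->
  Dtau g tau = Dtau f tau.
Proof.
  intros Hf E Ht. pose proof (proj2 (Qform_Dtau f r Hf) tau Ht) as D.
  apply Cder_half_plane with (g := g) in D; [|exact Ht|intros; symmetry; auto].
  rewrite (Dtau_Cder _ _ _ D). field. split; [apply Ci_nz|apply RtoC_nz; pose proof PI_RGT_0; lra].
Qed.

(** For p = 12 q + 7, (p + 3)/6 = 2 q + 1 is odd and [chi4] of [p] is -1; [theta] over [eta] has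
    weight 0. *)
Lemma case_mod7 (p : nat) (s : Z) : (p mod 12 = 7)%nat -> ((3 * s ^ 2) mod Z.of_nat p = (-1) mod Z.of_nat p)%Z ->
  multiples_solve_system p (H_mod7 p s).
Proof.
  intros Hp Hs. destruct (mod_decompose p 12 _ (Nat.neq_succ_0 11) Hp) as [q Hq].
  assert (p0 : (0 < p)%nat) by lia. assert (E : (Z.of_nat p = 12 * Z.of_nat q + 7)%Z) by lia.
  destruct (mod_minus_one _ (Z.of_nat p) ltac:(lia) Hs) as [m Hm].
  assert (Hc : rel_prime 24 (Z.of_nat p)) by (eapply coprime_24; eauto).
  assert (HQ : forall j, Qform (fun tau => th p (s * xj p j) tau * / eta tau) (1 / 8 - Delta_pj p j)).
  { intros j. destruct (xj_sqr p q j 7 E ltac:(auto)) as [m' Hx].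
    (* The residue is (4 p - x_j^2)/3, visibly 1 modulo 8 in this form. Modulo [p] it is -x_j^2/3,
       which is (s x_j)^2 since 3 s^2 = -1; its quotient by 8 p is 1/6 - Delta, and 1/eta subtracts
       1/24. *)
    apply Qform_eq with (IZR (16 * Z.of_nat q - 8 * m' + 9) / (8 * INR p) + - (INR 1 / 24))%R.
    { unfold Delta_pj. rewrite Hx. rewrite (INR_IZR_INZ p), E. rewrite !plus_IZR, minus_IZR, !mult_IZR.
      simpl INR. assert (0 <= IZR (Z.of_nat q))%R by (apply (IZR_le 0); lia). field. lra. }
    apply Qform_mult.
    - apply Qform_th; auto.
      + apply rel_prime_div_l with 3%Z. exact Hc.
      + nia.
      + replace (16 * Z.of_nat q - 8 * m' + 9)%Z with (1 + (2 * Z.of_nat q - m' + 1) * 8)%Z by ring. now rewrite Z.mod_add.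
      + apply Gauss with 3%Z; [|apply rel_prime_sym, rel_prime_div_l with 8%Z; exact Hc].
        exists (m * xj p j ^ 2 - 4)%Z. rewrite Z.pow_mul_l.
        replace (3 * (s ^ 2 * xj p j ^ 2 - (16 * Z.of_nat q - 8 * m' + 9)))%Z with
          (3 * s ^ 2 * xj p j ^ 2 - (48 * Z.of_nat q - 24 * m' + 27))%Z by ring.
        rewrite Hm. replace (48 * Z.of_nat q - 24 * m' + 27)%Z with (4 * Z.of_nat p - xj p j ^ 2)%Z by lia. ring.
    - eapply Qform_ext; [|apply (Qform_eta_inv 1)]. intros tau _. simpl. now rewrite Cmult_1_r. }
  apply solve_system_derivative with (fun j tau => RtoC ((-1) ^ (j + 1)) * (th p (s * xj p j) tau * / eta tau)).
  - intros j Hj. apply Qform_scal, HQ.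
  - intros j tau Hj Ht. rewrite (Dtau_scal _ _ _ _ (HQ j) Ht). unfold H_mod7.
    rewrite (Dtau_ext _ (fun u => theta p (s * xj p j) u / eta u) _ tau (HQ j)); auto.
    + unfold Cdiv. ring.
    + intros u Hu. now rewrite theta_th.
  - intros j tau Hj Ht. pose proof (Csqrt_root tau Ht) as Hw. set (w := Csqrt (- Ci * tau)) in *.
    rewrite (lsum_ext_in _ (fun k => RtoC (Mcoef p j k) * (RtoC ((-1) ^ k) * th p (s * xj p k) tau * - / eta tau))).
    2:{ intros k _. rewrite Nat.add_1_r. simpl (_ ^ _)%R. rewrite RtoC_mult. ring. }
    rewrite (signed_sum p j (-1)).
    2:{ replace ((p + 3) / 6)%nat with (2 * q + 1)%nat; [apply odd_pow_neg_one|]. rewrite Hq.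
        replace (12 * q + 7 + 3)%nat with (4 + (2 * q + 1) * 6)%nat by lia. now rewrite Nat.div_add. }
    rewrite (th_S_xj p s m j w tau), (eta_S w); auto.
    + replace (chi4 (Z.of_nat p)) with (-1)%Z.
      2:{ rewrite E. replace (12 * Z.of_nat q + 7)%Z with (3 + (3 * Z.of_nat q + 1) * Z.of_nat 4)%Z by lia. now rewrite chi4_per. }
      set (L := lsum _ _). pose proof (root_of_tau_nz _ _ Hw). pose proof (eta_nz tau Ht).
      rewrite Nat.add_1_r. simpl (_ ^ _)%R. rewrite RtoC_mult. field. auto.
    + rewrite Hq. replace (12 * q + 7)%nat with (1 + (6 * q + 3) * 2)%nat by lia. now rewrite Nat.Div0.mod_add.
    + apply rel_prime_div_l with 6%Z. exact Hc.
Qed.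

(** * The prime 11 *)

(** Odd functions on Z/11 in terms of five free values: sines and theta series become
    indeterminates, and the identity below a matter of polynomial algebra. *)
Definition odd11 (a1 a2 a3 a4 a5 : C) (m : Z) : C :=
  match (m mod 11)%Z with
  | 1 => a1 | 2 => a2 | 3 => a3 | 4 => a4 | 5 => a5
  | 6 => (- a5)%C | 7 => (- a4)%C | 8 => (- a3)%C | 9 => (- a2)%C | 10 => (- a1)%C
  | _ => RtoC 0
  end%Z.

Lemma odd11_eq (f : Z -> C) : (forall x y, (x mod 11 = y mod 11)%Z -> f x = f y) -> (forall x, f (- x)%Z = - f x) ->
  forall m, f m = odd11 (f 1%Z) (f 2%Z) (f 3%Z) (f 4%Z) (f 5%Z) m.
Proof.
  intros Hp Ho m. rewrite (Hp m (m mod 11)%Z) by now rewrite Z.mod_mod. unfold odd11.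
  pose proof (Z.mod_pos_bound m 11 ltac:(lia)) as B. set (r := (m mod 11)%Z) in *. clearbody r.
  assert (E : forall x, f (11 - x)%Z = - f x).
  { intros x. rewrite <- Ho. apply Hp. replace (11 - x)%Z with (- x + 1 * 11)%Z by ring. now apply Z.mod_add. }
  assert (E0 : f 0%Z = 0).
  { pose proof (Ho 0%Z) as H0. change (- 0)%Z with 0%Z in H0.
    replace (f 0%Z) with (/ RtoC 2 * (f 0%Z - - f 0%Z)) by field. rewrite <- H0. ring. }
  assert (r = 0 \/ r = 1 \/ r = 2 \/ r = 3 \/ r = 4 \/ r = 5 \/ r = 6 \/ r = 7 \/ r = 8 \/ r = 9 \/ r = 10)%Z as D by lia.
  destruct D as [->|[->|[->|[->|[->|[->|[->|[->|[->|[->| ->]]]]]]]]]]; auto.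
  - exact (E 5%Z). - exact (E 4%Z). - exact (E 3%Z). - exact (E 2%Z). - exact (E 1%Z).
Qed.

(** Doubled, so that products become differences of cosines without denominators. *)
Definition sn (m : Z) : R := (2 * sin (2 * PI * (IZR m / 11)))%R.
Definition cs (m : Z) : R := (2 * cos (2 * PI * (IZR m / 11)))%R.

Lemma sn_sn i j : (sn i * sn j = cs (i - j) - cs (i + j))%R.
Proof.
  unfold sn, cs. rewrite plus_IZR, minus_IZR.
  set (x := (2 * PI * (IZR i / 11))%R). set (y := (2 * PI * (IZR j / 11))%R).
  replace (2 * PI * ((IZR i - IZR j) / 11))%R with (x - y)%R by (unfold x, y; field).
  replace (2 * PI * ((IZR i + IZR j) / 11))%R with (x + y)%R by (unfold x, y; field).
  rewrite cos_minus, cos_plus. ring.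
Qed.

Lemma sn_cs i j : (sn i * cs j = sn (i + j) + sn (i - j))%R.
Proof.
  unfold sn, cs. rewrite plus_IZR, minus_IZR.
  set (x := (2 * PI * (IZR i / 11))%R). set (y := (2 * PI * (IZR j / 11))%R).
  replace (2 * PI * ((IZR i - IZR j) / 11))%R with (x - y)%R by (unfold x, y; field).
  replace (2 * PI * ((IZR i + IZR j) / 11))%R with (x + y)%R by (unfold x, y; field).
  rewrite sin_minus, sin_plus. ring.
Qed.

Lemma sn_mod x y : (x mod 11 = y mod 11)%Z -> sn x = sn y.
Proof.
  intros E. destruct (mod_divide_minus x y 11 ltac:(lia) E) as [k Hk]. unfold sn. f_equal.
  pose proof (sin_mod 11 x y k ltac:(lia) ltac:(lia)) as H. now replace (INR 11) with 11%R in H by (simpl; lra).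
Qed.

Lemma sn_opp x : sn (- x) = (- sn x)%R.
Proof. unfold sn. rewrite opp_IZR. replace (2 * PI * (- IZR x / 11))%R with (- (2 * PI * (IZR x / 11)))%R by field. rewrite sin_neg. ring. Qed.

Lemma cs_opp x : cs (- x) = cs x.
Proof. unfold cs. rewrite opp_IZR. replace (2 * PI * (- IZR x / 11))%R with (- (2 * PI * (IZR x / 11)))%R by field. now rewrite cos_neg. Qed.

Lemma cs_compl x : cs (11 - x) = cs x.
Proof.
  unfold cs. rewrite minus_IZR. replace (2 * PI * ((11 - IZR x) / 11))%R with (- (2 * PI * (IZR x / 11)) + 2 * PI)%R by field.
  rewrite cos_plus, cos_2PI, sin_2PI, cos_neg. ring.
Qed.

Lemma cs_0 : cs 0 = 2%R.
Proof. unfold cs. replace (2 * PI * (0 / 11))%R with 0%R by field. rewrite cos_0. ring. Qed.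

Lemma sn_pos m : (0 < m < 6)%Z -> (0 < sn m)%R.
Proof.
  intros H. unfold sn. assert (1 <= IZR m <= 5)%R by (split; apply IZR_le; lia). pose proof PI_RGT_0.
  assert (0 < sin (2 * PI * (IZR m / 11)))%R; [|lra]. apply sin_gt_0.
  - apply Rmult_lt_0_compat; lra.
  - apply Rlt_le_trans with (2 * PI * (5.5 / 11))%R; [|lra]. apply Rmult_lt_compat_l; lra.
Qed.

(** The eleventh roots of unity add up to 0; multiplication by [sn 1] makes the sum telescope. *)
Lemma cs_sum : cs 5 = (- 1 - cs 1 - cs 2 - cs 3 - cs 4)%R.
Proof.
  assert (sn 1 * (1 + cs 1 + cs 2 + cs 3 + cs 4 + cs 5) = 0)%R as H.
  { rewrite !Rmult_plus_distr_l, !sn_cs. simpl (_ + _)%Z. simpl (_ - _)%Z.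
    rewrite (sn_opp 1 : sn (-1) = _), (sn_opp 2 : sn (-2) = _), (sn_opp 3 : sn (-3) = _), (sn_opp 4 : sn (-4) = _).
    rewrite (sn_mod 6 (- (5)) eq_refl), sn_opp. pose proof (sn_opp 0) as E0. simpl in E0. lra. }
  apply Rmult_integral in H. pose proof (sn_pos 1 ltac:(lia)). lra.
Qed.

(** Quadratic Gauss sum modulo 11, folded by oddness: among 1, ..., 5 only 2 is a non-residue. The
    square is computed with the product formulas and [cs_sum], the sign follows from positivity. *)
Lemma sqrt_11 : sqrt 11 = (sn 1 - sn 2 + sn 3 + sn 4 + sn 5)%R.
Proof.
  set (r := (sn 1 - sn 2 + sn 3 + sn 4 + sn 5)%R).
  assert (H : (r * r = 11)%R).
  { unfold r.
    replace ((sn 1 - sn 2 + sn 3 + sn 4 + sn 5) * (sn 1 - sn 2 + sn 3 + sn 4 + sn 5))%R with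
      (sn 1 * sn 1 + sn 2 * sn 2 + sn 3 * sn 3 + sn 4 * sn 4 + sn 5 * sn 5
       + 2 * (sn 3 * sn 1 + sn 4 * sn 1 + sn 5 * sn 1 + sn 4 * sn 3 + sn 5 * sn 3 + sn 5 * sn 4)
       - 2 * (sn 2 * sn 1 + sn 3 * sn 2 + sn 4 * sn 2 + sn 5 * sn 2))%R by ring.
    rewrite !sn_sn. simpl (_ + _)%Z. simpl (_ - _)%Z. rewrite cs_0, (cs_compl 5 : cs 6 = _), (cs_compl 4 : cs 7 = _), (cs_compl 3 : cs 8 = _),
      (cs_compl 2 : cs 9 = _), (cs_compl 1 : cs 10 = _), cs_sum. ring. }
  assert (P : (0 < r)%R).
  (* 6 pi/11 is replaced by its supplement 5 pi/11, so both angles lie where the sine increases. *)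
  { assert (K : (sn 2 < sn 3)%R).
    { unfold sn. replace (2 * PI * (3 / 11))%R with (PI - 5 / 11 * PI)%R by field. rewrite <- (sin_PI_x (PI - 5 / 11 * PI)).
      pose proof PI_RGT_0. replace (PI - (PI - 5 / 11 * PI))%R with (5 / 11 * PI)%R by ring.
      apply Rmult_lt_compat_l; [lra|]. apply sin_increasing_1; lra. }
    pose proof (sn_pos 1 ltac:(lia)). pose proof (sn_pos 4 ltac:(lia)). pose proof (sn_pos 5 ltac:(lia)). unfold r. lra. }
  rewrite <- H. now apply sqrt_square; left.
Qed.

Section Bilinear.

Variables a1 a2 a3 a4 a5 T1 T2 T3 T4 T5 t1 t2 t3 t4 t5 : C.

Let A := odd11 a1 a2 a3 a4 a5.
Let T := odd11 T1 T2 T3 T4 T5.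
Let t := odd11 t1 t2 t3 t4 t5.

(* In the notation of [Xi11] with [x = x_j]; [T_hat] and [t_hat] are the sine transforms to which the
   inversion of the half-plane takes [Theta] and [theta]. *)
Definition Xi_form x := T x * t (5 * x)%Z - T (3 * x)%Z * t (2 * x)%Z + T (4 * x)%Z * t (3 * x)%Z.

Definition T_hat x := A (x * 1)%Z * T1 + A (x * 2)%Z * T2 + A (x * 3)%Z * T3 + A (x * 4)%Z * T4 + A (x * 5)%Z * T5.
Definition t_hat x := A (3 * x * 1)%Z * t1 + A (3 * x * 2)%Z * t2 + A (3 * x * 3)%Z * t3 + A (3 * x * 4)%Z * t4 + A (3 * x * 5)%Z * t5.

Definition Xi_hat x := T_hat x * t_hat (5 * x) - T_hat (3 * x) * t_hat (2 * x) + T_hat (4 * x) * t_hat (3 * x).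

(** The arguments -5, 1, 7, 13, 19 are x_1, ..., x_5, and the signs are their Legendre symbols
    modulo 11. *)
Definition Xi_sum j := - (A (3 * j * 1)%Z * Xi_form (-5)) + A (3 * j * 2)%Z * Xi_form 1 - A (3 * j * 3)%Z * Xi_form 7
  - A (3 * j * 4)%Z * Xi_form 13 - A (3 * j * 5)%Z * Xi_form 19.

Variables c1 c2 c3 c4 : C.
Let c5 := - RtoC 1 - c1 - c2 - c3 - c4.
Hypotheses (e11 : a1 * a1 = RtoC 2 - c2) (e22 : a2 * a2 = RtoC 2 - c4) (e33 : a3 * a3 = RtoC 2 - c5)
  (e44 : a4 * a4 = RtoC 2 - c3) (e55 : a5 * a5 = RtoC 2 - c1)
  (e12 : a1 * a2 = c1 - c3) (e13 : a1 * a3 = c2 - c4) (e14 : a1 * a4 = c3 - c5) (e15 : a1 * a5 = c4 - c5)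
  (e23 : a2 * a3 = c1 - c5) (e24 : a2 * a4 = c2 - c5) (e25 : a2 * a5 = c3 - c4)
  (e34 : a3 * a4 = c1 - c4) (e35 : a3 * a5 = c2 - c3) (e45 : a4 * a5 = c1 - c2).

(** Both sides are quadratic in the [a]'s: the left as a product of two transforms, the right
    because the Gauss sum multiplies a linear form. The fifteen product formulas make them linear in
    [c1], ..., [c4], where they agree coefficientwise. The sign in front is (x_j/11), and x_2 = 1 is
    the only residue among the x_j. *)
Lemma Xi_hat_eq (j : Z) : (1 <= j <= 5)%Z ->
  (if (j =? 2)%Z then 1 else - RtoC 1) * Xi_hat (6 * j - 11) = (a1 - a2 + a3 + a4 + a5) * Xi_sum j.
Proof.
  intros Hj. assert (j = 1 \/ j = 2 \/ j = 3 \/ j = 4 \/ j = 5)%Z as [-> | [-> | [-> | [-> | ->]]]] by lia;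
    unfold Xi_hat, Xi_sum, T_hat, t_hat, Xi_form, A, T, t; cbv [odd11 Z.modulo Z.div_eucl]; simpl; unfold c5 in *;
    ring [e11 e22 e33 e44 e55 e12 e13 e14 e15 e23 e24 e25 e34 e35 e45].
Qed.

End Bilinear.

Lemma sn_odd11 m : RtoC (sn m) = odd11 (RtoC (sn 1)) (RtoC (sn 2)) (RtoC (sn 3)) (RtoC (sn 4)) (RtoC (sn 5)) m.
Proof.
  apply (odd11_eq (fun m => RtoC (sn m))).
  - intros x y E. now rewrite (sn_mod x y).
  - intros x. now rewrite sn_opp, RtoC_opp.
Qed.

Lemma Th_odd11 tau m : (0 < Im tau)%R ->
  Th 11 m tau = odd11 (Th 11 1 tau) (Th 11 2 tau) (Th 11 3 tau) (Th 11 4 tau) (Th 11 5 tau) m.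
Proof.
  intros Ht. apply (odd11_eq (fun m => Th 11 m tau)).
  - intros x y E. apply Th_mod; [lia|exact E].
  - intros x. apply Th_opp; [lia|exact Ht].
Qed.

Lemma th_odd11 tau m : (0 < Im tau)%R ->
  th 11 m tau = odd11 (th 11 1 tau) (th 11 2 tau) (th 11 3 tau) (th 11 4 tau) (th 11 5 tau) m.
Proof.
  intros Ht. apply (odd11_eq (fun m => th 11 m tau)).
  - intros x y E. apply th_mod; [lia|exact E].
  - intros x. apply th_opp; [lia|exact Ht].
Qed.

Notation with_sines f := (f (RtoC (sn 1)) (RtoC (sn 2)) (RtoC (sn 3)) (RtoC (sn 4)) (RtoC (sn 5))) (only parsing).
Notation with_Th f tau := (f (Th 11 1 tau) (Th 11 2 tau) (Th 11 3 tau) (Th 11 4 tau) (Th 11 5 tau)) (only parsing).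
Notation with_th f tau := (f (th 11 1 tau) (th 11 2 tau) (th 11 3 tau) (th 11 4 tau) (th 11 5 tau)) (only parsing).

Lemma INR_11 : INR 11 = 11%R.
Proof. simpl. lra. Qed.

(** 12 is 1 modulo 11, so [a = 1]; the classes are kept as they are, with [v = 1]. *)
Lemma Th_S_11 x w tau : (0 < Im tau)%R -> root_of_tau w tau ->
  Th 11 x (tauS tau) = RtoC (/ sqrt 11) * w ^ 3 * with_Th (with_sines T_hat) tau x.
Proof.
  intros Ht Hw.
  rewrite (Th_S 11 1 1 x w tau eq_refl Ht Hw (rel_prime_1 _) (ex_intro _ 1%Z eq_refl)).
  change (chi12 (Z.of_nat 11)) with 1%Z. rewrite INR_11.
  rewrite (lsum_ext_in _ (fun k => RtoC (/ 2) * (RtoC (sn (x * Z.of_nat k)) * Th 11 (Z.of_nat k) tau))).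
  - rewrite lsum_scal. unfold T_hat. rewrite <- !sn_odd11. simpl.
    replace (2 * 1 / sqrt 11)%R with (2 * / sqrt 11)%R by (unfold Rdiv; ring). rewrite RtoC_mult, (RtoC_inv 2) by lra. field.
  - intros k _. rewrite (Z.mul_1_l (Z.of_nat k)). replace (1 * x * 1 * Z.of_nat k)%Z with (x * Z.of_nat k)%Z by ring.
    unfold sn. rewrite RtoC_mult, (RtoC_inv 2) by lra. field.
Qed.

(** The inverse of 4 modulo 11 is 3, the origin of the factor 3 in [t_hat]. *)
Lemma th_S_11 x w tau : (0 < Im tau)%R -> root_of_tau w tau ->
  th 11 x (tauS tau) = RtoC (/ sqrt 11) * w * with_th (with_sines t_hat) tau x.
Proof.
  intros Ht Hw.
  rewrite (th_S 11 3 1 x w tau eq_refl Ht Hw (rel_prime_1 _) (ex_intro _ 1%Z eq_refl)).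
  change (chi4 (Z.of_nat 11)) with (-1)%Z. rewrite INR_11.
  rewrite (lsum_ext_in _ (fun k => RtoC (/ 2) * (RtoC (sn (3 * x * Z.of_nat k)) * th 11 (Z.of_nat k) tau))).
  - rewrite lsum_scal. unfold t_hat. rewrite <- !sn_odd11. simpl.
    replace (2 * -1 / sqrt 11)%R with (2 * - / sqrt 11)%R by (unfold Rdiv; ring). rewrite RtoC_mult, RtoC_opp, (RtoC_inv 2) by lra. field.
  - intros k _. rewrite (Z.mul_1_l (Z.of_nat k)). replace (3 * x * 1 * Z.of_nat k)%Z with (3 * x * Z.of_nat k)%Z by ring.
    unfold sn. rewrite RtoC_mult, (RtoC_inv 2) by lra. field.
Qed.

Lemma Xi11_form j tau : (0 < Im tau)%R -> Xi11 j tau = with_th (with_Th Xi_form tau) tau (xj 11 j).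
Proof.
  intros Ht. unfold Xi11, Xi_form. rewrite <- !Th_odd11, <- !th_odd11 by exact Ht.
  rewrite !Theta_Th, !theta_th by (lia || exact Ht). reflexivity.
Qed.

Lemma Xi11_S j w tau : (0 < Im tau)%R -> root_of_tau w tau ->
  Xi11 j (tauS tau) = RtoC (/ 11) * w ^ 4 * with_th (with_Th (with_sines Xi_hat) tau) tau (xj 11 j).
Proof.
  intros Ht Hw. pose proof (Im_tauS tau Ht) as Ht'. unfold Xi11.
  rewrite !Theta_Th, !theta_th by (lia || exact Ht').
  rewrite !(Th_S_11 _ w), !(th_S_11 _ w) by auto.
  replace (/ 11)%R with (/ sqrt 11 * / sqrt 11)%R.
  - rewrite RtoC_mult. unfold Xi_hat. ring.
  - rewrite <- Rinv_mult, sqrt_sqrt; lra.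
Qed.

Lemma sn_sn_C i j a b : cs (i - j) = cs a -> cs (i + j) = cs b -> RtoC (sn i) * RtoC (sn j) = RtoC (cs a) - RtoC (cs b).
Proof. intros <- <-. now rewrite <- RtoC_mult, sn_sn, RtoC_minus. Qed.

Lemma Mcoef_11 j k : Mcoef 11 j k = ((-1) ^ j * (-1) ^ k * / sqrt 11 * sn (3 * Z.of_nat j * Z.of_nat k))%R.
Proof.
  rewrite (Mcoef_sign 11 j k 1) by (change ((11 + 3) / 6)%nat with 2%nat; simpl; ring).
  unfold sn. rewrite !mult_IZR, <- !INR_IZR_INZ, INR_11.
  replace (2 * PI * (3 * INR j * INR k / 11))%R with (6 * PI * INR j * INR k / 11)%R by field. unfold Rdiv. ring.
Qed.

(** Whichever way primality of the other candidates is decided, their valuation is 0 and their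
    factor is 1; only 11 contributes, once. *)
Lemma kronecker_11 a : prime 11 -> kronecker a 11 = legendre a 11.
Proof.
  intros H11. unfold kronecker. change (11 =? 0)%Z with false. change (11 <? 0)%Z with false.
  change (Z.abs 11) with 11%Z. cbv iota beta. simpl andb. cbv iota.
  assert (K : forall q : nat, valuation (Z.of_nat q) 11 = 0%nat ->
    (if prime_dec (Z.of_nat q) then (kronecker_prime a (Z.of_nat q) ^ Z.of_nat (valuation (Z.of_nat q) 11))%Z else 1%Z) = 1%Z).
  { intros q Hq. rewrite Hq. now destruct (prime_dec _). }
  change (Z.abs_nat 11) with 11%nat. simpl (seq 2 11). rewrite !map_cons.
  rewrite (K 2%nat), (K 3%nat), (K 4%nat), (K 5%nat), (K 6%nat), (K 7%nat), (K 8%nat), (K 9%nat), (K 10%nat), (K 12%nat) by reflexivity.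
  change (Z.of_nat 11) with 11%Z. destruct (prime_dec 11) as [_|N]; [|contradiction].
  change (valuation 11 11) with 1%nat. change (kronecker_prime a 11) with (legendre a 11).
  cbn [map fold_right]. rewrite Z.pow_1_r. ring.
Qed.

Lemma kronecker_xj j : prime 11 -> (1 <= j <= 5)%nat -> kronecker (xj 11 j) 11 = if (Z.of_nat j =? 2)%Z then 1%Z else (-1)%Z.
Proof.
  intros H11 Hj. rewrite kronecker_11 by exact H11.
  assert (j = 1 \/ j = 2 \/ j = 3 \/ j = 4 \/ j = 5)%nat as [-> | [-> | [-> | [-> | ->]]]] by lia; reflexivity.
Qed.

(** Residues by the Chinese remainder theorem: 144 y^2 + 121 is 1 modulo 24 and y^2 modulo 11, while
    56 z^2 + 33 is 1 modulo 8 and z^2 modulo 11. The hypothesis is the comparison of exponents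
    multiplied by 264, with 77 = 33 + 44 from 1/8 and [eta ^ 4]. *)
Lemma Qform_Th_th_11 (y z x : Z) (K : nat) :
  ((144 * y ^ 2 + 121) mod 264 + 3 * ((56 * z ^ 2 + 33) mod 88) + x ^ 2 = 77 + 264 * Z.of_nat K)%Z ->
  Qform (fun tau => Th 11 y tau * th 11 z tau * / eta tau ^ 4) (1 / 8 - IZR (x ^ 2) / 264).
Proof.
  intros E. set (r1 := ((144 * y ^ 2 + 121) mod 264)%Z) in *. set (r2 := ((56 * z ^ 2 + 33) mod 88)%Z) in *.
  pose proof (Z.mod_pos_bound (144 * y ^ 2 + 121) 264 ltac:(lia)) as B1. fold r1 in B1.
  pose proof (Z.mod_pos_bound (56 * z ^ 2 + 33) 88 ltac:(lia)) as B2. fold r2 in B2.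
  pose proof (Z.div_mod (144 * y ^ 2 + 121) 264 ltac:(lia)) as D1. fold r1 in D1.
  pose proof (Z.div_mod (56 * z ^ 2 + 33) 88 ltac:(lia)) as D2. fold r2 in D2.
  set (d1 := ((144 * y ^ 2 + 121) / 264)%Z) in *. set (d2 := ((56 * z ^ 2 + 33) / 88)%Z) in *.
  clearbody r1 r2 d1 d2.
  assert (C24 : rel_prime 24 (Z.of_nat 11)) by (apply bezout_rel_prime, Bezout_intro with (-5)%Z 11%Z; reflexivity).
  apply Qform_shift with K.
  apply Qform_eq with (IZR r1 / (24 * INR 11) + IZR r2 / (8 * INR 11) + - (INR 4 / 24))%R.
  { rewrite INR_11. simpl (INR 4). apply (f_equal IZR) in E. rewrite !plus_IZR, !mult_IZR, <- INR_IZR_INZ in E.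
    set (X := IZR (x ^ 2)) in *. lra. }
  apply Qform_mult; [apply Qform_mult|apply Qform_eta_inv].
  - apply Qform_Th; auto; try lia.
    + replace r1 with (1 + (6 * y ^ 2 + 5 - 11 * d1) * 24)%Z by lia. now rewrite Z.mod_add.
    + exists (24 * d1 - 13 * y ^ 2 - 11)%Z. lia.
  - apply Qform_th; try lia.
    + apply rel_prime_div_l with 3%Z. exact C24.
    + replace r2 with (1 + (7 * z ^ 2 + 4 - 11 * d2) * 8)%Z by lia. now rewrite Z.mod_add.
    + exists (8 * d2 - 5 * z ^ 2 - 3)%Z. lia.
Qed.

Lemma Qform_Xi11 j : (1 <= j <= 5)%nat -> Qform (fun tau => Xi11 j tau * / eta tau ^ 4) (1 / 8 - Delta_pj 11 j).
Proof.
  intros Hj. apply Qform_eq with (1 / 8 - IZR (xj 11 j ^ 2) / 264)%R.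
  { unfold Delta_pj. rewrite INR_11. f_equal. f_equal. f_equal. lra. }
  set (x := xj 11 j).
  apply Qform_ext with (fun tau => Th 11 x tau * th 11 (5 * x) tau * / eta tau ^ 4
    + (- RtoC 1) * (Th 11 (3 * x) tau * th 11 (2 * x) tau * / eta tau ^ 4)
    + Th 11 (4 * x) tau * th 11 (3 * x) tau * / eta tau ^ 4).
  { intros tau Ht. unfold Xi11. rewrite !Theta_Th, !theta_th by (lia || exact Ht). fold x. ring. }
  assert (E : forall y z : Z, (exists K : nat, (144 * y ^ 2 + 121) mod 264 + 3 * ((56 * z ^ 2 + 33) mod 88) + x ^ 2
    = 77 + 264 * Z.of_nat K)%Z -> Qform (fun tau => Th 11 y tau * th 11 z tau * / eta tau ^ 4) (1 / 8 - IZR (x ^ 2) / 264)).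
  { intros y z [K HK]. now apply Qform_Th_th_11 with K. }
  apply Qform_plus; [apply Qform_plus; [|apply Qform_scal]|]; apply E;
    (* The surplus is found by division, and the equation checked by computation for each of the
       five [j]. *)
    match goal with |- exists K, ?v = _ => exists (Z.to_nat ((v - 77) / 264)) end; unfold x;
    assert (j = 1 \/ j = 2 \/ j = 3 \/ j = 4 \/ j = 5)%nat as [-> | [-> | [-> | [-> | ->]]]] by lia; reflexivity.
Qed.

Lemma case_11 : prime 11 -> multiples_solve_system 11 H_11.
Proof.
  intros H11. set (kap := fun j => if (Z.of_nat j =? 2)%Z then RtoC 1 else - RtoC 1).
  assert (Hkap : forall j, (1 <= j <= 5)%nat -> RtoC (IZR (kronecker (xj 11 j) 11)) = kap j).
  { intros j Hj. rewrite kronecker_xj by auto. unfold kap. destruct (_ =? 2)%Z; [reflexivity|]. now rewrite <- RtoC_opp. }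
  apply solve_system_derivative with (fun j tau => (RtoC ((-1) ^ (j + 1)) * kap j) * (Xi11 j tau * / eta tau ^ 4)).
  - intros j Hj. apply Qform_scal, Qform_Xi11, Hj.
  - intros j tau Hj Ht. rewrite (Dtau_scal _ _ _ _ (Qform_Xi11 j Hj) Ht). unfold H_11. rewrite Hkap by exact Hj.
    unfold Cdiv. ring.
  - intros j tau Hj Ht. pose proof (Csqrt_root tau Ht) as Hw. set (w := Csqrt (- Ci * tau)) in *.
    change (ell 11) with 5%nat in *.
    rewrite (Xi11_S j w), (eta_S w) by auto.
    rewrite (lsum_ext_in _ (fun k => RtoC ((-1) ^ (j + 1) * / sqrt 11) * / eta tau ^ 4 * (RtoC (sn (3 * Z.of_nat j * Z.of_nat k)) *
       (kap k * with_th (with_Th Xi_form tau) tau (6 * Z.of_nat k - 11)%Z)))).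
    + rewrite lsum_scal.
      (* The product formulas for sines discharge the hypotheses, all cosines being reduced to
         [cs 0], ..., [cs 5]. The Gauss sum on the right equals [sqrt 11], and turns the 1/11 of the
         two transforms into the 1/sqrt 11 of [Mcoef]. *)
      pose proof (with_th (with_Th (with_sines Xi_hat_eq) tau) tau (RtoC (cs 1)) (RtoC (cs 2)) (RtoC (cs 3)) (RtoC (cs 4))) as I.
      replace (- RtoC 1 - RtoC (cs 1) - RtoC (cs 2) - RtoC (cs 3) - RtoC (cs 4)) with (RtoC (cs 5)) in I
        by (rewrite <- RtoC_opp, <- !RtoC_minus; f_equal; pose proof cs_sum; lra).
      rewrite <- cs_0 in I.
      specialize (I (sn_sn_C 1 1 0 2 eq_refl eq_refl) (sn_sn_C 2 2 0 4 eq_refl eq_refl) (sn_sn_C 3 3 0 5 eq_refl (cs_compl 5))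
        (sn_sn_C 4 4 0 3 eq_refl (cs_compl 3)) (sn_sn_C 5 5 0 1 eq_refl (cs_compl 1))
        (sn_sn_C 1 2 1 3 (cs_opp 1) eq_refl) (sn_sn_C 1 3 2 4 (cs_opp 2) eq_refl) (sn_sn_C 1 4 3 5 (cs_opp 3) eq_refl)
        (sn_sn_C 1 5 4 5 (cs_opp 4) (cs_compl 5)) (sn_sn_C 2 3 1 5 (cs_opp 1) eq_refl) (sn_sn_C 2 4 2 5 (cs_opp 2) (cs_compl 5))
        (sn_sn_C 2 5 3 4 (cs_opp 3) (cs_compl 4)) (sn_sn_C 3 4 1 4 (cs_opp 1) (cs_compl 4)) (sn_sn_C 3 5 2 3 (cs_opp 2) (cs_compl 3))
        (sn_sn_C 4 5 1 2 (cs_opp 1) (cs_compl 2)) (Z.of_nat j) ltac:(lia)).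
      fold (kap j) in I. rewrite <- RtoC_minus, <- !RtoC_plus, <- sqrt_11 in I.
      match type of I with _ = _ * ?z => set (Y := z) in * end.
      replace (lsum _ _) with Y.
      2:{ unfold Y, Xi_sum. rewrite <- !sn_odd11. unfold kap. simpl. ring. }
      change (xj 11 j) with (6 * Z.of_nat j - 11)%Z.
      match type of I with _ * ?z = _ => set (X := z) in * end.
      transitivity (RtoC ((-1) ^ (j + 1)) * RtoC (/ 11) * (kap j * X) * / eta tau ^ 4).
      * pose proof (root_of_tau_nz _ _ Hw). pose proof (eta_nz tau Ht). field. auto.
      * rewrite I, RtoC_mult. replace (/ 11)%R with (/ sqrt 11 * / sqrt 11)%R.
        -- rewrite RtoC_mult. assert (RtoC (sqrt 11) <> 0) by (apply RtoC_nz, Rgt_not_eq, sqrt_lt_R0; lra).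
           rewrite !RtoC_inv by (apply Rgt_not_eq, sqrt_lt_R0; lra). pose proof (eta_nz tau Ht). field. auto.
        -- rewrite <- Rinv_mult, sqrt_sqrt; lra.
    + intros k Hk. rewrite Mcoef_11, Xi11_form by exact Ht. change (xj 11 k) with (6 * Z.of_nat k - 11)%Z.
      set (X := Xi_form _ _ _ _ _ _ _ _ _ _ _). rewrite !pow_add, !pow_1, !RtoC_mult.
      transitivity (RtoC ((-1) ^ k * (-1) ^ k) * (RtoC ((-1) ^ j) * RtoC (-1) * RtoC (/ sqrt 11) * / eta tau ^ 4
        * (RtoC (sn (3 * Z.of_nat j * Z.of_nat k)) * (kap k * X)))).
      * rewrite RtoC_mult. ring.
      * rewrite neg_one_pow_sqr. ring.
Qed.

Theorem theorem3p12 (p : nat) (p_prime : prime (Z.of_nat p)) (p_ge5 : (5 <= p)%nat) :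
  ((p mod 12 = 1)%nat ->
   forall s : Z, (1 <= s)%Z -> rel_prime s (6 * Z.of_nat p) ->
   (s ^ 2 mod Z.of_nat p = (-1) mod Z.of_nat p)%Z ->
   (forall (j : nat) (tau : C), (1 <= j <= ell p)%nat -> (0 < Im tau)%R ->
      H_mod1 p s j tau = H_mod1_series p s j tau) /\
   multiples_solve_system p (H_mod1 p s)) /\
  ((p mod 12 = 5)%nat ->
   forall s : Z, (1 <= s)%Z -> rel_prime s (6 * Z.of_nat p) ->
   (s ^ 2 mod Z.of_nat p = (-1) mod Z.of_nat p)%Z ->
   (forall (j : nat) (tau : C), (1 <= j <= ell p)%nat -> (0 < Im tau)%R ->
      H_mod5 p s j tau = H_mod5_series p s j tau) /\
   multiples_solve_system p (H_mod5 p s)) /\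
  ((p mod 12 = 7)%nat ->
   forall s : Z, (1 <= s)%Z -> rel_prime s (2 * Z.of_nat p) ->
   ((3 * s ^ 2) mod Z.of_nat p = (-1) mod Z.of_nat p)%Z ->
   multiples_solve_system p (H_mod7 p s)) /\
  (p = 11%nat -> multiples_solve_system p H_11).
Proof.
  assert (p0 : (0 < p)%nat) by lia. split; [|split; [|split]].
  - intros Hp s _ _ Hs. split.
    + intros j tau _ Ht. now apply mod1_series.
    + now apply case_mod1.
  - intros Hp s _ _ Hs. split.
    + intros j tau _ Ht. now apply mod5_series.
    + now apply case_mod5.
  - intros Hp s _ _ Hs. now apply case_mod7.
  - intros ->. exact (case_11 p_prime).
Qed.
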